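(* As algebras: (1) $\overline{S_q(V)}\simeq S(\mathbb{C}^7)/\langle S^1(\mathbb{C}^7)\phi\rangle$, where $\langle S^1(\mathbb{C}^7)\phi\rangle$ is the two-sided ideal in $S(\mathbb{C}^7)$ generated by $S^1(\mathbb{C}^7)\phi$; and (2) $\overline{\mathcal{A}_m(V)}=\overline{S_q(V)}^{\otimes m}$ with component-wise multiplication.
   Context: $\mathrm{U}_q=\mathrm{U}_q(G_2)$ is the quantum group over $\mathbb{C}(q)$ ($q$ an indeterminate) with generators $E_i,F_i,K_i^{\pm1}$, $i=1,2$, and the standard Drinfeld–Jimbo relations, for simple roots $\alpha_1$ (short), $\alpha_2$ with $(\alpha_1,\alpha_1)=2$, $(\alpha_1,\alpha_2)=-3$, $(\alpha_2,\alpha_2)=6$. Co-multiplication: $\Delta(E_i)=E_i\otimes K_i+1\otimes E_i$, $\Delta(F_i)=F_i\otimes 1+K_i^{-1}\otimes F_i$, $\Delta(K_i)=K_i\otimes K_i$. $V_\lambda$ is the type-$\mathbf 1$ simple module with highest weight $\lambda$; $\lambda_1=2\alpha_1+\alpha_2$, $\lambda_2=3\alpha_1+2\alpha_2$. $V=V_{\lambda_1}$ is the 7-dimensional simple module with basis $v_1,v_2,v_3,v_0,v_{-3},v_{-2},v_{-1}$ and action (basis vectors not listed are sent to $0$): $E_1: v_2\mapsto v_1,\ v_0\mapsto (q+q^{-1})v_3,\ v_{-3}\mapsto -(q+q^{-1})v_0,\ v_{-1}\mapsto -v_{-2}$; $E_2: v_3\mapsto v_2,\ v_{-2}\mapsto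 -v_{-3}$; $F_1: v_1\mapsto v_2,\ v_3\mapsto v_0,\ v_0\mapsto -v_{-3},\ v_{-2}\mapsto -v_{-1}$; $F_2: v_2\mapsto v_3,\ v_{-3}\mapsto -v_{-2}$; $K_1$, $K_2$ act diagonally (in the order $v_1,v_2,v_3,v_0,v_{-3},v_{-2},v_{-1}$) with eigenvalues $(q,q^{-1},q^2,1,q^{-2},q,q^{-1})$ and $(1,q^3,q^{-3},1,q^3,q^{-3},1)$. $V\otimes V=V_{2\lambda_1}\oplus V_{\lambda_2}\oplus V_{\lambda_1}\oplus V_0$; $\wedge_q^2V=V_{\lambda_2}\oplus V_{\lambda_1}$; $S_q(V)=T(V)/\langle\wedge_q^2V\rangle$, graded, with components $S_q(V)_n$. Braiding: with universal $R$-matrix $\sum_t\alpha_t\otimes\beta_t$, set $\check R_{W,W'}(w\otimes w')=\sum_t\beta_tw'\otimes\alpha_tw$, normalised so that $\check R_{V,V}=q^2P[2\lambda_1]+q^{-12}P[0]-P[\lambda_2]-q^{-6}P[\lambda_1]$, with $P[\mu]$ the projection of $V\otimes V$ onto $V_\mu$. The braided tensor product of module algebras $A,B$ is $A\otimes B$ with multiplication $(\mu_A\otimes\mu_B)(\mathrm{id}_A\otimes\check R_{B,A}\otimes\mathrm{id}_B)$; $\mathcal{A}_m(V)$ is $S_q(V)^{\otimes m}$ with the iterated braided multiplication. Classical limits: let $\mathbb{A}=\mathbb{C}[q,q^{-1}]\subset\mathbb{C}(q)$ and $V_{\mathbb{A}}=\sum_a\mathbb{A}v_a$. $S_{\mathbb{A}}(V_{\mathbb{A}})\subset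 S_q(V)$ is the $\mathbb{A}$-form whose degree $n$ part is the image of $V_{\mathbb{A}}^{\otimes_{\mathbb{A}} n}$ in $S_q(V)_n$, and $\mathcal{A}_m(V_{\mathbb{A}})=S_{\mathbb{A}}(V_{\mathbb{A}})^{\otimes_{\mathbb{A}}m}$ with the braided multiplication. For the $\mathbb{C}$-linear ring homomorphism $\theta:\mathbb{A}\to\mathbb{C}$, $\theta(q)=1$, put $\overline{S_q(V)}=S_{\mathbb{A}}(V_{\mathbb{A}})\otimes_\theta\mathbb{C}$ and $\overline{\mathcal{A}_m(V)}=\mathcal{A}_m(V_{\mathbb{A}})\otimes_\theta\mathbb{C}$. $\mathbb{C}^7$ is the 7-dimensional simple $G_2$-module, $S(\mathbb{C}^7)$ its symmetric algebra, and $\phi\in S^2(\mathbb{C}^7)$ is an element spanning the 1-dimensional space $(\mathbb{C}^7\otimes\mathbb{C}^7)^{G_2}\subset S^2(\mathbb{C}^7)$. *)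

(* Defs.v *)
From HB Require Import structures.
From mathcomp Require Import all_boot all_order all_algebra.
From mathcomp Require Import boolp reals complex.
From mathcomp Require Import finmap mpoly monalg.

Set Implicit Arguments.
Unset Strict Implicit.
Unset Printing Implicit Defensive.

Import GRing.Theory.
Local Open Scope quotient_scope.
Local Open Scope ring_scope.

Section Span.
Variables (R : nzRingType) (M : lmodType R).

Inductive lspan (S : M -> Prop) : M -> Prop :=
| lspan0 : lspan S 0
| lspanD a x y : S x -> lspan S y -> lspan S (a *: x + y).

Definition lspanp (S : M -> Prop) : {pred M} := fun x => `[< lspan S x >].

Lemma lspan_comb S a x y : lspan S x -> lspan S y -> lspan S (a *: x + y).
Proof.
move=> + Sy; elim=> [|b u v Su _ IH]; first by rewrite scaler0 add0r.
by rewrite scalerDr scalerA -addrA; apply: lspanD.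
Qed.

Lemma lspanp_submod S : submod_closed (lspanp S).
Proof.
split; first by apply/asboolP; constructor.
by move=> a x y /asboolP Sx /asboolP Sy; apply/asboolP/lspan_comb.
Qed.

HB.instance Definition _ S :=
  GRing.isSubmodClosed.Build R M (lspanp S) (lspanp_submod S).

Definition qmod (S : M -> Prop) : Type := Quotient.quot (lspanp S).

HB.instance Definition _ S := GRing.Zmodule.on (qmod S).
HB.instance Definition _ S := EqQuotient.on (qmod S).

Section Qmod.
Variable S : M -> Prop.

Definition qproj (x : M) : qmod S := \pi x.
Definition qscale (a : R) (x : qmod S) : qmod S := qproj (a *: repr x).

Lemma qprojP x y : (qproj x = qproj y) <-> lspan S (x - y).
Proof.
rewrite /qproj; split=> [/eqP|h]; first by rewrite -Quotient.idealrBE => /asboolP.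
by apply/eqP; rewrite -Quotient.idealrBE; apply/asboolP.
Qed.

Lemma qprojK x : qproj (repr x) = x. Proof. exact: reprK. Qed.

Lemma qprojD : {morph qproj : x y / x + y}.
Proof. exact: (raddfD (\pi_(Quotient.quot (lspanp S)))). Qed.

Lemma qscale_proj a x : qscale a (qproj x) = qproj (a *: x).
Proof.
apply/qprojP; rewrite -scalerBr -[_ *: _]addr0.
by apply: lspan_comb (lspan0 _); apply/qprojP; rewrite qprojK.
Qed.

Lemma qscaleA a b x : qscale a (qscale b x) = qscale (a * b) x.
Proof. by rewrite -[x]qprojK !qscale_proj scalerA. Qed.

Lemma qscale1 : left_id 1 qscale.
Proof. by move=> x; rewrite -[x]qprojK qscale_proj scale1r. Qed.

Lemma qscaleDr : right_distributive qscale +%R.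
Proof.
move=> a x y; rewrite -[x]qprojK -[y]qprojK -qprojD !qscale_proj.
by rewrite scalerDr qprojD.
Qed.

Lemma qscaleDl x : {morph qscale^~ x : a b / a + b}.
Proof.
by move=> a b; rewrite -[x]qprojK !qscale_proj scalerDl qprojD.
Qed.

HB.instance Definition _ := GRing.Zmodule_isLmodule.Build R (qmod S)
  qscaleA qscale1 qscaleDr qscaleDl.

Lemma qprojZ a x : qproj (a *: x) = a *: qproj x.
Proof. by rewrite -qscale_proj. Qed.

End Qmod.
End Span.

Section QuotientAlgebra.
Variables (R : nzRingType) (A : lalgType R).

Inductive ideal_gen (S : A -> Prop) : A -> Prop :=
| ideal_gen0 : ideal_gen S 0
| ideal_genD a x b y : S x -> ideal_gen S y -> ideal_gen S (a * x * b + y).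

Definition qalg (S : A -> Prop) : Type := qmod (ideal_gen S).

HB.instance Definition _ S := GRing.Lmodule.on (qalg S).
HB.instance Definition _ S := EqQuotient.on (qalg S).

Section Qalg.
Variable S : A -> Prop.

Definition aproj (x : A) : qalg S := qproj (ideal_gen S) x.

Lemma ideal_gen_mul a b x : ideal_gen S x -> ideal_gen S (a * x * b).
Proof.
elim=> [|c u d v Su _ IH]; first by rewrite mulr0 mul0r; constructor.
by rewrite mulrDr mulrDl !mulrA -[_ * d * b]mulrA; constructor.
Qed.

Lemma ideal_gen_add x y : ideal_gen S x -> ideal_gen S y -> ideal_gen S (x + y).
Proof.
move=> + Sy; elim=> [|c u d v Su _ IH]; first by rewrite add0r.
by rewrite -addrA; constructor.
Qed.

Lemma lspan_ideal_gen x : lspan (ideal_gen S) x <-> ideal_gen S x.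
Proof.
split=> [|Sx]; last first.
  by rewrite -[x]addr0 -[x]scale1r; apply: lspanD => //; constructor.
elim=> [|a u v Su _ IH]; first by constructor.
apply: ideal_gen_add => //.
by rewrite -[u]mul1r scalerAl -[_ * u]mulr1; apply: ideal_gen_mul.
Qed.

Lemma aprojP x y : aproj x = aproj y <-> ideal_gen S (x - y).
Proof. by rewrite qprojP lspan_ideal_gen. Qed.

Lemma aprojK x : aproj (repr x) = x. Proof. exact: reprK. Qed.

Definition qone : qalg S := aproj 1.
Definition qmul (x y : qalg S) : qalg S := aproj (repr x * repr y).

Lemma qmul_proj x y : qmul (aproj x) (aproj y) = aproj (x * y).
Proof.
apply/aprojP.
have Sx : ideal_gen S (repr (aproj x) - x) by apply/aprojP; rewrite aprojK.
have Sy : ideal_gen S (repr (aproj y) - y) by apply/aprojP; rewrite aprojK.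
rewrite -[_ * _](subrK (x * repr (aproj y))) -mulrBl -addrA -mulrBr.
apply: ideal_gen_add.
  by rewrite -[_ - _]mul1r; apply: ideal_gen_mul.
by rewrite -[_ * _]mulr1; apply: ideal_gen_mul.
Qed.

Lemma qmulA : associative qmul.
Proof.
by move=> x y z; rewrite -[x]aprojK -[y]aprojK -[z]aprojK !qmul_proj mulrA.
Qed.

Lemma qmul1 : left_id qone qmul.
Proof. by move=> x; rewrite -[x]aprojK qmul_proj mul1r. Qed.

Lemma qmulr1 : right_id qone qmul.
Proof. by move=> x; rewrite -[x]aprojK qmul_proj mulr1. Qed.

Lemma aprojD : {morph aproj : x y / x + y}.
Proof. by move=> x y; apply: qprojD. Qed.

Lemma qmulDl : left_distributive qmul +%R.
Proof.
move=> x y z; rewrite -[x]aprojK -[y]aprojK -[z]aprojK -aprojD !qmul_proj.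
by rewrite mulrDl aprojD.
Qed.

Lemma qmulDr : right_distributive qmul +%R.
Proof.
move=> x y z; rewrite -[x]aprojK -[y]aprojK -[z]aprojK -aprojD !qmul_proj.
by rewrite mulrDr aprojD.
Qed.

HB.instance Definition _ := GRing.Zmodule_isPzRing.Build (qalg S)
  qmulA qmul1 qmulr1 qmulDl qmulDr.

Lemma aprojM : {morph aproj : x y / x * y}.
Proof. by move=> x y; rewrite -qmul_proj. Qed.

Lemma aprojZ a x : aproj (a *: x) = a *: aproj x.
Proof. exact: qprojZ. Qed.

Lemma aprojB : {morph aproj : x y / x - y}.
Proof. by move=> x y; rewrite -[- y]scaleN1r aprojD aprojZ scaleN1r. Qed.

End Qalg.
End QuotientAlgebra.

(* semilinear extension of [f : X -> P] to the free module on [X] *)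
Definition lext (A B : nzRingType) (phi : A -> B) (X : choiceType)
    (P : lmodType B) (f : X -> P) (x : {malg A[X]}) : P :=
  \sum_(k <- msupp x) phi (mcoeff k x) *: f k.

Section Tensor.
Variables (A : comNzRingType) (M N : lmodType A).

Inductive tens_rel : {malg A[(M * N)%type]} -> Prop :=
| tens_addl m m' n :
    tens_rel (<< (m + m', n) >> - << (m, n) >> - << (m', n) >>)
| tens_addr m n n' :
    tens_rel (<< (m, n + n') >> - << (m, n) >> - << (m, n') >>)
| tens_scalel a m n : tens_rel (<< (a *: m, n) >> - a *: << (m, n) >>)
| tens_scaler a m n : tens_rel (<< (m, a *: n) >> - a *: << (m, n) >>).

Definition tens : lmodType A := qmod tens_rel.

Definition tpure (m : M) (n : N) : tens := qproj tens_rel << (m, n) >>.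

(* The linear map out of [tens] attached to a map [f] which is bilinear along
   [phi]; it is a total function, meaningful only for such [f]: see
   [tlift_pure] and [tlift_comb]. *)
Definition tlift (B : nzRingType) (phi : A -> B) (P : lmodType B)
  (f : M -> N -> P) (t : tens) : P := lext phi (fun p => f p.1 p.2) (repr t).

End Tensor.

Section BaseChange.
Variables (A : comNzRingType) (C : nzRingType) (theta : A -> C) (M : lmodType A).

Inductive bchange_rel : {malg C[M]} -> Prop :=
| bchange_add m m' : bchange_rel (<< m + m' >> - << m >> - << m' >>)
| bchange_scale a m : bchange_rel (<< a *: m >> - theta a *: << m >>).

(* [bchange] is M (x)_theta C, generated by the [bpure m] = m (x) 1 *)
Definition bchange : lmodType C := qmod bchange_rel.

Definition bpure (m : M) : bchange := qproj bchange_rel << m >>.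

Definition blift (P : lmodType C) (f : M -> P) (t : bchange) : P :=
  lext idfun f (repr t).

End BaseChange.

Arguments bpure {A C} theta {M} m.

Notation "m (x) n" := (tpure m n) (at level 40, left associativity).

Section LiftTheory.
Variables (A B : nzRingType) (phi : {rmorphism A -> B}) (X : choiceType).
Variables (P : lmodType B) (f : X -> P).

Lemma lext_sub (D : {fset X}) (x : {malg A[X]}) : {subset msupp x <= D} ->
  lext phi f x = \sum_(k <- D) phi (mcoeff k x) *: f k.
Proof.
move=> sxD; rewrite /lext [RHS](bigID (mem (msupp x))) /= [X in _ + X]big1.
  rewrite addr0 -[RHS]big_filter; apply: perm_big; apply: uniq_perm.
  - exact: fset_uniq.
  - by rewrite filter_uniq ?fset_uniq.
  by move=> k; rewrite mem_filter andbC; case: (boolP (k \in msupp x)) => [/sxD->|_];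
    rewrite ?andbF.
by move=> k kx; rewrite mcoeff_outdom // rmorph0 scale0r.
Qed.

Lemma lextD : {morph lext phi f : x y / x + y}.
Proof.
move=> x y; pose D := fsetU (msupp x) (msupp y).
rewrite !(@lext_sub D) -?big_split /=; last 3 first.
- by move=> k kx; rewrite in_fsetU kx orbT.
- by move=> k kx; rewrite in_fsetU kx.
- by move=> k; exact: (fsubsetP (msuppD_le x y)).
by apply: eq_bigr => k _; rewrite mcoeffD rmorphD scalerDl.
Qed.

Lemma lextZ a x : lext phi f (a *: x) = phi a *: lext phi f x.
Proof.
rewrite (@lext_sub (msupp x)) => [|k]; last exact: (fsubsetP (msuppZ_le a x)).
rewrite scaler_sumr; apply: eq_bigr => k _.
by rewrite mcoeffZ rmorphM scalerA.
Qed.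

Lemma lextN x : lext phi f (- x) = - lext phi f x.
Proof. by rewrite -[- x]scaleN1r lextZ rmorphN1 scaleN1r. Qed.

Lemma lextB : {morph lext phi f : x y / x - y}.
Proof. by move=> x y; rewrite lextD lextN. Qed.

Lemma lextU k : lext phi f << k >> = f k.
Proof.
rewrite (@lext_sub [fset k]%fset) => [|j]; last first.
  by rewrite msuppU oner_eq0.
by rewrite big_seq_fset1 mcoeffUU rmorph1 scale1r.
Qed.

Lemma lext_qmod (S : {malg A[X]} -> Prop) x :
  (forall y, S y -> lext phi f y = 0) ->
  lext phi f (repr (qproj S x)) = lext phi f x.
Proof.
move=> S0; apply/eqP; rewrite -subr_eq0 -lextB; apply/eqP.
have : lspan S (repr (qproj S x) - x) by apply/qprojP; rewrite qprojK.
elim=> [|a y z Sy _ IH]; first by rewrite /lext msupp0 big_seq_fset0.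
by rewrite lextD lextZ S0 // scaler0 add0r.
Qed.

End LiftTheory.

Section TliftTheory.
Variables (A : comNzRingType) (B : nzRingType) (phi : {rmorphism A -> B}).
Variables (M N : lmodType A) (P : lmodType B) (f : M -> N -> P).
Hypothesis fl : forall a m m' n, f (a *: m + m') n = phi a *: f m n + f m' n.
Hypothesis fr : forall a m n n', f m (a *: n + n') = phi a *: f m n + f m n'.

Lemma tlift_rel y : tens_rel y -> lext phi (fun p => f p.1 p.2) y = 0.
Proof.
have f0l n : f 0 n = 0.
  by have := fl (-1) 0 0 n; rewrite scaler0 addr0 rmorphN1 scaleN1r addNr.
have f0r m : f m 0 = 0.
  by have := fr (-1) m 0 0; rewrite scaler0 addr0 rmorphN1 scaleN1r addNr.
case=> [m m' n|m n n'|a m n|a m n]; rewrite !lextB ?lextZ !lextU /=.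
- by have := fl 1 m m' n; rewrite !scale1r rmorph1 scale1r => ->; rewrite addrAC addrK subrr.
- by have := fr 1 m n n'; rewrite !scale1r rmorph1 scale1r => ->; rewrite addrAC addrK subrr.
- by have := fl a m 0 n; rewrite f0l !addr0 => ->; rewrite subrr.
- by have := fr a m n 0; rewrite f0r !addr0 => ->; rewrite subrr.
Qed.

Lemma tlift_pure m n : tlift phi f (m (x) n) = f m n.
Proof. by rewrite /tlift /tpure lext_qmod ?lextU //; apply: tlift_rel. Qed.

Lemma tlift_comb a x y :
  tlift phi f (a *: x + y) = phi a *: tlift phi f x + tlift phi f y.
Proof.
rewrite /tlift -[in LHS](qprojK x) -[in LHS](qprojK y) -qprojZ -qprojD.
by rewrite lext_qmod ?lextD ?lextZ //; apply: tlift_rel.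
Qed.

End TliftTheory.

Section BliftTheory.
Variables (A : comNzRingType) (C : nzRingType) (theta : A -> C).
Variables (M : lmodType A) (P : lmodType C) (f : M -> P).
Hypothesis fl : forall a m m', f (a *: m + m') = theta a *: f m + f m'.
Hypothesis theta1 : theta 1 = 1.

Lemma blift_rel y : bchange_rel theta y -> lext idfun f y = 0.
Proof.
have fD m m' : f (m + m') = f m + f m'.
  by have := fl 1 m m'; rewrite theta1 !scale1r.
have f0 : f 0 = 0 by apply: (addrI (f 0)); rewrite -fD !addr0.
have fZ a m : f (a *: m) = theta a *: f m by have := fl a m 0; rewrite f0 !addr0.
pose i : {rmorphism C -> C} := idfun.
case=> [m m'|a m]; rewrite !(lextB i) ?(lextZ i) !(lextU i) ?fD ?fZ ?subrr //.
by rewrite addrAC addrK subrr.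
Qed.

Lemma blift_pure m : blift f (bpure theta m) = f m.
Proof.
pose i : {rmorphism C -> C} := idfun.
by rewrite /blift /bpure (lext_qmod (phi := i)) ?(lextU i) //; apply: blift_rel.
Qed.

End BliftTheory.

Definition tmap (A : comNzRingType) (M M' N N' : lmodType A)
    (f : M -> M') (g : N -> N') : tens M N -> tens M' N' :=
  tlift idfun (fun m n => f m (x) g n).

Definition tflip (A : comNzRingType) (M N : lmodType A) :
  tens M N -> tens N M := tlift idfun (fun m n => n (x) m).

(* (u (x) v) (x) w |-> u (x) (v (x) w) and back *)
Definition tassoc (A : comNzRingType) (U V W : lmodType A) :
    tens (tens U V) W -> tens U (tens V W) :=
  tlift idfun (fun t w => tmap idfun (fun v => v (x) w) t).

Definition tassocV (A : comNzRingType) (U V W : lmodType A) :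
    tens U (tens V W) -> tens (tens U V) W :=
  tlift idfun (fun u t => tmap (fun v => u (x) v) idfun t).

(* (u (x) v) (x) w |-> (u (x) w) (x) v *)
Definition tswap23 (A : comNzRingType) (U V W : lmodType A) :
    tens (tens U V) W -> tens (tens U W) V :=
  tlift idfun (fun t w => tmap (fun u => u (x) w) idfun t).

Fixpoint tpow (A : comNzRingType) (M : lmodType A) (n : nat) : lmodType A :=
  if n is n'.+1 then tens (tpow M n') M else M.

(* A module with a product and a unit. The ring axioms are not recorded:
   for the algebras below they are consequences of the definitions. *)
Record ralg (R : nzRingType) := Ralg {
  ralg_car :> lmodType R;
  ralg_mul : ralg_car -> ralg_car -> ralg_car;
  ralg_one : ralg_car }.

Definition alg_iso (R : nzRingType) (A B : ralg R) (f : A -> B) : Prop :=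
  [/\ forall a x y, f (a *: x + y) = a *: f x + f y,
      bijective f,
      f (ralg_one A) = ralg_one B &
      forall x y, f (ralg_mul x y) = ralg_mul (f x) (f y)].

Definition ralg_qalg (R : nzRingType) (A : lalgType R) (S : A -> Prop) : ralg R :=
  @Ralg R (qalg S) *%R 1.

Definition tens_alg (C : comNzRingType) (A B : ralg C) : ralg C :=
  @Ralg C (tens A B)
    (fun x y => tlift idfun (fun a b =>
                  tmap (@ralg_mul _ A a) (@ralg_mul _ B b) y) x)
    (ralg_one A (x) ralg_one B).

Fixpoint tens_alg_pow (C : comNzRingType) (A : ralg C) (n : nat) : ralg C :=
  if n is n'.+1 then tens_alg (tens_alg_pow A n') A else A.

Definition bchange_alg (A : comNzRingType) (C : nzRingType) (theta : A -> C)
    (M : ralg A) : ralg C :=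
  @Ralg C (bchange theta M)
    (fun x y => blift (fun a =>
                  blift (fun b => bpure theta (ralg_mul a b)) y) x)
    (bpure theta (ralg_one M)).

Section Laurent.
Variable C : fieldType.

Definition Kq := {fraction {poly C}}.
HB.instance Definition _ := GRing.Field.on Kq.

Definition qK : Kq := tofrac 'X.

Definition laurent : {pred Kq} :=
  fun x => `[< exists (p : {poly C}) n, x = tofrac p / qK ^+ n >].

Lemma qK_neq0 : qK != 0.
Proof. by rewrite /qK tofrac_eq0 polyX_eq0. Qed.

Lemma laurent_subring : subring_closed laurent.
Proof.
split.
- by apply/asboolP; exists 1, 0%N; rewrite tofrac1 expr0 divr1.
- move=> x y /asboolP[p [n ->]] /asboolP[r [m ->]]; apply/asboolP.
  exists (p * 'X^m - r * 'X^n), (n + m)%N.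
  rewrite tofracB !tofracM !tofracXn -/qK exprD mulrBl; congr (_ - _).
    by rewrite [qK ^+ n * _]mulrC invfM mulrA mulfK ?expf_neq0 ?qK_neq0.
  by rewrite invfM mulrA mulfK ?expf_neq0 ?qK_neq0.
- move=> x y /asboolP[p [n ->]] /asboolP[r [m ->]]; apply/asboolP.
  by exists (p * r), (n + m)%N; rewrite tofracM exprD invfM mulrACA.
Qed.

HB.instance Definition _ :=
  GRing.isSubringClosed.Build Kq laurent laurent_subring.

Record laurent_ring := LaurentRing { lval : Kq; lvalP : lval \in laurent }.

HB.instance Definition _ := [isSub for lval].
HB.instance Definition _ := [Choice of laurent_ring by <:].
HB.instance Definition _ := [SubChoice_isSubComNzRing of laurent_ring by <:].

HB.instance Definition _ := GRing.isZmodMorphism.Build laurent_ring Kq lval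
  (fun _ _ => erefl).
HB.instance Definition _ := GRing.isMonoidMorphism.Build laurent_ring Kq lval
  (conj erefl (fun _ _ => erefl)).

Lemma laurent_repr (a : laurent_ring) :
  exists pn : {poly C} * nat, lval a = tofrac pn.1 / qK ^+ pn.2.
Proof. by case: a => x /= /asboolP[p [n ->]]; exists (p, n). Qed.

(* theta(p / q^n) = p(1); see [thetaE] *)
Definition theta (a : laurent_ring) : C :=
  (projT1 (cid (laurent_repr a))).1.[1].

Lemma thetaE (a : laurent_ring) p n :
  lval a = tofrac p / qK ^+ n -> theta a = p.[1].
Proof.
move=> ap; rewrite /theta; case: (cid _) => -[r m] /= ar.
have /eqP : tofrac r / qK ^+ m = tofrac p / qK ^+ n by rewrite -ar.
rewrite eqr_div ?expf_neq0 ?qK_neq0 // -!tofracXn -!tofracM tofrac_eq.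
by move=> /eqP/(congr1 (horner^~ 1)); rewrite !hornerM !hornerXn !expr1n !mulr1.
Qed.

Lemma theta_zmod : zmod_morphism theta.
Proof.
move=> a b; have [[p n] /= ap] := laurent_repr a.
have [[r m] /= br] := laurent_repr b.
rewrite (thetaE ap) (thetaE br) (@thetaE _ (p * 'X^m - r * 'X^n) (n + m)).
  by rewrite !hornerE !expr1n !mulr1.
rewrite [lval _]/(lval a - lval b) ap br.
rewrite tofracB !tofracM !tofracXn -/qK exprD mulrBl; congr (_ - _).
  by rewrite [qK ^+ n * _]mulrC invfM mulrA mulfK ?expf_neq0 ?qK_neq0.
by rewrite invfM mulrA mulfK ?expf_neq0 ?qK_neq0.
Qed.

Lemma theta_monoid : monoid_morphism theta.
Proof.
split.
  by rewrite (@thetaE _ 1 0%N) ?hornerC //= expr0 divr1 tofrac1.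
move=> a b; have [[p n] /= ap] := laurent_repr a.
have [[r m] /= br] := laurent_repr b.
rewrite (thetaE ap) (thetaE br) (@thetaE _ (p * r) (n + m)) ?hornerE //.
by rewrite [lval _]/(lval a * lval b) ap br tofracM exprD invfM mulrACA.
Qed.

HB.instance Definition _ :=
  GRing.isZmodMorphism.Build laurent_ring C theta theta_zmod.
HB.instance Definition _ :=
  GRing.isMonoidMorphism.Build laurent_ring C theta theta_monoid.

End Laurent.

Inductive simple_root := alpha1 | alpha2.

Definition sform (i j : simple_root) : int :=
  match i, j with
  | alpha1, alpha1 => 2
  | alpha2, alpha2 => 6
  | _, _ => -3
  end.

(* [(m1, m2)] stands for m1 alpha_1 + m2 alpha_2; for G_2 the weight lattice
   is the root lattice *)
Definition weight := (int * int)%type.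

Definition wform (i : simple_root) (mu : weight) : int :=
  sform i alpha1 * mu.1 + sform i alpha2 * mu.2.

(* 1 - a_ij for j <> i, where a_12 = -3 and a_21 = -1 *)
Definition serre_exp (i : simple_root) : nat :=
  match i with alpha1 => 4 | alpha2 => 2 end.

Inductive Uq_gen :=
| gE of simple_root | gF of simple_root | gK of simple_root | gKV of simple_root.

(* Matrices of the generators on column vectors, in the basis
   v_1, v_2, v_3, v_0, v_{-3}, v_{-2}, v_{-1} numbered 0, ..., 6, with q := t. *)
Section SevenDim.
Variables (F : fieldType) (t : F).

(* sends the basis vector number j to the one number i *)
Let e (i j : nat) : 'M[F]_7 := delta_mx (inord i) (inord j).
Let two := t + t^-1.

Definition V_K_exp (i : simple_root) : seq int :=
  match i with
  | alpha1 => [:: 1; -1; 2; 0; -2; 1; -1]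
  | alpha2 => [:: 0; 3; -3; 0; 3; -3; 0]
  end.

Definition V_mx (g : Uq_gen) : 'M[F]_7 :=
  match g with
  | gE alpha1 => e 0 1 + two *: e 2 3 - two *: e 3 4 - e 5 6
  | gE alpha2 => e 1 2 - e 4 5
  | gF alpha1 => e 1 0 + e 3 2 - e 4 3 - e 6 5
  | gF alpha2 => e 2 1 - e 5 4
  | gK i => diag_mx (\row_j t ^ (V_K_exp i)`_j)
  | gKV i => diag_mx (\row_j t ^ (- (V_K_exp i)`_j))
  end.

End SevenDim.

Section QuantumG2.
Variable C : fieldType.
Local Notation K := (Kq C).
Local Notation q := (qK C).
Local Notation A := (laurent_ring C).

(* A vector space with operators E_i, F_i, K_i, K_i^-1; it is a U_q-module
   when [Uq_rel] holds. *)
Record opModule := OpModule {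
  om_car :> lmodType K;
  act : Uq_gen -> om_car -> om_car }.

Definition qi (i : simple_root) : K :=
  match i with alpha1 => q | alpha2 => q ^+ 3 end.

Definition qint (t : K) (n : nat) : K := (t ^+ n - t ^- n) / (t - t^-1).
Definition qfact (t : K) (n : nat) : K := \prod_(k < n) qint t k.+1.
Definition qbin (t : K) (n k : nat) : K :=
  qfact t n / (qfact t k * qfact t (n - k)).

Section Modules.
Variable W : opModule.
Local Notation E i := (@act W (gE i)).
Local Notation F i := (@act W (gF i)).
Local Notation Ki i := (@act W (gK i)).
Local Notation KVi i := (@act W (gKV i)).

Definition serre_sum (X Y : W -> W) (i : simple_root) (x : W) : W :=
  \sum_(k < (serre_exp i).+1)
    ((-1) ^+ k * qbin (qi i) (serre_exp i) k)
      *: iter (serre_exp i - k) X (Y (iter k X x)).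

Record Uq_rel : Prop := UqRel {
  act_lin g a x y : @act W g (a *: x + y) = a *: act g x + act g y;
  act_KV i x : Ki i (KVi i x) = x;
  act_VK i x : KVi i (Ki i x) = x;
  act_KK i j x : Ki i (Ki j x) = Ki j (Ki i x);
  act_KE i j x : Ki i (E j x) = q ^ (sform i j) *: E j (Ki i x);
  act_KF i j x : Ki i (F j x) = q ^ (- sform i j) *: F j (Ki i x);
  act_EF i x : E i (F i x) - F i (E i x)
                 = (qi i - (qi i)^-1)^-1 *: (Ki i x - KVi i x);
  act_EFneq i j x : i <> j -> E i (F j x) = F j (E i x);
  act_serreE i j x : i <> j -> serre_sum (E i) (E j) i x = 0;
  act_serreF i j x : i <> j -> serre_sum (F i) (F j) i x = 0 }.

Definition weight_vector (mu : weight) (x : W) : Prop :=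
  forall i, Ki i x = q ^ (wform i mu) *: x.

Definition type1 : Prop :=
  forall x, lspan (fun y => exists mu, weight_vector mu y) x.

Definition locally_finite : Prop :=
  forall x : W, exists s : seq W, let U := lspan (fun y => y \in s) in
    U x /\ forall g y, U y -> U (act g y).

(* locally finite U_q-modules of type 1, the modules on which the universal
   R-matrix acts *)
Definition Uq_module : Prop := [/\ Uq_rel, type1 & locally_finite].

Definition submodule (N : W -> Prop) : Prop :=
  [/\ N 0, forall a x y, N x -> N y -> N (a *: x + y) &
      forall g x, N x -> N (act g x)].

Definition simple_submodule (N : W -> Prop) : Prop :=
  [/\ submodule N, exists2 x, N x & x <> 0 &
      forall N', submodule N' -> (forall x, N' x -> N x) ->
        (forall x, N' x -> x = 0) \/ (forall x, N x -> N' x)].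

Definition highest_weight (mu : weight) (N : W -> Prop) : Prop :=
  exists v, [/\ N v, v <> 0, forall i, E i v = 0 & weight_vector mu v].

(* sum of the submodules of W isomorphic to V_mu *)
Definition component (mu : weight) : W -> Prop :=
  lspan (fun x => exists N,
    [/\ simple_submodule N, highest_weight mu N & N x]).

End Modules.

Definition Uq_hom (W W' : opModule) (f : W -> W') : Prop :=
  (forall a x y, f (a *: x + y) = a *: f x + f y) /\
  (forall g x, f (act g x) = act g (f x)).

Definition otens (W W' : opModule) : opModule :=
  @OpModule (tens W W') (fun g t =>
    match g with
    | gE i => tmap (act (gE i)) (act (gK i)) t + tmap idfun (act (gE i)) t
    | gF i => tmap (act (gF i)) idfun t + tmap (act (gKV i)) (act (gF i)) t
    | gK i => tmap (act (gK i)) (act (gK i)) t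
    | gKV i => tmap (act (gKV i)) (act (gKV i)) t
    end).

(* The universal R-matrix lives in a completion of U_q (x) U_q: it is given by
   its action on all W (x) W'. *)
Definition Rfamily := forall W W' : opModule, tens W W' -> tens W W'.

Section RMatrix.
Variable Rm : Rfamily.
Arguments Rm : clear implicits.

Definition R12 (U V W : opModule) : tens (tens U V) W -> tens (tens U V) W :=
  tmap (Rm U V) idfun.
Definition R13 (U V W : opModule) : tens (tens U V) W -> tens (tens U V) W :=
  fun t => tswap23 (tmap (Rm U W) idfun (tswap23 t)).
Definition R23 (U V W : opModule) : tens (tens U V) W -> tens (tens U V) W :=
  fun t => tassocV (tmap idfun (Rm V W) (tassoc t)).

Definition Rcheck (W W' : opModule) (t : otens W W') : otens W' W :=
  tflip (Rm W W' t).

Record universal_R : Prop := UniversalR {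
  (* R Delta(x) = Delta^op(x) R *)
  UR_hom (W W' : opModule) : Uq_module W -> Uq_module W' -> Uq_hom (@Rcheck W W');
  UR_bij (W W' : opModule) : Uq_module W -> Uq_module W' -> bijective (Rm W W');
  UR_natural (W W' W1 W1' : opModule) (f : W -> W1) (g : W' -> W1') :
    Uq_module W -> Uq_module W' -> Uq_module W1 -> Uq_module W1' ->
    Uq_hom f -> Uq_hom g ->
    forall t, tmap f g (Rm W W' t) = Rm W1 W1' (tmap f g t);
  (* (Delta (x) id) R = R_13 R_23 *)
  UR_coprodl (U V W : opModule) : Uq_module U -> Uq_module V -> Uq_module W ->
    forall t, Rm (otens U V) W t = R13 (R23 t);
  (* (id (x) Delta) R = R_13 R_12 *)
  UR_coprodr (U V W : opModule) : Uq_module U -> Uq_module V -> Uq_module W ->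
    forall t, Rm U (otens V W) (tassoc t) = tassoc (R13 (R12 t)) }.

End RMatrix.

Definition Vmod : opModule :=
  @OpModule 'cV[K]_7 (fun g v => V_mx q g *m v).

Local Notation VV := (otens Vmod Vmod).

Definition lambda1 : weight := (2, 1).
Definition lambda2 : weight := (3, 2).

Definition wedge2 (t : VV) : Prop :=
  exists t1 t2, [/\ @component VV lambda2 t1, @component VV lambda1 t2 &
                    t = t1 + t2].

Definition R_normalised (Rm : Rfamily) : Prop :=
  forall x y z w : VV,
    @component VV (4, 2) x -> @component VV (0, 0) y ->
    @component VV lambda2 z -> @component VV lambda1 w ->
    Rcheck Rm (x + y + z + w)
      = q ^+ 2 *: x + q ^- 12 *: y - z - q ^- 6 *: w.

(* the tensor algebra of V = free algebra on the basis of V *)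
Definition TV : lalgType K := {malg K[{fmonom 'I_7}]}.

Definition vinj (v : Vmod) : TV := \sum_(j < 7) v j 0 *: << fmu j >>.

(* the action on v_{a_1} ... v_{a_n}, through the iterated coproduct *)
Fixpoint word_act (g : Uq_gen) (w : seq 'I_7) : TV :=
  match w with
  | [::] => match g with gE _ | gF _ => 0 | gK _ | gKV _ => 1 end
  | a :: w' =>
      let v : Vmod := delta_mx a 0 in
      let w0 : TV := << fmonom_of_seq fmonom_key w' >> in
      match g with
      | gE i => vinj (act (gE i) v) * word_act (gK i) w'
                  + vinj v * word_act (gE i) w'
      | gF i => vinj (act (gF i) v) * w0
                  + vinj (act (gKV i) v) * word_act (gF i) w'
      | gK i => vinj (act (gK i) v) * word_act (gK i) w'
      | gKV i => vinj (act (gKV i) v) * word_act (gKV i) w'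
      end
  end.

Definition TV_act (g : Uq_gen) : TV -> TV :=
  lext idfun (fun w : {fmonom 'I_7} => word_act g w).

Definition Sq_rel (x : TV) : Prop :=
  exists2 t, wedge2 t & x = tlift idfun (fun u v => vinj u * vinj v) t.

Definition Sq : Type := qalg Sq_rel.
HB.instance Definition _ := GRing.Lmodule.on Sq.
HB.instance Definition _ := GRing.PzRing.on Sq.

Definition Sq_proj : TV -> Sq := @aproj K TV Sq_rel.

(* the ideal is stable under U_q, so the representative does not matter *)
Definition Sq_mod : opModule :=
  @OpModule Sq (fun g x => Sq_proj (TV_act g (repr (x : qalg Sq_rel)))).

Record opAlg := OpAlg {
  oa_mod :> opModule;
  oa_mul : oa_mod -> oa_mod -> oa_mod;
  oa_one : oa_mod }.

Definition Sq_alg : opAlg := @OpAlg Sq_mod (fun x y : Sq => x * y) (1 : Sq).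

(* (a (x) b) (a' (x) b') = (mu_A (x) mu_B) (a (x) Rcheck (b (x) a') (x) b') *)
Definition braided (Rm : Rfamily) (X Y : opAlg) : opAlg :=
  @OpAlg (otens X Y)
    (fun s t => tlift idfun (fun a b =>
                  tlift idfun (fun a' b' =>
                    tmap (fun x => oa_mul a x) (fun y => oa_mul y b')
                      (Rcheck Rm (b (x) a' : otens Y X))) t) s)
    (oa_one X (x) oa_one Y).

(* [Am Rm n] is A_{n+1}(V) *)
Fixpoint Am (Rm : Rfamily) (n : nat) : opAlg :=
  if n is n'.+1 then braided Rm (Am Rm n') Sq_alg else Sq_alg.

(* the image of T(V_A); as the relations are homogeneous, its degree n part is
   the image of the n-th tensor power of V_A *)
Definition SA_pred : {pred Sq} :=
  fun x => `[< exists2 t : TV, t \is a monalgOver (@laurent C) & x = Sq_proj t >].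

Lemma SA_subring : subring_closed SA_pred.
Proof.
split.
- by apply/asboolP; exists 1; rewrite ?monalgOver1.
- move=> x y /asboolP[s As ->] /asboolP[t At ->]; apply/asboolP.
  exists (s - t); first by rewrite rpredB.
  by rewrite /Sq_proj aprojB.
- move=> x y /asboolP[s As ->] /asboolP[t At ->]; apply/asboolP.
  exists (s * t); first by rewrite rpredM.
  exact: (esym (aprojM _ s t)).
Qed.

HB.instance Definition _ := GRing.isSubringClosed.Build Sq SA_pred SA_subring.

Record SA := SAelt { sval_SA : Sq; sval_SAP : sval_SA \in SA_pred }.

HB.instance Definition _ := [isSub for sval_SA].
HB.instance Definition _ := [Choice of SA by <:].
HB.instance Definition _ := 
  GRing.SubChoice_isSubPzRing.Build Sq SA_pred SA SA_subring.

Lemma SA_scale_subproof (a : A) (x : SA) : lval a *: sval_SA x \in SA_pred.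
Proof.
have /asboolP[t At ->] := sval_SAP x; apply/asboolP.
exists (lval a *: t); first by apply: monalgOverZ At; apply: lvalP.
exact: (esym (aprojZ _ _ t)).
Qed.

Definition SA_scale (a : A) (x : SA) : SA := SAelt (SA_scale_subproof a x).

Lemma SA_scaleA a b x : SA_scale a (SA_scale b x) = SA_scale (a * b) x.
Proof. by apply: val_inj; rewrite /= scalerA. Qed.

Lemma SA_scale1 : left_id 1 SA_scale.
Proof. by move=> x; apply: val_inj; rewrite /= scale1r. Qed.

Lemma SA_scaleDr : right_distributive SA_scale +%R.
Proof. by move=> a x y; apply: val_inj; rewrite /= scalerDr. Qed.

Lemma SA_scaleDl x : {morph SA_scale^~ x : a b / a + b}.
Proof. by move=> a b; apply: val_inj; rewrite /= scalerDl. Qed.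

HB.instance Definition _ := GRing.Zmodule_isLmodule.Build A SA
  SA_scaleA SA_scale1 SA_scaleDr SA_scaleDl.

Definition SA_alg : ralg A := @Ralg A SA *%R 1.

Definition Sq_bar : ralg C := bchange_alg (@theta C) SA_alg.

(* the (n+1)-st tensor power of S_A(V_A) over A *)
Definition AmA (n : nat) : lmodType A := tpow SA n.

Fixpoint AmA_one (n : nat) : AmA n :=
  if n is n'.+1 then AmA_one n' (x) (1 : SA) else (1 : SA).

(* the canonical map from the tensor power over A to A_{n+1}(V) *)
Fixpoint AmA_incl (Rm : Rfamily) (n : nat) : AmA n -> Am Rm n :=
  match n return AmA n -> Am Rm n with
  | 0 => fun x => sval_SA x
  | n'.+1 => tlift (@lval C) (fun t x => @AmA_incl Rm n' t (x) (sval_SA x))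
  end.

(* [mul] is the restriction to the A-form of the product of A_{n+1}(V) *)
Definition braided_form (Rm : Rfamily) (n : nat)
    (mul : AmA n -> AmA n -> AmA n) : Prop :=
  injective (@AmA_incl Rm n) /\
  forall x y, AmA_incl Rm (mul x y) = oa_mul (AmA_incl Rm x) (AmA_incl Rm y).

(* the classical limit of A_{n+1}(V) *)
Definition Am_bar (n : nat) (mul : AmA n -> AmA n -> AmA n) : ralg C :=
  bchange_alg (@theta C) (@Ralg A (AmA n) mul (AmA_one n)).

(* the canonical identification of (M (x)_A ... (x)_A M) (x)_theta C with
   (M (x)_theta C) (x)_C ... (x)_C (M (x)_theta C), for M = S_A(V_A) *)
Fixpoint AmA_red (n : nat) : AmA n -> tens_alg_pow Sq_bar n :=
  match n return AmA n -> tens_alg_pow Sq_bar n with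
  | 0 => fun x => bpure (@theta C) x
  | n'.+1 =>
      tlift (@theta C) (fun t x => @AmA_red n' t (x) bpure (@theta C) x)
  end.

Definition Am_bar_canon (n : nat) (mul : AmA n -> AmA n -> AmA n) :
    Am_bar mul -> tens_alg_pow Sq_bar n := blift (@AmA_red n).

(* exp(z x), for x nilpotent *)
Definition exp_mx (z : C) (x : 'M[C]_7) : 'M[C]_7 :=
  \sum_(k < 7) (z ^+ k / k`!%:R) *: x ^+ k.

(* The Chevalley group of type G_2 in its 7-dimensional representation: the
   group generated by the root subgroups exp(z e_i), exp(z f_i). *)
Inductive G2 : 'M[C]_7 -> Prop :=
| G2_1 : G2 1
| G2_E i z g : G2 g -> G2 (exp_mx z (V_mx 1 (gE i)) *m g)
| G2_F i z g : G2 g -> G2 (exp_mx z (V_mx 1 (gF i)) *m g).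

(* [T] stands for \sum_(i, j) T i j v_i (x) v_j *)
Definition G2_invariant (T : 'M[C]_7) : Prop :=
  forall g, G2 g -> g *m T *m g^T = T.

Definition spans_invariants (T : 'M[C]_7) : Prop :=
  G2_invariant T /\ forall T', G2_invariant T' -> exists c, T' = c *: T.

(* S(C^7) is the polynomial ring [mpoly 7 C], its i-th variable being the
   i-th basis vector *)
Definition sym_tensor (T : 'M[C]_7) : (mpoly 7 C) :=
  \sum_i \sum_j T i j *: ('X_i * 'X_j).

Definition S1_times (phi x : (mpoly 7 C)) : Prop :=
  exists c : 'I_7 -> C, x = (\sum_i c i *: 'X_i) * phi.

Definition Sym_quot (T : 'M[C]_7) : ralg C :=
  @ralg_qalg C (mpoly 7 C) (S1_times (sym_tensor T)).

End QuantumG2.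

(* Main.v *)
From HB Require Import structures.
Require Import Defs.
From Stdlib Require Import ZArith.
From mathcomp Require Import all_boot all_order all_algebra.
From mathcomp Require Import boolp reals complex.
From mathcomp Require Import finmap mpoly monalg ssrcomplements.
From mathcomp Require Import ssrZ zify ring.

Set Implicit Arguments.
Unset Strict Implicit.
Unset Printing Implicit Defensive.

Import GRing.Theory.
Local Open Scope ring_scope.
Delimit Scope Z_scope with Zc.

(** The relations of S_q(V) can be read as rewriting rules sending v_j v_i, for j
   > i, to a combination of smaller words; at q = 1 they become commutators.
   Their overlaps force v_i phi = phi v_i = 0 for a quadratic element phi = v_0^2
   + ..., that is, one more rule for v_0^2, valid in degree at least 3 only. The
   completed system is confluent over Z[q, q^-1], so that the irreducible words
   are a basis of the A-form of S_q(V) (diamond lemma); hence its specialisation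
   at q = 1 is the polynomial ring modulo the elements x_i phi, and phi
   specialises to the invariant quadratic form, up to a scalar.

   For the second part, the explicit braiding of V (x) V shows that R is
   congruent to the identity modulo q - 1 on the standard lattice. The hexagon
   axioms propagate this to the tensor powers of V, and naturality along
   T(V) -> S_q(V) to S_q(V) and to its tensor powers. So the A-form is closed
   under the braided product, which is componentwise modulo q - 1.

   The finitely many identities in V, in V (x) V and between words of length 3
   are checked by computation with integral Laurent polynomials: for instance the
   isotypic components of V (x) V are generated by explicit highest weight
   vectors, on which the braiding is known. *)

(** * Semilinear maps and tensor products *)

(** At q = 1 the quadratic relations are only commutators, so v_i phi = 0 cannot be found by
    specialising them. The difference of the two reductions of an overlap is a unit times (q -
    q^-1)^2 times a cubic relation. The factor can be divided out over C(q), and the A-form, being a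
    subset of S_q(V), inherits the quotient; this is why the classical limit is smaller than S(C^7).
    Relations are therefore derived over C(q), while the completed rules have coefficients in A, so
    that they can be specialised. The universal R-matrix is known only through its axioms and, on V
    (x) V, through its eigenvalues. The axioms apply to locally finite modules of type 1 only, so
    tensor products, S_q(V) and the A_m(V) must all be shown to be such modules; the laborious point
    is the Serre relations for the coproduct. The product of the A-form lives on an abstract tensor
    power over A, whereas the congruences modulo q - 1 are proved for lattices inside modules over
    C(q). The comparison map is injective because S_q(V) and its A-form share the basis of
    irreducible words. *)

Definition semilin (A B : nzRingType) (phi : A -> B) (M : lmodType A)
    (P : lmodType B) (f : M -> P) : Prop :=
  forall a x y, f (a *: x + y) = phi a *: f x + f y.

Notation lin f := (semilin idfun f).

Section Semilin.
Variables (A B : nzRingType) (phi : {rmorphism A -> B}).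
Variables (M : lmodType A) (P : lmodType B).
Implicit Types f g : M -> P.

Lemma semilinD f : semilin phi f -> {morph f : x y / x + y}.
Proof. by move=> fl x y; have := fl 1 x y; rewrite rmorph1 !scale1r. Qed.

Lemma semilin0 f : semilin phi f -> f 0 = 0.
Proof. by move=> fl; have := fl (-1) 0 0; rewrite scaler0 addr0 rmorphN1 scaleN1r addNr. Qed.

Lemma semilinZ f : semilin phi f -> forall a x, f (a *: x) = phi a *: f x.
Proof. by move=> fl a x; have := fl a x 0; rewrite !addr0 (semilin0 fl) addr0. Qed.

Lemma semilinN f : semilin phi f -> {morph f : x / - x}.
Proof. by move=> fl x; rewrite -scaleN1r (semilinZ fl) rmorphN1 scaleN1r. Qed.

Lemma semilinB f : semilin phi f -> {morph f : x y / x - y}.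
Proof. by move=> fl x y; rewrite (semilinD fl) (semilinN fl). Qed.

Lemma semilin_sum f (I : Type) (r : seq I) (Q : pred I) (F : I -> M) :
  semilin phi f -> f (\sum_(i <- r | Q i) F i) = \sum_(i <- r | Q i) f (F i).
Proof. by move=> fl; apply: (big_morph f (semilinD fl) (semilin0 fl)). Qed.

Lemma semilin_add f g : semilin phi f -> semilin phi g -> semilin phi (fun x => f x + g x).
Proof. by move=> fl gl a x y; rewrite fl gl scalerDr addrACA. Qed.

Lemma semilin_opp f : semilin phi f -> semilin phi (fun x => - f x).
Proof. by move=> fl a x y; rewrite fl opprD scalerN. Qed.

End Semilin.

Lemma semilin_scale (A : nzRingType) (B : comNzRingType) (phi : A -> B) (M : lmodType A)
    (P : lmodType B) (f : M -> P) b :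
  semilin phi f -> semilin phi (fun x => b *: f x).
Proof. by move=> fl a x y; rewrite fl scalerDr !scalerA mulrC. Qed.

Section Lin.
Variable (A : nzRingType).
Let i : {rmorphism A -> A} := idfun.

Lemma lin_id (M : lmodType A) : lin (@idfun M).
Proof. by []. Qed.

Variables (M P : lmodType A).
Implicit Types f g : M -> P.

Lemma linD f : lin f -> {morph f : x y / x + y}.
Proof. exact: (semilinD (phi := i)). Qed.

Lemma lin0 f : lin f -> f 0 = 0.
Proof. exact: (semilin0 (phi := i)). Qed.

Lemma linZ f : lin f -> forall a x, f (a *: x) = a *: f x.
Proof. exact: (semilinZ (phi := i)). Qed.

Lemma linB f : lin f -> {morph f : x y / x - y}.
Proof. exact: (semilinB (phi := i)). Qed.

Lemma lin_sum f (I : Type) (r : seq I) (Q : pred I) (F : I -> M) :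
  lin f -> f (\sum_(i <- r | Q i) F i) = \sum_(i <- r | Q i) f (F i).
Proof. exact: (semilin_sum (phi := i)). Qed.

Lemma lin_add f g : lin f -> lin g -> lin (fun x => f x + g x).
Proof. exact: (semilin_add (phi := i)). Qed.

Lemma lin_opp f : lin f -> lin (fun x => - f x).
Proof. exact: (semilin_opp (phi := i)). Qed.
End Lin.

Lemma lin_comp (A : nzRingType) (M N P : lmodType A) (f : M -> N) (g : N -> P) :
  lin f -> lin g -> lin (fun x => g (f x)).
Proof. by move=> fl gl a x y; rewrite fl gl. Qed.

Section Lspan.
Variables (R : nzRingType) (M : lmodType R).
Implicit Types S T : M -> Prop.

Lemma lspan_in S x : S x -> lspan S x.
Proof. by move=> Sx; rewrite -[x]addr0 -[x]scale1r; apply: lspanD (lspan0 _). Qed.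

Lemma lspan_add S x y : lspan S x -> lspan S y -> lspan S (x + y).
Proof. by move=> hx hy; rewrite -[x]scale1r; apply: lspan_comb. Qed.

Lemma lspan_scale S a x : lspan S x -> lspan S (a *: x).
Proof. by move=> hx; rewrite -[_ *: _]addr0; apply: lspan_comb (lspan0 _). Qed.

Lemma lspan_opp S x : lspan S x -> lspan S (- x).
Proof. by rewrite -scaleN1r; apply: lspan_scale. Qed.

Lemma lspan_sum S (I : Type) (r : seq I) (Q : pred I) (F : I -> M) :
  (forall i, Q i -> lspan S (F i)) -> lspan S (\sum_(i <- r | Q i) F i).
Proof.
move=> h; elim/big_rec: _ => [|i x Qi hx]; first by constructor.
by apply: lspan_add => //; apply: h.
Qed.

Lemma lspan_sub S T :
  T 0 -> (forall a x y, T x -> T y -> T (a *: x + y)) ->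
  (forall x, S x -> T x) -> forall x, lspan S x -> T x.
Proof. by move=> T0 TD ST x; elim=> // a u v /ST Tu _ Tv; apply: TD. Qed.

Lemma lspan_mono S T x : (forall y, S y -> T y) -> lspan S x -> lspan T x.
Proof.
move=> ST; apply: lspan_sub; [by constructor|by move=> *; apply: lspan_comb|].
by move=> y /ST; apply: lspan_in.
Qed.

End Lspan.

Lemma lspan_image (R : nzRingType) (M N : lmodType R) (f : M -> N)
    (S : M -> Prop) (T : N -> Prop) :
  lin f -> (forall x, S x -> lspan T (f x)) -> forall x, lspan S x -> lspan T (f x).
Proof.
move=> fl h; apply: lspan_sub; first by rewrite (lin0 fl); constructor.
  by move=> a x y hx hy; rewrite fl; apply: lspan_comb.
exact: h.
Qed.

Section Malg.
Variables (A : nzRingType) (X : choiceType).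

Lemma malg_ind (P : {malg A[X]} -> Prop) :
  P 0 -> (forall a k x, P x -> P (a *: << k >> + x)) -> forall x, P x.
Proof.
move=> P0 PD x; rewrite [x]monalgE; elim/big_rec: _ => // k y _.
have -> : << mcoeff k x *g k >> = mcoeff k x *: << k >>.
  by apply/malgP=> j; rewrite mcoeffZ !mcoeffU mulr_natr.
exact: PD.
Qed.
End Malg.

Section Tens.
Variables (A : comNzRingType).
Let i : {rmorphism A -> A} := idfun.

Section Pure.
Variables (M N : lmodType A).

Lemma tpureDl (m m' : M) (n : N) : (m + m') (x) n = m (x) n + m' (x) n.
Proof.
rewrite /tpure -qprojD; apply/qprojP.
by rewrite opprD addrA; apply: lspan_in; apply: tens_addl.
Qed.

Lemma tpureDr (m : M) (n n' : N) : m (x) (n + n') = m (x) n + m (x) n'.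
Proof.
rewrite /tpure -qprojD; apply/qprojP.
by rewrite opprD addrA; apply: lspan_in; apply: tens_addr.
Qed.

Lemma tpureZl a (m : M) (n : N) : (a *: m) (x) n = a *: (m (x) n).
Proof. by rewrite /tpure -qprojZ; apply/qprojP; apply: lspan_in; apply: tens_scalel. Qed.

Lemma tpureZr a (m : M) (n : N) : m (x) (a *: n) = a *: (m (x) n).
Proof. by rewrite /tpure -qprojZ; apply/qprojP; apply: lspan_in; apply: tens_scaler. Qed.

Lemma tpurel (n : N) : lin (fun m : M => m (x) n).
Proof. by move=> a x y; rewrite tpureDl tpureZl. Qed.

Lemma tpurer (m : M) : lin (fun n : N => m (x) n).
Proof. by move=> a x y; rewrite tpureDr tpureZr. Qed.

(** Scalars are absorbed in the left factor, so the induction step only has to add a pure tensor. *)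
Lemma tens_ind (P : tens M N -> Prop) :
  P 0 -> (forall m n x, P x -> P (m (x) n + x)) -> forall t, P t.
Proof.
move=> P0 PD t; rewrite -[t]qprojK; move: (repr t) => x.
elim/malg_ind: x => [|a [m n] x IH]; first by rewrite -(scale0r 0) qprojZ scale0r.
rewrite qprojD qprojZ -[qproj _ << _ >>]/(m (x) n) -tpureZl; exact: PD.
Qed.

Lemma tens_lspan (t : tens M N) (S : M -> Prop) (T : N -> Prop) :
  (forall m, lspan S m) -> (forall n, lspan T n) ->
  lspan (fun t => exists m n, [/\ S m, T n & t = m (x) n]) t.
Proof.
move=> hS hT; elim/tens_ind: t => [|m n t IH]; first by constructor.
apply: lspan_add IH; apply: (lspan_image (tpurel n) _ (hS m)) => m' Sm.
by apply: (lspan_image (tpurer m') _ (hT n)) => n' Tn; apply: lspan_in; exists m', n'.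
Qed.

Lemma tens_eq (B : nzRingType) (phi : {rmorphism A -> B}) (P : lmodType B)
    (f g : tens M N -> P) :
  semilin phi f -> semilin phi g -> (forall m n, f (m (x) n) = g (m (x) n)) -> f =1 g.
Proof.
move=> fl gl fg; elim/tens_ind => [|m n t IH]; first by rewrite (semilin0 fl) (semilin0 gl).
by rewrite (semilinD fl) (semilinD gl) fg IH.
Qed.

End Pure.

Lemma tens_eq3 (U V W : lmodType A) (P : lmodType A) (f g : tens (tens U V) W -> P) :
  lin f -> lin g -> (forall u v w, f ((u (x) v) (x) w) = g ((u (x) v) (x) w)) -> f =1 g.
Proof.
move=> fl gl fg; apply: (tens_eq (phi := i)) => // t w; move: t.
apply: (tens_eq (phi := i)) => [||u v]; last exact: fg.
  exact: (lin_comp (tpurel w) fl).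
exact: (lin_comp (tpurel w) gl).
Qed.

Section Tlift.
Variables (M N P : lmodType A) (f : M -> N -> P).
Hypothesis fl : forall n, lin (f^~ n).
Hypothesis fr : forall m, lin (f m).

Lemma tliftE m n : tlift idfun f (m (x) n) = f m n.
Proof. by apply: (tlift_pure (phi := i)) => a *; [apply: fl | apply: fr]. Qed.

Lemma tlift_lin : lin (tlift idfun f).
Proof. by move=> a x y; apply: (tlift_comb (phi := i)) => b *; [apply: fl | apply: fr]. Qed.

End Tlift.

Section Tmap.
Variables (M M' N N' : lmodType A) (f : M -> M') (g : N -> N').
Hypotheses (fl : lin f) (gl : lin g).

Lemma tmapE m n : tmap f g (m (x) n) = f m (x) g n.
Proof.
rewrite /tmap tliftE // => [n'|m']; first exact: (lin_comp fl (tpurel (g n'))).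
exact: (lin_comp gl (tpurer (f m'))).
Qed.

Lemma tmap_lin : lin (tmap f g).
Proof.
apply: tlift_lin => [n'|m']; first exact: (lin_comp fl (tpurel (g n'))).
exact: (lin_comp gl (tpurer (f m'))).
Qed.

End Tmap.

Section Assoc.
Variables (U V W : lmodType A).

Lemma tflipE (u : U) (v : V) : tflip (u (x) v) = v (x) u.
Proof. by rewrite /tflip tliftE // => x; [apply: tpurer|apply: tpurel]. Qed.

Lemma tflip_lin : lin (@tflip A U V).
Proof. by apply: tlift_lin => x; [apply: tpurer|apply: tpurel]. Qed.

Lemma tmap_pure_linr (t : tens U V) : lin (fun w : W => tmap idfun (fun v : V => v (x) w) t).
Proof.
have h w := tmap_lin (@lin_id A U) (@tpurel V W w).
elim/tens_ind: t => [|u v t IH] a x y; first by rewrite !(lin0 (h _)) scaler0 addr0.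
rewrite !(linD (h _)) !(tmapE (@lin_id A U) (@tpurel V W _)) IH !tpurer scalerDr addrACA.
by [].
Qed.

Lemma tassocE u v w : @tassoc A U V W ((u (x) v) (x) w) = u (x) (v (x) w).
Proof.
rewrite /tassoc tliftE; first by rewrite tmapE //; apply: tpurel.
  by move=> n; apply: tmap_lin => //; apply: tpurel.
exact: tmap_pure_linr.
Qed.

Lemma tassoc_lin : lin (@tassoc A U V W).
Proof.
apply: tlift_lin; last exact: tmap_pure_linr.
by move=> n; apply: tmap_lin => //; apply: tpurel.
Qed.

Lemma tmap_pure_linl (t : tens V W) : lin (fun u : U => tmap (fun v : V => u (x) v) (@idfun W) t).
Proof.
have h u := tmap_lin (@tpurer U V u) (@lin_id A W).
elim/tens_ind: t => [|u v t IH] a x y; first by rewrite !(lin0 (h _)) scaler0 addr0.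
rewrite !(linD (h _)) !(tmapE (@tpurer U V _) (@lin_id A W)) IH !tpurel scalerDr addrACA.
by [].
Qed.

Lemma tassocVE u v w : @tassocV A U V W (u (x) (v (x) w)) = (u (x) v) (x) w.
Proof.
rewrite /tassocV tliftE; first by rewrite tmapE //; apply: tpurer.
  exact: tmap_pure_linl.
by move=> n; apply: tmap_lin => //; apply: tpurer.
Qed.

Lemma tassocV_lin : lin (@tassocV A U V W).
Proof.
apply: tlift_lin; first exact: tmap_pure_linl.
by move=> n; apply: tmap_lin => //; apply: tpurer.
Qed.

Lemma tmap_swap_linr (t : tens U V) : lin (fun w : W => tmap (fun u : U => u (x) w) (@idfun V) t).
Proof.
have h w := tmap_lin (@tpurel U W w) (@lin_id A V).
elim/tens_ind: t => [|u v t IH] a x y; first by rewrite !(lin0 (h _)) scaler0 addr0.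
rewrite !(linD (h _)) !(tmapE (@tpurel U W _) (@lin_id A V)) IH tpurer tpurel scalerDr addrACA.
by [].
Qed.

Lemma tswap23E u v w : @tswap23 A U V W ((u (x) v) (x) w) = (u (x) w) (x) v.
Proof.
rewrite /tswap23 tliftE; first by rewrite tmapE //; apply: tpurel.
  by move=> n; apply: tmap_lin => //; apply: tpurel.
exact: tmap_swap_linr.
Qed.

Lemma tswap23_lin : lin (@tswap23 A U V W).
Proof.
apply: tlift_lin; last exact: tmap_swap_linr.
by move=> n; apply: tmap_lin => //; apply: tpurel.
Qed.

End Assoc.
End Tens.

(** * Computations with words and Laurent polynomials *)

(* Laurent polynomials in q with integer coefficients, as lists of pairs
   (exponent, coefficient) *)
Definition lp := seq (Z * Z).

(** Terms are inserted in increasing order of the exponent and zero coefficients are dropped.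
    Equality is then tested by whether a difference comes out empty; only the soundness of this test
    is used. *)
Fixpoint lp_ins (e c : Z) (l : lp) : lp :=
  match l with
  | [::] => if Z.eqb c Z0 then [::] else [:: (e, c)]
  | (e', c') :: l' =>
      match Z.compare e e' with
      | Lt => if Z.eqb c Z0 then l else (e, c) :: l
      | Eq => let s := Z.add c c' in if Z.eqb s Z0 then l' else (e, s) :: l'
      | Gt => (e', c') :: lp_ins e c l'
      end
  end.

Definition lp_add (l m : lp) : lp := foldr (fun x => lp_ins x.1 x.2) m l.

Definition lp_mul (l m : lp) : lp :=
  foldr (fun x acc =>
    foldr (fun y => lp_ins (Z.add x.1 y.1) (Z.mul x.2 y.2)) acc m) [::] l.

Definition lp_opp (l : lp) : lp := [seq (x.1, Z.opp x.2) | x <- l].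

Definition lp_X (e : Z) : lp := [:: (e, 1%Zc)].
Definition lp_C (c : Z) : lp := [:: (0%Zc, c)].

Section LpEval.
Variables (B : comNzRingType) (u : Z -> B).
Hypothesis uD : forall a b, u (Z.add a b) = u a * u b.
Hypothesis u0 : u 0%Zc = 1.

Definition zr (c : Z) : B := (int_of_Z c)%:~R.

Lemma zrD a b : zr (Z.add a b) = zr a + zr b.
Proof. by rewrite /zr -[Z.add a b]/(a + b) rmorphD /= intrD. Qed.

Lemma zrM a b : zr (Z.mul a b) = zr a * zr b.
Proof. by rewrite /zr -[Z.mul a b]/(a * b) rmorphM /= intrM. Qed.

Lemma zrN a : zr (Z.opp a) = - zr a.
Proof. by rewrite /zr -[Z.opp a]/(- a) rmorphN /= mulrNz. Qed.

(** The character [u] gives the powers of q. It will be instantiated with q in C(q), with q in A and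
    with 1 in C, so that one computation with lists is valid in all three rings. *)
Definition lpev (l : lp) : B := \sum_(x <- l) zr x.2 * u x.1.

Lemma lpev_nil : lpev [::] = 0.
Proof. by rewrite /lpev big_nil. Qed.

Lemma lpev_cons x l : lpev (x :: l) = zr x.2 * u x.1 + lpev l.
Proof. by rewrite /lpev big_cons. Qed.

Lemma lpev_ins e c l : lpev (lp_ins e c l) = zr c * u e + lpev l.
Proof.
elim: l => [|[e' c'] l IH] /=.
  by case: Z.eqb_spec => [->|_]; rewrite ?lpev_cons lpev_nil // /zr mulr0z mul0r addr0.
case: Z.compare_spec => [->|_|_].
- rewrite lpev_cons /= addrA -mulrDl -zrD.
  by case: Z.eqb_spec => [->|_]; rewrite ?lpev_cons //= /zr mulr0z mul0r add0r.
- by case: Z.eqb_spec => [->|_]; rewrite ?lpev_cons //= /zr mulr0z mul0r add0r.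
- by rewrite !lpev_cons IH addrCA.
Qed.

Lemma lpevD l m : lpev (lp_add l m) = lpev l + lpev m.
Proof.
elim: l => [|x l IH] /=; first by rewrite lpev_nil add0r.
by rewrite lpev_ins IH lpev_cons addrA.
Qed.

Lemma lpevM l m : lpev (lp_mul l m) = lpev l * lpev m.
Proof.
elim: l => [|x l IH] /=; first by rewrite lpev_nil mul0r.
rewrite lpev_cons mulrDl -IH /lp_mul /=; move: (foldr _ [::] l) => acc {IH}.
elim: m => [|y m IHm] /=; first by rewrite lpev_nil mulr0 add0r.
by rewrite lpev_ins IHm lpev_cons mulrDr zrM uD addrA mulrACA.
Qed.

Lemma lpevN l : lpev (lp_opp l) = - lpev l.
Proof. by rewrite /lpev big_map -sumrN; apply: eq_bigr => x _; rewrite zrN mulNr. Qed.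

Lemma lpevX e : lpev (lp_X e) = u e.
Proof. by rewrite lpev_cons lpev_nil addr0 mul1r. Qed.

Lemma lpevC c : lpev (lp_C c) = zr c.
Proof. by rewrite lpev_cons lpev_nil addr0 u0 mulr1. Qed.

Lemma lpev1 : lpev (lp_C 1%Zc) = 1.
Proof. by rewrite lpevC. Qed.

End LpEval.

Lemma lpev_morph (B D : comNzRingType) (f : {rmorphism B -> D}) (u : Z -> B) (v : Z -> D) :
  (forall e, f (u e) = v e) -> forall l, f (lpev u l) = lpev v l.
Proof.
move=> fu l; rewrite /lpev rmorph_sum; apply: eq_bigr => x _.
by rewrite rmorphM /= fu /zr rmorph_int.
Qed.

(** In this order the letters stand for v_1, v_2, v_3, v_0, v_{-3}, v_{-2}, v_{-1}; [L3] is the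
    vector of weight 0. A plain enumeration is used because the checks are run by evaluation. *)
Inductive letter := L0 | L1 | L2 | L3 | L4 | L5 | L6.

Definition lidx (a : letter) : nat :=
  match a with L0 => 0 | L1 => 1 | L2 => 2 | L3 => 3 | L4 => 4 | L5 => 5 | L6 => 6 end.
Definition letters := [:: L0; L1; L2; L3; L4; L5; L6].
Definition lofn (n : nat) : letter := nth L0 letters n.

Lemma lidxK : cancel lidx lofn. Proof. by case. Qed.
HB.instance Definition _ := Countable.copy letter (can_type lidxK).

Lemma lidx_lt a : (lidx a < 7)%N. Proof. by case: a. Qed.

Definition lord (a : letter) : 'I_7 := Ordinal (lidx_lt a).
Definition ordl (i : 'I_7) : letter := lofn i.
Lemma lordK : cancel lord ordl. Proof. by case. Qed.

Lemma ordlK : cancel ordl lord.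
Proof. by move=> [[|[|[|[|[|[|[|i]]]]]]] hi]; apply: val_inj. Qed.

Lemma all_letters (P : pred letter) : all P letters -> forall a, P a.
Proof. by move=> /= /and5P[p0 p1 p2 p3 /and4P[p4 p5 p6 _]] []. Qed.

Definition word := seq letter.

Fixpoint weqb (v w : word) : bool :=
  match v, w with
  | [::], [::] => true
  | a :: v', b :: w' => eqn (lidx a) (lidx b) && weqb v' w'
  | _, _ => false
  end.

Lemma weqbP v w : weqb v w -> v = w.
Proof.
elim: v w => [|a v IH] [|b w] //= /andP[/eqnP ab /IH ->].
by rewrite (can_inj lidxK ab).
Qed.

(** Formal combinations of words. Words of length 1, of length 2 and of any length serve for V, for
    V (x) V and for the tensor algebra; the map [e] in [fvev] says which. *)
Definition fv := seq (word * lp).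

Fixpoint fv_ins (w : word) (c : lp) (v : fv) : fv :=
  match v with
  | [::] => if c is [::] then [::] else [:: (w, c)]
  | (w', c') :: v' =>
      if weqb w w' then
        let s := lp_add c c' in if s is [::] then v' else (w, s) :: v'
      else (w', c') :: fv_ins w c v'
  end.

Definition fv_add (v v' : fv) : fv := foldr (fun x => fv_ins x.1 x.2) v' v.
Definition fv_scale (c : lp) (v : fv) : fv := [seq (x.1, lp_mul c x.2) | x <- v].
Definition fv_bind (f : word -> fv) (v : fv) : fv :=
  foldr (fun x acc => fv_add (fv_scale x.2 (f x.1)) acc) [::] v.
Definition fv_opp (v : fv) : fv := [seq (x.1, lp_opp x.2) | x <- v].
Definition fv_sub (v v' : fv) : fv := fv_add v (fv_opp v').
Definition fv_word (w : word) : fv := [:: (w, lp_C 1%Zc)].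
Definition fv_eqb (v v' : fv) : bool := if fv_sub v v' is [::] then true else false.

Section FvEval.
Variables (B : comNzRingType) (u : Z -> B).
Hypothesis uD : forall a b, u (Z.add a b) = u a * u b.
Hypothesis u0 : u 0%Zc = 1.
Variables (M : lmodType B) (e : word -> M).

Definition fvev (v : fv) : M := \sum_(x <- v) lpev u x.2 *: e x.1.

Lemma fvev_nil : fvev [::] = 0.
Proof. by rewrite /fvev big_nil. Qed.

Lemma fvev_cons x v : fvev (x :: v) = lpev u x.2 *: e x.1 + fvev v.
Proof. by rewrite /fvev big_cons. Qed.

Lemma fvev_ins w c v : fvev (fv_ins w c v) = lpev u c *: e w + fvev v.
Proof.
elim: v => [|[w' c'] v IH] /=.
  by case: c => [|y c]; rewrite ?fvev_cons fvev_nil // lpev_nil scale0r addr0.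
case: ifP => [/weqbP <-|_]; last by rewrite !fvev_cons IH addrCA.
have := lpevD u c c'; case: lp_add => [|y s] h.
  by rewrite fvev_cons /= addrA -scalerDl -h lpev_nil scale0r add0r.
by rewrite !fvev_cons /= h scalerDl addrA.
Qed.

Lemma fvevD v v' : fvev (fv_add v v') = fvev v + fvev v'.
Proof.
elim: v => [|x v IH] /=; first by rewrite fvev_nil add0r.
by rewrite fvev_ins IH fvev_cons addrA.
Qed.

Lemma fvevZ c v : fvev (fv_scale c v) = lpev u c *: fvev v.
Proof.
rewrite /fvev big_map scaler_sumr; apply: eq_bigr => x _.
by rewrite scalerA lpevM.
Qed.

Lemma fvevN v : fvev (fv_opp v) = - fvev v.
Proof. by rewrite /fvev big_map -sumrN; apply: eq_bigr => x _; rewrite lpevN scaleNr. Qed.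

Lemma fvevB v v' : fvev (fv_sub v v') = fvev v - fvev v'.
Proof. by rewrite fvevD fvevN. Qed.

Lemma fvev_word w : fvev (fv_word w) = e w.
Proof. by rewrite fvev_cons fvev_nil addr0 lpev1 // scale1r. Qed.

Lemma fv_eqbP v v' : fv_eqb v v' -> fvev v = fvev v'.
Proof.
rewrite /fv_eqb => h; apply/eqP; rewrite -subr_eq0 -fvevB.
by case: fv_sub h => // _; rewrite fvev_nil.
Qed.

End FvEval.

Lemma fvev_semilin (B D : comNzRingType) (phi : {rmorphism B -> D}) (u : Z -> B) (v : Z -> D)
    (M : lmodType B) (N : lmodType D) (e : word -> M) (g : M -> N) x :
  (forall a, phi (u a) = v a) -> semilin phi g ->
  g (fvev u e x) = fvev v (g \o e) x.
Proof.
move=> uv gl; rewrite /fvev (semilin_sum _ _ _ gl); apply: eq_bigr => y _.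
by rewrite (semilinZ gl) /= (lpev_morph uv).
Qed.

Section Bind.
Variables (B : comNzRingType) (u : Z -> B).
Hypothesis uD : forall a b, u (Z.add a b) = u a * u b.
Hypothesis u0 : u 0%Zc = 1.
Variables (M : lmodType B) (e : word -> M).

Lemma fvev_bind f v : fvev u e (fv_bind f v) = fvev u (fun w => fvev u e (f w)) v.
Proof.
elim: v => [|x v IH] /=; first by rewrite !fvev_nil.
by rewrite fvevD fvevZ // fvev_cons IH.
Qed.

Lemma eq_fvev (e' : word -> M) v : (forall x, x \in map fst v -> e x = e' x) -> fvev u e v = fvev u e' v.
Proof.
rewrite /fvev !big_seq => h; apply: eq_bigr => x xv.
by rewrite h //; apply: map_f.
Qed.

Lemma eq_fvev' (e' : word -> M) v : e =1 e' -> fvev u e v = fvev u e' v.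
Proof. by move=> h; apply: eq_fvev => x _. Qed.

End Bind.

Lemma lin_scale (A : comNzRingType) (M P : lmodType A) (f : M -> P) b :
  lin f -> lin (fun x => b *: f x).
Proof. exact: semilin_scale. Qed.

Ltac lin_tac := repeat first
  [ assumption | exact: lin_id
  | match goal with
    | H : forall _, _ |- semilin _ _ => exact: H
    | |- semilin _ (fun x => x) => exact: lin_id
    | |- semilin _ (fun x => _ + _) => apply: lin_add
    | |- semilin _ (fun x => - _) => apply: lin_opp
    | |- semilin _ (fun x => _ *: _) => apply: lin_scale
    | |- semilin _ (fun x => tmap ?f ?g x) => apply: (@tmap_lin _ _ _ _ _ f g)
    | |- semilin _ (tmap ?f ?g) => apply: (@tmap_lin _ _ _ _ _ f g)
    | |- semilin _ (fun x => tmap ?f ?g (@?h x)) =>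
        apply: (@lin_comp _ _ _ _ h (tmap f g))
    | |- semilin _ (fun x => ?g (@?h x)) => apply: (@lin_comp _ _ _ _ h g)
    end ].

Section Character.
Variable C : fieldType.
Local Notation K := (Kq C).
Local Notation q := (qK C).
Local Notation A := (laurent_ring C).

Definition uK (e : Z) : K := q ^ int_of_Z e.

Lemma uKD a b : uK (Z.add a b) = uK a * uK b.
Proof. by rewrite /uK -[Z.add a b]/(a + b) rmorphD expfzDr ?qK_neq0. Qed.

Lemma uK0 : uK Z0 = 1. Proof. by []. Qed.

Lemma uK_laurent e : uK e \in @laurent C.
Proof.
apply/asboolP; rewrite /uK; case: (int_of_Z e) => n.
  by exists 'X^n, 0%N; rewrite tofracXn expr0 divr1.
by exists 1, n.+1; rewrite tofrac1 mul1r NegzE -exprz_inv -exprnP exprVn.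
Qed.

Definition uA (e : Z) : A := LaurentRing (uK_laurent e).

Lemma uAD a b : uA (Z.add a b) = uA a * uA b.
Proof. by apply: val_inj; exact: uKD. Qed.

Lemma uA0 : uA Z0 = 1. Proof. exact: val_inj. Qed.

Definition u1 (e : Z) : C := 1.
Lemma u10 : u1 Z0 = 1. Proof. by []. Qed.

Lemma theta_uA e : theta (uA e) = u1 e.
Proof.
rewrite /u1; case en: (int_of_Z e) => [n|n].
  rewrite (@thetaE _ _ 'X^n 0%N) ?hornerXn ?expr1n //=.
  by rewrite /uK en tofracXn expr0 divr1.
rewrite (@thetaE _ _ 1 n.+1) ?hornerC //=.
by rewrite /uK en tofrac1 mul1r NegzE -exprz_inv -exprnP exprVn.
Qed.

Lemma lval_uA e : lval (uA e) = uK e. Proof. by []. Qed.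

Lemma theta_lpev l : theta (lpev uA l) = lpev u1 l.
Proof. exact: (lpev_morph theta_uA). Qed.

Lemma lval_lpev l : lval (lpev uA l) = lpev uK l.
Proof. exact: (lpev_morph (f := @lval C : {rmorphism A -> K}) lval_uA). Qed.

(** The numerator has the root 1, hence a factor X - 1. This turns the vanishing of a coefficient at
    q = 1 into divisibility by q - 1 in A. *)
Lemma theta_eq0 (a : A) : theta a = 0 -> exists b : A, a = (uA 1%Zc - 1) * b.
Proof.
have [[p n] /= ap] := laurent_repr a; rewrite (thetaE ap) => /eqP.
rewrite -/(root p 1) => /factor_theorem[r pr].
have rA : tofrac r / q ^+ n \in @laurent C by apply/asboolP; exists r, n.
exists (LaurentRing rA); apply: val_inj; rewrite /= ap pr tofracM.
rewrite [LHS]mulrAC mulrC; congr (_ * _).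
by rewrite tofracB tofrac1.
Qed.

Definition lp_at2 (N : Z) (l : lp) : Z :=
  foldr (fun x acc => Z.add (Z.mul x.2 (Z.pow 2 (Z.add N x.1))) acc) Z0 l.

(** After multiplication by q^N the list is an integral polynomial, and a nonzero value at 2 shows
    that it is nonzero. Characteristic 0 keeps this integer nonzero in C. *)
Lemma lpK_neq0 N l : [pchar C] =i pred0 ->
  all (fun x => Z.leb Z0 (Z.add N x.1)) l -> ~~ Z.eqb (lp_at2 N l) Z0 -> lpev uK l != 0.
Proof.
move=> C0 lN l2.
pose P : {poly C} := \sum_(x <- l) zr C x.2 *: 'X^(Z.to_nat (Z.add N x.1)).
have PE : tofrac P = uK N * lpev uK l.
  rewrite /P raddf_sum /lpev mulr_sumr /= !big_seq; apply: eq_bigr => x xl.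
  rewrite -mul_polyC tofracM mulrCA -uKD /zr -[_%:P]/(polyC _) rmorph_int rmorph_int; congr (_ * _).
  rewrite tofracXn /uK; have /Z.leb_le := allP lN _ xl.
  move: (Z.add N x.1) => z z0; rewrite -[in RHS](Z2Nat.id z) //.
  have -> : int_of_Z (Z.of_nat (Z.to_nat z)) = Z.to_nat z :> int by lia.
  by [].
have P2 : P.[2%:R] = zr C (lp_at2 N l).
  rewrite /P horner_sum {PE P l2}; elim: l lN => [|x l IH]; first by rewrite big_nil.
  move=> /andP[x0 /IH {}IH]; rewrite big_cons IH /= zrD zrM hornerZ hornerXn; congr (_ * _ + _).
  have /Z.leb_le := x0; move: (Z.add N x.1) => z z0; rewrite -[in RHS](Z2Nat.id z) //.
  elim: (Z.to_nat z) => [|n IHn]; first by rewrite expr0.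
  rewrite exprS IHn Nat2Z.inj_succ Z.pow_succ_r ?zrM //; lia.
apply: contraNneq l2 => l0; move: PE; rewrite l0 mulr0 => /eqP; rewrite tofrac_eq0 => /eqP P0.
move: P2; rewrite P0 horner0 => /esym/eqP; rewrite /zr.
have /pcharf0P inj := C0.
case E: (int_of_Z _) => [n|n]; rewrite ?NegzE ?mulrNz ?oppr_eq0 -?pmulrn inj.
  by move=> /eqP n0; apply/Z.eqb_spec; lia.
by [].
Qed.

End Character.

(** * Gaussian binomials in the Serre relations *)

Lemma cube_sub1 (R : comNzRingType) (t : R) :
  t ^+ 6 - 1 = (t ^+ 2 - 1) * (t ^+ 4 + t ^+ 2 + 1).
Proof. by ring. Qed.

Section GaussianBinomials.
Variables (F : fieldType) (t : F).
Hypotheses (t0 : t != 0) (t2 : t ^+ 2 != 1) (t4 : t ^+ 2 + 1 != 0) (t3 : t ^+ 4 + t ^+ 2 + 1 != 0)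
  (t5 : t ^+ 4 + 1 != 0).

Let qi n := (t ^+ n - t ^- n) / (t - t^-1).
Let qf n := \prod_(k < n) qi k.+1.
Let qb n k := qf n / (qf k * qf (n - k)).

Let d0 : t - t^-1 != 0.
Proof.
apply: contraNneq t2 => h.
by rewrite expr2 -[X in _ * X](subrK t^-1) h add0r divff.
Qed.

Let qi1 : qi 1 = 1.
Proof. by rewrite /qi expr1 divff. Qed.

Let qi2 : qi 2 = t + t^-1.
Proof. by apply: (canLR (mulfK d0)); field. Qed.

Let qi3 : qi 3 = t ^+ 2 + 1 + t ^- 2.
Proof. by apply: (canLR (mulfK d0)); field. Qed.

Let qi4 : qi 4 = t ^+ 3 + t + t^-1 + t ^- 3.
Proof. by apply: (canLR (mulfK d0)); field. Qed.

Let n2 : t + t^-1 != 0.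
Proof.
have -> : t + t^-1 = (t ^+ 2 + 1) / t by field.
by rewrite mulf_neq0 ?invr_neq0.
Qed.

Let n3 : t ^+ 2 + 1 + t ^- 2 != 0.
Proof.
have -> : t ^+ 2 + 1 + t ^- 2 = (t ^+ 4 + t ^+ 2 + 1) / t ^+ 2 by field.
by rewrite mulf_neq0 ?invr_neq0 ?expf_neq0.
Qed.

Let qf0 : qf 0 = 1. Proof. by rewrite /qf big_ord0. Qed.
Let qfS n : qf n.+1 = qf n * qi n.+1. Proof. by rewrite /qf big_ord_recr. Qed.

Lemma qbin2E : (qb 2 0 = 1) * (qb 2 1 = t + t^-1) * (qb 2 2 = 1).
Proof. by rewrite /qb /= !qfS qf0 qi1 qi2 !mul1r !invr1 !mulr1 divff. Qed.

Let a := t + t^-1.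
Let b := t ^+ 2 + 1 + t ^- 2.
Let c := t ^+ 2 + t ^- 2.

Let qi4' : qi 4 = a * c.
Proof. by rewrite qi4 /a /c; field. Qed.

Let s := t ^+ 3 + t.
Let p := t ^+ 4.
Let s' := t^-1 + t ^- 3.
Let p' := t ^- 4.

(** By the q-binomial theorem the sum of the (-1)^k [4 choose k] X^k is the product of the 1 - t^j X
    for j = 3, 1, -1, -3. The right-hand sides are its coefficients when the factors are grouped as
    (1 - s X + p X^2)(1 - s' X + p' X^2), the form in which the Serre sum factors. *)
Lemma qbin4E : (qb 4 0 = 1) * (qb 4 1 = s + s') * (qb 4 2 = p + s * s' + p') *
  (qb 4 3 = s * p' + p * s') * (qb 4 4 = 1) * (p * p' = 1).
Proof.
have c0 : qi 4 = s + s' by rewrite qi4 /s /s' addrA.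
have ss' : s + s' = a * c by rewrite -c0 qi4'.
have e3 : s * p' + p * s' = a * c by rewrite /s /s' /p /p' /a /c; field.
have e2 : p + s * s' + p' = b * c by rewrite /s /s' /p /p' /b /c; field.
have a0 : a != 0 := n2.
have b0 : b != 0 := n3.
have cc : c != 0.
  have -> : c = (t ^+ 4 + 1) / t ^+ 2 by rewrite /c; field.
  by rewrite mulf_neq0 ?invr_neq0 ?expf_neq0.
have qb0 : qf 4 = a * b * (a * c) by rewrite !qfS qf0 qi1 qi2 qi3 qi4' !mul1r.
have q3 : qf 3 = a * b by rewrite !qfS qf0 qi1 qi2 qi3 !mul1r.
have q2 : qf 2 = a by rewrite !qfS qf0 qi1 qi2 !mul1r.
have q1 : qf 1 = 1 by rewrite !qfS qf0 qi1 !mul1r.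
have E k : qb 4 k = qf 4 / (qf k * qf (4 - k)) by [].
rewrite ss' e2 e3 !E [qf (4 - 1)]q3 [qf (4 - 2)]q2 [qf (4 - 3)]q1 [qf (4 - 4)]qf0.
rewrite -[(4 - 0)%N]/4%N qb0.
split; last by rewrite /p /p'; field.
by do !split; field; rewrite ?a0 ?b0 ?cc.
Qed.

End GaussianBinomials.

(** * Modules over the quantum group *)

Section Serre.
Variable C : fieldType.
Hypothesis C0 : [pchar C] =i pred0.
Local Notation K := (Kq C).
Local Notation q := (qK C).

(** With L and R for composition with X on the left and on the right, this is L^2 - s L R + p R^2
    applied to Z: a quadratic factor of the Serre polynomial. *)
Definition op2 (W : lmodType K) (X Z : W -> W) (s p : K) (x : W) : W :=
  X (X (Z x)) - s *: X (Z (X x)) + p *: Z (X (X x)).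

(* The Serre sums are iterated twisted commutators (see serre1_tad), and the
   twist is such that the summands of the coproduct do not interact. *)
Definition tad (W : lmodType K) (X Z : W -> W) (c : K) (x : W) : W :=
  X (Z x) - c *: Z (X x).

Lemma tad_lin (W : lmodType K) (X Z : W -> W) c : lin X -> lin Z -> lin (tad X Z c).
Proof. by move=> Xl Zl; rewrite /tad; lin_tac. Qed.

Lemma tad2 (W : lmodType K) (X Z : W -> W) a b x : lin X ->
  tad X (tad X Z b) a x = op2 X Z (a + b) (a * b) x.
Proof.
move=> Xl; rewrite /tad /op2 (linB Xl) (linZ Xl) scalerBr opprB scalerA scalerDl opprD.
by rewrite -!addrA; congr (_ + _); rewrite [RHS]addrCA [_ - a *: _]addrC.
Qed.

Lemma qX_neq1 n : q ^+ n.+1 - 1 != 0.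
Proof.
rewrite -tofracXn -tofrac1 -tofracB tofrac_eq0; apply/eqP => /(congr1 (fun p : {poly C} => p`_n.+1)).
by rewrite coefB coefXn eqxx coef1 subr0 coef0 => /eqP; rewrite oner_eq0.
Qed.

Lemma qXp_neq0 n : q ^+ n.+1 + 1 != 0.
Proof.
rewrite -tofracXn -tofrac1 -tofracD tofrac_eq0; apply/eqP => /(congr1 (fun p : {poly C} => p`_n.+1)).
by rewrite coefD coefXn eqxx coef1 addr0 coef0 => /eqP; rewrite oner_eq0.
Qed.

Lemma qX_neq1' n : q ^+ n.+1 != 1.
Proof. by rewrite -subr_eq0; exact: qX_neq1. Qed.

Variable W : opModule C.
Implicit Types X Y Z : W -> W.

Lemma op2_op2 X Y s p s' p' x : lin X ->
  op2 X (op2 X Y s' p') s p x =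
    X (X (X (X (Y x)))) - (s + s') *: X (X (X (Y (X x))))
      + (p + s * s' + p') *: X (X (Y (X (X x))))
      - (s * p' + p * s') *: X (Y (X (X (X x)))) + (p * p') *: Y (X (X (X (X x)))).
Proof.
move=> Xl; rewrite /op2 !(linB Xl, linD Xl, linZ Xl) !(scalerDr, scalerBr, scalerN, scalerA).
rewrite !scalerDl !opprD !opprK !addrA.
by rewrite [LHS](ACl (1*4*2*7*5*3*6*8*9)).
Qed.

Lemma serre2E X Y x : lin X ->
  serre_sum X Y alpha2 x = op2 X Y (q ^+ 3 + q ^- 3) 1 x.
Proof.
move=> Xl; rewrite /serre_sum !big_ord_recl big_ord0 /= /bump /=.
have t0 : q ^+ 3 != 0 by rewrite expf_neq0 ?qK_neq0.
have t2 : (q ^+ 3) ^+ 2 != 1 by rewrite -exprM qX_neq1'.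
have t2' : (q ^+ 3) ^+ 2 + 1 != 0 by rewrite -exprM qXp_neq0.
have h := qbin2E t0 t2 t2'.
rewrite [qbin _ _ 0]h [qbin _ _ (1 + 0)]h [qbin _ _ _]h /op2.
by rewrite expr0 mulr1 expr1 mulN1r sqrrN expr1n mulr1 !scale1r scaleNr addr0 addrA.
Qed.

(** Both sides are polynomials in the commuting operations of composing with X on the left and on
    the right. *)
Lemma op2_swap X Y s p s' p' x : lin X ->
  op2 X (op2 X Y s' p') s p x = op2 X (op2 X Y s p) s' p' x.
Proof.
move=> Xl; rewrite !op2_op2 //.
have e2 : p + s * s' + p' = p' + s' * s + p by rewrite addrAC [p + _]addrC [s * _]mulrC addrAC.
have e3 : s * p' + p * s' = s' * p + p' * s by rewrite addrC mulrC [s * _]mulrC.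
by rewrite e2 e3 [s + _]addrC [p * _]mulrC.
Qed.

Lemma serre1E X Y x : lin X ->
  serre_sum X Y alpha1 x =
    op2 X (op2 X Y (q^-1 + q ^- 3) (q ^- 4)) (q ^+ 3 + q) (q ^+ 4) x.
Proof.
move=> Xl; rewrite op2_op2 // /serre_sum !big_ord_recl big_ord0 /= /bump /=.
have t0 : q != 0 by rewrite qK_neq0.
have t3 : q ^+ 4 + q ^+ 2 + 1 != 0.
  (* q^4 + q^2 + 1 divides q^6 - 1, which is nonzero. *)
  by have := qX_neq1 5; apply: contraNneq => h; rewrite cube_sub1 h mulr0.
have h := qbin4E t0 (qX_neq1' 1) (qXp_neq0 1) t3 (qXp_neq0 3).
rewrite [qbin _ _ 0]h [qbin _ _ (1 + 0)]h [qbin _ _ (1 + (1 + 0))]h.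
rewrite [qbin _ _ (1 + (1 + (1 + 0)))]h [qbin _ _ _]h [q ^+ 4 / _]h.
rewrite !(exprS (-1)) expr0 !mulr1 !mulN1r !opprK !mulNr !mul1r !scaleNr !scale1r.
by rewrite addr0 !addrA.
Qed.

End Serre.

(** * The Serre sum of a coproduct *)

Section SerreCoproduct.
Variable C : fieldType.
Local Notation K := (Kq C).
Local Notation q := (qK C).
Variable W : opModule C.
Implicit Types X Y Z a b c : W -> W.

Lemma lin_tad X Z g : lin X -> lin Z -> lin (tad X Z g).
Proof. exact: tad_lin. Qed.

Definition tad4 X c g m :=
  tad X (tad X (tad X (tad X c g) (m * g)) (m * (m * g))) (m * (m * (m * g))).

Section Half.
Variables (a b : W -> W) (m : K).
Hypotheses (al : lin a) (bl : lin b) (ba : forall x, b (a x) = m *: a (b x)).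
Local Notation X := (fun x => a x + b x).

(** Since b Z = g Z b, the two contributions of b to the commutator with twist g cancel. *)
Lemma tad_half Z g : lin Z -> (forall x, b (Z x) = g *: Z (b x)) ->
  tad X Z g = tad a Z g.
Proof.
move=> Zl bZ; apply: funext => x; rewrite /tad (linD Zl) bZ scalerDr opprD addrA.
by rewrite addrAC addrK.
Qed.

(** The factor m g found here is the twist of the next commutator, so that b cancels there as well;
    this explains the twists g, m g, m^2 g, m^3 g of [tad4]. *)
Lemma tad_half_comm Z g : lin Z -> (forall x, b (Z x) = g *: Z (b x)) ->
  forall x, b (tad a Z g x) = (m * g) *: tad a Z g (b x).
Proof.
move=> Zl bZ x; rewrite /tad (linB bl) (linZ bl) ba !bZ (linZ al) ba (linZ Zl).
by rewrite scalerBr !scalerA; congr (_ - _ *: _); rewrite -mulrA mulrC [g * m]mulrC.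
Qed.

Lemma tad4_half c g : lin c -> (forall x, b (c x) = g *: c (b x)) ->
  tad4 X c g m = tad4 a c g m.
Proof.
move=> cl bc; have Xl : lin X by lin_tac.
rewrite /tad4 (tad_half cl bc).
have l1 := lin_tad g al cl; have b1 := tad_half_comm cl bc.
rewrite (tad_half l1 b1); have l2 := lin_tad (m * g) al l1; have b2 := tad_half_comm l1 b1.
rewrite (tad_half l2 b2); have l3 := lin_tad (m * (m * g)) al l2; have b3 := tad_half_comm l2 b2.
by rewrite (tad_half l3 b3).
Qed.

Lemma tad2_half c g : lin c -> (forall x, b (c x) = g *: c (b x)) ->
  tad X (tad X c g) (m * g) = tad a (tad a c g) (m * g).
Proof.
move=> cl bc; rewrite (tad_half cl bc).
by have l1 := lin_tad g al cl; rewrite (tad_half l1 (tad_half_comm cl bc)).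
Qed.

End Half.

Lemma tad4_op2 X c g m x : lin X -> lin c -> tad4 X c g m x =
  op2 X (op2 X c (m * g + g) (m * g * g)) (m * (m * (m * g)) + m * (m * g))
    (m * (m * (m * g)) * (m * (m * g))) x.
Proof.
move=> Xl cl; rewrite /tad4 tad2 //; congr (op2 X _ _ _ x).
by apply: funext => y; rewrite tad2.
Qed.

Let q0 : q != 0 := qK_neq0 C.

Lemma qzM (a b c : int) : a + b = c -> q ^ a * q ^ b = q ^ c.
Proof. by move=> <-; rewrite -expfzDr. Qed.

Lemma serre1_tad X c x : lin X -> lin c -> serre_sum X c alpha1 x = tad4 X c (q ^ (-3)) (q ^ 2) x.
Proof.
move=> Xl cl; rewrite tad4_op2 //.
rewrite !(@qzM 2 (-3) (-1)) // !(@qzM 2 (-1) 1) // !(@qzM 2 1 3) //.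
by rewrite (@qzM (-1) (-3) (-4)) // (@qzM 3 1 4) // serre1E.
Qed.

(** The twists q^-3, q^-1, q, q^3 of [serre1_tad] in the opposite order, which is allowed because
    the quadratic factors commute. This order fits a summand that q-commutes with the inverse
    powers. *)
Lemma serre1_tadV X c x : lin X -> lin c -> serre_sum X c alpha1 x = tad4 X c (q ^ 3) (q ^ (-2)) x.
Proof.
move=> Xl cl; rewrite tad4_op2 //.
rewrite !(@qzM (-2) 3 1) // !(@qzM (-2) 1 (-1)) // !(@qzM (-2) (-1) (-3)) //.
rewrite (@qzM 1 3 4) // (@qzM (-3) (-1) (-4)) // serre1E // op2_swap //.
by rewrite [q ^ (-3) + _]addrC [q ^ 1 + _]addrC.
Qed.

Lemma serre2_tad X c x : lin X -> lin c -> serre_sum X c alpha2 x = tad X (tad X c (q ^ (-3))) (q ^ 6 * q ^ (-3)) x.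
Proof. by move=> Xl cl; rewrite tad2 // !(@qzM 6 (-3) 3) // (@qzM 3 (-3) 0) // serre2E. Qed.

Lemma serre2_tadV X c x : lin X -> lin c -> serre_sum X c alpha2 x = tad X (tad X c (q ^ 3)) (q ^ (-6) * q ^ 3) x.
Proof.
move=> Xl cl; rewrite tad2 // !(@qzM (-6) 3 (-3)) // (@qzM (-3) 3 0) // serre2E //.
by rewrite [q ^ (-3) + _]addrC.
Qed.

(** The twists of the iterated commutator are exactly the factors by which b passes the successive
    commutators, so b drops out at every stage. The flag [e] selects the order of the twists,
    according to the sign of the exponents. *)
Lemma serre_half (e : bool) a b c i x : lin a -> lin b -> lin c ->
  (forall x, b (a x) = q ^ ((-1) ^+ e * sform i i) *: a (b x)) ->
  (forall x, b (c x) = q ^ ((-1) ^+ e * -3) *: c (b x)) ->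
  serre_sum (fun x => a x + b x) c i x = serre_sum a c i x.
Proof.
move=> al bl cl ba bc; have Xl : lin (fun x => a x + b x) by lin_tac.
case: i e ba bc => [] [] ba bc.
- by rewrite !serre1_tadV // (tad4_half al bl ba cl bc).
- by rewrite !serre1_tad // (tad4_half al bl ba cl bc).
- by rewrite !serre2_tadV // (tad2_half al bl ba cl bc).
- by rewrite !serre2_tad // (tad2_half al bl ba cl bc).
Qed.

Lemma serre_sum_lin X c i : lin X -> lin c -> lin (serre_sum X c i).
Proof.
move=> Xl cl a x y; case: i.
  by rewrite !serre1_tad //; rewrite /tad4; apply/tad_lin=> //; do 3?apply/tad_lin=> //.
by rewrite !serre2_tad //; apply/tad_lin=> //; apply/tad_lin.
Qed.

Lemma serre_sumD X c d i x : lin X -> lin c -> lin d ->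
  serre_sum X (fun x => c x + d x) i x = serre_sum X c i x + serre_sum X d i x.
Proof.
move=> Xl cl dl; rewrite /serre_sum -big_split; apply: eq_bigr => k _ /=.
rewrite -scalerDr; congr (_ *: _); elim: (serre_exp i - k)%N => //= n ->.
by rewrite (linD Xl).
Qed.

End SerreCoproduct.

Lemma mulDD (R : pzSemiRingType) (a b x y z w : R) :
  a * (x + y) + b * (z + w) = (a * x + b * z) + (a * y + b * w).
Proof. by rewrite !mulrDr addrACA. Qed.

(** * Tensor products of U_q-modules *)

Section Otens.
Variable C : fieldType.
Local Notation K := (Kq C).
Local Notation q := (qK C).

Lemma tens_eqK (M N P : lmodType K) (f g : tens M N -> P) :
  lin f -> lin g -> (forall m n, f (m (x) n) = g (m (x) n)) -> f =1 g.
Proof. exact: (tens_eq (phi := (idfun : {rmorphism K -> K}))). Qed.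

Lemma lin_cst0 (M P : lmodType K) : lin (fun _ : M => 0 : P).
Proof. by move=> a x y; rewrite scaler0 addr0. Qed.

Section ActPure.
Variables U W : opModule C.
Hypotheses (Ul : forall g, lin (@act _ U g)) (Wl : forall g, lin (@act _ W g)).

Definition otens_lin g : lin (@act _ (otens U W) g).
Proof. by case: g => i; rewrite /act /=; lin_tac. Qed.

Lemma otensE i u w : @act _ (otens U W) (gE i) (u (x) w) =
  act (gE i) u (x) act (gK i) w + u (x) act (gE i) w.
Proof. by rewrite /= !tmapE //; lin_tac. Qed.

Lemma otensF i u w : @act _ (otens U W) (gF i) (u (x) w) =
  act (gF i) u (x) w + act (gKV i) u (x) act (gF i) w.
Proof. by rewrite /= !tmapE //; lin_tac. Qed.

Lemma otensK i u w : @act _ (otens U W) (gK i) (u (x) w) = act (gK i) u (x) act (gK i) w.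
Proof. by rewrite /= !tmapE //; lin_tac. Qed.

Lemma otensKV i u w : @act _ (otens U W) (gKV i) (u (x) w) = act (gKV i) u (x) act (gKV i) w.
Proof. by rewrite /= !tmapE //; lin_tac. Qed.

End ActPure.

Section Rel.
Variables U W : opModule C.
Hypotheses (HU : Uq_rel U) (HW : Uq_rel W).
Local Notation T := (otens U W).

Let Ul g : lin (@act _ U g) := act_lin HU g.
Let Wl g : lin (@act _ W g) := act_lin HW g.
Let Tl g : lin (@act _ T g) := otens_lin Ul Wl g.
Let TE := otensE Ul Wl.
Let TF := otensF Ul Wl.
Let TK := otensK Ul Wl.
Let TKV := otensKV Ul Wl.
Let q0 : q != 0 := qK_neq0 C.

Let TKD g x y : @act _ T g (x + y) = act g x + act g y.
Proof. exact: (linD (Tl g)). Qed.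

Ltac pure := apply: tens_eqK => [||u w]; [ by lin_tac | by lin_tac | ].

Lemma otens_KV i x : @act _ T (gK i) (act (gKV i) x) = x.
Proof.
move: x; pure.
by rewrite TKV TK !act_KV.
Qed.

Lemma otens_VK i x : @act _ T (gKV i) (act (gK i) x) = x.
Proof.
move: x; pure.
by rewrite TK TKV !act_VK.
Qed.

Lemma otens_KK i j x : @act _ T (gK i) (act (gK j) x) = act (gK j) (act (gK i) x).
Proof.
move: x; pure.
by rewrite !TK (act_KK HU i j) (act_KK HW i j).
Qed.

Lemma otens_KE i j x : @act _ T (gK i) (act (gE j) x) = q ^ (sform i j) *: act (gE j) (act (gK i) x).
Proof.
move: x; pure.
rewrite TE TK TKD !TK TE (act_KE HU) (act_KE HW) (act_KK HW i j).
by rewrite tpureZl tpureZr scalerDr.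
Qed.

Lemma act_KVF (Z : opModule C) (HZ : Uq_rel Z) i j x :
  @act _ Z (gKV i) (act (gF j) x) = q ^ (sform i j) *: act (gF j) (act (gKV i) x).
Proof.
rewrite -{1}(act_KV HZ i x) -[act (gF j) (act (gK i) _)](scale1r) -(expr0z q) -(addrN (sform i j)).
rewrite expfzDr // -scalerA -(act_KF HZ) (linZ (act_lin HZ _)); congr (_ *: _).
exact: act_VK.
Qed.

Lemma act_KVE (Z : opModule C) (HZ : Uq_rel Z) i j x :
  @act _ Z (gKV i) (act (gE j) x) = q ^ (- sform i j) *: act (gE j) (act (gKV i) x).
Proof.
rewrite -{1}(act_KV HZ i x) -[act (gE j) (act (gK i) _)](scale1r) -(expr0z q) -(addNr (sform i j)).
rewrite expfzDr // -scalerA -(act_KE HZ) (linZ (act_lin HZ _)); congr (_ *: _).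
exact: act_VK.
Qed.

Lemma act_KKV (Z : opModule C) (HZ : Uq_rel Z) i j x :
  @act _ Z (gK i) (act (gKV j) x) = act (gKV j) (act (gK i) x).
Proof. by rewrite -[in RHS](act_KV HZ j x) (act_KK HZ i j) act_VK. Qed.

Lemma act_KVKV (Z : opModule C) (HZ : Uq_rel Z) i j x :
  @act _ Z (gKV i) (act (gKV j) x) = act (gKV j) (act (gKV i) x).
Proof.
by rewrite -[in RHS](act_KV HZ j x) -[in RHS](act_KKV HZ j i) act_VK.
Qed.

Lemma otens_KF i j x : @act _ T (gK i) (act (gF j) x) = q ^ (- sform i j) *: act (gF j) (act (gK i) x).
Proof.
move: x; pure.
rewrite TF TK TKD !TK TF (act_KF HU) (act_KF HW).
rewrite (act_KKV HU).
by rewrite tpureZl tpureZr scalerDr.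
Qed.

Lemma otens_EF_sub i j (u : U) (w : W) :
  @act _ T (gE i) (@act _ T (gF j) (u (x) w)) - @act _ T (gF j) (@act _ T (gE i) (u (x) w)) =
  (act (gE i) (act (gF j) u) - act (gF j) (act (gE i) u)) (x) act (gK i) w
  + act (gKV j) u (x) (act (gE i) (act (gF j) w) - act (gF j) (act (gE i) w)).
Proof.
rewrite TE TF !TKD !TE !TF.
(* The mixed terms of the commutator cancel: exchanging E_i with K_j^-1 on the left and K_i with F_j
   on the right costs the same power of q, by the symmetry of the form. *)
have -> : act (gE i) (act (gKV j) u) (x) act (gK i) (act (gF j) w) =
    act (gKV j) (act (gE i) u) (x) act (gF j) (act (gK i) w).
  rewrite (act_KVE HU) (act_KF HW) tpureZl tpureZr.
  have -> : sform i j = sform j i by case: i; case: j.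
  by [].
rewrite (linB (tpurel _)) (linB (tpurer _)).
set x1 := act (gE i) (act (gF j) u) (x) _; set x2 := act (gF j) u (x) _; set x3 := _ (x) act (gF j) _.
set x4 := _ (x) act (gE i) _; set y1 := _ (x) act (gK i) w; set y4 := _ (x) act (gF j) _.
rewrite [RHS]addrACA !opprD !addrA [LHS](ACl (1*4*5*8*2*7*3*6)) /=.
by rewrite addrK addrK.
Qed.

Lemma otens_EF i x : @act _ T (gE i) (act (gF i) x) - act (gF i) (act (gE i) x)
   = (qi C i - (qi C i)^-1)^-1 *: (act (gK i) x - act (gKV i) x).
Proof.
move: x; pure.
rewrite otens_EF_sub !act_EF // tpureZl tpureZr -scalerDr; congr (_ *: _).
by rewrite TK TKV (linB (tpurel _)) (linB (tpurer _)) addrA subrK.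
Qed.

Lemma otens_EFneq i j x : i <> j -> @act _ T (gE i) (act (gF j) x) = act (gF j) (act (gE i) x).
Proof.
move=> ij; move: x; pure.
apply/eqP; rewrite -subr_eq0 otens_EF_sub !act_EFneq // !subrr.
by rewrite (lin0 (tpurel _)) (lin0 (tpurer _)) addr0.
Qed.

Lemma sum_tpurel (I : Type) (r : seq I) (c : I -> K) (f : I -> U) w :
  (\sum_(k <- r) c k *: f k) (x) w = \sum_(k <- r) c k *: (f k (x) w) :> T.
Proof. by rewrite (lin_sum _ _ _ (tpurel w)); apply: eq_bigr => k _; rewrite tpureZl. Qed.

Lemma sum_tpurer (I : Type) (r : seq I) (c : I -> K) (f : I -> W) u :
  u (x) (\sum_(k <- r) c k *: f k) = \sum_(k <- r) c k *: (u (x) f k) :> T.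
Proof. by rewrite (lin_sum _ _ _ (tpurer u)); apply: eq_bigr => k _; rewrite tpureZr. Qed.

(** For pure operators whose second components commute, the second components collect into a single
    operator common to all summands, and the Serre sum takes place in the first factor. *)
Lemma serre_pure (X Y : T -> T) (f g : U -> U) (h k : W -> W) i (u : U) (w : W) :
  (forall (u : U) (w : W), X (u (x) w) = f u (x) h w) -> (forall (u : U) (w : W), Y (u (x) w) = g u (x) k w) ->
  (forall w, k (h w) = h (k w)) ->
  serre_sum X Y i (u (x) w) = serre_sum f g i u (x) iter (serre_exp i) h (k w).
Proof.
move=> XE YE kh; rewrite /serre_sum sum_tpurel; apply: eq_bigr => j _; congr (_ *: _).
have it n (u' : U) (w' : W) : iter n X (u' (x) w') = iter n f u' (x) iter n h w'.
  by elim: n => //= n ->; rewrite XE.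
rewrite it YE it; congr (_ (x) _).
have -> : k (iter j h w) = iter j h (k w) by elim: (nat_of_ord j) => //= n <-.
by rewrite -iterD subnK // -ltnS.
Qed.

Lemma serre_pure' (X Y : T -> T) (f g : U -> U) (h k : W -> W) i (u : U) (w : W) :
  (forall (u : U) (w : W), X (u (x) w) = f u (x) h w) -> (forall (u : U) (w : W), Y (u (x) w) = g u (x) k w) ->
  (forall u, g (f u) = f (g u)) ->
  serre_sum X Y i (u (x) w) = iter (serre_exp i) f (g u) (x) serre_sum h k i w.
Proof.
move=> XE YE kh; rewrite /serre_sum sum_tpurer; apply: eq_bigr => j _; congr (_ *: _).
have it n (u' : U) (w' : W) : iter n X (u' (x) w') = iter n f u' (x) iter n h w'.
  by elim: n => //= n ->; rewrite XE.
rewrite it YE it; congr (_ (x) _).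
have -> : g (iter j f u) = iter j f (g u) by elim: (nat_of_ord j) => //= n <-.
by rewrite -iterD subnK // -ltnS.
Qed.

(** With a + b and c + d for the coproducts of E_i and E_j, the Serre sum splits into one for c and
    one for d. In the first b drops out by q-commutation and in the second a does; what remains is a
    Serre relation in one of the two modules. *)
Lemma otens_serreE i j x : i <> j -> serre_sum (@act _ T (gE i)) (act (gE j)) i x = 0.
Proof.
move=> ij.
have sij : sform i j = -3 by case: i j ij => [] [].
have sji : sform j i = -3 by case: i j ij {sij} => [] [].
pose a (t : T) : T := tmap (act (gE i)) (act (gK i)) t.
pose b (t : T) : T := tmap idfun (act (gE i)) t.
pose c (t : T) : T := tmap (act (gE j)) (act (gK j)) t.
pose d (t : T) : T := tmap idfun (act (gE j)) t.
have al : lin a := tmap_lin (Ul _) (Wl _).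
have bl : lin b := tmap_lin (@lin_id K U) (Wl _).
have cl : lin c := tmap_lin (Ul _) (Wl _).
have dl : lin d := tmap_lin (@lin_id K U) (Wl _).
have aE (u : U) (w : W) : a (u (x) w) = act (gE i) u (x) act (gK i) w := tmapE (Ul _) (Wl _) u w.
have bE (u : U) (w : W) : b (u (x) w) = u (x) act (gE i) w := tmapE (@lin_id K U) (Wl _) u w.
have cE (u : U) (w : W) : c (u (x) w) = act (gE j) u (x) act (gK j) w := tmapE (Ul _) (Wl _) u w.
have dE (u : U) (w : W) : d (u (x) w) = u (x) act (gE j) w := tmapE (@lin_id K U) (Wl _) u w.
have EK k l w : act (gE k) (act (gK l) w) = q ^ (- sform l k) *: act (gK l) (act (gE k) w) :> W.
  by rewrite (act_KE HW) scalerA -expfzDr // addNr scale1r.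
rewrite (_ : serre_sum _ _ i x = serre_sum (fun t => a t + b t) (fun t => c t + d t) i x) //.
clearbody a b c d.
have abl := lin_add al bl.
rewrite serre_sumD // (@serre_half _ _ true a b) //; first last.
- apply: tens_eqK => [||u w]; [exact: lin_comp|by apply: lin_scale; apply: lin_comp|].
  by rewrite cE !bE cE EK tpureZr sji.
- apply: tens_eqK => [||u w]; [exact: lin_comp|by apply: lin_scale; apply: lin_comp|].
  by rewrite aE !bE aE EK tpureZr expr1 mulN1r.
have -> : (fun t => a t + b t) = (fun t => b t + a t) by apply: funext => t; rewrite addrC.
rewrite (@serre_half _ _ false b a) //; first last.
- apply: tens_eqK => [||u w]; [exact: lin_comp|by apply: lin_scale; apply: lin_comp|].
  by rewrite dE !aE dE (act_KE HW) tpureZr sij.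
- apply: tens_eqK => [||u w]; [exact: lin_comp|by apply: lin_scale; apply: lin_comp|].
  by rewrite aE !bE aE (act_KE HW) tpureZr mul1r.
suff [-> ->] : serre_sum a c i x = 0 /\ serre_sum b d i x = 0 by rewrite addr0.
have ac0 := serre_sum_lin i al cl; have bd0 := serre_sum_lin i bl dl.
have [l0 l1] := (tens_eqK ac0 (@lin_cst0 _ _), tens_eqK bd0 (@lin_cst0 _ _)).
split; [apply: l0 | apply: l1] => u w.
- rewrite (serre_pure _ _ _ aE cE) => [|w']; last exact: act_KK.
  by rewrite (act_serreE HU) // (lin0 (tpurel _)).
- rewrite (@serre_pure' b d idfun idfun _ _ _ _ _ bE dE) //.
  by rewrite (act_serreE HW) // (lin0 (tpurer _)).
Qed.

(** As for E, except that the factors K^-1 now stand on the left, so that the two orders of the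
    twists are exchanged. *)
Lemma otens_serreF i j x : i <> j -> serre_sum (@act _ T (gF i)) (act (gF j)) i x = 0.
Proof.
move=> ij.
have sij : sform i j = -3 by case: i j ij => [] [].
have sji : sform j i = -3 by case: i j ij {sij} => [] [].
pose a (t : T) : T := tmap (act (gF i)) idfun t.
pose b (t : T) : T := tmap (act (gKV i)) (act (gF i)) t.
pose c (t : T) : T := tmap (act (gF j)) idfun t.
pose d (t : T) : T := tmap (act (gKV j)) (act (gF j)) t.
have al : lin a := tmap_lin (Ul _) (@lin_id K W).
have bl : lin b := tmap_lin (Ul _) (Wl _).
have cl : lin c := tmap_lin (Ul _) (@lin_id K W).
have dl : lin d := tmap_lin (Ul _) (Wl _).
have aE (u : U) (w : W) : a (u (x) w) = act (gF i) u (x) w := tmapE (Ul _) (@lin_id K W) u w.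
have bE (u : U) (w : W) : b (u (x) w) = act (gKV i) u (x) act (gF i) w := tmapE (Ul _) (Wl _) u w.
have cE (u : U) (w : W) : c (u (x) w) = act (gF j) u (x) w := tmapE (Ul _) (@lin_id K W) u w.
have dE (u : U) (w : W) : d (u (x) w) = act (gKV j) u (x) act (gF j) w := tmapE (Ul _) (Wl _) u w.
have FK k l u : act (gF k) (act (gKV l) u) = q ^ (- sform l k) *: act (gKV l) (act (gF k) u) :> U.
  by rewrite (act_KVF HU) scalerA -expfzDr // addNr scale1r.
rewrite (_ : serre_sum _ _ i x = serre_sum (fun t => a t + b t) (fun t => c t + d t) i x) //.
clearbody a b c d.
have abl := lin_add al bl.
rewrite serre_sumD // (@serre_half _ _ false a b) //; first last.
- apply: tens_eqK => [||u w]; [exact: lin_comp|by apply: lin_scale; apply: lin_comp|].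
  by rewrite cE !bE cE (act_KVF HU) tpureZl sij.
- apply: tens_eqK => [||u w]; [exact: lin_comp|by apply: lin_scale; apply: lin_comp|].
  by rewrite aE !bE aE (act_KVF HU) tpureZl mul1r.
have -> : (fun t => a t + b t) = (fun t => b t + a t) by apply: funext => t; rewrite addrC.
rewrite (@serre_half _ _ true b a) //; first last.
- apply: tens_eqK => [||u w]; [exact: lin_comp|by apply: lin_scale; apply: lin_comp|].
  by rewrite dE !aE dE FK tpureZl sji.
- apply: tens_eqK => [||u w]; [exact: lin_comp|by apply: lin_scale; apply: lin_comp|].
  by rewrite aE !bE aE FK tpureZl expr1 mulN1r.
suff [-> ->] : serre_sum a c i x = 0 /\ serre_sum b d i x = 0 by rewrite addr0.
have ac0 := serre_sum_lin i al cl; have bd0 := serre_sum_lin i bl dl.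
have [l0 l1] := (tens_eqK ac0 (@lin_cst0 _ _), tens_eqK bd0 (@lin_cst0 _ _)).
split; [apply: l0 | apply: l1] => u w.
- rewrite (@serre_pure a c _ _ idfun idfun _ _ _ aE cE) //.
  by rewrite (act_serreF HU) // (lin0 (tpurel _)).
- rewrite (serre_pure' _ _ _ bE dE) => [|u']; last exact: act_KVKV.
  by rewrite (act_serreF HW) // (lin0 (tpurer _)).
Qed.

Lemma otens_rel : Uq_rel T.
Proof.
split; [exact: Tl|exact: otens_KV|exact: otens_VK|exact: otens_KK|exact: otens_KE|
  exact: otens_KF|exact: otens_EF|exact: otens_EFneq|exact: otens_serreE|exact: otens_serreF].
Qed.

End Rel.

Definition lfinite (W : opModule C) (x : W) : Prop :=
  exists s : seq W, let U := lspan (fun y => y \in s) in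
    U x /\ forall g y, U y -> U (act g y).

Section Finite.
Variable W : opModule C.
Hypothesis Wl : forall g, lin (@act _ W g).

Lemma lfinite0 : lfinite (0 : W).
Proof.
exists [::]; split; first by constructor.
move=> g y; elim=> [|a u v]; last by [].
by rewrite (lin0 (Wl g)); constructor.
Qed.

Lemma lspan_cat (s t : seq W) x :
  lspan (fun y => y \in s ++ t) x <->
  exists u v, [/\ lspan (fun y => y \in s) u, lspan (fun y => y \in t) v & x = u + v].
Proof.
split=> [|[u [v [hu hv ->]]]].
  elim=> [|a y z]; first by exists 0, 0; rewrite addr0; split=> //; constructor.
  rewrite mem_cat => /orP[] hy _ [u [v [hu hv ->]]].
    exists (a *: y + u), v; rewrite addrA; split=> //.
    by apply: lspan_comb => //; apply: lspan_in.
  exists u, (a *: y + v); rewrite addrCA; split=> //.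
  by apply: lspan_comb => //; apply: lspan_in.
by apply: lspan_add; [move: hu|move: hv]; apply: lspan_mono => y yi; rewrite mem_cat yi ?orbT.
Qed.

Lemma lfiniteD (x y : W) : lfinite x -> lfinite y -> lfinite (x + y).
Proof.
move=> [s [sx sa]] [t [ty ta]]; exists (s ++ t); split.
  by apply/lspan_cat; exists x, y.
move=> g z /lspan_cat[u [v [hu hv ->]]]; apply/lspan_cat.
by exists (act g u), (act g v); split; [exact: sa|exact: ta|rewrite (linD (Wl g))].
Qed.

End Finite.

Lemma lfinite_hom (W W' : opModule C) (f : W -> W') x : Uq_hom f -> lfinite x -> lfinite (f x).
Proof.
move=> [fl fa] [s [sx sa]]; exists (map f s).
have fs z : lspan (fun y => y \in s) z -> lspan (fun y => y \in map f s) (f z).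
  by apply: (lspan_image fl) => u us; apply: lspan_in; apply: map_f.
split; first exact: fs.
move=> g y hy.
have [z [hz ->]] : exists z, lspan (fun y => y \in s) z /\ y = f z.
  elim: hy => [|a _ v /mapP[u us ->] _ [v' [hv ->]]].
    by exists 0; rewrite (lin0 fl); split=> //; constructor.
  by exists (a *: u + v'); rewrite fl; split=> //; apply: lspan_comb => //; apply: lspan_in.
by rewrite -fa; apply: fs; apply: sa.
Qed.

Lemma weight_hom (W W' : opModule C) (f : W -> W') mu x :
  Uq_hom f -> weight_vector mu x -> weight_vector mu (f x).
Proof. by move=> [fl fa] xm i; rewrite -fa xm (linZ fl). Qed.

Definition wspan (W : opModule C) (x : W) : Prop :=
  lspan (fun y => exists mu, weight_vector mu y) x.

Lemma wspan_hom (W W' : opModule C) (f : W -> W') x : Uq_hom f -> wspan x -> wspan (f x).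
Proof.
move=> fh; apply: lspan_image; first by case: fh.
by move=> y [mu ymu]; apply: lspan_in; exists mu; apply: weight_hom.
Qed.

Section OtensModule.
Variables U W : opModule C.
Hypotheses (HU : Uq_module U) (HW : Uq_module W).
Local Notation T := (otens U W).

Let HUr : Uq_rel U. Proof. by case: HU. Qed.
Let HWr : Uq_rel W. Proof. by case: HW. Qed.
Let Ul g : lin (@act _ U g) := act_lin HUr g.
Let Wl g : lin (@act _ W g) := act_lin HWr g.
Let Tl g : lin (@act _ T g) := otens_lin Ul Wl g.

Lemma otens_type1 : type1 T.
Proof.
move=> t; have [_ U1 _] := HU; have [_ W1 _] := HW.
have := tens_lspan t U1 W1; apply: lspan_mono => y [m [n [[mu mm] [nu nn] ->]]].
exists (mu.1 + nu.1, mu.2 + nu.2) => i; rewrite (otensK Ul Wl) mm nn tpureZl tpureZr scalerA.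
have -> : wform i (mu.1 + nu.1, mu.2 + nu.2) = wform i mu + wform i nu.
  exact: mulDD.
by rewrite (expfzDr (wform i mu) (wform i nu) (qK_neq0 C)).
Qed.

Lemma otens_finite : locally_finite T.
Proof.
have [_ _ U1] := HU; have [_ _ W1] := HW.
apply: tens_ind => [|m n t IH]; first exact: lfinite0.
apply: (lfiniteD Tl) IH; have [s [sm sa]] := U1 m; have [r [rn ra]] := W1 n.
exists [seq x (x) y | x <- s, y <- r].
pose S := lspan (fun y : U => y \in s); pose R := lspan (fun y : W => y \in r).
have SR u w : S u -> R w -> lspan (fun y : T => y \in [seq x (x) y | x <- s, y <- r]) (u (x) w).
  move=> hu hw; move: u hu; apply: (lspan_image (tpurel w)) => u us.
  move: w hw; apply: (lspan_image (tpurer u)) => w wr.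
  by apply: lspan_in; apply: allpairs_f.
split; first exact: SR.
move=> g y; apply: (lspan_image (Tl g)) => z /allpairsP[[u w] /= [us wr ->]].
have su : S u by apply: lspan_in.
have rw : R w by apply: lspan_in.
suff : lspan (fun y : T => y \in [seq x (x) y | x <- s, y <- r]) (@act _ T g (u (x) w)) by [].
case: g => i; [rewrite (otensE Ul Wl)|rewrite (otensF Ul Wl)|rewrite (otensK Ul Wl)|rewrite (otensKV Ul Wl)];
  do ?apply: lspan_add; apply: SR; rewrite //; (apply: sa || apply: ra); by [].
Qed.

Lemma otens_module : Uq_module T.
Proof. by split; [apply: otens_rel|apply: otens_type1|apply: otens_finite]. Qed.

End OtensModule.

(** The counit. It will be the degree 0 part of the tensor algebra. *)
Definition triv : opModule C :=
  @OpModule C (K^o) (fun g x => match g with gE _ | gF _ => 0 | gK _ | gKV _ => x end).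

Lemma triv_module : Uq_module triv.
Proof.
have S i : forall (X Y : triv -> triv) x, (forall x, X x = 0) -> (forall x, Y x = 0) -> serre_sum X Y i x = 0.
  move=> X Y x X0 Y0; rewrite /serre_sum big1 // => k _; rewrite Y0.
  case: (_ - _)%N => [|n]; rewrite /= ?scaler0 //; elim: n => [|n IH] /=; by rewrite X0 scaler0.
split.
- split; rewrite /act /=.
  + case=> i a x y; [| | |]; rewrite ?scaler0 ?addr0; reflexivity.
  + move=> i x; reflexivity.
  + move=> i x; reflexivity.
  + move=> i j x; reflexivity.
  + move=> i j x; rewrite scaler0; reflexivity.
  + move=> i j x; rewrite scaler0; reflexivity.
  + move=> i x; rewrite !subrr scaler0; reflexivity.
  + move=> i j x _; reflexivity.
  + move=> i j x _; by apply: S.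
  + move=> i j x _; by apply: S.
- move=> x; apply: lspan_in; exists ((0 : int), (0 : int)) => i /=.
  have -> : wform i ((0 : int), (0 : int)) = 0 by case: i.
  by rewrite expr0z scale1r.
- move=> x; exists [:: 1 : K^o]; split.
    have -> : x = x *: (1 : K^o) :> K^o by rewrite [RHS]mulr1.
    by apply: lspan_scale; apply: lspan_in; rewrite mem_head.
  case=> i y hy /=; [exact: lspan0|exact: lspan0|exact: hy|exact: hy].
Qed.

End Otens.

(** * The module V by tables *)

Definition kexp (i : simple_root) (a : letter) : Z :=
  match i, a with
  | alpha1, L0 => 1 | alpha1, L1 => -1 | alpha1, L2 => 2 | alpha1, L3 => 0
  | alpha1, L4 => -2 | alpha1, L5 => 1 | alpha1, L6 => -1
  | alpha2, L0 => 0 | alpha2, L1 => 3 | alpha2, L2 => -3 | alpha2, L3 => 0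
  | alpha2, L4 => 3 | alpha2, L5 => -3 | alpha2, L6 => 0
  end%Zc.

Definition lp2 : lp := [:: (-1, 1); (1, 1)]%Zc.

Definition act1 (g : Uq_gen) (a : letter) : seq (letter * lp) :=
  match g with
  | gE alpha1 => match a with
    | L1 => [:: (L0, lp_C 1)] | L3 => [:: (L2, lp2)]
    | L4 => [:: (L3, lp_opp lp2)] | L6 => [:: (L5, lp_C (-1))] | _ => [::] end
  | gE alpha2 => match a with
    | L2 => [:: (L1, lp_C 1)] | L5 => [:: (L4, lp_C (-1))] | _ => [::] end
  | gF alpha1 => match a with
    | L0 => [:: (L1, lp_C 1)] | L2 => [:: (L3, lp_C 1)]
    | L3 => [:: (L4, lp_C (-1))] | L5 => [:: (L6, lp_C (-1))] | _ => [::] end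
  | gF alpha2 => match a with
    | L1 => [:: (L2, lp_C 1)] | L4 => [:: (L5, lp_C (-1))] | _ => [::] end
  | gK i => [:: (a, lp_X (kexp i a))]
  | gKV i => [:: (a, lp_X (- kexp i a))]
  end%Zc.

Definition act1w (g : Uq_gen) (w : word) : fv :=
  if w is [:: a] then [seq ([:: x.1], x.2) | x <- act1 g a] else [::].

Definition tens1 (u v : seq (letter * lp)) : fv :=
  [seq ([:: x.1; y.1], lp_mul x.2 y.2) | x <- u, y <- v].

Definition act2w (g : Uq_gen) (w : word) : fv :=
  if w is [:: a; b] then
    let s c := [:: (c, lp_C 1%Zc)] in
    match g with
    | gE i => fv_add (tens1 (act1 g a) (act1 (gK i) b)) (tens1 (s a) (act1 g b))
    | gF i => fv_add (tens1 (act1 g a) (s b)) (tens1 (act1 (gKV i) a) (act1 g b))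
    | gK _ | gKV _ => tens1 (act1 g a) (act1 g b)
    end
  else [::].

Lemma enum_letters : enum 'I_7 = map lord letters.
Proof. by apply: (inj_map val_inj); rewrite val_enum_ord. Qed.

Lemma big_letters (M : nmodType) (F : 'I_7 -> M) :
  \sum_(i < 7) F i = \sum_(a <- letters) F (lord a).
Proof. by rewrite -big_enum enum_letters big_map. Qed.

Section Vmod.
Variable C : fieldType.
Local Notation K := (Kq C).
Local Notation q := (qK C).
Local Notation V := (Vmod C).
Local Notation VV := (otens V V).
Local Notation uK := (@uK C).

Definition ev (a : letter) : V := delta_mx (lord a) 0.

(** Words of the wrong length are sent to 0, in agreement with the default [[::]] of the tables of
    the action. *)
Definition e1 (w : word) : V := if w is [:: a] then ev a else 0.
Definition e2 (w : word) : VV := if w is [:: a; b] then ev a (x) ev b else 0.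

Lemma Vl g : lin (@act _ V g).
Proof. by move=> a x y; rewrite /= mulmxDr scalemxAr. Qed.

Lemma V_basis (v : V) : v = \sum_(a <- letters) v (lord a) 0 *: ev a.
Proof.
rewrite {1}[v]matrix_sum_delta big_letters; apply: eq_bigr => a _.
by rewrite big_ord1.
Qed.

Lemma e_delta (i j k : nat) : (i < 7)%N -> (j < 7)%N -> (k < 7)%N ->
  (delta_mx (inord i) (inord j) : 'M[K]_7) *m (delta_mx (inord k) 0 : 'cV[K]_7) =
  (j == k)%:R *: (delta_mx (inord i) 0 : 'cV[K]_7).
Proof.
move=> hi hj hk; rewrite mul_delta_mx_cond -(inj_eq val_inj) /= !inordK //.
by case: eqP => _; rewrite ?scale1r ?scale0r.
Qed.

Lemma ev_inord a : ev a = delta_mx (inord (lidx a)) 0.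
Proof. by congr delta_mx; apply: val_inj; rewrite /= inordK // lidx_lt. Qed.

Lemma lpev_uK_C c : lpev uK (lp_C c) = zr K c.
Proof. exact: lpevC (uK0 C) c. Qed.

Lemma zr1 : zr K 1%Zc = 1. Proof. by []. Qed.

Lemma zrN1 : zr K (-1)%Zc = -1. Proof. by []. Qed.

Lemma lpev_lp2 : lpev uK lp2 = q + q^-1.
Proof.
rewrite /lp2 !lpev_cons lpev_nil addr0 /= zr1 !mul1r addrC; congr (_ + _).
Qed.

Lemma act_ev g a : @act _ V g (ev a) = \sum_(x <- act1 g a) lpev uK x.2 *: ev x.1.
Proof.
rewrite ev_inord; case: g => i; last first.
- rewrite /= big_seq1 /= lpevX -ev_inord.
  rewrite mul_diag_mx; apply/colP => j; rewrite !mxE.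
  case: (j =P lord a) => [->|]; rewrite ?mulr0 // !mulr1 /uK.
  by case: i; case: a.
- rewrite /= big_seq1 /= lpevX -ev_inord.
  rewrite mul_diag_mx; apply/colP => j; rewrite !mxE.
  case: (j =P lord a) => [->|]; rewrite ?mulr0 // !mulr1 /uK.
  by case: i; case: a.
- case: i a => [] [] /=; rewrite ?mulmxDl ?mulNmx !e_delta //= ?scale1r ?scale0r ?oppr0 ?addr0 ?add0r;
  by rewrite ?big_nil ?big_seq1 ?big_seq1 //= ?lpev_uK_C ?zr1 ?zrN1 ?scaleN1r ?scale1r ev_inord.
- case: i a => [] [] /=; rewrite ?(mulmxBl, mulmxDl) ?mulNmx -?scalemxAl !e_delta //= ?scaler0 ?scale1r ?scale0r ?scaler0 ?oppr0 ?addr0 ?add0r;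
  try by rewrite ?big_nil ?big_seq1 ?big_seq1 //= ?lpevN ?lpev_lp2 ?lpev_uK_C ?zr1 ?zrN1 ?scaleNr ?scaleN1r ?scale1r ev_inord.
  by rewrite big_seq1 [lpev _ _](_ : _ = - (q + q^-1)) ?scaleNr ?ev_inord // -lpev_lp2 -lpevN.
Qed.

Lemma act1_sound g w : @act _ V g (e1 w) = fvev uK e1 (act1w g w).
Proof.
case: w => [|a [|b w]]; rewrite ?fvev_nil; try exact: (lin0 (Vl g)).
by rewrite [e1 _]/(ev a) act_ev /fvev big_map.
Qed.

Lemma fvev_tens1 (u v : seq (letter * lp)) :
  fvev uK e2 (tens1 u v) =
  (\sum_(x <- u) lpev uK x.2 *: ev x.1) (x) (\sum_(x <- v) lpev uK x.2 *: ev x.1).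
Proof.
rewrite /fvev big_allpairs_dep /= (lin_sum _ _ _ (tpurel _)); apply: eq_bigr => x _.
rewrite (lin_sum _ _ _ (tpurer _)); apply: eq_bigr => y _.
by rewrite /= lpevM ?tpureZl ?tpureZr ?scalerA //; apply: uKD.
Qed.

Lemma sum_ev1 a : \sum_(x <- [:: (a, lp_C 1%Zc)]) lpev uK x.2 *: ev x.1 = ev a.
Proof. by rewrite big_seq1 lpev_uK_C zr1 scale1r. Qed.

Lemma act2_sound g w : @act _ VV g (e2 w) = fvev uK e2 (act2w g w).
Proof.
have VVl := otens_lin Vl Vl g.
case: w => [|a [|b [|c w]]]; rewrite ?fvev_nil; try exact: (lin0 VVl).
case: g {VVl} => i; rewrite [e2 _]/(ev a (x) ev b).
- by rewrite (otensE Vl Vl) fvevD !fvev_tens1 !sum_ev1 -!act_ev.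
- by rewrite (otensF Vl Vl) fvevD !fvev_tens1 !sum_ev1 -!act_ev.
- by rewrite (otensK Vl Vl) fvev_tens1 -!act_ev.
- by rewrite (otensKV Vl Vl) fvev_tens1 -!act_ev.
Qed.

Definition app (f : Uq_gen -> word -> fv) (s : seq Uq_gen) (v : fv) : fv :=
  foldr (fun g => fv_bind (f g)) v s.

Lemma app_sound (W : opModule C) (e : word -> W) f :
  (forall g, lin (@act _ W g)) -> (forall g w, act g (e w) = fvev uK e (f g w)) ->
  forall s v, foldr (fun g x => act g x) (fvev uK e v) s = fvev uK e (app f s v).
Proof.
move=> Wl h s v; elim: s => [|g s IH] //=; rewrite IH fvev_bind; last exact: uKD.
rewrite /fvev (lin_sum _ _ _ (Wl g)); apply: eq_bigr => x _.
by rewrite (linZ (Wl g)) h.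
Qed.

Lemma V_ind (P : V -> Prop) : (forall a x y, P x -> P y -> P (a *: x + y)) -> P 0 ->
  (forall a, P (ev a)) -> forall v, P v.
Proof.
move=> PD P0 Pe v; rewrite [v]V_basis; elim/big_rec: _ => // a x _ Px.
exact: PD.
Qed.

Lemma lin_V (M : lmodType K) (f g : V -> M) : lin f -> lin g ->
  (forall a, f (ev a) = g (ev a)) -> f =1 g.
Proof.
move=> fl gl fg; apply: V_ind => // [a x y hx hy|]; first by rewrite fl gl hx hy.
by rewrite (lin0 fl) (lin0 gl).
Qed.

Lemma lin_VV (M : lmodType K) (f g : VV -> M) : lin f -> lin g ->
  (forall a b, f (ev a (x) ev b) = g (ev a (x) ev b)) -> f =1 g.
Proof.
move=> fl gl fg; apply: tens_eqK => // u v; move: u.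
apply: lin_V => [||a]; [exact: (lin_comp (tpurel v) fl)|exact: (lin_comp (tpurel v) gl)|].
move: v; apply: lin_V => [||b]; [exact: (lin_comp (tpurer _) fl)|exact: (lin_comp (tpurer _) gl)|].
exact: fg.
Qed.

Definition sroots := [:: alpha1; alpha2].
Definition qiZ (i : simple_root) : Z := match i with alpha1 => 1 | alpha2 => 3 end%Zc.

(** A relation of U_q is a list of products of generators with coefficients; by linearity it is
    enough to evaluate it on the seven basis vectors. *)
Definition rel_check (r : seq (seq Uq_gen * lp)) : bool :=
  all (fun a => if foldr (fun x acc => fv_add (fv_scale x.2 (app act1w x.1 (fv_word [:: a]))) acc) [::] r
                is [::] then true else false) letters.

Lemma rel_checkP r : rel_check r ->
  forall x : V, \sum_(y <- r) lpev uK y.2 *: foldr (fun g x => act g x) x y.1 = 0.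
Proof.
move=> h x.
have appl s : lin (fun x : V => foldr (fun g x => act g x) x s).
  elim: s => [|g s IH]; first exact: lin_id.
  exact: (lin_comp IH (Vl g)).
pose f x : V := \sum_(y <- r) lpev uK y.2 *: foldr (fun g x => act g x) x y.1.
have fl : lin f.
  rewrite /f; elim: (r) => [|y r' IH] b u v; first by rewrite !big_nil scaler0 addr0.
  rewrite !big_cons appl IH !scalerDr !scalerA [lpev _ _ * b]mulrC addrACA.
  by [].
suff : f =1 (fun=> 0) by apply.
apply: lin_V => // [|a]; first exact: lin_cst0.
have := all_letters h a; rewrite /f; set z := foldr _ _ _.
suff -> : \sum_(y <- r) lpev uK y.2 *: foldr (fun g x => act g x) (ev a) y.1 = fvev uK e1 z.
  by case: z => // _; rewrite fvev_nil.
rewrite {}/z {h}; elim: r {f fl} => [|y r IH]; first by rewrite big_nil fvev_nil.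
rewrite big_cons IH /= fvevD fvevZ; last exact: uKD.
rewrite -(app_sound Vl act1_sound) fvev_word //; exact: uK0.
Qed.

End Vmod.

Section ScaleIdentities.
Variables (F : fieldType) (M : lmodType F).
Implicit Types (x y : M).

Lemma two_terms (a b c : F) x y : a = 1 -> b = - c ->
  a *: x + (b *: y + 0) = 0 -> x = c *: y.
Proof. by move=> -> ->; rewrite addr0 scale1r scaleNr => /eqP; rewrite subr_eq0 => /eqP. Qed.

Lemma three_terms (s t : F) (a b c : F) x y z : a = 1 -> b = - s -> c = t ->
  a *: x + (b *: y + (c *: z + 0)) = 0 -> x - s *: y + t *: z = 0.
Proof. by move=> -> -> ->; rewrite addr0 !scale1r scaleNr addrA. Qed.

Lemma four_terms (d : F) (a b c e : F) x y z w : d != 0 ->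
  a = d -> b = - d -> c = -1 -> e = 1 ->
  a *: x + (b *: y + (c *: z + (e *: w + 0))) = 0 -> x - y = d^-1 *: (z - w).
Proof.
move=> d0 -> -> -> ->; rewrite addr0 scale1r scaleN1r scaleNr addrA -scalerBr.
move=> /eqP; rewrite addr_eq0 opprD opprK => /eqP h.
by apply: (canRL (scalerK d0)); rewrite h.
Qed.

Lemma five_terms (s p t u : F) (a b c d e : F) x y z w v :
  a = 1 -> b = - s -> c = p -> d = - t -> e = u ->
  a *: x + (b *: y + (c *: z + (d *: w + (e *: v + 0)))) = 0 ->
  x - s *: y + p *: z - t *: w + u *: v = 0.
Proof. by move=> -> -> -> -> ->; rewrite addr0 scale1r !scaleNr !addrA. Qed.

End ScaleIdentities.

Section VmodRelations.
Variable C : fieldType.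
Local Notation q := (qK C).
Local Notation V := (Vmod C).
Local Notation VV := (otens V V).
Local Notation uK := (@uK C).

Definition rK i : seq (seq Uq_gen * lp) := [:: ([:: gK i; gKV i], lp_C 1); ([::], lp_C (-1))]%Zc.
Definition rKV i : seq (seq Uq_gen * lp) := [:: ([:: gKV i; gK i], lp_C 1); ([::], lp_C (-1))]%Zc.
Definition rcomm c g h : seq (seq Uq_gen * lp) :=
  [:: ([:: g; h], lp_C 1%Zc); ([:: h; g], lp_opp (lp_X c))].
Definition zform (i j : simple_root) : Z :=
  match i, j with alpha1, alpha1 => 2 | alpha2, alpha2 => 6 | _, _ => -3 end%Zc.
Definition lqi i : lp := [:: (- qiZ i, -1); (qiZ i, 1)]%Zc.
(** The relation is multiplied by q_i - q_i^-1, so that all coefficients are Laurent polynomials;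
    [four_terms] divides again. *)
Definition rEF i : seq (seq Uq_gen * lp) :=
  [:: ([:: gE i; gF i], lqi i); ([:: gF i; gE i], lp_opp (lqi i));
      ([:: gK i], lp_C (-1)); ([:: gKV i], lp_C 1)]%Zc.
Definition lps : lp := [:: (1, 1); (3, 1)]%Zc.
Definition lps' : lp := [:: (-3, 1); (-1, 1)]%Zc.
Definition lps2 : lp := [:: (-3, 1); (3, 1)]%Zc.
(** The Gaussian binomials appear in the factored form of [qbin4E], with [lps] and [lps'] for s and
    s'; this avoids division. *)
Definition rserre1 x y : seq (seq Uq_gen * lp) :=
  [:: ([:: x; x; x; x; y], lp_C 1);
      ([:: x; x; x; y; x], lp_opp (lp_add lps lps'));
      ([:: x; x; y; x; x], lp_add (lp_X 4) (lp_add (lp_mul lps lps') (lp_X (-4))));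
      ([:: x; y; x; x; x], lp_opp (lp_add (lp_mul lps (lp_X (-4))) (lp_mul (lp_X 4) lps')));
      ([:: y; x; x; x; x], lp_C 1)]%Zc.
Definition rserre2 x y : seq (seq Uq_gen * lp) :=
  [:: ([:: x; x; y], lp_C 1); ([:: x; y; x], lp_opp lps2); ([:: y; x; x], lp_C 1)]%Zc.

Definition V_checks : bool :=
  all (fun i =>
    [&& rel_check (rK i), rel_check (rKV i), rel_check (rEF i)
      & all (fun j => [&& rel_check (rcomm 0 (gK i) (gK j)),
                rel_check (rcomm (zform i j) (gK i) (gE j)) &
                rel_check (rcomm (- zform i j)%Zc (gK i) (gF j))]) sroots]) sroots
  && [&& rel_check (rcomm 0 (gE alpha1) (gF alpha2)), rel_check (rcomm 0 (gE alpha2) (gF alpha1)),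
       rel_check (rserre1 (gE alpha1) (gE alpha2)), rel_check (rserre1 (gF alpha1) (gF alpha2)),
       rel_check (rserre2 (gE alpha2) (gE alpha1)) & rel_check (rserre2 (gF alpha2) (gF alpha1))].

Lemma V_checksP : V_checks.
Proof. by vm_compute. Qed.

Lemma all_roots (P : pred simple_root) : all P sroots -> forall i, P i.
Proof. by move=> /= /and3P[? ? _] []. Qed.

Lemma lpev_lps : lpev uK lps = q ^+ 3 + q.
Proof. by rewrite !lpev_cons lpev_nil /= !mul1r addr0 addrC. Qed.

Lemma lpev_lps' : lpev uK lps' = q^-1 + q ^- 3.
Proof. by rewrite !lpev_cons lpev_nil /= !mul1r addr0 addrC. Qed.

Lemma lpev_lps2 : lpev uK lps2 = q ^+ 3 + q ^- 3.
Proof. by rewrite !lpev_cons lpev_nil /= !mul1r addr0 addrC. Qed.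

Lemma lpev_X e : lpev uK (lp_X e) = q ^ int_of_Z e.
Proof. by rewrite lpevX. Qed.

Lemma lpev_lqi i : lpev uK (lqi i) = qi C i - (qi C i)^-1.
Proof. by case: i; rewrite !lpev_cons lpev_nil /= zrN1 zr1 mul1r mulN1r addr0 addrC. Qed.

Fixpoint rsum (r : seq (seq Uq_gen * lp)) (x : V) : V :=
  if r is y :: r' then lpev uK y.2 *: foldr (fun g x => act g x) x y.1 + rsum r' x else 0.

Lemma rsum0 r : rel_check r -> forall x : V, rsum r x = 0.
Proof.
move=> /(@rel_checkP C) h x; rewrite -[RHS](h x) {h}.
by elim: r => [|y r IH]; rewrite ?big_nil // big_cons -IH.
Qed.

Lemma lpevC1 : lpev uK (lp_C 1%Zc) = 1. Proof. by rewrite lpev_uK_C. Qed.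

Lemma lpevCN1 : lpev uK (lp_C (-1)%Zc) = -1. Proof. by rewrite lpev_uK_C. Qed.

Lemma lpevNX c : lpev uK (lp_opp (lp_X c)) = - q ^ int_of_Z c.
Proof. by rewrite lpevN lpevX. Qed.

Lemma rcommP c g h : rel_check (rcomm c g h) -> forall x : V,
  act g (act h x) = q ^ int_of_Z c *: act h (act g x).
Proof. by move=> /rsum0 r x; apply: (two_terms lpevC1 (lpevNX c) (r x)). Qed.

Lemma rinvP g h : rel_check [:: ([:: g; h], lp_C 1%Zc); ([::], lp_C (-1)%Zc)] ->
  forall x : V, act g (act h x) = x.
Proof. by move=> /rsum0 r x; rewrite [LHS](two_terms lpevC1 lpevCN1 (r x)) scale1r. Qed.

Lemma qi_neq0 i : qi C i - (qi C i)^-1 != 0.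
Proof.
have t0 : qi C i != 0 by case: i; rewrite /= ?expf_neq0 ?qK_neq0.
have t2 : qi C i ^+ 2 != 1.
  case: i {t0}; first exact: (qX_neq1' C 1).
  by rewrite -exprM; apply: (qX_neq1' C 5).
apply: contraNneq t2 => h.
by rewrite expr2 -[X in _ * X](subrK (qi C i)^-1) h add0r divff.
Qed.

Let cb : lpev uK (lp_opp (lp_add lps lps')) = - (q ^+ 3 + q + (q^-1 + q ^- 3)).
Proof. by rewrite lpevN lpevD lpev_lps lpev_lps'. Qed.

Let cc : lpev uK (lp_add (lp_X 4%Zc) (lp_add (lp_mul lps lps') (lp_X (-4)%Zc))) =
  q ^+ 4 + (q ^+ 3 + q) * (q^-1 + q ^- 3) + q ^- 4.
Proof.
rewrite lpevD lpevD (lpevM (@uKD C)) lpev_lps lpev_lps' (lpev_X 4%Zc) (lpev_X (-4)%Zc).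
exact: addrA.
Qed.

Let cd : lpev uK (lp_opp (lp_add (lp_mul lps (lp_X (-4)%Zc)) (lp_mul (lp_X 4%Zc) lps'))) =
  - ((q ^+ 3 + q) * q ^- 4 + q ^+ 4 * (q^-1 + q ^- 3)).
Proof.
have h1 : lpev uK (lp_mul lps (lp_X (-4)%Zc)) = (q ^+ 3 + q) * q ^- 4.
  by rewrite (lpevM (@uKD C)) lpev_lps lpevX.
have h2 : lpev uK (lp_mul (lp_X 4%Zc) lps') = q ^+ 4 * (q^-1 + q ^- 3).
  by rewrite (lpevM (@uKD C)) lpev_lps' lpevX.
by rewrite lpevN lpevD h1 h2.
Qed.

Let ce : lpev uK (lp_C 1%Zc) = q ^+ 4 * q ^- 4.
Proof. by rewrite lpevC1 divff // expf_neq0 // qK_neq0. Qed.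

Let c2 : lpev uK (lp_opp lps2) = - (q ^+ 3 + q ^- 3).
Proof. by rewrite lpevN lpev_lps2. Qed.

Let cqi i : lpev uK (lp_opp (lqi i)) = - (qi C i - (qi C i)^-1).
Proof. by rewrite lpevN lpev_lqi. Qed.

Lemma V_rel : Uq_rel V.
Proof.
have /andP[/all_roots h1 h2] := V_checksP.
have hE i j (x : V) : act (gK i) (act (gE j) x) = q ^ sform i j *: act (gE j) (act (gK i) x).
  have /and4P[_ _ _ /all_roots h] := h1 i; have /and3P[_ h' _] := h j.
  by rewrite (rcommP h'); congr (q ^ _ *: _); case: i j {h h'} => [] [].
have hF i j (x : V) : act (gK i) (act (gF j) x) = q ^ (- sform i j) *: act (gF j) (act (gK i) x).
  have /and4P[_ _ _ /all_roots h] := h1 i; have /and3P[_ _ h'] := h j.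
  by rewrite (rcommP h'); congr (q ^ _ *: _); case: i j {h h'} => [] [].
have /and5P[h12 h21 s1 s2 /andP[s3 s4]] := h2.
have se1 x y : rel_check (rserre1 x y) -> forall v : V, serre_sum (act x) (act y) alpha1 v = 0.
  move=> /rsum0 r v; rewrite serre1E; last exact: Vl.
  rewrite op2_op2; last exact: Vl.
  exact: (five_terms lpevC1 cb cc cd ce (r v)).
have se2 x y : rel_check (rserre2 x y) -> forall v : V, serre_sum (act x) (act y) alpha2 v = 0.
  move=> /rsum0 r v; rewrite serre2E; last exact: Vl.
  exact: (three_terms lpevC1 c2 lpevC1 (r v)).
split.
- exact: Vl.
- by move=> i x; have /and4P[/rinvP h _ _ _] := h1 i; apply: h.
- by move=> i x; have /and4P[_ /rinvP h _ _] := h1 i; apply: h.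
- move=> i j x; have /and4P[_ _ _ /all_roots h] := h1 i; have /and3P[/rcommP h' _ _] := h j.
  by rewrite h' scale1r.
- exact: hE.
- exact: hF.
- move=> i x; have /and4P[_ _ /rsum0 h _] := h1 i.
  exact: (four_terms (qi_neq0 i) (lpev_lqi i) (cqi i) lpevCN1 lpevC1 (h x)).
- move=> i j x; case: i; case: j => ij; [by case: (ij erefl)| | |by case: (ij erefl)].
    by rewrite (rcommP h12) scale1r.
  by rewrite (rcommP h21) scale1r.
- move=> i j x; case: i; case: j => ij; [by case: (ij erefl)| | |by case: (ij erefl)].
    exact: (se1 _ _ s1).
  exact: (se2 _ _ s3).
- move=> i j x; case: i; case: j => ij; [by case: (ij erefl)| | |by case: (ij erefl)].
    exact: (se1 _ _ s2).
  exact: (se2 _ _ s4).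
Qed.

Definition lwt (a : letter) : weight :=
  match a with L0 => (2, 1) | L1 => (1, 1) | L2 => (1, 0) | L3 => (0, 0)
   | L4 => (-1, 0) | L5 => (-1, -1) | L6 => (-2, -1) end.

Lemma ev_weight a : weight_vector (lwt a) (ev C a).
Proof.
move=> i; rewrite act_ev /= big_seq1 lpev_X; congr (q ^ _ *: _).
by case: i a => [] [].
Qed.

Lemma V_module : Uq_module V.
Proof.
split; first exact: V_rel.
- move=> x; rewrite [x]V_basis; apply: lspan_sum => a _; apply: lspan_scale; apply: lspan_in.
  by exists (lwt a); apply: ev_weight.
- move=> x; exists [seq ev C a | a <- letters].
  have all y : lspan (fun y => y \in [seq ev C a | a <- letters]) y.
    rewrite [y]V_basis big_seq; apply: lspan_sum => a ain; apply: lspan_scale; apply: lspan_in.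
    exact: map_f.
  by split=> *; apply: all.
Qed.

Lemma VV_module : Uq_module VV.
Proof. exact: otens_module V_module V_module. Qed.

End VmodRelations.

(** * The module V (x) V and its braiding *)

(* highest weights 2 lambda_1, lambda_2, lambda_1 and 0 of the components of V (x) V *)
Inductive hwt := Hs | Ha | Hv | Ht.

(* the highest weight vectors *)
Definition sing (h : hwt) : fv :=
  match h with
  | Hs => [:: ([:: L0; L0], [:: (0,1)])]
  | Ha => [:: ([:: L0; L1], [:: (1,-1)]);
     ([:: L1; L0], [:: (0,1)])]
  | Hv => [:: ([:: L0; L3], [:: (6,-1)]);
     ([:: L1; L2], [:: (3,1); (5,1)]);
     ([:: L2; L1], [:: (0,-1); (2,-1)]);
     ([:: L3; L0], [:: (0,1)])]
  | Ht => [:: ([:: L0; L6], [:: (10,1)]);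
     ([:: L1; L5], [:: (9,1)]);
     ([:: L2; L4], [:: (6,1)]);
     ([:: L3; L3], [:: (6,1)]);
     ([:: L4; L2], [:: (4,1)]);
     ([:: L5; L1], [:: (1,1)]);
     ([:: L6; L0], [:: (0,1)])]
  end%Zc.

(* The functionals cosing h vanish on the images of F_1 and F_2 and are, up to
   scalars, dual to the vectors sing h. *)
Definition cosing_Hs (a b : letter) : lp :=
  match a, b with
  | L0, L0 => [:: (0,1)]
  | _, _ => [::]
  end%Zc.

Definition cosing_Ha (a b : letter) : lp :=
  match a, b with
  | L0, L1 => [:: (1,-1)]
  | L1, L0 => [:: (0,1)]
  | _, _ => [::]
  end%Zc.

Definition cosing_Hv (a b : letter) : lp :=
  match a, b with
  | L0, L3 => [:: (6,-1)]
  | L1, L2 => [:: (5,1)]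
  | L2, L1 => [:: (2,-1)]
  | L3, L0 => [:: (0,1)]
  | _, _ => [::]
  end%Zc.

Definition cosing_Ht (a b : letter) : lp :=
  match a, b with
  | L0, L6 => [:: (10,1)]
  | L1, L5 => [:: (9,1)]
  | L2, L4 => [:: (6,1)]
  | L3, L3 => [:: (4,1)]
  | L4, L2 => [:: (4,1)]
  | L5, L1 => [:: (1,1)]
  | L6, L0 => [:: (0,1)]
  | _, _ => [::]
  end%Zc.

Definition cosing (h : hwt) : letter -> letter -> lp :=
  match h with Hs => cosing_Hs | Ha => cosing_Ha | Hv => cosing_Hv | Ht => cosing_Ht end.

(* [singA1 (E_1 t) + singA2 (E_2 t) + singC t = singD * t], so that a vector
   killed by E_1 and E_2 is a combination of the vectors sing h *)
Definition singA1 (a b : letter) : fv :=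
  match a, b with
  | L0, L0 => [:: ([:: L0; L1], [:: (0,1); (2,2); (4,1)])]
  | L0, L2 => [:: ([:: L0; L3], [:: (1,1); (3,1)])]
  | L0, L3 => [:: ([:: L0; L4], [:: (1,-1); (3,-1)])]
  | L0, L4 => [:: ([:: L1; L4], [:: (2,1); (4,2); (6,1)])]
  | L0, L5 => [:: ([:: L0; L6], [:: (0,-1); (2,-2); (4,-1)])]
  | L1, L0 => [:: ([:: L1; L1], [:: (0,1); (2,2); (4,1)])]
  | L1, L2 => [:: ([:: L0; L4], [:: (2,1)]);
     ([:: L1; L3], [:: (1,1); (3,1)])]
  | L1, L5 => [:: ([:: L1; L6], [:: (0,-1); (2,-2); (4,-1)])]
  | L2, L0 => [:: ([:: L0; L3], [:: (6,1); (8,1)]);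
     ([:: L1; L2], [:: (3,-1); (5,-2); (7,-1)]);
     ([:: L2; L1], [:: (0,1); (2,2); (4,1)])]
  | L2, L1 => [:: ([:: L3; L1], [:: (2,1); (4,1)]);
     ([:: L4; L0], [:: (2,1)])]
  | L2, L3 => [:: ([:: L0; L6], [:: (5,-1); (7,-1)]);
     ([:: L1; L5], [:: (4,-1); (6,-1)]);
     ([:: L2; L4], [:: (1,-1); (3,-1)])]
  | L2, L5 => [:: ([:: L2; L6], [:: (0,-1); (2,-2); (4,-1)])]
  | L3, L0 => [:: ([:: L4; L0], [:: (0,-1); (2,-1)])]
  | L3, L2 => [:: ([:: L0; L6], [:: (5,1); (7,1)]);
     ([:: L1; L5], [:: (4,1); (6,1)]);
     ([:: L2; L4], [:: (1,1); (3,1)]);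
     ([:: L3; L3], [:: (1,1); (3,1)])]
  | L3, L3 => [:: ([:: L3; L4], [:: (1,-1); (3,-1)])]
  | L3, L5 => [:: ([:: L3; L6], [:: (0,-1); (2,-2); (4,-1)])]
  | L4, L0 => [:: ([:: L4; L1], [:: (0,1); (2,2); (4,1)])]
  | L4, L2 => [:: ([:: L3; L4], [:: (1,-1); (3,-1)]);
     ([:: L4; L3], [:: (1,1); (3,1)])]
  | L4, L3 => [:: ([:: L4; L4], [:: (1,-1); (3,-1)])]
  | L4, L5 => [:: ([:: L4; L6], [:: (0,-1); (2,-2); (4,-1)])]
  | L5, L0 => [:: ([:: L0; L6], [:: (9,1); (11,2); (13,1)]);
     ([:: L1; L5], [:: (8,1); (10,2); (12,1)]);
     ([:: L2; L4], [:: (5,1); (7,2); (9,1)]);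
     ([:: L3; L3], [:: (5,1); (7,2); (9,1)]);
     ([:: L4; L2], [:: (3,1); (5,2); (7,1)]);
     ([:: L5; L1], [:: (0,1); (2,2); (4,1)])]
  | L5, L3 => [:: ([:: L3; L6], [:: (4,-1); (6,-2); (8,-1)]);
     ([:: L4; L5], [:: (4,1); (6,1)]);
     ([:: L5; L4], [:: (1,-1); (3,-1)])]
  | L5, L4 => [:: ([:: L6; L4], [:: (2,-1); (4,-2); (6,-1)])]
  | L5, L5 => [:: ([:: L5; L6], [:: (0,-1); (2,-2); (4,-1)])]
  | L6, L0 => [:: ([:: L6; L1], [:: (0,1); (2,2); (4,1)])]
  | L6, L2 => [:: ([:: L3; L6], [:: (5,-1); (7,-1)]);
     ([:: L4; L5], [:: (5,1)]);
     ([:: L5; L4], [:: (2,-1)]);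
     ([:: L6; L3], [:: (1,1); (3,1)])]
  | L6, L5 => [:: ([:: L6; L6], [:: (0,-1); (2,-2); (4,-1)])]
  | _, _ => [::]
  end%Zc.

Definition singA2 (a b : letter) : fv :=
  match a, b with
  | L0, L1 => [:: ([:: L0; L2], [:: (0,1); (2,2); (4,1)])]
  | L0, L4 => [:: ([:: L0; L5], [:: (0,-1); (2,-2); (4,-1)])]
  | L1, L0 => [:: ([:: L2; L0], [:: (0,1); (2,2); (4,1)])]
  | L1, L1 => [:: ([:: L0; L3], [:: (3,-1); (5,-1)]);
     ([:: L1; L2], [:: (0,1); (2,2); (4,1)])]
  | L1, L3 => [:: ([:: L2; L3], [:: (0,1); (2,2); (4,1)])]
  | L1, L4 => [:: ([:: L0; L6], [:: (1,-1); (3,-2); (5,-1)]);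
     ([:: L1; L5], [:: (0,-1); (2,-2); (4,-1)])]
  | L2, L1 => [:: ([:: L2; L2], [:: (0,1); (2,2); (4,1)])]
  | L2, L4 => [:: ([:: L2; L5], [:: (0,-1); (2,-2); (4,-1)])]
  | L3, L1 => [:: ([:: L3; L2], [:: (0,1); (2,2); (4,1)])]
  | L3, L4 => [:: ([:: L2; L6], [:: (0,-1); (2,-3); (4,-3); (6,-1)]);
     ([:: L3; L5], [:: (0,-1); (2,-2); (4,-1)])]
  | L4, L0 => [:: ([:: L5; L0], [:: (0,-1); (2,-2); (4,-1)])]
  | L4, L1 => [:: ([:: L0; L6], [:: (6,1); (8,2); (10,1)]);
     ([:: L1; L5], [:: (5,1); (7,2); (9,1)]);
     ([:: L2; L4], [:: (2,1); (4,2); (6,1)]);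
     ([:: L3; L3], [:: (2,1); (4,2); (6,1)]);
     ([:: L4; L2], [:: (0,1); (2,2); (4,1)])]
  | L4, L3 => [:: ([:: L5; L3], [:: (0,-1); (2,-2); (4,-1)])]
  | L4, L4 => [:: ([:: L3; L6], [:: (0,1); (2,3); (4,3); (6,1)]);
     ([:: L4; L5], [:: (0,-1); (2,-2); (4,-1)])]
  | L5, L1 => [:: ([:: L5; L2], [:: (0,1); (2,2); (4,1)])]
  | L5, L4 => [:: ([:: L5; L5], [:: (0,-1); (2,-2); (4,-1)])]
  | L6, L1 => [:: ([:: L6; L2], [:: (0,1); (2,2); (4,1)])]
  | L6, L4 => [:: ([:: L5; L6], [:: (1,1); (3,2); (5,1)]);
     ([:: L6; L5], [:: (0,-1); (2,-2); (4,-1)])]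
  | _, _ => [::]
  end%Zc.

Definition singC (a b : letter) : option hwt :=
  match a, b with
  | L0, L0 => Some Hs
  | L1, L0 => Some Ha
  | L3, L0 => Some Hv
  | L6, L0 => Some Ht
  | _, _ => None
  end%Zc.

Definition singD : lp := [:: (0,1); (2,2); (4,1)]%Zc.

(* An entry ((a, b), (D, (x1, x2), c)) says [D * v_a (x) v_b = F_1 x1 + F_2 x2]
   + the multiple c of a highest weight vector, where x1 and x2 only involve
   earlier entries. *)
Definition gen_tab : seq ((letter * letter) * (lp * (fv * fv) * option (hwt * lp))) :=
 [:: ((L0, L0), ([:: (0,1)], ([::], [::]), Some (Hs, [:: (0,1)])));
    ((L0, L1), ([:: (0,1); (2,1)], ([:: ([:: L0; L0], [:: (1,1)])], [::]), Some (Ha, [:: (1,-1)])));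
    ((L1, L0), ([:: (0,1); (2,1)], ([:: ([:: L0; L0], [:: (2,1)])], [::]), Some (Ha, [:: (0,1)])));
    ((L1, L1), ([:: (0,1)], ([:: ([:: L0; L1], [:: (0,1)])], [::]), None));
    ((L0, L2), ([:: (0,1)], ([::], [:: ([:: L0; L1], [:: (0,1)])]), None));
    ((L2, L0), ([:: (0,1)], ([::], [:: ([:: L1; L0], [:: (0,1)])]), None));
    ((L0, L3), ([:: (0,1); (2,1); (4,1); (8,1); (10,1); (12,1)], ([:: ([:: L0; L2], [:: (1,1); (3,1); (5,1); (9,1); (11,1)]);
     ([:: L2; L0], [:: (6,1)])], [:: ([:: L1; L1], [:: (4,-1); (6,-1); (8,-1)])]), Some (Hv, [:: (6,-1)])));
    ((L1, L2), ([:: (0,1); (2,1); (4,1); (8,1); (10,1); (12,1)], ([:: ([:: L0; L2], [:: (12,1)]);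
     ([:: L2; L0], [:: (5,-1)])], [:: ([:: L1; L1], [:: (3,1); (5,1); (7,1)])]), Some (Hv, [:: (5,1)])));
    ((L2, L1), ([:: (0,1); (2,1); (4,1); (8,1); (10,1); (12,1)], ([:: ([:: L0; L2], [:: (9,-1)]);
     ([:: L2; L0], [:: (2,1)])], [:: ([:: L1; L1], [:: (8,1); (10,1); (12,1)])]), Some (Hv, [:: (2,-1)])));
    ((L3, L0), ([:: (0,1); (2,1); (4,1); (8,1); (10,1); (12,1)], ([:: ([:: L0; L2], [:: (7,1)]);
     ([:: L2; L0], [:: (2,1); (4,1); (8,1); (10,1); (12,1)])], [:: ([:: L1; L1], [:: (6,-1); (8,-1); (10,-1)])]), Some (Hv, [:: (0,1)])));
    ((L0, L4), ([:: (0,1)], ([:: ([:: L0; L3], [:: (1,-1)]);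
     ([:: L1; L2], [:: (0,1)])], [::]), None));
    ((L1, L3), ([:: (1,1)], ([:: ([:: L1; L2], [:: (0,1)])], [::]), None));
    ((L3, L1), ([:: (0,1)], ([:: ([:: L2; L1], [:: (0,1)])], [::]), None));
    ((L4, L0), ([:: (0,1)], ([:: ([:: L2; L1], [:: (0,1)]);
     ([:: L3; L0], [:: (0,-1)])], [::]), None));
    ((L2, L2), ([:: (0,1)], ([::], [:: ([:: L1; L2], [:: (0,1)])]), None));
    ((L1, L4), ([:: (0,1)], ([:: ([:: L0; L4], [:: (0,1)])], [::]), None));
    ((L4, L1), ([:: (0,1)], ([:: ([:: L3; L1], [:: (0,-1)])], [::]), None));
    ((L0, L5), ([:: (0,1)], ([::], [:: ([:: L0; L4], [:: (0,-1)])]), None));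
    ((L2, L3), ([:: (0,1)], ([::], [:: ([:: L1; L3], [:: (0,1)])]), None));
    ((L3, L2), ([:: (2,1)], ([:: ([:: L2; L2], [:: (2,1)])], [:: ([:: L1; L3], [:: (0,-1)])]), None));
    ((L5, L0), ([:: (0,1)], ([::], [:: ([:: L4; L0], [:: (0,-1)])]), None));
    ((L0, L6), ([:: (0,1); (2,1); (8,1); (10,1); (12,1); (18,1); (20,1)], ([:: ([:: L0; L5], [:: (1,-1); (3,-1); (9,-1); (11,-1); (13,-1); (19,-1)]);
     ([:: L2; L3], [:: (6,-1); (8,-1); (14,-1); (16,-1)]);
     ([:: L3; L2], [:: (6,1); (8,1); (14,1)]);
     ([:: L5; L0], [:: (10,1)])], [:: ([:: L1; L4], [:: (4,-1); (6,-1); (12,-1); (14,-1); (16,-1)]);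
     ([:: L4; L1], [:: (9,1); (11,1)])]), Some (Ht, [:: (10,1)])));
    ((L1, L5), ([:: (0,1); (2,1); (8,1); (10,1); (12,1); (18,1); (20,1)], ([:: ([:: L0; L5], [:: (20,1)]);
     ([:: L2; L3], [:: (5,-1); (7,-1); (13,-1); (15,-1)]);
     ([:: L3; L2], [:: (5,1); (7,1); (13,1)]);
     ([:: L5; L0], [:: (9,1)])], [:: ([:: L1; L4], [:: (3,-1); (5,-1); (11,-1); (13,-1); (15,-1)]);
     ([:: L4; L1], [:: (8,1); (10,1)])]), Some (Ht, [:: (9,1)])));
    ((L2, L4), ([:: (0,1); (2,1); (8,1); (10,1); (12,1); (18,1); (20,1)], ([:: ([:: L0; L5], [:: (17,1)]);
     ([:: L2; L3], [:: (2,-1); (4,-1); (10,-1); (12,-1)]);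
     ([:: L3; L2], [:: (2,1); (4,1); (10,1)]);
     ([:: L5; L0], [:: (6,1)])], [:: ([:: L1; L4], [:: (18,1); (20,1)]);
     ([:: L4; L1], [:: (5,1); (7,1)])]), Some (Ht, [:: (6,1)])));
    ((L3, L3), ([:: (0,1); (2,1); (8,1); (10,1); (12,1); (18,1); (20,1)], ([:: ([:: L0; L5], [:: (15,1)]);
     ([:: L2; L3], [:: (12,1); (18,1); (20,1)]);
     ([:: L3; L2], [:: (0,1); (2,1); (8,1)]);
     ([:: L5; L0], [:: (4,1)])], [:: ([:: L1; L4], [:: (16,1); (18,1)]);
     ([:: L4; L1], [:: (3,1); (5,1)])]), Some (Ht, [:: (4,1)])));
    ((L4, L2), ([:: (0,1); (2,1); (8,1); (10,1); (12,1); (18,1); (20,1)], ([:: ([:: L0; L5], [:: (15,1)]);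
     ([:: L2; L3], [:: (12,1); (18,1); (20,1)]);
     ([:: L3; L2], [:: (10,-1); (12,-1); (18,-1); (20,-1)]);
     ([:: L5; L0], [:: (4,1)])], [:: ([:: L1; L4], [:: (16,1); (18,1)]);
     ([:: L4; L1], [:: (3,1); (5,1)])]), Some (Ht, [:: (4,1)])));
    ((L5, L1), ([:: (0,1); (2,1); (8,1); (10,1); (12,1); (18,1); (20,1)], ([:: ([:: L0; L5], [:: (12,1)]);
     ([:: L2; L3], [:: (9,1); (15,1); (17,1)]);
     ([:: L3; L2], [:: (7,-1); (9,-1); (15,-1); (17,-1)]);
     ([:: L5; L0], [:: (1,1)])], [:: ([:: L1; L4], [:: (13,1); (15,1)]);
     ([:: L4; L1], [:: (8,-1); (10,-1); (12,-1); (18,-1); (20,-1)])]), Some (Ht, [:: (1,1)])));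
    ((L6, L0), ([:: (0,1); (2,1); (8,1); (10,1); (12,1); (18,1); (20,1)], ([:: ([:: L0; L5], [:: (11,1)]);
     ([:: L2; L3], [:: (8,1); (14,1); (16,1)]);
     ([:: L3; L2], [:: (6,-1); (8,-1); (14,-1); (16,-1)]);
     ([:: L5; L0], [:: (2,-1); (8,-1); (10,-1); (12,-1); (18,-1); (20,-1)])], [:: ([:: L1; L4], [:: (12,1); (14,1)]);
     ([:: L4; L1], [:: (7,-1); (9,-1); (11,-1); (17,-1); (19,-1)])]), Some (Ht, [:: (0,1)])));
    ((L1, L6), ([:: (0,1)], ([:: ([:: L0; L6], [:: (0,1)])], [::]), None));
    ((L3, L4), ([:: (0,1)], ([:: ([:: L2; L4], [:: (0,1)])], [::]), None));
    ((L4, L3), ([:: (0,1)], ([:: ([:: L2; L4], [:: (0,-1)]);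
     ([:: L3; L3], [:: (0,-1)])], [::]), None));
    ((L6, L1), ([:: (0,1)], ([:: ([:: L5; L1], [:: (0,-1)])], [::]), None));
    ((L2, L5), ([:: (0,1)], ([::], [:: ([:: L1; L5], [:: (0,1)])]), None));
    ((L5, L2), ([:: (0,1)], ([::], [:: ([:: L4; L2], [:: (0,-1)])]), None));
    ((L4, L4), ([:: (0,1)], ([:: ([:: L3; L4], [:: (0,-1)])], [::]), None));
    ((L2, L6), ([:: (0,1)], ([::], [:: ([:: L1; L6], [:: (0,1)])]), None));
    ((L3, L5), ([:: (2,1)], ([:: ([:: L2; L5], [:: (2,1)])], [:: ([:: L1; L6], [:: (0,1)])]), None));
    ((L5, L3), ([:: (0,1)], ([::], [:: ([:: L4; L3], [:: (0,-1)])]), None));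
    ((L6, L2), ([:: (1,1)], ([:: ([:: L5; L2], [:: (1,-1)])], [:: ([:: L4; L3], [:: (0,-1)])]), None));
    ((L3, L6), ([:: (0,1)], ([:: ([:: L2; L6], [:: (0,1)])], [::]), None));
    ((L4, L5), ([:: (0,1)], ([:: ([:: L2; L6], [:: (0,-1)]);
     ([:: L3; L5], [:: (0,-1)])], [::]), None));
    ((L5, L4), ([:: (0,1)], ([:: ([:: L5; L3], [:: (1,-1)]);
     ([:: L6; L2], [:: (0,-1)])], [::]), None));
    ((L6, L3), ([:: (1,1)], ([:: ([:: L6; L2], [:: (0,1)])], [::]), None));
    ((L4, L6), ([:: (0,1)], ([:: ([:: L3; L6], [:: (0,-1)])], [::]), None));
    ((L6, L4), ([:: (0,1)], ([:: ([:: L5; L4], [:: (0,-1)])], [::]), None));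
    ((L5, L5), ([:: (0,1)], ([::], [:: ([:: L4; L5], [:: (0,-1)])]), None));
    ((L5, L6), ([:: (0,1)], ([::], [:: ([:: L4; L6], [:: (0,-1)])]), None));
    ((L6, L5), ([:: (1,1)], ([:: ([:: L5; L5], [:: (1,-1)])], [:: ([:: L4; L6], [:: (0,1)])]), None));
    ((L6, L6), ([:: (0,1)], ([:: ([:: L5; L6], [:: (0,-1)])], [::]), None))]%Zc.

(* the normalised braiding of v_a (x) v_b *)
Definition R0 (a b : letter) : fv :=
  match a, b with
  | L0, L0 => [:: ([:: L0; L0], [:: (2,1)])]
  | L0, L1 => [:: ([:: L1; L0], [:: (1,1)])]
  | L0, L2 => [:: ([:: L2; L0], [:: (1,1)])]
  | L0, L3 => [:: ([:: L3; L0], [:: (0,1)])]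
  | L0, L4 => [:: ([:: L4; L0], [:: (-1,1)])]
  | L0, L5 => [:: ([:: L5; L0], [:: (-1,1)])]
  | L0, L6 => [:: ([:: L6; L0], [:: (-2,1)])]
  | L1, L0 => [:: ([:: L0; L1], [:: (1,1)]);
     ([:: L1; L0], [:: (0,-1); (2,1)])]
  | L1, L1 => [:: ([:: L1; L1], [:: (2,1)])]
  | L1, L2 => [:: ([:: L2; L1], [:: (-1,1)]);
     ([:: L3; L0], [:: (-1,-1); (1,1)])]
  | L1, L3 => [:: ([:: L3; L1], [:: (0,1)]);
     ([:: L4; L0], [:: (-2,1); (0,-1)])]
  | L1, L4 => [:: ([:: L4; L1], [:: (1,1)])]
  | L1, L5 => [:: ([:: L5; L1], [:: (-2,1)]);
     ([:: L6; L0], [:: (-3,1); (-1,-1)])]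
  | L1, L6 => [:: ([:: L6; L1], [:: (-1,1)])]
  | L2, L0 => [:: ([:: L0; L2], [:: (1,1)]);
     ([:: L2; L0], [:: (0,-1); (2,1)])]
  | L2, L1 => [:: ([:: L1; L2], [:: (-1,1)]);
     ([:: L2; L1], [:: (-4,-1); (2,1)]);
     ([:: L3; L0], [:: (-4,1); (-2,-1)])]
  | L2, L2 => [:: ([:: L2; L2], [:: (2,1)])]
  | L2, L3 => [:: ([:: L3; L2], [:: (0,1)]);
     ([:: L5; L0], [:: (-2,-1); (0,1)])]
  | L2, L4 => [:: ([:: L4; L2], [:: (-2,1)]);
     ([:: L5; L1], [:: (-5,1); (1,-1)]);
     ([:: L6; L0], [:: (-6,1); (-4,-1)])]
  | L2, L5 => [:: ([:: L5; L2], [:: (1,1)])]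
  | L2, L6 => [:: ([:: L6; L2], [:: (-1,1)])]
  | L3, L0 => [:: ([:: L0; L3], [:: (0,1)]);
     ([:: L1; L2], [:: (-3,-1); (1,1)]);
     ([:: L2; L1], [:: (-6,1); (-2,-1)]);
     ([:: L3; L0], [:: (-6,-1); (-4,1); (0,-1); (2,1)])]
  | L3, L1 => [:: ([:: L1; L3], [:: (0,1)]);
     ([:: L3; L1], [:: (-2,-1); (2,1)]);
     ([:: L4; L0], [:: (-4,-1); (-2,1)])]
  | L3, L2 => [:: ([:: L2; L3], [:: (0,1)]);
     ([:: L3; L2], [:: (-2,-1); (2,1)]);
     ([:: L5; L0], [:: (-4,1); (-2,-1)])]
  | L3, L3 => [:: ([:: L3; L3], [:: (0,1)]);
     ([:: L4; L2], [:: (-4,1); (0,-1)]);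
     ([:: L5; L1], [:: (-7,1); (-3,-1)]);
     ([:: L6; L0], [:: (-8,1); (-6,-1); (-2,1); (0,-1)])]
  | L3, L4 => [:: ([:: L4; L3], [:: (0,1)]);
     ([:: L6; L1], [:: (-3,-1); (1,1)])]
  | L3, L5 => [:: ([:: L5; L3], [:: (0,1)]);
     ([:: L6; L2], [:: (-3,1); (1,-1)])]
  | L3, L6 => [:: ([:: L6; L3], [:: (0,1)])]
  | L4, L0 => [:: ([:: L0; L4], [:: (-1,1)]);
     ([:: L1; L3], [:: (-2,1); (2,-1)]);
     ([:: L3; L1], [:: (-4,-1); (0,1)]);
     ([:: L4; L0], [:: (-6,-1); (-2,1); (0,-1); (2,1)])]
  | L4, L1 => [:: ([:: L1; L4], [:: (1,1)]);
     ([:: L4; L1], [:: (0,-1); (2,1)])]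
  | L4, L2 => [:: ([:: L2; L4], [:: (-2,1)]);
     ([:: L3; L3], [:: (-2,1); (2,-1)]);
     ([:: L4; L2], [:: (-4,1); (-2,-1); (0,-1); (2,1)]);
     ([:: L5; L1], [:: (-7,1); (-5,-1)]);
     ([:: L6; L0], [:: (-8,1); (-6,-1); (-4,1); (0,-1)])]
  | L4, L3 => [:: ([:: L3; L4], [:: (0,1)]);
     ([:: L4; L3], [:: (-2,-1); (2,1)]);
     ([:: L6; L1], [:: (-5,1); (-1,-1)])]
  | L4, L4 => [:: ([:: L4; L4], [:: (2,1)])]
  | L4, L5 => [:: ([:: L5; L4], [:: (-1,1)]);
     ([:: L6; L3], [:: (-2,-1); (2,1)])]
  | L4, L6 => [:: ([:: L6; L4], [:: (1,1)])]
  | L5, L0 => [:: ([:: L0; L5], [:: (-1,1)]);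
     ([:: L2; L3], [:: (-2,-1); (2,1)]);
     ([:: L3; L2], [:: (-4,1); (0,-1)]);
     ([:: L5; L0], [:: (-6,-1); (-2,1); (0,-1); (2,1)])]
  | L5, L1 => [:: ([:: L1; L5], [:: (-2,1)]);
     ([:: L2; L4], [:: (-5,1); (1,-1)]);
     ([:: L3; L3], [:: (-5,1); (-1,-1)]);
     ([:: L4; L2], [:: (-7,1); (-5,-1)]);
     ([:: L5; L1], [:: (-10,1); (-8,-1); (0,-1); (2,1)]);
     ([:: L6; L0], [:: (-11,1); (-9,-1); (-7,1); (-3,-1)])]
  | L5, L2 => [:: ([:: L2; L5], [:: (1,1)]);
     ([:: L5; L2], [:: (0,-1); (2,1)])]
  | L5, L3 => [:: ([:: L3; L5], [:: (0,1)]);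
     ([:: L5; L3], [:: (-2,-1); (2,1)]);
     ([:: L6; L2], [:: (-5,-1); (-1,1)])]
  | L5, L4 => [:: ([:: L4; L5], [:: (-1,1)]);
     ([:: L5; L4], [:: (-4,-1); (2,1)]);
     ([:: L6; L3], [:: (-5,1); (-1,-1)])]
  | L5, L5 => [:: ([:: L5; L5], [:: (2,1)])]
  | L5, L6 => [:: ([:: L6; L5], [:: (1,1)])]
  | L6, L0 => [:: ([:: L0; L6], [:: (-2,1)]);
     ([:: L1; L5], [:: (-3,1); (-1,-1)]);
     ([:: L2; L4], [:: (-6,1); (-4,-1)]);
     ([:: L3; L3], [:: (-6,1); (-4,-1); (0,1); (2,-1)]);
     ([:: L4; L2], [:: (-8,1); (-6,-1); (-4,1); (0,-1)]);
     ([:: L5; L1], [:: (-11,1); (-9,-1); (-7,1); (-3,-1)]);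
     ([:: L6; L0], [:: (-12,1); (-10,-1); (-8,1); (-6,-1); (-4,-1); (-2,1); (0,-1); (2,1)])]
  | L6, L1 => [:: ([:: L1; L6], [:: (-1,1)]);
     ([:: L3; L4], [:: (-1,-1); (1,1)]);
     ([:: L4; L3], [:: (-3,1); (-1,-1)]);
     ([:: L6; L1], [:: (-6,-1); (-2,1); (0,-1); (2,1)])]
  | L6, L2 => [:: ([:: L2; L6], [:: (-1,1)]);
     ([:: L3; L5], [:: (-1,1); (1,-1)]);
     ([:: L5; L3], [:: (-3,-1); (-1,1)]);
     ([:: L6; L2], [:: (-6,-1); (-2,1); (0,-1); (2,1)])]
  | L6, L3 => [:: ([:: L3; L6], [:: (0,1)]);
     ([:: L4; L5], [:: (-2,-1); (0,1)]);
     ([:: L5; L4], [:: (-5,1); (-3,-1)]);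
     ([:: L6; L3], [:: (-6,-1); (-4,1); (0,-1); (2,1)])]
  | L6, L4 => [:: ([:: L4; L6], [:: (1,1)]);
     ([:: L6; L4], [:: (0,-1); (2,1)])]
  | L6, L5 => [:: ([:: L5; L6], [:: (1,1)]);
     ([:: L6; L5], [:: (0,-1); (2,1)])]
  | L6, L6 => [:: ([:: L6; L6], [:: (2,1)])]
  end%Zc.

(* the relations of S_q(V) in the form v_a v_b = rule2 a b, for a > b *)
Definition rule2 (a b : letter) : fv :=
  match a, b with
  | L1, L0 => [:: ([:: L0; L1], [:: (1,1)])]
  | L2, L0 => [:: ([:: L0; L2], [:: (1,1)])]
  | L2, L1 => [:: ([:: L0; L3], [:: (2,1); (4,-1)]);
     ([:: L1; L2], [:: (3,1)])]
  | L3, L0 => [:: ([:: L0; L3], [:: (2,1)])]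
  | L3, L1 => [:: ([:: L0; L4], [:: (1,-1); (3,1)]);
     ([:: L1; L3], [:: (2,1)])]
  | L3, L2 => [:: ([:: L0; L5], [:: (1,1); (3,-1)]);
     ([:: L2; L3], [:: (2,1)])]
  | L4, L0 => [:: ([:: L0; L4], [:: (3,1)])]
  | L4, L1 => [:: ([:: L1; L4], [:: (1,1)])]
  | L4, L2 => [:: ([:: L0; L6], [:: (0,1); (2,-1)]);
     ([:: L1; L5], [:: (1,-1); (3,1)]);
     ([:: L2; L4], [:: (0,1)]);
     ([:: L3; L3], [:: (0,1); (2,-1)])]
  | L4, L3 => [:: ([:: L1; L6], [:: (0,1); (4,-1)]);
     ([:: L3; L4], [:: (2,1)])]
  | L5, L0 => [:: ([:: L0; L5], [:: (3,1)])]
  | L5, L1 => [:: ([:: L0; L6], [:: (-3,1); (-1,-1)]);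
     ([:: L1; L5], [:: (0,1)]);
     ([:: L2; L4], [:: (-3,1); (1,-1)]);
     ([:: L3; L3], [:: (-3,1); (-1,-1)])]
  | L5, L2 => [:: ([:: L2; L5], [:: (1,1)])]
  | L5, L3 => [:: ([:: L2; L6], [:: (0,-1); (4,1)]);
     ([:: L3; L5], [:: (2,1)])]
  | L5, L4 => [:: ([:: L3; L6], [:: (1,1); (5,-1)]);
     ([:: L4; L5], [:: (3,1)])]
  | L6, L0 => [:: ([:: L0; L6], [:: (-4,1); (-2,-1); (2,1)]);
     ([:: L1; L5], [:: (-1,1); (3,-1)]);
     ([:: L2; L4], [:: (-4,1); (0,-1)]);
     ([:: L3; L3], [:: (-4,1); (-2,-1)])]
  | L6, L1 => [:: ([:: L1; L6], [:: (3,1)])]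
  | L6, L2 => [:: ([:: L2; L6], [:: (3,1)])]
  | L6, L3 => [:: ([:: L3; L6], [:: (2,1)])]
  | L6, L4 => [:: ([:: L4; L6], [:: (1,1)])]
  | L6, L5 => [:: ([:: L5; L6], [:: (1,1)])]
  | _, _ => [::]
  end%Zc.

(* v_0 v_0 = rule33 in degree at least 3 *)
Definition rule33 : fv := [:: ([:: L0; L6], [:: (0,-1); (6,-1)]);
     ([:: L1; L5], [:: (3,-1); (5,-1)]);
     ([:: L2; L4], [:: (0,-1); (2,-1)])]%Zc.

Definition hwts := [:: Hs; Ha; Hv; Ht].
Lemma all_hwts (P : pred hwt) : all P hwts -> forall h, P h.
Proof. by move=> /= /and5P[? ? ? ? _] []. Qed.

Definition hweqb (h k : hwt) : bool :=
  match h, k with Hs, Hs | Ha, Ha | Hv, Hv | Ht, Ht => true | _, _ => false end.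
Lemma hweqbP h k : hweqb h k -> h = k. Proof. by case: h k => [] []. Qed.

Definition hwz (i : simple_root) (h : hwt) : Z :=
  match i, h with
  | alpha1, Hs => 2 | alpha1, Hv => 1 | alpha2, Ha => 3 | _, _ => 0 end%Zc.
Definition hw_weight (h : hwt) : weight :=
  match h with Hs => (4, 2) | Ha => (3, 2) | Hv => (2, 1) | Ht => (0, 0) end.

Definition tab2 (f : letter -> letter -> fv) (w : word) : fv :=
  if w is [:: a; b] then f a b else [::].
Definition fnl2 (f : letter -> letter -> lp) (w : word) : lp :=
  if w is [:: a; b] then f a b else [::].
Definition fv_fnl (f : word -> lp) (v : fv) : lp :=
  foldr (fun x acc => lp_add (lp_mul x.2 (f x.1)) acc) [::] v.
Definition isnil (T : Type) (s : seq T) := if s is [::] then true else false.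

Definition all2l (P : letter -> letter -> bool) := all (fun a => all (P a) letters) letters.
Lemma all2lP P : all2l P -> forall a b, P a b.
Proof. by move=> /all_letters h a b; move: b; apply/all_letters; apply: h. Qed.

Definition heightZ (a : letter) : Z :=
  match a with L0 => 3 | L1 => 2 | L2 => 1 | L3 => 0 | L4 => -1 | L5 => -2 | L6 => -3 end%Zc.
(** The shift by 6 makes the heights of V (x) V run from 0 to 12. Since E_1 and E_2 raise the
    height, they act nilpotently. *)
Definition height2 (w : word) : nat :=
  if w is [:: a; b] then Z.to_nat (heightZ a + heightZ b + 6)%Zc else 0.

Definition sing_checks : bool :=
  all (fun h =>
    [&& all (fun i => isnil (fv_bind (act2w (gE i)) (sing h))
          && fv_eqb (fv_bind (act2w (gK i)) (sing h)) (fv_scale (lp_X (hwz i h)) (sing h))) sroots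
      , all (fun i => all2l (fun a b => isnil (fv_fnl (fnl2 (cosing h)) (act2w (gF i) [:: a; b])))) sroots
      & all (fun k => let l := fv_fnl (fnl2 (cosing h)) (sing k) in
          if hweqb h k then ~~ Z.eqb (lp_at2 Z0 l) Z0 && all (fun x => Z.leb Z0 (Z.add Z0 x.1)) l
          else isnil l) hwts]) hwts.

Lemma sing_checksP : sing_checks. Proof. by vm_compute. Qed.

Definition sing_image (a b : letter) : fv := if singC a b is Some h then fv_scale singD (sing h) else [::].

Definition class_check : bool :=
  all2l (fun a b => fv_eqb (fv_scale singD (fv_word [:: a; b]))
    (fv_add (fv_bind (tab2 singA1) (act2w (gE alpha1) [:: a; b]))
     (fv_add (fv_bind (tab2 singA2) (act2w (gE alpha2) [:: a; b])) (sing_image a b)))).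
Lemma class_checkP : class_check. Proof. by vm_compute. Qed.

Definition height_check : bool :=
  all (fun i => all2l (fun a b =>
    all (fun x => (height2 [:: a; b] < height2 x.1 < 13)%N) (act2w (gE i) [:: a; b]))) sroots.
Lemma height_checkP : height_check. Proof. by vm_compute. Qed.

Fixpoint gen_check (known : seq (letter * letter)) (t : seq ((letter * letter) * (lp * (fv * fv) * option (hwt * lp)))) : bool :=
  if t is (p, (D, (x1, x2), c)) :: t' then
    [&& all (fun x => has (fun k => weqb [:: k.1; k.2] x.1) known) (x1 ++ x2),
      ~~ Z.eqb (lp_at2 Z0 D) Z0 && all (fun x => Z.leb Z0 (Z.add Z0 x.1)) D,
      fv_eqb (fv_scale D (fv_word [:: p.1; p.2]))
        (fv_add (fv_bind (act2w (gF alpha1)) x1) (fv_add (fv_bind (act2w (gF alpha2)) x2)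
          (if c is Some (h, l) then fv_scale l (sing h) else [::])))
      & gen_check (p :: known) t']
  else all2l (fun a b => has (fun k => weqb [:: k.1; k.2] [:: a; b]) known).
Lemma gen_checkP : gen_check [::] gen_tab. Proof. by vm_compute. Qed.

Definition rmu (h : hwt) : lp :=
  match h with Hs => lp_X 2 | Ha => lp_C (-1) | Hv => lp_opp (lp_X (-6)) | Ht => lp_X (-12) end%Zc.

Definition R0_check : bool :=
  all (fun h => fv_eqb (fv_bind (tab2 R0) (sing h)) (fv_scale (rmu h) (sing h))) hwts
  && all (fun i => all2l (fun a b =>
       fv_eqb (fv_bind (tab2 R0) (act2w (gF i) [:: a; b])) (fv_bind (act2w (gF i)) (R0 a b)))) sroots.
Lemma R0_checkP : R0_check. Proof. by vm_compute. Qed.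

Definition rel2 (a b : letter) : fv := fv_sub (fv_word [:: a; b]) (rule2 a b).
Definition lltb (b a : letter) : bool := ltn (lidx b) (lidx a).

(** Each relation x is certified by (R0 + 1)(R0 + q^-6) x = 0, as -1 and -q^-6 are the eigenvalues
    on the two components of the quantum exterior square. *)
Definition rel2_check : bool :=
  all2l (fun a b => lltb b a ==>
    (let x := rel2 a b in
     let y := fv_add (fv_bind (tab2 R0) x) (fv_scale (lp_X (-6)%Zc) x) in
     isnil (fv_add (fv_bind (tab2 R0) y) y))).
Lemma rel2_checkP : rel2_check. Proof. by vm_compute. Qed.

(** Reduction of words of length 2 by the quadratic rules. The check shows that the kernel contains
    the highest weight vectors of the quantum exterior square, and that F_1 and F_2 send the
    relations into it. *)
Definition nf2 (w : word) : fv := if w is [:: a; b] then if lltb b a then rule2 a b else [:: (w, lp_C 1%Zc)] else [::].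
Definition nf2_check : bool :=
  [&& isnil (fv_bind nf2 (sing Ha)), isnil (fv_bind nf2 (sing Hv)) &
   all2l (fun a b => lltb b a ==> all (fun i => isnil (fv_bind nf2 (fv_bind (act2w (gF i)) (rel2 a b)))) sroots)].
Lemma nf2_checkP : nf2_check. Proof. by vm_compute. Qed.

Definition lp_sum (l : lp) : Z := foldr (fun x acc => Z.add x.2 acc) Z0 l.
(* R0 is the flip modulo q - 1 *)
Definition flip_check : bool :=
  all2l (fun a b => all (fun x => Z.eqb (lp_sum x.2) Z0) (fv_sub (R0 a b) (fv_word [:: b; a]))).
Lemma flip_checkP : flip_check. Proof. by vm_compute. Qed.

(** * Submodules generated by a highest weight vector *)

Section Gen.
Variable C : fieldType.
Local Notation K := (Kq C).
Local Notation q := (qK C).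
Variable W : opModule C.
Hypothesis HW : Uq_rel W.
Implicit Types s x y : W.

Let Wl g : lin (@act _ W g) := act_lin HW g.

Inductive lowered (s : W) : W -> Prop :=
| lowered_top : lowered s s
| lowered_F i x : lowered s x -> lowered s (act (gF i) x).

Definition gen (s : W) : W -> Prop := lspan (lowered s).

Variables (s : W) (mu : weight).
Hypotheses (Es : forall i, act (gE i) s = 0) (sw : weight_vector mu s).

Lemma gen_stable g : (forall x, lowered s x -> gen s (act g x)) -> forall x, gen s x -> gen s (act g x).
Proof. exact: (lspan_image (Wl g)). Qed.

Lemma gen_F i x : gen s x -> gen s (act (gF i) x).
Proof. by apply: gen_stable => y hy; apply: lspan_in; constructor. Qed.

Lemma gen_K i x : gen s x -> gen s (act (gK i) x).
Proof.
apply: gen_stable => y; elim=> [|j z _ IH].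
  by rewrite sw; apply: lspan_scale; apply: lspan_in; constructor.
by rewrite (act_KF HW); apply: lspan_scale; apply: gen_F.
Qed.

Lemma gen_KV i x : gen s x -> gen s (act (gKV i) x).
Proof.
apply: gen_stable => y; elim=> [|j z _ IH].
  have e : act (gKV i) s = q ^ (- wform i mu) *: s.
    apply: (can_inj (scalerK (expfz_neq0 (wform i mu) (qK_neq0 C)))).
    rewrite scalerA -(expfzDr _ _ (qK_neq0 C)) addrN scale1r -(linZ (Wl _)) -(sw i).
    exact: (act_VK HW).
  by rewrite e; apply: lspan_scale; apply: lspan_in; constructor.
by rewrite (act_KVF HW); apply: lspan_scale; apply: gen_F.
Qed.

(** E_i is moved to the right past the lowering operators until it meets s, which it kills; each
    commutator with F_i only leaves K_i and K_i^-1. *)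
Lemma gen_E i x : gen s x -> gen s (act (gE i) x).
Proof.
apply: gen_stable => y; elim=> [|j z hz IH]; first by rewrite Es; constructor.
have hz' : gen s z by apply: lspan_in.
have [ij|ij] : (i = j) \/ (i <> j) by case: (i) (j) => [] []; [left|right|right|left].
  rewrite -ij -[act (gE i) _](subrK (act (gF i) (act (gE i) z))) (act_EF HW).
  apply: lspan_add; last exact: gen_F.
  by apply: lspan_scale; apply: lspan_add; [apply: gen_K|apply/lspan_opp/gen_KV].
by rewrite (act_EFneq HW _ ij); apply: gen_F.
Qed.

Lemma gen_submodule : submodule (gen s).
Proof.
split=> [|a x y|]; first by constructor.
  exact: lspan_comb.
case=> i x; [exact: gen_E|exact: gen_F|exact: gen_K|exact: gen_KV].
Qed.

Lemma gen_min (N : W -> Prop) : submodule N -> N s -> forall x, gen s x -> N x.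
Proof.
move=> [N0 ND Na] Ns; apply: lspan_sub => // x; elim=> // i y _; exact: Na.
Qed.

(** Serves to separate the components of V (x) V by functionals that vanish on the images of F_1 and
    F_2. *)
Lemma gen_kill (M : lmodType K) (f : W -> M) : lin f -> (forall i x, f (act (gF i) x) = 0) ->
  f s = 0 -> forall x, gen s x -> f x = 0.
Proof.
move=> fl fF fs x; elim=> [|a y z hy _ IH]; first exact: (lin0 fl).
rewrite fl IH addr0; case: hy => [|i t _]; first by rewrite fs scaler0.
by rewrite fF scaler0.
Qed.

End Gen.

Section VVext.
Variable C : fieldType.
Local Notation K := (Kq C).
Local Notation V := (Vmod C).
Local Notation VV := (otens V V).
Local Notation uK := (@uK C).
Local Notation ev := (@ev C).
Local Notation e2 := (@e2 C).

Definition VVext (M : lmodType K) (f : letter -> letter -> M) : VV -> M :=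
  tlift idfun (fun u v : V => \sum_(a <- letters) \sum_(b <- letters)
    (u (lord a) 0 * v (lord b) 0) *: f a b).

Section Ext.
Variables (M : lmodType K) (f : letter -> letter -> M).

Let fl (v : V) : lin (fun u : V => \sum_(a <- letters) \sum_(b <- letters)
    (u (lord a) 0 * v (lord b) 0) *: f a b).
Proof.
move=> c x y; rewrite scaler_sumr -big_split; apply: eq_bigr => a _.
rewrite scaler_sumr -big_split; apply: eq_bigr => b _ /=.
by rewrite !mxE mulrDl scalerDl scalerA mulrA.
Qed.

Let fr (u : V) : lin (fun v : V => \sum_(a <- letters) \sum_(b <- letters)
    (u (lord a) 0 * v (lord b) 0) *: f a b).
Proof.
move=> c x y; rewrite scaler_sumr -big_split; apply: eq_bigr => a _.
rewrite scaler_sumr -big_split; apply: eq_bigr => b _ /=.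
by rewrite !mxE mulrDr scalerDl scalerA mulrCA.
Qed.

Lemma VVext_lin : lin (VVext f).
Proof. exact: tlift_lin. Qed.

Lemma big_letter_pick (N : nmodType) (F : letter -> N) a :
  (forall b, b != a -> F b = 0) -> \sum_(b <- letters) F b = F a.
Proof.
move=> h; rewrite (bigD1_seq a) /=; [|by case: a {h}|by []].
by rewrite big1 ?addr0.
Qed.

Lemma VVextE a b : VVext f (ev a (x) ev b) = f a b.
Proof.
rewrite /VVext tliftE // (@big_letter_pick _ _ a) => [|c ca].
  rewrite (@big_letter_pick _ _ b) => [|c cb]; rewrite !mxE !eqxx /= ?mul1r ?scale1r //.
  by rewrite (inj_eq (can_inj lordK)) (negPf cb) scale0r.
rewrite big1 // => d _; rewrite !mxE (inj_eq (can_inj lordK)) (negPf ca).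
by rewrite mul0r scale0r.
Qed.

End Ext.

Lemma VVext_tab t w : VVext (fun a b => fvev uK e2 (t a b)) (e2 w) = fvev uK e2 (tab2 t w).
Proof.
case: w => [|a [|b [|c w]]]; rewrite ?fvev_nil; try exact: (lin0 (VVext_lin _)).
exact: VVextE.
Qed.

Lemma fvev_lin (M : lmodType K) (W : lmodType K) (e : word -> W) (f : W -> M) v : lin f ->
  f (fvev uK e v) = fvev uK (f \o e) v.
Proof. by move=> fl; apply: (fvev_semilin (phi := (idfun : {rmorphism K -> K}))) => //. Qed.

Lemma VVext_fvev t v : VVext (fun a b => fvev uK e2 (t a b)) (fvev uK e2 v) =
  fvev uK e2 (fv_bind (tab2 t) v).
Proof.
rewrite fvev_lin; last exact: VVext_lin.
by rewrite (fvev_bind (@uKD C)); apply: eq_fvev' => w; rewrite /= VVext_tab.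
Qed.

Lemma act2_fvev g v : @act _ VV g (fvev uK e2 v) = fvev uK e2 (fv_bind (act2w g) v).
Proof.
rewrite fvev_lin; last exact: (otens_lin (@Vl C) (@Vl C)).
by rewrite (fvev_bind (@uKD C)); apply: eq_fvev' => w; exact: act2_sound.
Qed.

Lemma fv_fnlP (f : letter -> letter -> lp) v :
  VVext (M := K^o) (fun a b => lpev uK (f a b)) (fvev uK e2 v) = lpev uK (fv_fnl (fnl2 f) v).
Proof.
rewrite fvev_lin; last exact: VVext_lin.
elim: v => [|x v IH]; first by rewrite fvev_nil /= lpev_nil.
rewrite fvev_cons IH /= lpevD (lpevM (@uKD C)); congr (_ + _).
case: x => [[|a [|b [|c w]]] l] /=; rewrite ?(lin0 (VVext_lin _)) ?lpev_nil ?scaler0 ?mulr0 //.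
by rewrite VVextE.
Qed.

End VVext.

Lemma qXz_inj (C : fieldType) (a b : int) : qK C ^ a = qK C ^ b -> a = b.
Proof.
have q0 := qK_neq0 C.
wlog ab : a b / (a <= b)%R => [H|].
  case: (Num.Theory.lerP a b) => ab e; first exact: H.
  by apply/esym/H => //; exact: Order.POrderTheory.ltW.
move=> e; have : qK C ^ (b - a) = 1.
  by rewrite expfzDr // -e -expfzDr // addrN expr0z.
have : 0 <= b - a by rewrite Num.Theory.subr_ge0.
case E: (b - a) => [[|n]|n] // _ /eqP h; first by apply/esym/eqP; rewrite -subr_eq0 E.
by move: (qX_neq1' C n); rewrite exprnP h.
Qed.

(** * The isotypic components of V (x) V *)

Section Decomposition.
Variable C : fieldType.
Hypothesis C0 : [pchar C] =i pred0.
Local Notation K := (Kq C).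
Local Notation q := (qK C).
Local Notation V := (Vmod C).
Local Notation VV := (otens V V).
Local Notation uK := (@uK C).
Local Notation ev := (@ev C).
Local Notation e2 := (@e2 C).

Let HVV : Uq_rel VV. Proof. by case: (VV_module C). Qed.
Let VVl g : lin (@act _ VV g) := act_lin HVV g.

Definition svec (h : hwt) : VV := fvev uK e2 (sing h).
Definition cosv (h : hwt) : VV -> K^o := VVext (M := K^o) (fun a b => lpev uK (cosing h a b)).

Lemma cosv_lin h : lin (cosv h). Proof. exact: VVext_lin. Qed.

Lemma isnilP (v : fv) : isnil v -> fvev uK e2 v = 0.
Proof. by case: v => // _; rewrite fvev_nil. Qed.

Lemma isnil_lp (l : lp) : isnil l -> lpev uK l = 0.
Proof. by case: l => // _; rewrite lpev_nil. Qed.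

Lemma svec_E h i : act (gE i) (svec h) = 0.
Proof.
have /and3P[/all_roots k _ _] := all_hwts sing_checksP h.
by have /andP[k' _] := k i; rewrite /svec act2_fvev isnilP.
Qed.

Lemma svec_weight h : weight_vector (hw_weight h) (svec h).
Proof.
have /and3P[/all_roots k _ _] := all_hwts sing_checksP h.
move=> i; have /andP[_ /fv_eqbP k'] := k i.
have -> : q ^ wform i (hw_weight h) = lpev uK (lp_X (hwz i h)).
  by rewrite lpevX; congr (q ^ _); case: i h {k k'} => [] [].
apply: (etrans (act2_fvev _ _ _)); apply: (etrans (k' _ _ _ _)).
exact: (fvevZ (@uKD C)).
Qed.

Lemma cosv_F h i x : cosv h (act (gF i) x) = 0.
Proof.
have /and3P[_ /all_roots k _] := all_hwts sing_checksP h.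
have fl : lin (fun x => cosv h (act (gF i) x)) := lin_comp (VVl _) (cosv_lin h).
move: x; apply: (lin_VV fl (@lin_cst0 _ _ _)) => a b.
have := act2_sound C (gF i) [:: a; b]; rewrite [e2 _]/(ev a (x) ev b) => ->.
by rewrite /cosv fv_fnlP isnil_lp //; apply: (all2lP (k i)).
Qed.

Lemma cosv_svec h k : (cosv h (svec k) == 0) = ~~ hweqb h k.
Proof.
have /and3P[_ _ /all_hwts /(_ k)] := all_hwts sing_checksP h.
rewrite /cosv /svec fv_fnlP; case: hweqb => /=.
  by move=> /andP[l2 lN]; apply/negbTE; exact: (lpK_neq0 (N := Z0) C0 lN l2).
by move=> /isnil_lp ->; rewrite eqxx.
Qed.

Lemma singD_neq0 : lpev uK singD != 0.
Proof. by apply: (lpK_neq0 (N := Z0) C0); vm_compute. Qed.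

Lemma singular_span (t : VV) : (forall i, act (gE i) t = 0) ->
  exists c : hwt -> K, t = \sum_(h <- hwts) c h *: svec h.
Proof.
move=> Et.
pose A1 := VVext (fun a b => fvev uK e2 (singA1 a b)).
pose A2 := VVext (fun a b => fvev uK e2 (singA2 a b)).
pose S := VVext (fun a b => fvev uK e2 (sing_image a b)).
have A1l : lin A1 := VVext_lin _; have A2l : lin A2 := VVext_lin _; have Sl : lin S := VVext_lin _.
have A1E v : A1 (fvev uK e2 v) = fvev uK e2 (fv_bind (tab2 singA1) v) := VVext_fvev C singA1 v.
have A2E v : A2 (fvev uK e2 v) = fvev uK e2 (fv_bind (tab2 singA2) v) := VVext_fvev C singA2 v.
have SE a b : S (ev a (x) ev b) = fvev uK e2 (sing_image a b) := VVextE _ _ _.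
clearbody A1 A2 S.
have fl := lin_add (lin_comp (VVl (gE alpha1)) A1l) (lin_add (lin_comp (VVl (gE alpha2)) A2l) Sl).
(* The identity behind the tables: for a vector killed by E_1 and E_2 only the term S t', a
   combination of the four highest weight vectors, is left. *)
have key t' : lpev uK singD *: t' = A1 (act (gE alpha1) t') + (A2 (act (gE alpha2) t') + S t').
  move: t'; apply: (lin_VV (lin_scale _ (@lin_id K VV)) fl) => a b.
  have /fv_eqbP k := all2lP class_checkP a b.
  have {k} := k _ uK _ e2; rewrite (fvevZ (@uKD C)) (fvev_word (uK0 C)) !fvevD => ->.
  have sd i : act (gE i) (ev a (x) ev b : VV) = fvev uK e2 (act2w (gE i) [:: a; b]) := act2_sound C (gE i) [:: a; b].
  by rewrite !sd A1E A2E SE.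
have Ss t' : exists c : hwt -> K, S t' = \sum_(h <- hwts) c h *: svec h.
  have S0 : exists c : hwt -> K, 0 = \sum_(h <- hwts) c h *: svec h.
    by exists (fun=> 0); rewrite big1 // => h _; rewrite scale0r.
  have SD (b : K) (x y : VV) : (exists c : hwt -> K, x = \sum_(h <- hwts) c h *: svec h) ->
      (exists c : hwt -> K, y = \sum_(h <- hwts) c h *: svec h) ->
      exists c : hwt -> K, b *: x + y = \sum_(h <- hwts) c h *: svec h.
    move=> [c ->] [d ->]; exists (fun h => b * c h + d h).
    rewrite scaler_sumr -big_split; apply: eq_bigr => h _.
    by rewrite scalerA scalerDl.
  elim/tens_ind: t' => [|u v t' IH]; first by rewrite (lin0 Sl).
  rewrite (linD Sl) -[S (u (x) v)]scale1r; apply: (SD _ _ _ _ IH).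
  move: u; apply: V_ind => [b x y hx hy||a].
  - by rewrite tpurel Sl; apply: SD.
  - by rewrite (lin0 (tpurel _)) (lin0 Sl).
  move: v; apply: V_ind => [c x y hx hy||b].
  - by rewrite tpurer Sl; apply: SD.
  - by rewrite (lin0 (tpurer _)) (lin0 Sl).
  rewrite SE /sing_image; case: singC => [h|]; last by rewrite fvev_nil.
  exists (fun k => if hweqb k h then lpev uK singD else 0).
  rewrite (fvevZ (@uKD C)); case: h; rewrite !big_cons big_nil /= !scale0r ?addr0 ?add0r; reflexivity.
have := key t; rewrite !Et (lin0 A1l) (lin0 A2l) !add0r => h.
have [c hc] := Ss t; exists (fun h => (lpev uK singD)^-1 * c h).
apply: (can_inj (scalerK singD_neq0)); rewrite h hc scaler_sumr.
by apply: eq_bigr => k _; rewrite scalerA mulVKf // singD_neq0.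
Qed.

Lemma hweqb_refl h : hweqb h h. Proof. by case: h. Qed.

Lemma big_hwt_pick (N : nmodType) (F : hwt -> N) h :
  (forall k, ~~ hweqb h k -> F k = 0) -> \sum_(k <- hwts) F k = F h.
Proof.
rewrite !big_cons big_nil addr0; case: h => h.
- by rewrite [F Ha]h // [F Hv]h // [F Ht]h // !addr0.
- by rewrite [F Hs]h // [F Hv]h // [F Ht]h // add0r !addr0.
- by rewrite [F Hs]h // [F Ha]h // [F Ht]h // !add0r addr0.
- by rewrite [F Hs]h // [F Ha]h // [F Hv]h // !add0r.
Qed.

Lemma cosv_comb h (c : hwt -> K) : cosv h (\sum_(k <- hwts) c k *: svec k) = c h *: cosv h (svec h).
Proof.
rewrite (lin_sum _ _ _ (cosv_lin h)) (@big_hwt_pick _ _ h) => [|k hk]; first by rewrite (linZ (cosv_lin h)).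
by rewrite (linZ (cosv_lin h)); move: (cosv_svec h k); rewrite hk => /eqP ->; rewrite scaler0.
Qed.

Lemma cosv_gen h k x : ~~ hweqb h k -> gen (svec k) x -> cosv h x = 0.
Proof.
move=> hk; apply: (gen_kill (cosv_lin h) (cosv_F h)).
by apply/eqP; rewrite cosv_svec.
Qed.

Lemma svec_neq0 h : svec h <> 0.
Proof.
by move=> s0; have := cosv_svec h h; rewrite hweqb_refl s0 (lin0 (cosv_lin h)) eqxx.
Qed.

(** For h different from k the functional [cosv h] vanishes on the module generated by [svec k],
    which kills the h-th coefficient of t. *)
Lemma singular_gen k (t : VV) : (forall i, act (gE i) t = 0) -> gen (svec k) t ->
  exists c : K, t = c *: svec k.
Proof.
move=> /singular_span[c ->] g; exists (c k); apply: (@big_hwt_pick _ (fun h => c h *: svec h)) => h kh.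
have hk : ~~ hweqb h k by case: h k kh {g} => [] [].
have := cosv_gen hk g; rewrite cosv_comb => /eqP; rewrite scaler_eq0 cosv_svec hweqb_refl orbF.
by move=> /eqP ->; rewrite scale0r.
Qed.

Definition above (n : nat) (t : VV) : Prop :=
  lspan (fun x => exists a b, (n <= height2 [:: a; b])%N /\ x = ev a (x) ev b) t.

Lemma above_E n t i : above n t -> above n.+1 (act (gE i) t).
Proof.
apply: (lspan_image (VVl _)) => x [a [b [nab ->]]].
have := act2_sound C (gE i) [:: a; b]; rewrite [e2 _]/(ev a (x) ev b) => ->.
have := all2lP (all_roots height_checkP i) a b.
elim: act2w => [|y v IH]; first by rewrite fvev_nil; constructor.
rewrite fvev_cons => /andP[/andP[h1 h2] /IH {}IH]; apply: lspan_comb => //.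
case: y h1 {h2} => [[|c [|d [|e w]]] l] //= h1; apply: lspan_in.
by exists c, d; split=> //; apply: leq_ltn_trans h1.
Qed.

Lemma VV_ind (P : VV -> Prop) : P 0 -> (forall (c : K) x y, P x -> P y -> P (c *: x + y)) ->
  (forall a b, P (ev a (x) ev b)) -> forall t, P t.
Proof.
move=> P0 PD Pe; apply: tens_ind => // u v t IH.
rewrite -[u (x) v]scale1r; apply: (PD _ _ _ _ IH).
move: u; apply: V_ind => [b x y hx hy||a].
- by rewrite tpurel; apply: PD.
- by rewrite (lin0 (tpurel _)).
move: v; apply: V_ind => [c x y hx hy||b].
- by rewrite tpurer; apply: PD.
- by rewrite (lin0 (tpurer _)).
exact: Pe.
Qed.

Lemma above0 t : above 0 t.
Proof.
elim/VV_ind: t => [|c x y hx hy|a b]; [exact: lspan0|exact: lspan_comb|].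
by apply: lspan_in; exists a, b.
Qed.

Lemma above13 t : above 13%N t -> t = 0.
Proof.
by elim=> // c x y [a [b [h _]]] _ _; move: h; case: a; case: b.
Qed.

(** E_1 and E_2 raise the height, which is bounded by 12. Applied to a nonzero vector as long as the
    result is nonzero, they end at a vector killed by both. *)
Lemma sub_singular (N : VV -> Prop) x : submodule N -> N x -> x <> 0 ->
  exists y, [/\ N y, y <> 0 & forall i, act (gE i) y = 0].
Proof.
move=> [_ _ Na] Nx x0.
have main n : forall m, (n + m)%N = 13%N -> forall y, above m y -> N y -> y <> 0 ->
    exists z, [/\ N z, z <> 0 & forall i, act (gE i) z = 0].
  elim: n => [|n IH] m nm y my Ny y0.
    by case: y0; apply: above13; rewrite -nm.
  have nm' : (n + m.+1)%N = 13%N by rewrite addnS -nm.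
  have [h1|h1] := pselect (act (gE alpha1) y = 0); last first.
    exact: (IH m.+1 nm' _ (above_E alpha1 my) (Na _ _ Ny) h1).
  have [h2|h2] := pselect (act (gE alpha2) y = 0); last first.
    exact: (IH m.+1 nm' _ (above_E alpha2 my) (Na _ _ Ny) h2).
  exists y; split; [exact: Ny|exact: y0|by case].
exact: (main 13%N 0%N erefl x (above0 x) Nx x0).
Qed.

Lemma gen_sub h : submodule (gen (svec h)).
Proof. exact: (gen_submodule HVV (svec_E h) (svec_weight h)). Qed.

Lemma gen_top h : gen (svec h) (svec h).
Proof. by apply: lspan_in; constructor. Qed.

(** A nonzero submodule contains a nonzero singular vector; by [singular_gen] this is a multiple of
    the generator. *)
Lemma gen_simple h : simple_submodule (gen (svec h)).
Proof.
split; first exact: gen_sub.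
  by exists (svec h); [apply: gen_top|apply: svec_neq0].
move=> N' N's N'g; have [|/existsNP[x /not_implyP[Nx x0]]] := pselect (forall x, N' x -> x = 0); first by left.
right; have [y [Ny y0 Ey]] := sub_singular N's Nx x0.
have [c yc] := singular_gen Ey (N'g _ Ny).
have c0 : c != 0 by apply/eqP => c0; apply: y0; rewrite yc c0 scale0r.
have [N0 ND _] := N's.
apply: gen_min => //; rewrite -[svec h](scalerK c0) -yc -[_ *: _]addr0.
by apply: ND.
Qed.

(** The four highest weights are distinct, so a singular vector of weight [hw_weight h] is a
    multiple of [svec h]. Every simple submodule with that highest weight therefore contains, and by
    simplicity equals, the module generated by [svec h]. *)
Lemma component_gen h x : @component C VV (hw_weight h) x <-> gen (svec h) x.
Proof.
split; last first.
  move=> hx; apply: lspan_in; exists (gen (svec h)); split=> //; first exact: gen_simple.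
  by exists (svec h); split; [apply: gen_top|apply: svec_neq0|apply: svec_E|apply: svec_weight].
have [G0 GD _] := gen_sub h.
apply: lspan_sub => // {}x [N [[Ns _ Nmin] [v [Nv v0 Ev vw]] Nx]].
have [c vc] := singular_span Ev.
have {vc}vc : v = c h *: svec h.
  rewrite vc; apply: (@big_hwt_pick _ (fun k => c k *: svec k)) => k hk.
  have [i ki] : exists i, wform i (hw_weight k) <> wform i (hw_weight h).
    by case: h k hk {vw Nmin G0 GD} => [] [] // _; first [by exists alpha1|by exists alpha2].
  (* The value of [cosv k] at K_i v is computed from the expansion of v and from the weight of v;
     the two weights differ at i, so the coefficient c k must vanish. *)
  have e1 : cosv k (act (gK i) v) = (q ^ wform i (hw_weight k) * c k) *: cosv k (svec k).
    rewrite vc (lin_sum _ _ _ (VVl _)).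
    rewrite (eq_bigr (fun j => (q ^ wform i (hw_weight j) * c j) *: svec j)) => [|j _].
      exact: (cosv_comb k (fun j => q ^ wform i (hw_weight j) * c j)).
    by rewrite (linZ (VVl _)) svec_weight scalerA mulrC.
  have e2 : cosv k (act (gK i) v) = (q ^ wform i (hw_weight h) * c k) *: cosv k (svec k).
    by rewrite vw (linZ (cosv_lin k)) vc cosv_comb scalerA.
  have L0 : cosv k (svec k) != 0 by rewrite cosv_svec hweqb_refl.
  have e3 : q ^ wform i (hw_weight k) * c k = q ^ wform i (hw_weight h) * c k.
    by apply: (mulIf L0); rewrite -[LHS]e1 -[RHS]e2.
  have [->|ck] := eqVneq (c k) 0; first by rewrite scale0r.
  by case: ki; apply: (qXz_inj (C := C)); apply: (mulIf ck).
have c0 : c h != 0 by apply/eqP => c0; apply: v0; rewrite vc c0 scale0r.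
have [_ ND _] := Ns.
have Nh : N (svec h).
  by rewrite -[svec h](scalerK c0) -vc -[_ *: _]addr0; apply: ND => //; case: Ns.
have sub := gen_min Ns Nh.
have [G00|GN] := Nmin _ (gen_sub h) sub; last exact: GN.
by case: (svec_neq0 (G00 _ (gen_top h))).
Qed.

End Decomposition.

Lemma comb0 (F : nzRingType) (M : lmodType F) (c : F) (x y : M) :
  x = 0 -> y = 0 -> c *: x + y = 0.
Proof. by move=> -> ->; rewrite scaler0 addr0. Qed.

Section Eigen.
Variables (F : fieldType) (M : lmodType F) (R : M -> M) (c : F).
Hypothesis Rl : lin R.
Variables (x y z w : M) (rx ry rz rw : F).
Hypotheses (Rx : R x = rx *: x) (Ry : R y = ry *: y) (Rz : R z = rz *: z) (Rw : R w = rw *: w).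

Let k r := (r + c) * (r + 1).
Let P u := R (R u + c *: u) + (R u + c *: u).

Let Pk u r : R u = r *: u -> P u = k r *: u.
Proof.
move=> Ru; rewrite /P Ru -scalerDl (linZ Rl) Ru scalerA -scalerDl.
by rewrite -{2}[r + c]mulr1 -mulrDr.
Qed.

(* (R + 1) (R + c) kills the eigenvectors z and w only *)
Lemma eigen_split : k rx != 0 -> k ry != 0 -> k rz = 0 -> k rw = 0 -> rx - ry != 0 ->
  P (x + y + z + w) = 0 -> x = 0 /\ y = 0.
Proof.
move=> kx ky kz kw rxy.
have Pl : lin P.
  exact: (lin_add (lin_comp (lin_add Rl (lin_scale c (@lin_id F M))) Rl)
    (lin_add Rl (lin_scale c (@lin_id F M)))).
rewrite !(linD Pl) (Pk Rx) (Pk Ry) (Pk Rz) (Pk Rw) kz kw !scale0r !addr0 => e.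
(* Applying R gives a second equation between x and y; the two are independent because rx and ry
   differ. *)
have := congr1 R e; rewrite (linD Rl) !(linZ Rl) Rx Ry (lin0 Rl) !scalerA => e2.
have x0 : x = 0.
  apply: (can_inj (scalerK (mulf_neq0 kx rxy))); rewrite scaler0 mulrBr scalerBl.
  rewrite mulrC [_ * ry]mulrC -[(ry * _) *: x]scalerA.
  have -> : k rx *: x = - (k ry *: y) by apply/eqP; rewrite -addr_eq0 e.
  by rewrite scalerN opprK scalerA [rx * _]mulrC [ry * _]mulrC.
split=> //; move: e; rewrite x0 scaler0 add0r => e.
by apply: (can_inj (scalerK ky)); rewrite e scaler0.
Qed.

End Eigen.

(** * The braiding of V (x) V and the quadratic relations *)

Section Braiding.
Variable C : fieldType.
Hypothesis C0 : [pchar C] =i pred0.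
Local Notation K := (Kq C).
Local Notation V := (Vmod C).
Local Notation VV := (otens V V).
Local Notation uK := (@uK C).
Local Notation ev := (@ev C).
Local Notation e2 := (@e2 C).
Local Notation svec := (@svec C).

Let HVV : Uq_rel VV. Proof. by case: (VV_module C). Qed.
Let VVl g : lin (@act _ VV g) := act_lin HVV g.

Definition sumgen (t : VV) : Prop :=
  exists x : hwt -> VV, (forall h, gen (svec h) (x h)) /\ t = \sum_(h <- hwts) x h.

Lemma sumgen_comb c t t' : sumgen t -> sumgen t' -> sumgen (c *: t + t').
Proof.
move=> [x [gx ->]] [y [gy ->]]; exists (fun h => c *: x h + y h); split.
  by move=> h; apply: (lspan_comb _ (gx h) (gy h)).
by rewrite scaler_sumr -big_split.
Qed.

Lemma sumgen0 : sumgen 0.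
Proof. by exists (fun=> 0); split=> [h|]; [apply: lspan0|rewrite big1]. Qed.

Lemma sumgen_F i t : sumgen t -> sumgen (act (gF i) t).
Proof.
move=> [x [gx ->]]; exists (fun h => act (gF i) (x h)); split=> [h|].
  exact: (gen_F HVV _ (gx h)).
exact: (lin_sum _ _ _ (VVl _)).
Qed.

Lemma sumgen_svec h : sumgen (svec h).
Proof.
exists (fun k => if hweqb h k then svec h else 0); split.
  by move=> k; case: ifP => [/hweqbP <-|_]; [apply: gen_top|apply: lspan0].
rewrite (@big_hwt_pick _ _ h) ?hweqb_refl // => k /negbTE -> //.
Qed.

(** Induction along the table: D times the new basis tensor is a sum of images under F_1 and F_2 of
    earlier ones and of a multiple of a highest weight vector, and D is invertible in C(q). *)
Lemma gen_check_sound t known :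
  (forall k, k \in known -> sumgen (ev k.1 (x) ev k.2)) -> gen_check known t ->
  forall a b, sumgen (ev a (x) ev b).
Proof.
elim: t known => [|[p [[D [x1 x2]] c]] t IH] known hk.
  move=> /all2lP h a b; have /hasP[k kk /weqbP e] := h a b.
  by case: e => <- <-; apply: hk.
case/and4P => hx /andP[D0 DN] /fv_eqbP e; apply: IH => k; rewrite inE => /predU1P[->{k}|/hk //].
have D0' : lpev uK D != 0 := lpK_neq0 (N := Z0) C0 DN D0.
have {e} := e _ uK _ e2; rewrite (fvevZ (@uKD C)) (fvev_word (uK0 C)) !fvevD => e.
have -> : ev p.1 (x) ev p.2 = (lpev uK D)^-1 *: (lpev uK D *: (ev p.1 (x) ev p.2)) by rewrite (scalerK D0').
rewrite [X in _ *: X]e -[_ *: _]addr0; apply: sumgen_comb; last exact: sumgen0.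
have kn w : w \in map fst (x1 ++ x2) -> sumgen (e2 w).
  move=> /mapP[y yx ->]; have /hasP[k kk /weqbP <-] := allP hx _ yx.
  exact: hk.
have sF i v : {subset v <= x1 ++ x2} -> sumgen (fvev uK e2 (fv_bind (act2w (gF i)) v)).
  move=> sv; rewrite -act2_fvev; apply: sumgen_F.
  elim: v sv => [|y v IHv] sv; first by rewrite fvev_nil; apply: sumgen0.
  rewrite fvev_cons; apply: sumgen_comb.
    by apply: kn; apply: map_f; apply: sv; rewrite mem_head.
  by apply: IHv => z zv; apply: sv; rewrite inE zv orbT.
rewrite -[fvev _ _ _ as X in X + _]scale1r; apply: sumgen_comb.
  by apply: sF => z zx; rewrite mem_cat zx.
rewrite -[fvev _ _ _ as X in X + _]scale1r; apply: sumgen_comb.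
  by apply: sF => z zx; rewrite mem_cat zx orbT.
case: c {e} => [[h l]|]; last by rewrite fvev_nil; apply: sumgen0.
rewrite (fvevZ (@uKD C)) -[_ *: _]addr0; apply: sumgen_comb; last exact: sumgen0.
exact: sumgen_svec.
Qed.

(** Complete reducibility of V (x) V, obtained by computation. *)
Lemma VV_sumgen (t : VV) : sumgen t.
Proof.
elim/VV_ind: t => [|c x y hx hy|a b]; [exact: sumgen0|exact: sumgen_comb|].
by apply: (gen_check_sound _ gen_checkP).
Qed.

Definition R0v : VV -> VV := VVext (fun a b => fvev uK e2 (R0 a b)).
Lemma R0v_lin : lin R0v. Proof. exact: VVext_lin. Qed.

Lemma R0v_F i x : R0v (act (gF i) x) = act (gF i) (R0v x).
Proof.
move: x; apply: (lin_VV (lin_comp (VVl _) R0v_lin) (lin_comp R0v_lin (VVl _))) => a b.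
have /andP[_ /all_roots /(_ i) /all2lP /(_ a b) /fv_eqbP e] := R0_checkP.
have := act2_sound C (gF i) [:: a; b]; rewrite [e2 _]/(ev a (x) ev b) => ->.
rewrite /R0v VVext_fvev VVextE; apply: (etrans (e _ _ _ _)); apply: esym.
exact: act2_fvev.
Qed.

(** R0 commutes with F_1 and F_2 and has [svec h] as an eigenvector, hence is a scalar on everything
    generated from it. Commutation with E_1 and E_2 is not checked by computation. *)
Lemma R0v_gen h x : gen (svec h) x -> R0v x = lpev uK (rmu h) *: x.
Proof.
move: x; apply: (lspan_sub (T := fun x => R0v x = lpev uK (rmu h) *: x)).
- by rewrite (lin0 R0v_lin) scaler0.
- by move=> a y z hy hz; rewrite R0v_lin hy hz scalerDr !scalerA [a * _]mulrC.
move=> x; elim=> [|i z _ IH]; last first.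
  exact: (etrans (R0v_F i z) (etrans (congr1 (act (gF i)) IH) (linZ (VVl (gF i)) _ _))).
have /andP[/all_hwts /(_ h) /fv_eqbP e _] := R0_checkP.
apply: (etrans (VVext_fvev _ _ _)).
by apply: (etrans (e _ _ _ _)); apply: (fvevZ (@uKD C)).
Qed.

Lemma lambda_gen h x : gen (svec h) x -> @component C VV (hw_weight h) x.
Proof. by move=> gx; apply/(component_gen C0). Qed.

(** The order of the components in [R_normalised]. *)
Lemma sum_hwts (M : nmodType) (F : hwt -> M) : \sum_(h <- hwts) F h = F Hs + F Ht + F Ha + F Hv.
Proof. by rewrite !big_cons big_nil addr0 !addrA [LHS](ACl (1*4*2*3)). Qed.

(** The normalisation fixes Rcheck on the four components, which span V (x) V; R0 has the same
    eigenvalues there. *)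
Lemma Rcheck_R0v (Rm : Rfamily C) : R_normalised Rm -> forall t : VV, Rcheck Rm t = R0v t.
Proof.
move=> Rn t; have [x [gx ->]] := VV_sumgen t; rewrite sum_hwts.
rewrite (Rn _ _ _ _ (lambda_gen (gx Hs)) (lambda_gen (gx Ht)) (lambda_gen (gx Ha)) (lambda_gen (gx Hv))).
rewrite !(linD R0v_lin) (R0v_gen (gx Hs)) (R0v_gen (gx Ht)) (R0v_gen (gx Ha)) (R0v_gen (gx Hv)).
rewrite /rmu !lpevX lpevN lpevX lpev_uK_C zrN1 scaleN1r scaleNr.
by [].
Qed.

Lemma wedge_gen t : @wedge2 C t <-> exists t1 t2, [/\ gen (svec Ha) t1, gen (svec Hv) t2 & t = t1 + t2].
Proof.
by split=> [] [t1 [t2 [h1 h2 ->]]]; exists t1, t2; split; rewrite //;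
  [exact/(component_gen C0 Ha)|exact/(component_gen C0 Hv)
  |exact: (proj2 (component_gen C0 Ha t1) h1)|exact: (proj2 (component_gen C0 Hv t2) h2)].
Qed.

Lemma wedge_act g t : @wedge2 C t -> @wedge2 C (act g t).
Proof.
move=> /wedge_gen[t1 [t2 [h1 h2 ->]]]; apply/wedge_gen; exists (act g t1), (act g t2).
have [_ _ s1] := gen_sub C Ha; have [_ _ s2] := gen_sub C Hv.
split; [exact: (s1 _ _ h1)|exact: (s2 _ _ h2)|exact: (linD (VVl g))].
Qed.

Lemma R0v_fvev v : R0v (fvev uK e2 v) = fvev uK e2 (fv_bind (tab2 R0) v).
Proof. exact: VVext_fvev. Qed.

Definition eig (h : hwt) : lp :=
  lp_mul (lp_add (rmu h) (lp_X (-6)%Zc)) (lp_add (rmu h) (lp_C 1%Zc)).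

Lemma eig_neq0 h :
  match h with
  | Hs | Ht => is_true (lpev uK (eig h) != 0)
  | _ => lpev uK (eig h) = 0
  end.
Proof.
case: h.
(* The shift 30 only has to exceed the pole order of the eigenvalue. *)
- by apply: (lpK_neq0 (N := 30%Zc) C0); vm_compute.
- have -> : eig Ha = [::] by vm_compute.
  exact: lpev_nil.
- have -> : eig Hv = [::] by vm_compute.
  exact: lpev_nil.
- by apply: (lpK_neq0 (N := 30%Zc) C0); vm_compute.
Qed.

Lemma rmu_neq : lpev uK (rmu Hs) - lpev uK (rmu Ht) != 0.
Proof. by rewrite -lpevN -lpevD; apply: (lpK_neq0 (N := 30%Zc) C0); vm_compute. Qed.

(* R0 has the distinct eigenvalues rmu on the four components, so that
   (R0 + 1)(R0 + q^-6) t = 0 kills the components of t in the first and the last *)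
Lemma wedge_criterion t :
  R0v (R0v t + lpev uK (lp_X (-6)%Zc) *: t) + (R0v t + lpev uK (lp_X (-6)%Zc) *: t) = 0 ->
  @wedge2 C t.
Proof.
have [x [gx tx]] := VV_sumgen t; move: tx; rewrite sum_hwts => -> P0.
have eE h : lpev uK (eig h) = (lpev uK (rmu h) + lpev uK (lp_X (-6)%Zc)) * (lpev uK (rmu h) + 1).
  by rewrite (lpevM (@uKD C)) lpevD lpevD (lpev1 (uK0 C)).
have n h := eig_neq0 h.
have ns := etrans (congr1 (fun z => z != 0) (esym (eE Hs))) (n Hs).
have nt := etrans (congr1 (fun z => z != 0) (esym (eE Ht))) (n Ht).
have na := etrans (esym (eE Ha)) (n Ha); have nv := etrans (esym (eE Hv)) (n Hv).
have [xs xt] := eigen_split R0v_lin (R0v_gen (gx Hs)) (R0v_gen (gx Ht)) (R0v_gen (gx Ha))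
  (R0v_gen (gx Hv)) ns nt na nv rmu_neq P0.
apply/wedge_gen; exists (x Ha), (x Hv); split; [exact: gx|exact: gx|].
by rewrite xs xt !add0r.
Qed.

Lemma rel2_wedge a b : lltb b a -> @wedge2 C (fvev uK e2 (rel2 a b)).
Proof.
move=> ba; apply: wedge_criterion.
have /implyP /(_ ba) /isnilP h := all2lP rel2_checkP a b.
move: (h C); rewrite fvevD -R0v_fvev fvevD -R0v_fvev (fvevZ (@uKD C)).
exact.
Qed.

Definition nf2v : VV -> VV := VVext (fun a b => fvev uK e2 (nf2 [:: a; b])).
Lemma nf2v_lin : lin nf2v. Proof. exact: VVext_lin. Qed.

Lemma nf2v_fvev v : nf2v (fvev uK e2 v) = fvev uK e2 (fv_bind nf2 v).
Proof.
rewrite /nf2v VVext_fvev !(fvev_bind (@uKD C)); apply: eq_fvev' => w.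
by case: w => [|a [|b [|c w]]].
Qed.

Definition subnf2 (t : VV) : VV := t - nf2v t.
Lemma subnf2_lin : lin subnf2. Proof. exact: (lin_add (@lin_id K VV) (lin_opp nf2v_lin)). Qed.

(** A reduction step subtracts a multiple of a relation; in particular the kernel of [nf2v] is
    spanned by the relations. *)
Lemma subnf2_rel t : lspan (fun x => exists a b, lltb b a /\ x = fvev uK e2 (rel2 a b)) (subnf2 t).
Proof.
elim/VV_ind: t => [|c x y hx hy|a b]; first by rewrite (lin0 subnf2_lin); apply: lspan0.
  by rewrite subnf2_lin; exact: (lspan_comb _ hx hy).
have fE : subnf2 (ev a (x) ev b) = fvev uK e2 (fv_sub (fv_word [:: a; b]) (nf2 [:: a; b])).
  by rewrite fvevB (fvev_word (uK0 C)) /subnf2 /nf2v VVextE.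
rewrite fE /nf2; case: ifP => ab; first by apply: lspan_in; exists a, b.
suff -> : fvev uK e2 (fv_sub (fv_word [:: a; b]) (fv_word [:: a; b])) = 0 by exact: lspan0.
by rewrite fvevB subrr.
Qed.

(** A vector of the kernel is a combination of the relations by [subnf2_rel], and for these the
    claim was checked. *)
Lemma nf2v_F t i : nf2v t = 0 -> nf2v (act (gF i) t) = 0.
Proof.
move=> t0; have := subnf2_rel t; rewrite /subnf2 t0 subr0.
move: {t0} t; apply: (lspan_sub (T := fun t => nf2v (act (gF i) t) = 0)) => [|c x y hx hy|x [a [b [ba ->]]]].
- exact: (lin0 (lin_comp (VVl (gF i)) nf2v_lin)).
- exact: (etrans (lin_comp (VVl (gF i)) nf2v_lin c x y) (comb0 c hx hy)).
have /and3P[_ _ /all2lP /(_ a b) /implyP /(_ ba) /all_roots /(_ i) /isnilP h] := nf2_checkP.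
by rewrite act2_fvev nf2v_fvev h.
Qed.

Lemma wedge_nf2v t : @wedge2 C t -> nf2v t = 0.
Proof.
have /and3P[/isnilP ha /isnilP hv _] := nf2_checkP.
have G h x : nf2v (svec h) = 0 -> gen (svec h) x -> nf2v x = 0.
  move=> h0; move: x; apply: (lspan_sub (T := fun t => nf2v t = 0)) => [|c x y hx hy|x].
  - exact: (lin0 nf2v_lin).
  - exact: (etrans (nf2v_lin c x y) (comb0 c hx hy)).
  by elim=> [|i w _ IHw]; [exact: h0|exact: nf2v_F].
move=> /wedge_gen[t1 [t2 [h1 h2 ->]]]; rewrite (linD nf2v_lin).
rewrite (G Ha _ (etrans (nf2v_fvev _) (ha C)) h1).
by rewrite (G Hv _ (etrans (nf2v_fvev _) (hv C)) h2) addr0.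
Qed.

(** Together with [rel2_wedge] this replaces the quantum exterior square, of dimension 14 + 7, by
    the 21 relations that are used for rewriting. *)
Lemma wedge_rel t : @wedge2 C t -> lspan (fun x => exists a b, lltb b a /\ x = fvev uK e2 (rel2 a b)) t.
Proof. by move=> /wedge_nf2v h; have := subnf2_rel t; rewrite /subnf2 h subr0. Qed.

End Braiding.

(** * Normal forms in S_q(V) *)

Definition isL3 (a : letter) : bool := if a is L3 then true else false.

(* v_0 v_0 is reducible in degree at least 3 only *)
Definition red (n : nat) (a b : letter) : bool := lltb b a || [&& isL3 a, isL3 b & ltn 2 n].
Definition rl (a b : letter) : fv := if lltb b a then rule2 a b else rule33.

(** Finds the leftmost reducible pair. The number [n] is the length of the whole word and stays
    fixed while the search moves to suffixes, because the reducibility of v_0 v_0 depends on it. *)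
Fixpoint fstep (n : nat) (w : word) : option (word * (letter * letter) * word) :=
  if w is a :: w' then
    if w' is b :: v then
      if red n a b then Some ([::], (a, b), v)
      else if fstep n w' is Some (u, p, v') then Some (a :: u, p, v') else None
    else None
  else None.

Definition normal (w : word) : bool := if fstep (size w) w is Some _ then false else true.

Lemma fstepP n w u a b v : fstep n w = Some (u, (a, b), v) ->
  w = u ++ a :: b :: v /\ red n a b.
Proof.
elim: w u => [|c w IH] u //=; case: w IH => [|d w] IH //.
case: ifP => [cd [<- <- <- <-] //|_].
by case E: fstep => [[[u' p] v']|] // [<- pE vE]; have [] := IH u'; rewrite ?E ?pE ?vE // => ->.
Qed.

Lemma fstep_first n u a b v : red n a b ->
  exists u0 a0 b0 v0, fstep n (u ++ a :: b :: v) = Some (u0, (a0, b0), v0) /\ (size u0 <= size u)%N.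
Proof.
move=> ab; elim: u => [|c u IH]; first by rewrite /= ab; exists [::], a, b, v.
have [u0 [a0 [b0 [v0 [E le]]]]] := IH.
rewrite cat_cons /=; case E' : (u ++ a :: b :: v) => [|d w]; first by case: (u) E'.
case: ifP => _; first by exists [::], c, d, w.
by rewrite -E' E; exists (c :: u0), a0, b0, v0.
Qed.

(** The word read in base 7. On words of equal length this is the lexicographic order as a natural
    number; it is the termination measure of the rewriting and also its fuel. *)
Definition wval (w : word) : nat := foldl (fun n a => n * 7 + lidx a)%N 0 w.

Lemma foldl_val n w : foldl (fun n a => n * 7 + lidx a)%N n w = (n * 7 ^ size w + wval w)%N.
Proof.
elim: w n => [|a w IH] n; first by rewrite /= muln1 addn0.
by rewrite /wval /= IH [in RHS]IH add0n expnS; lia.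
Qed.

Lemma wval_cat u v : wval (u ++ v) = (wval u * 7 ^ size v + wval v)%N.
Proof. by rewrite /wval foldl_cat foldl_val. Qed.

Lemma wval_ctx u p r v : size p = size r -> (wval p < wval r)%N ->
  (wval (u ++ p ++ v) < wval (u ++ r ++ v))%N.
Proof.
move=> pr h; rewrite !wval_cat !size_cat pr ltn_add2l ltn_add2r ltn_pmul2r ?expn_gt0 //.
Qed.

Definition rl_check : bool :=
  all2l (fun a b => red 3 a b ==> all (fun x => (size x.1 == 2)%N && (wval x.1 < wval [:: a; b])%N) (rl a b)).
Lemma rl_checkP : rl_check. Proof. by vm_compute. Qed.

Lemma red_mono n m a b : (n <= m)%N -> red n a b -> red m a b.
Proof.
move=> nm; rewrite /red; case: lltb => //= /and3P[-> -> h] /=.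
exact: (leq_trans h).
Qed.

Lemma red3 n a b : red n a b -> red 3 a b.
Proof. by rewrite /red; case: lltb => //= /and3P[-> ->]. Qed.

Lemma rl_keys n a b p : red n a b -> p \in map fst (rl a b) ->
  size p = 2%N /\ (wval p < wval [:: a; b])%N.
Proof.
move=> /red3 r /mapP[x xr ->]; have /implyP /(_ r) /allP /(_ x xr) /andP[/eqP] := all2lP rl_checkP a b.
by [].
Qed.

Lemma rl_lt n a b u v p : red n a b -> p \in map fst (rl a b) ->
  (wval (u ++ p ++ v) < wval (u ++ a :: b :: v))%N.
Proof.
move=> r pr; have [sp lp] := rl_keys r pr.
by rewrite -[a :: b :: v]/([:: a; b] ++ v); apply: wval_ctx.
Qed.

(** Reduction of words of length 3 by all rules. When the fuel is exhausted the word is returned as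
    it is, so that the result is sound for every [k]. *)
Fixpoint nf3 (k : nat) (z : word) : fv :=
  if k is k'.+1 then
    if fstep 3 z is Some (u, (a, b), v) then
      fv_bind (fun p => nf3 k' (u ++ p ++ v)) (rl a b)
    else fv_word z
  else fv_word z.

Lemma nf3_0 z : nf3 0 z = fv_word z. Proof. by []. Qed.

Lemma nf3S k z : nf3 k.+1 z = if fstep 3 z is Some (u, (a, b), v) then
  fv_bind (fun p => nf3 k (u ++ p ++ v)) (rl a b) else fv_word z.
Proof. by []. Qed.

Definition overlap_check : bool :=
  all2l (fun a b => all (fun c => red 3 a b && red 3 b c ==>
    fv_eqb (fv_bind (fun p => nf3 30 (p ++ [:: c])) (rl a b))
           (fv_bind (fun p => nf3 30 (a :: p)) (rl b c))) letters).
Lemma overlap_checkP : overlap_check. Proof. by vm_compute. Qed.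

Section Normal.
Local Opaque rl wval nf3.
Variables (B : comNzRingType) (u : Z -> B).
Hypothesis uD : forall a b, u (Z.add a b) = u a * u b.
Hypothesis u0 : u 0%Zc = 1.
Local Notation T := ({malg B[{fmonom 'I_7}]}).

Definition mw (w : word) : {fmonom 'I_7} := fmonom_of_seq fmonom_key (map lord w).
Definition wm (m : {fmonom 'I_7}) : word := map ordl m.

Lemma mwK : cancel mw wm.
Proof.
move=> w; rewrite /mw /wm fmE /= -map_comp -[RHS]map_id.
by apply: eq_map => a; rewrite /= lordK.
Qed.

Lemma wmK : cancel wm mw.
Proof.
move=> m; rewrite /mw /wm -map_comp -[RHS]fmK fmE; congr FMonom.
by rewrite -[RHS]map_id; apply: eq_map => a; rewrite /= ordlK.
Qed.

Definition eT (w : word) : T := << mw w >>.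

Lemma eT_cat w w' : eT (w ++ w') = eT w * eT w'.
Proof.
rewrite /eT malgM_def fgmulUU mulr1; congr mkmalgU.
by apply/eqP; rewrite fmP fmM /mw !fmE map_cat.
Qed.

Lemma eT_nil : eT [::] = 1. Proof. by []. Qed.

(** The default 0 is never reached when [k] exceeds [wval w], since each rule lowers that value. *)
Fixpoint nfuel (k : nat) (w : word) : T :=
  if k is k'.+1 then
    if fstep (size w) w is Some (x, (a, b), y) then
      fvev u (fun p => nfuel k' (x ++ p ++ y)) (rl a b)
    else eT w
  else 0.

Lemma nfuelS k w : nfuel k.+1 w = if fstep (size w) w is Some (x, (a, b), y) then
      fvev u (fun p => nfuel k (x ++ p ++ y)) (rl a b) else eT w.
Proof. by []. Qed.

Definition nform (w : word) : T := nfuel (wval w).+1 w.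

Lemma nfuel_eq k k' w : (wval w < k)%N -> (wval w < k')%N -> nfuel k w = nfuel k' w.
Proof.
elim: k k' w => [|k IH] [|k'] w hk hk'; try by rewrite ltn0 in hk hk'.
rewrite !nfuelS; case E: fstep => [[[x [a b]] y]|]; last by [].
have [wE r] := fstepP E.
apply: eq_fvev => p pr; have lt := rl_lt x y r pr; rewrite -wE in lt.
exact: (IH _ _ (leq_trans lt hk) (leq_trans lt hk')).
Qed.

Lemma nfuelE k w : (wval w < k)%N -> nfuel k w = nform w.
Proof. by move=> h; apply: nfuel_eq. Qed.

Lemma nform_step w x a b y : fstep (size w) w = Some (x, (a, b), y) ->
  nform w = fvev u (fun p => nform (x ++ p ++ y)) (rl a b).
Proof.
move=> E; rewrite {1}/nform nfuelS E; have [wE r] := fstepP E.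
apply: eq_fvev => p pr; apply: nfuelE; rewrite [in X in (_ < X)%N]wE.
exact: (rl_lt x y r pr).
Qed.

Lemma nform_normal w : normal w -> nform w = eT w.
Proof. by rewrite /normal /nform nfuelS; case: fstep. Qed.

Local Opaque nform.

(** [nform] always reduces the leftmost pair; here any other reducible pair may be reduced instead.
    This local independence makes the normal form vanish on the ideal. *)
Definition diamond (w : word) : Prop := forall x a b y, w = x ++ a :: b :: y ->
  red (size w) a b -> nform w = fvev u (fun p => nform (x ++ p ++ y)) (rl a b).

Lemma fvev_bindE (M : lmodType B) (e : word -> M) f v :
  fvev u e (fv_bind f v) = fvev u (fun w => fvev u e (f w)) v.
Proof. exact: fvev_bind. Qed.

(** Computations with an isolated word of length 3 may be carried out in any context, provided that
    all smaller words already satisfy [diamond]. *)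
Lemma nf3_sound x y n k z : (forall w, (wval w < n)%N -> diamond w) ->
  (wval (x ++ z ++ y) < n)%N -> size z = 3%N ->
  nform (x ++ z ++ y) = fvev u (fun z => nform (x ++ z ++ y)) (nf3 k z).
Proof.
move=> Dn; elim: k z => [|k IH] z lt sz; first by rewrite nf3_0 fvev_word.
rewrite nf3S; case E: (fstep 3 z) => [[[x' [a b]] y']|]; last by rewrite fvev_word.
have [zE r] := fstepP E; rewrite fvev_bindE.
have wE : x ++ z ++ y = (x ++ x') ++ a :: b :: (y' ++ y) by rewrite zE -!catA.
(* The whole word is at least as long as z, so a pair reducible in degree 3 stays reducible. *)
have r' : red (size (x ++ z ++ y)) a b.
  by apply: red_mono r; rewrite !size_cat sz; lia.
rewrite (Dn _ lt _ _ _ _ wE r'); apply: eq_fvev => p pr.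
have e : (x ++ x') ++ p ++ y' ++ y = x ++ (x' ++ p ++ y') ++ y by rewrite -!catA.
rewrite e; apply: IH.
  by rewrite -e; apply: leq_ltn_trans lt; rewrite wE; apply: ltnW; apply: (rl_lt _ _ r').
have [sp _] := rl_keys r pr; rewrite -sz zE !size_cat sp /=; lia.
Qed.

Lemma fvev_exchange (M : lmodType B) (f : word -> word -> M) v v' :
  fvev u (fun p => fvev u (f p) v') v = fvev u (fun p' => fvev u (f ^~ p') v) v'.
Proof.
rewrite /fvev; under eq_bigr => x _ do rewrite scaler_sumr.
rewrite exchange_big /=; apply: eq_bigr => y _; rewrite scaler_sumr.
by apply: eq_bigr => x _; rewrite !scalerA mulrC.
Qed.

(** Strong induction on the base 7 value. The given pair is compared with the leftmost one: the two
    coincide, or share one letter, which is the case settled by [overlap_check], or are disjoint,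
    and then the reductions commute. *)
Lemma nform_diamond w : diamond w.
Proof.
move: {2}(wval w).+1 (ltnSn (wval w)) => n; elim: n w => // n IH w lt x a b y wE r.
have Dlt w' : (wval w' < wval w)%N -> diamond w' by move=> h; apply: IH; apply: leq_trans h lt.
have := fstep_first x y r; rewrite -wE => -[x0 [a0 [b0 [y0 [E le]]]]].
have [wE0 r0] := fstepP E; rewrite (nform_step E).
(* [t] is the stretch between the beginnings of the two pairs; its length 0, 1 or at least 2
   distinguishes the three cases. *)
have [t [xE sE]] : exists t, x = x0 ++ t /\ a0 :: b0 :: y0 = t ++ a :: b :: y.
  exists (drop (size x0) x); move: wE; rewrite wE0 -{1 2}(cat_take_drop (size x0) x) -catA => /eqP.
  rewrite eqseq_cat ?size_takel // => /andP[/eqP e /eqP ->].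
  by rewrite -e.
case: t xE sE => [|c [|d t]] xE /=.
- by move=> [-> -> ->]; rewrite xE cats0.
- move=> [ca0 b0a y0E]; subst c b0 y0; rewrite {x le}xE in wE *.
  have e3 : w = x0 ++ [:: a0; a; b] ++ y by rewrite wE -catA.
  pose X z := nform (x0 ++ z ++ y).
  have s1 p : p \in map fst (rl a0 a) -> nform (x0 ++ p ++ [:: b & y]) = fvev u X (nf3 30 (p ++ [:: b])).
    move=> pr; have [sp lp] := rl_keys r0 pr.
    have -> : x0 ++ p ++ b :: y = x0 ++ (p ++ [:: b]) ++ y by rewrite -!catA.
    apply: (nf3_sound (n := wval w) _ Dlt); last by rewrite size_cat sp.
    by rewrite -!catA; have := rl_lt x0 (b :: y) r0 pr; rewrite e3.
  have s2 p : p \in map fst (rl a b) -> nform ((x0 ++ [:: a0]) ++ p ++ y) = fvev u X (nf3 30 (a0 :: p)).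
    move=> pr; have [sp lp] := rl_keys r pr.
    have -> : (x0 ++ [:: a0]) ++ p ++ y = x0 ++ (a0 :: p) ++ y by rewrite -!catA.
    apply: (nf3_sound (n := wval w) _ Dlt); last by rewrite /= sp.
    by have := rl_lt (x0 ++ [:: a0]) y r pr; rewrite -!catA e3.
  rewrite (eq_fvev u s1) (eq_fvev u s2) -!fvev_bindE.
  have bl : b \in letters by case: (b).
  have /allP /(_ b bl) /implyP h := all2lP overlap_checkP a0 a.
  by apply: fv_eqbP; apply: h; rewrite (red3 r0) (red3 r).
move=> [ca0 db0 y0E]; subst c d y0; rewrite {x le}xE in wE *.
have s1 p : p \in map fst (rl a0 b0) ->
    nform (x0 ++ p ++ t ++ a :: b :: y) = fvev u (fun p' => nform (x0 ++ p ++ t ++ p' ++ y)) (rl a b).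
  move=> pr; have [sp lp] := rl_keys r0 pr.
  have lt' : (wval (x0 ++ p ++ t ++ a :: b :: y) < wval w)%N by rewrite wE0; exact: (rl_lt x0 _ r0 pr).
  have e : x0 ++ p ++ t ++ a :: b :: y = (x0 ++ p ++ t) ++ a :: b :: y by rewrite -!catA.
  have sw : size (x0 ++ p ++ t ++ a :: b :: y) = size w by rewrite wE0 !(size_cat, sp) /= !size_cat.
  rewrite -sw in r; rewrite (Dlt _ lt' _ _ _ _ e r); apply: eq_fvev => p' _; by rewrite -!catA.
have s2 p : p \in map fst (rl a b) ->
    nform ((x0 ++ a0 :: b0 :: t) ++ p ++ y) = fvev u (fun p' => nform (x0 ++ p' ++ t ++ p ++ y)) (rl a0 b0).
  move=> pr; have [sp lp] := rl_keys r pr.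
  have lt' : (wval ((x0 ++ a0 :: b0 :: t) ++ p ++ y) < wval w)%N by rewrite wE; exact: (rl_lt _ y r pr).
  have e : (x0 ++ a0 :: b0 :: t) ++ p ++ y = x0 ++ a0 :: b0 :: (t ++ p ++ y) by rewrite -!catA.
  have sw : size ((x0 ++ a0 :: b0 :: t) ++ p ++ y) = size w by rewrite wE !(size_cat, sp).
  by rewrite -sw in r0; rewrite (Dlt _ lt' _ _ _ _ e r0).
exact: (etrans (eq_fvev u s1) (etrans (fvev_exchange _ _ _) (esym (eq_fvev u s2)))).
Qed.

Lemma nform_span w : lspan (fun t => exists2 w', normal w' & t = eT w') (nform w).
Proof.
move: {2}(wval w).+1 (ltnSn (wval w)) => n; elim: n w => [//|n IH] w lt.
have [nw|nw] := boolP (normal w).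
  by rewrite (nform_normal nw); apply: lspan_in; exists w.
move: nw; rewrite /normal; case E: fstep => [[[x [a b]] y]|] // _.
rewrite (nform_step E) /fvev big_seq; apply: lspan_sum => z zr; apply: lspan_scale; apply: IH.
have [wE r] := fstepP E; have pr : z.1 \in map fst (rl a b) by apply: map_f.
by have := rl_lt x y r pr; rewrite -wE => h; apply: (leq_trans h).
Qed.

(** A map that respects every single reduction respects the normal form. It will be applied to the
    projection onto S_q(V) and to the specialisation in the quotient of the polynomial ring. *)
Lemma nform_compat (D : comNzRingType) (phi : {rmorphism B -> D}) (M : lmodType D) (f : T -> M) :
  semilin phi f ->
  (forall x a b y, red (size (x ++ a :: b :: y)) a b ->
     f (eT (x ++ a :: b :: y)) = f (fvev u (fun p => eT (x ++ p ++ y)) (rl a b))) ->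
  forall w, f (nform w) = f (eT w).
Proof.
move=> fl h w; move: {2}(wval w).+1 (ltnSn (wval w)) => n; elim: n w => [//|n IH] w lt.
have [nw|nw] := boolP (normal w); first by rewrite (nform_normal nw).
move: nw; rewrite /normal; case E: fstep => [[[x [a b]] y]|] // _.
have [wE r] := fstepP E; rewrite (nform_step E).
have hw : f (eT w) = f (fvev u (fun p => eT (x ++ p ++ y)) (rl a b)) by rewrite wE; apply: h; rewrite -wE.
have fE e v : f (fvev u e v) = fvev (fun z => phi (u z)) (f \o e) v.
  exact: (fvev_semilin (phi := phi) e v (fun=> erefl) fl).
rewrite hw; apply: (etrans (fE _ _)); apply: esym; apply: (etrans (fE _ _)); apply: esym.
apply: eq_fvev => p pr; apply: IH.
by have := rl_lt x y r pr; rewrite -wE => h'; apply: (leq_trans h').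
Qed.

End Normal.

(** The element phi in ordered words: v_0 v_0 + (1 + q^2) v_3 v_{-3} + (q^3 + q^5) v_2 v_{-2} + (1 +
    q^6) v_1 v_{-1}. *)
Definition phi_fv : fv := fv_sub (fv_word [:: L3; L3]) rule33.

(** Reduction by the quadratic rules alone: with first argument 2 the function [fstep] never selects
    v_0 v_0. Its steps are thus valid in S_q(V) before the cubic relations are known. *)
Fixpoint nfq (k : nat) (w : word) : fv :=
  if k is k'.+1 then
    if fstep 2 w is Some (x, (a, b), y) then
      fv_bind (fun p => nfq k' (x ++ p ++ y)) (rule2 a b)
    else fv_word w
  else fv_word w.

(* (a, b, c) is an overlap whose two reductions differ by D times a cubic
   relation, and l, r times that relation are the reductions of v_i phi and phi v_i *)
Definition cubic_data (i : letter) : (letter * letter * letter) * (lp * lp * lp) :=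
  match i with
  | L0 => ((L3, L2, L1), ([:: (-2,1); (0,-2); (2,1)], [:: (0,1)], [:: (-4,1); (-2,-1); (2,1)]))
  | L1 => ((L4, L2, L1), ([:: (-2,-1); (0,2); (2,-1)], [:: (0,1)], [:: (0,1)]))
  | L2 => ((L5, L2, L1), ([:: (-2,1); (0,-2); (2,1)], [:: (0,1)], [:: (0,1)]))
  | L3 => ((L6, L2, L1), ([:: (-2,-1); (0,2); (2,-1)], [:: (0,1)], [:: (0,1)]))
  | L4 => ((L5, L4, L1), ([:: (-2,-1); (0,2); (2,-1)], [:: (0,1)], [:: (0,1)]))
  | L5 => ((L5, L4, L2), ([:: (-2,1); (0,-2); (2,1)], [:: (0,1)], [:: (0,1)]))
  | L6 => ((L6, L5, L1), ([:: (-7,-1); (-5,2); (-3,-1)], [:: (-4,1); (-2,-1); (2,1)], [:: (0,1)]))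
  end%Zc.

Definition lphi (i : letter) := fv_bind (fun w => nfq 30 (i :: w)) phi_fv.
Definition phir (i : letter) := fv_bind (fun w => nfq 30 (w ++ [:: i])) phi_fv.
(** The side of the product is chosen so that the product on the other side is a multiple of this
    one; for v_1 and v_{-1} that multiple is q^-4 - q^-2 + q^2, which is not a unit of A. *)
Definition cubic (i : letter) : fv := if ltn 3 (lidx i) then phir i else lphi i.

Definition cubic_check : bool :=
  all (fun i => let: ((a, b, c), (D, l, r)) := cubic_data i in
    [&& lltb b a, lltb c b,
      fv_eqb (fv_sub (fv_bind (fun p => nfq 30 (p ++ [:: c])) (rule2 a b))
                     (fv_bind (fun p => nfq 30 (a :: p)) (rule2 b c)))
             (fv_scale D (cubic i)),
      ~~ Z.eqb (lp_at2 10 D) Z0 && all (fun x => Z.leb Z0 (Z.add 10 x.1)) D,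
      fv_eqb (lphi i) (fv_scale l (cubic i)) & fv_eqb (phir i) (fv_scale r (cubic i))]) letters.
Lemma cubic_checkP : cubic_check. Proof. by vm_compute. Qed.

Section LextLin.
Variables (A B : nzRingType) (phi : {rmorphism A -> B}) (X : choiceType).
Variables (P : lmodType B) (f : X -> P).
Lemma lext_semilin : semilin phi (lext phi f).
Proof. by move=> a x y; rewrite lextD lextZ. Qed.
End LextLin.

Lemma lext_lin (A : nzRingType) (X : choiceType) (P : lmodType A) (f : X -> P) : lin (lext idfun f).
Proof. exact: (lext_semilin (idfun : {rmorphism A -> A}) f). Qed.

Lemma lext_linU (A : nzRingType) (X : choiceType) (P : lmodType A) (f : X -> P) k :
  lext idfun f << k >> = f k.
Proof. exact: (lextU (idfun : {rmorphism A -> A}) f). Qed.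

Section MalgScale.
Variables (R : comNzRingType) (M : monomType).
Local Notation T := ({malg R[M]}).

Lemma malg_scaleU (a : R) (k : M) : a *: << k >> = << a *g k >> :> T.
Proof. by apply/malgP => i; rewrite mcoeffZ !mcoeffU mulr_natr. Qed.

Lemma malg_scaleUr (a : R) k (y : T) : << k >> * (a *: y) = a *: (<< k >> * y).
Proof.
elim/malg_ind: y => [|c j y IH]; first by rewrite scaler0 mulr0 scaler0.
rewrite scalerDr !mulrDr scalerDr IH; congr (_ + _).
rewrite [a *: (c *: _)]scalerA !malg_scaleU !malgM_def !fgmulUU !mul1r.
by apply/malgP => i; rewrite mcoeffZ !mcoeffU mulrnAr.
Qed.

Lemma malg_scaleAr (a : R) (x y : T) : x * (a *: y) = a *: (x * y).
Proof.
elim/malg_ind: x => [|b k x IH]; first by rewrite !mul0r scaler0.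
rewrite [LHS]mulrDl [in RHS]mulrDl scalerDr IH -!scalerAl malg_scaleUr.
by rewrite !scalerA [b * a]mulrC.
Qed.
End MalgScale.

Section QalgScale.
Variables (R : comNzRingType) (T : lalgType R).
Hypothesis hT : forall a (x y : T), x * (a *: y) = a *: (x * y).
Variable S : T -> Prop.

Lemma qalg_mulr_lin (x : qalg S) : lin (fun y : qalg S => x * y).
Proof.
move=> a y z; rewrite mulrDr; congr (_ + _).
by rewrite -[x]aprojK -[y]aprojK -aprojZ -!aprojM hT aprojZ.
Qed.

Lemma qalg_mull_lin (y : qalg S) : lin (fun x : qalg S => x * y).
Proof.
move=> a x z; rewrite mulrDl; congr (_ + _).
by rewrite -[x]aprojK -[y]aprojK -aprojZ -!aprojM -scalerAl aprojZ.
Qed.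
End QalgScale.

Lemma ring_phi_ctx (T : pzRingType) (s : word -> T) (z : T) :
  (forall x y, s (x ++ y) = s x * s y) ->
  (forall i, s [:: i] * z = 0) -> (forall i, z * s [:: i] = 0) ->
  forall x y, (0 < size x + size y)%N -> s x * z * s y = 0.
Proof.
move=> sM hl hr x y; case/lastP: x => [|x i]; last by rewrite -cats1 sM -[s x * _ * _]mulrA hl mulr0 mul0r.
by case: y => [|i y] // _; rewrite -cat1s sM mulrA -[_ * z * _]mulrA hr mulr0 mul0r.
Qed.

Lemma ring_ctxB (T : pzRingType) (x y z w : T) : x * (z - w) * y = 0 -> x * z * y = x * w * y.
Proof. by move=> h; apply/eqP; rewrite -subr_eq0 -mulrBl -mulrBr h. Qed.

Section SqNormal.
Variable C : fieldType.
Hypothesis C0 : [pchar C] =i pred0.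
Local Notation K := (Kq C).
Local Notation V := (Vmod C).
Local Notation VV := (otens V V).
Local Notation uK := (@uK C).
Local Notation uA := (@uA C).
Local Notation ev := (@ev C).
Local Notation e2 := (@e2 C).
Local Notation TV := (TV C).
Local Notation eK := (@eT K).

Lemma vinj_lin : lin (@vinj C).
Proof.
move=> a x y; rewrite /vinj scaler_sumr -big_split; apply: eq_bigr => j _ /=.
by rewrite !mxE scalerDl scalerA.
Qed.

Lemma vinj_ev a : vinj (ev a) = eK [:: a].
Proof.
rewrite /vinj (bigD1 (lord a)) //= mxE !eqxx scale1r big1 ?addr0 => [|j ja].
  by congr mkmalgU; rewrite /mw fmE fmuE.
by rewrite mxE (negPf ja) scale0r.
Qed.

Definition m2 : VV -> TV := tlift idfun (fun u v : V => vinj u * vinj v).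

Lemma TV_scaleAr (a : K) (x y : TV) : x * (a *: y) = a *: (x * y).
Proof. exact: malg_scaleAr. Qed.

Lemma TV_mulr_lin (x : TV) : lin (fun y : TV => x * y).
Proof. by move=> a y y'; rewrite mulrDr TV_scaleAr. Qed.

Lemma TV_mull_lin (y : TV) : lin (fun x : TV => x * y).
Proof. by move=> a x x'; rewrite mulrDl scalerAl. Qed.

Let m2l (v : V) : lin (fun u : V => vinj u * vinj v).
Proof. exact: (lin_comp vinj_lin (TV_mull_lin _)). Qed.
Let m2r (u : V) : lin (fun v : V => vinj u * vinj v).
Proof. exact: (lin_comp vinj_lin (TV_mulr_lin _)). Qed.

Lemma m2_lin : lin m2. Proof. exact: (tlift_lin m2l m2r). Qed.

Lemma m2E u v : m2 (u (x) v) = vinj u * vinj v. Proof. exact: (tliftE m2l m2r). Qed.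

Lemma m2_fvev (v : fv) : all (fun x => size x.1 == 2%N) v -> m2 (fvev uK e2 v) = fvev uK eK v.
Proof.
move=> v2; rewrite (fvev_lin _ _ m2_lin); apply: eq_fvev => w /mapP[x xv ->].
have := allP v2 _ xv; case: x.1 => [|a [|b [|c w']]] //= _.
by rewrite m2E !vinj_ev -eT_cat.
Qed.

Lemma rel2_size a b : all (fun x => size x.1 == 2%N) (rel2 a b).
Proof. by case: a; case: b; vm_compute. Qed.

Lemma Sq_rel_rel2 a b : lltb b a -> Sq_rel (fvev uK eK (rel2 a b)).
Proof.
move=> ba; exists (fvev uK e2 (rel2 a b)); first exact: rel2_wedge.
exact: (esym (m2_fvev (rel2_size a b))).
Qed.

Lemma Sq_rel_span x : Sq_rel x -> lspan (fun y => exists a b, lltb b a /\ y = fvev uK eK (rel2 a b)) x.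
Proof.
move=> [t /(wedge_rel C0) ht ->]; apply: (lspan_image m2_lin) ht => y [a [b [ba ->]]].
by apply: lspan_in; exists a, b; split=> //; rewrite (m2_fvev (rel2_size a b)).
Qed.

Local Notation Sq := (Sq C).
Definition sproj : TV -> Sq := @Sq_proj C.
Lemma sproj_lin : lin sproj.
Proof. by move=> a x y; rewrite /sproj /Sq_proj aprojD aprojZ. Qed.

Lemma sprojM x y : sproj (x * y) = sproj x * sproj y. Proof. exact: aprojM. Qed.

Definition sw (w : word) : Sq := sproj (eK w).
Lemma sw_cat w w' : sw (w ++ w') = sw w * sw w'.
Proof. by rewrite /sw eT_cat sprojM. Qed.

Lemma Sq_mulr_lin (x : Sq) : lin (fun y : Sq => x * y).
Proof. exact: (qalg_mulr_lin TV_scaleAr). Qed.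

Lemma Sq_mull_lin (y : Sq) : lin (fun x : Sq => x * y).
Proof. exact: (@qalg_mull_lin _ TV _). Qed.

Lemma Sq_ctx_lin (x y : Sq) : lin (fun z => x * z * y).
Proof. exact: (lin_comp (Sq_mulr_lin x) (Sq_mull_lin y)). Qed.

Lemma sw_ctx x y v : fvev uK (fun p => sw (x ++ p ++ y)) v = sw x * fvev uK sw v * sw y.
Proof.
apply: esym; apply: (etrans (fvev_lin _ _ (Sq_ctx_lin (sw x) (sw y)))).
by apply: eq_fvev' => p /=; rewrite !sw_cat mulrA.
Qed.

Lemma sw_rule2 a b : lltb b a -> fvev uK sw (rule2 a b) = sw [:: a; b].
Proof.
move=> ba; apply/eqP; rewrite eq_sym -subr_eq0 -(fvev_word (uK0 C)) -fvevB; apply/eqP.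
apply: (etrans (esym (fvev_lin _ _ sproj_lin))).
rewrite -(lin0 sproj_lin); apply/aprojP; rewrite subr0.
rewrite -[X in ideal_gen _ X]mul1r -[X in ideal_gen _ X]mulr1 -[X in ideal_gen _ X]addr0.
by apply: ideal_genD; [exact: Sq_rel_rel2|constructor].
Qed.

Lemma sw_rule2_ctx x a b y : lltb b a ->
  sw (x ++ a :: b :: y) = fvev uK (fun p => sw (x ++ p ++ y)) (rule2 a b).
Proof. by move=> ba; rewrite sw_ctx sw_rule2 // -!sw_cat -catA. Qed.

Lemma red2 a b : red 2 a b -> lltb b a.
Proof. by rewrite /red !andbF orbF. Qed.

Local Opaque rule2 rule33 lltb.

Lemma nfq_sound k w : fvev uK sw (nfq k w) = sw w.
Proof.
elim: k w => [|k IH] w /=; first exact: (fvev_word (uK0 C)).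
case E: fstep => [[[x [a b]] y]|]; last exact: (fvev_word (uK0 C)).
have [wE /red2 r] := fstepP E; rewrite wE.
apply: (etrans (fvev_bind (@uKD C) sw _ (rule2 a b))).
apply: etrans (esym (sw_rule2_ctx x y r)).
by apply: eq_fvev' => p; apply: IH.
Qed.

(** Both reductions of the overlap v_a v_b v_c have its value in S_q(V), so D times the cubic
    relation is zero there. *)
Lemma cubic0 i : fvev uK sw (lphi i) = 0 /\ fvev uK sw (phir i) = 0.
Proof.
have := all_letters cubic_checkP i; case: cubic_data => -[[a b] c] [[D l] r].
case/and5P => ba cb /fv_eqbP e /andP[D0 DN] /andP[/fv_eqbP el /fv_eqbP er].
(* Each D is a unit of A times (q - q^-1)^2: invertible in C(q), although it vanishes at q = 1. *)
have D0' : lpev uK D != 0 := lpK_neq0 (N := 10%Zc) C0 DN D0.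
have c0 : fvev uK sw (cubic i) = 0.
  have := e _ uK _ sw; rewrite fvevB (fvevZ (@uKD C)) !(fvev_bind (@uKD C)) => {}e.
  apply: (scalerI D0'); apply: etrans (esym (scaler0 _ _)); apply: etrans (esym e) _.
  apply/eqP; rewrite subr_eq0; apply/eqP.
  have e1 : fvev uK (fun w => fvev uK sw (nfq 30 (w ++ [:: c]))) (rule2 a b) = sw [:: a; b; c].
    apply: (etrans (eq_fvev' _ _ (fun w => nfq_sound 30 _))).
    exact: (esym (sw_rule2_ctx [::] [:: c] ba)).
  rewrite e1; apply: esym; apply: (etrans (eq_fvev' _ _ (fun w => nfq_sound 30 _))).
  rewrite (sw_rule2_ctx [:: a] [::] cb); by apply: eq_fvev' => w; rewrite cats0.
have := el _ uK _ sw; have := er _ uK _ sw.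
by rewrite !(fvevZ (@uKD C)) c0 !scaler0.
Qed.

Let phi := fvev uK sw phi_fv.

Lemma sw_nil : sw [::] = 1.
Proof. by rewrite /sw eT_nil; exact: (erefl (1 : Sq)). Qed.

Lemma letter_phi i : sw [:: i] * phi = 0.
Proof.
have [h _] := cubic0 i; move: h; rewrite /lphi (fvev_bind (@uKD C)) => h.
apply: etrans h; apply: esym.
apply: (etrans (eq_fvev' uK phi_fv (fun w => nfq_sound 30 (i :: w)))).
apply: etrans (etrans (sw_ctx [:: i] [::] phi_fv) _); last by rewrite sw_nil mulr1.
by apply: eq_fvev' => w; rewrite cats0.
Qed.

Lemma phi_letter i : phi * sw [:: i] = 0.
Proof.
have [_ h] := cubic0 i; move: h; rewrite /phir (fvev_bind (@uKD C)) => h.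
apply: etrans h; apply: esym.
apply: (etrans (eq_fvev' uK phi_fv (fun w => nfq_sound 30 (w ++ [:: i])))).
by apply: etrans (sw_ctx [::] [:: i] phi_fv) _; rewrite sw_nil mul1r.
Qed.

Lemma phi_ctx x y : (0 < size x + size y)%N -> sw x * phi * sw y = 0.
Proof. exact: (ring_phi_ctx sw_cat letter_phi phi_letter). Qed.

(* In degree at least 3 also v_0 v_0 reduces: the S-polynomials of the
   quadratic relations give v_i phi = phi v_i = 0. *)
Lemma sw_red x a b y : red (size (x ++ a :: b :: y)) a b ->
  sw (x ++ a :: b :: y) = fvev uK (fun p => sw (x ++ p ++ y)) (rl a b).
Proof.
rewrite /red /rl; case: ifP => [ba _|_ /=]; first exact: sw_rule2_ctx.
case: a; rewrite // => /andP[]; case: b; rewrite // => _ h.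
apply: etrans (esym (sw_ctx x y rule33)).
apply: (etrans (etrans (sw_cat _ _) (etrans (congr1 (fun z => sw x * z) (sw_cat [:: L3; L3] y)) (mulrA _ _ _)))).
apply: ring_ctxB; have <- : phi = sw [:: L3; L3] - fvev uK sw rule33 by rewrite /phi fvevB (fvev_word (uK0 C)).
by apply: phi_ctx; move: h; rewrite size_cat /=; lia.
Qed.

End SqNormal.

(** * The basis of S_q(V) and of its form over A *)

Section MalgMap.
Variables (A B : comNzRingType) (phi : {rmorphism A -> B}) (X : choiceType).
Local Notation TA := {malg A[X]}.
Local Notation TB := {malg B[X]}.

Definition cmap : TA -> TB := lext phi (fun k => << k >>).

Lemma cmap_semilin : semilin phi cmap. Proof. exact: lext_semilin. Qed.

Lemma cmapU k : cmap << k >> = << k >>. Proof. exact: lextU. Qed.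

Lemma mcoeff_cmap k t : mcoeff k (cmap t) = phi (mcoeff k t).
Proof.
elim/malg_ind: t => [|a j t IH]; first by rewrite (semilin0 cmap_semilin) !mcoeff0 rmorph0.
by rewrite cmap_semilin cmapU !mcoeffD !mcoeffZ IH !mcoeffU rmorphD rmorphM rmorph_nat.
Qed.

Lemma cmap_inj : injective phi -> injective cmap.
Proof. by move=> h s t st; apply/malgP => k; apply: h; rewrite -!mcoeff_cmap st. Qed.

Lemma cmap_surj (t : TB) : (forall k, exists a, mcoeff k t = phi a) -> exists s, t = cmap s.
Proof.
move=> h; have [c hc] := choice h; exists (\sum_(k <- msupp t) c k *: << k >>).
rewrite (semilin_sum _ _ _ cmap_semilin) {1}[t]monalgE; apply: eq_bigr => k _.
rewrite (semilinZ cmap_semilin) cmapU -hc; apply/malgP => j.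
by rewrite mcoeffZ !mcoeffU mulr_natr.
Qed.
End MalgMap.

Lemma cmapM (A B : comNzRingType) (phi : {rmorphism A -> B}) (X : monomType) :
  {morph (@cmap A B phi X) : x y / x * y}.
Proof.
have cl := cmap_semilin phi (X := X).
move=> x y; elim/malg_ind: x => [|a k x IH]; first by rewrite mul0r (semilin0 cl) mul0r.
rewrite [(_ + x) * y]mulrDl cl [RHS]mulrDl (semilinD cl) -IH; congr (_ + _); rewrite -!scalerAl (semilinZ cl).
congr (_ *: _); rewrite cmapU.
elim/malg_ind: {IH} y => [|b j y IH]; first by rewrite mulr0 (semilin0 cl) mulr0.
have e (R : comNzRingType) (c : R) (z : {malg R[X]}) :
    << k >> * (c *: << j >> + z) = c *: << mmul k j >> + << k >> * z.
  by rewrite mulrDr malg_scaleUr malgM_def fgmulUU mulr1.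
apply: etrans (congr1 _ (e A b y)) _; rewrite cl cl IH !cmapU.
exact: esym (e B (phi b) (cmap phi y)).
Qed.

Lemma section_lin (R : nzRingType) (M N : lmodType R) (f : M -> N) (g : N -> M) (p : M -> M) :
  lin f -> lin p -> cancel g f -> (forall t, g (f t) = p t) -> lin g.
Proof.
move=> fl pl gK gf a x y; have pg z : p (g z) = g z by rewrite -gf gK.
have {1}-> : a *: x + y = f (a *: g x + g y) by rewrite fl !gK.
by rewrite gf pl !pg.
Qed.

Section WordInd.
Variables (A B : comNzRingType) (phi : {rmorphism A -> B}) (M : lmodType B).
Local Notation TA := {malg A[{fmonom 'I_7}]}.

Lemma word_ind (P : TA -> Prop) : P 0 -> (forall a x y, P x -> P y -> P (a *: x + y)) ->
  (forall w, P (eT A w)) -> forall x, P x.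
Proof.
move=> P0 PD PE; elim/malg_ind => // a m x Px; rewrite -[m]wmK; exact: PD (PE _) Px.
Qed.

Lemma word_eq (f g : TA -> M) : semilin phi f -> semilin phi g ->
  (forall w, f (eT A w) = g (eT A w)) -> f =1 g.
Proof.
move=> fl gl fg; apply: word_ind => // [|a x y hx hy]; first by rewrite (semilin0 fl) (semilin0 gl).
by rewrite fl gl hx hy.
Qed.
End WordInd.

Section SqBasis.
Variable C : fieldType.
Hypothesis C0 : [pchar C] =i pred0.
Local Notation K := (Kq C).
Local Notation A := (laurent_ring C).
Local Notation uK := (@uK C).
Local Notation uA := (@uA C).
Local Notation TV := (TV C).
Local Notation TA := {malg A[{fmonom 'I_7}]}.
Local Notation eK := (@eT K).
Local Notation eA := (@eT A).
Local Notation lvm := (@lval C : {rmorphism A -> K}).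
Local Notation Sq := (Sq C).
Local Notation sproj := (@sproj C).
Local Notation sw := (@sw C).
Local Notation uAD := (@uAD C).
Local Notation nfA := (nform uA).

Definition iota : TA -> TV := cmap lvm (X := {fmonom 'I_7}).
Lemma iota_semilin : semilin lvm iota. Proof. exact: cmap_semilin. Qed.

Lemma iota_eA w : iota (eA w) = eK w. Proof. exact: cmapU. Qed.

Lemma iota_inj : injective iota.
Proof. by apply: cmap_inj => a b; apply: val_inj. Qed.

Lemma sproj_iota_semilin : semilin lvm (fun t => sproj (iota t)).
Proof. by move=> a x y; rewrite iota_semilin sproj_lin. Qed.

Lemma iota_fvev e v : iota (fvev uA e v) = fvev uK (fun w => iota (e w)) v.
Proof. exact: (fvev_semilin (phi := lvm) e v (fun=> erefl) iota_semilin). Qed.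

Lemma sproj_fvev e v : sproj (fvev uK e v) = fvev uK (fun w => sproj (e w)) v.
Proof. exact: (fvev_lin _ _ (@sproj_lin C)). Qed.

Lemma sw_nform w : sproj (iota (nfA w)) = sw w.
Proof.
have h := nform_compat (u := uA) sproj_iota_semilin.
apply: (etrans (h _ w)); last by rewrite iota_eA.
move=> x a b y r; rewrite iota_eA iota_fvev sproj_fvev.
apply: etrans (sw_red C0 r) _; apply: eq_fvev' => p; by rewrite iota_eA.
Qed.

Definition NA : TA -> TA := lext idfun (fun m => nfA (wm m)).
Lemma NA_lin : lin NA. Proof. exact: lext_lin. Qed.

Lemma NA_eA w : NA (eA w) = nfA w.
Proof. by rewrite /NA /eT lext_linU mwK. Qed.

Lemma sproj_NA t : sproj (iota (NA t)) = sproj (iota t).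
Proof.
have fl : semilin lvm (fun t => sproj (iota (NA t))).
  by move=> a x y; rewrite NA_lin; exact: sproj_iota_semilin.
apply: (word_eq (phi := lvm) fl sproj_iota_semilin) => w.
have h1 := congr1 (fun t => sproj (iota t)) (NA_eA w).
have h2 := etrans (sw_nform w) (esym (congr1 sproj (iota_eA w))).
by have h := etrans h1 h2; apply: h.
Qed.

(** The coefficients are in C(q), but words are reduced over A; this is what makes the normal form
    respect the A-form. *)
Definition NK : TV -> TV := lext idfun (fun m => iota (nfA (wm m))).
Lemma NK_lin : lin NK. Proof. exact: lext_lin. Qed.

Lemma NK_eK w : NK (eK w) = iota (nfA w).
Proof. by rewrite /NK /eT lext_linU mwK. Qed.

Lemma NK_iota t : NK (iota t) = iota (NA t).
Proof.
have fl : semilin lvm (fun t => NK (iota t)) by move=> a x y; rewrite iota_semilin NK_lin.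
have gl : semilin lvm (fun t => iota (NA t)) by move=> a x y; rewrite NA_lin iota_semilin.
apply: (word_eq (phi := lvm) fl gl) => w.
have h1 := etrans (congr1 NK (iota_eA w)) (NK_eK w).
by have h := etrans h1 (esym (congr1 iota (NA_eA w))); apply: h.
Qed.

(** [nform_diamond] at the pair a, b, which need not be the leftmost one in the word. *)
Lemma NK_rel w a b w' : lltb b a -> NK (eK w * fvev uK eK (rel2 a b) * eK w') = 0.
Proof.
move=> ba.
have cl := lin_comp (lin_comp (@TV_mulr_lin C (eK w)) (@TV_mull_lin C (eK w'))) NK_lin.
have e0 := fvev_lin eK (rel2 a b) cl; apply: etrans e0 _.
have -> : fvev uK ((fun x => NK (eK w * x * eK w')) \o eK) (rel2 a b)
  = fvev uK (fun p => iota (nfA (w ++ p ++ w'))) (rel2 a b).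
  by apply: eq_fvev' => p; rewrite /= -!eT_cat NK_eK catA.
rewrite fvevB (fvev_word (uK0 C)) -iota_fvev.
have r : red (size (w ++ a :: b :: w')) a b by rewrite /red ba.
have := nform_diamond uAD (uA0 C) (erefl (w ++ a :: b :: w')) r.
by rewrite /rl ba => <-; rewrite subrr.
Qed.

Lemma TV_ind (P : TV -> Prop) : P 0 -> (forall a x y, P x -> P y -> P (a *: x + y)) ->
  (forall w, P (eK w)) -> forall x, P x.
Proof. exact: word_ind. Qed.

(** The independence half of the diamond lemma: the normal form depends only on the class in S_q(V).
    By [Sq_rel_span] the ideal is generated by the relations, so multiples of these by words
    suffice. *)
Lemma NK_ideal x : ideal_gen (@Sq_rel C) x -> NK x = 0.
Proof.
elim=> [|s r t y Sr _ IH]; first exact: (lin0 NK_lin).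
rewrite (linD NK_lin) IH addr0.
have /(_ C0) := Sq_rel_span _ Sr => {Sr}; move: r.
apply: (lspan_sub (T := fun r => NK (s * r * t) = 0)) => [|a r r' h h'|r [a [b [ba ->]]]].
- by rewrite mulr0 mul0r (lin0 NK_lin).
- exact: etrans (lin_comp (lin_comp (@TV_mulr_lin C s) (@TV_mull_lin C t)) NK_lin a r r') (comb0 a h h').
elim/TV_ind: s => [|c x1 x2 h1 h2|w]; first by rewrite !mul0r (lin0 NK_lin).
  exact: etrans (lin_comp (lin_comp (@TV_mull_lin C _) (@TV_mull_lin C t)) NK_lin c x1 x2) (comb0 c h1 h2).
elim/TV_ind: t => [|c x1 x2 h1 h2|w']; first by rewrite mulr0 (lin0 NK_lin).
  exact: etrans (lin_comp (@TV_mulr_lin C _) NK_lin c x1 x2) (comb0 c h1 h2).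
exact: NK_rel.
Qed.

Lemma sproj_eq0 x : sproj x = 0 -> NK x = 0.
Proof.
rewrite -(lin0 (@sproj_lin C)) => /(proj1 (aprojP _ _ _)); rewrite subr0; exact: NK_ideal.
Qed.

Lemma sproj_iota_eq0 t : sproj (iota t) = 0 -> NA t = 0.
Proof.
by move=> /sproj_eq0; rewrite NK_iota -(semilin0 iota_semilin); apply: iota_inj.
Qed.

Local Notation SA := (SA C).

Lemma sproj_iota_SA t : sproj (iota t) \in @SA_pred C.
Proof.
apply/asboolP; exists (iota t) => //; apply/monalgOverP => m.
by rewrite mcoeff_cmap; apply: lvalP.
Qed.

Definition mkSA (t : TA) : SA := SAelt (sproj_iota_SA t).

Lemma mkSA_lin : lin mkSA.
Proof. by move=> a x y; apply: val_inj; exact: sproj_iota_semilin. Qed.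

Lemma mkSAM : {morph mkSA : x y / x * y}.
Proof. by move=> x y; apply: val_inj; rewrite /= /iota cmapM; apply: sprojM. Qed.

Lemma mkSA1 : mkSA 1 = 1.
Proof. by apply: val_inj; rewrite /= -(eT_nil A) iota_eA; apply: sw_nil. Qed.

Lemma mkSA_NA t : mkSA (NA t) = mkSA t.
Proof. by apply: val_inj; apply: sproj_NA. Qed.

Lemma mkSA_surj x : exists t, mkSA t = x.
Proof.
have /asboolP[s As xs] := sval_SAP x.
have [|t st] := cmap_surj (phi := lvm) (t := s).
  by move=> k; move: As => /monalgOverP /(_ k) h; exists (LaurentRing h).
by exists t; apply: val_inj; rewrite /= xs st.
Qed.

Lemma mkSA_eq0 t : mkSA t = 0 -> NA t = 0.
Proof. by move=> /(congr1 (@sval_SA C)); apply: sproj_iota_eq0. Qed.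

(** The normal form of some preimage. By [mkSA_eq0] the choice of the preimage does not matter, so
    this is a linear section of [mkSA]. *)
Definition liftA (x : SA) : TA := NA (projT1 (cid (mkSA_surj x))).

Lemma liftAK x : mkSA (liftA x) = x.
Proof. by rewrite /liftA mkSA_NA; case: cid. Qed.

Lemma liftA_mkSA t : liftA (mkSA t) = NA t.
Proof.
rewrite /liftA; case: cid => s /= e; apply/eqP; rewrite -subr_eq0 -(linB NA_lin); apply/eqP.
by apply: mkSA_eq0; rewrite (linB mkSA_lin) e subrr.
Qed.

Lemma NA_liftA x : NA (liftA x) = liftA x.
Proof.
have h1 := liftA_mkSA (liftA x); have h2 := congr1 liftA (liftAK x).
by have h := etrans (esym h1) h2; apply: h.
Qed.

Lemma liftA_lin : lin liftA.
Proof. exact: (section_lin mkSA_lin NA_lin liftAK liftA_mkSA). Qed.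

Definition swA (w : word) : SA := mkSA (eA w).
Lemma sval_swA w : sval_SA (swA w) = sw w. Proof. by rewrite /= iota_eA. Qed.

Lemma SA_ind (P : SA -> Prop) : P 0 -> (forall a x y, P x -> P y -> P (a *: x + y)) ->
  (forall w, normal w -> P (swA w)) -> forall x, P x.
Proof.
move=> P0 PD PW x; rewrite -[x]liftAK /liftA; move: (projT1 _).
apply: word_ind => [|a y z hy hz|w].
- by rewrite (lin0 NA_lin) (lin0 mkSA_lin).
- by rewrite NA_lin mkSA_lin; apply: PD.
rewrite NA_eA; move: (nform_span uA w); set z := nform _ _; move: z.
apply: (lspan_sub (T := fun t => P (mkSA t))) => [|b y z hy hz|y [w' nw ->]].
- by rewrite (lin0 mkSA_lin).
- by rewrite mkSA_lin; apply: PD.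
exact: PW.
Qed.

(** Coordinates with respect to the irreducible words. The agreement with [coordK] over C(q) is what
    will give the injectivity of the maps from tensor powers over A. *)
Definition coordA (k : {fmonom 'I_7}) (x : SA) : A := mcoeff k (liftA x).

Lemma SA_coord x : x = \sum_(k <- msupp (liftA x)) coordA k x *: mkSA << k >>.
Proof.
rewrite -{1}[x]liftAK [X in mkSA X]monalgE (lin_sum _ _ _ mkSA_lin); apply: eq_bigr => k _.
by rewrite -(linZ mkSA_lin) malg_scaleU.
Qed.

Definition coordK (k : {fmonom 'I_7}) (x : Sq) : K := mcoeff k (NK (repr (x : qalg (@Sq_rel C)))).

Lemma NK_repr t : NK (repr (sproj t : qalg (@Sq_rel C))) = NK t.
Proof.
apply/eqP; rewrite -subr_eq0 -(linB NK_lin); apply/eqP; apply: NK_ideal.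
by apply/aprojP; rewrite aprojK.
Qed.

Lemma Sq_repr (x : Sq) : exists t : TV, x = sproj t.
Proof. by exists (repr (x : qalg (@Sq_rel C))); rewrite /sproj /Sq_proj aprojK. Qed.

Lemma coordK_lin k : lin (coordK k : Sq -> K^o).
Proof.
move=> a x y; have [s ->] := Sq_repr x; have [t ->] := Sq_repr y.
by rewrite -sproj_lin /coordK !NK_repr NK_lin mcoeffD mcoeffZ.
Qed.

Lemma coordK_sval k x : coordK k (sval_SA x) = lval (coordA k x).
Proof.
have e : sval_SA x = sproj (iota (liftA x)) := congr1 (@sval_SA C) (esym (liftAK x)).
have e1 := etrans (congr1 (fun z => mcoeff k z) (NK_repr (iota (liftA x)))) (congr1 _ (NK_iota _)).
rewrite e; apply: etrans e1 _; rewrite mcoeff_cmap NA_liftA; exact: erefl.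
Qed.

End SqBasis.

Lemma quot_lin (R : nzRingType) (M N P : lmodType R) (p : M -> N) (f : M -> P) (F : N -> P) :
  lin p -> (forall x, exists t, x = p t) -> lin f -> (forall t, F (p t) = f t) -> lin F.
Proof.
move=> pl ps fl h a x y; have [s ->] := ps x; have [t ->] := ps y.
by rewrite -pl !h fl.
Qed.

(** * The module structure of S_q(V) *)

Section Cover.
Variable C : fieldType.
Local Notation K := (Kq C).

Lemma serre_sum_hom (U W : opModule C) (f : U -> W) (X Y : U -> U) (X' Y' : W -> W) i u :
  lin f -> (forall x, f (X x) = X' (f x)) -> (forall x, f (Y x) = Y' (f x)) ->
  serre_sum X' Y' i (f u) = f (serre_sum X Y i u).
Proof.
move=> fl fX fY; rewrite /serre_sum (lin_sum _ _ _ fl); apply: eq_bigr => k _; rewrite (linZ fl).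
have fi n x : f (iter n X x) = iter n X' (f x) by elim: n => //= n IH; rewrite fX IH.
by rewrite fi fY fi.
Qed.

Variable W : opModule C.
Hypothesis Wl : forall g, lin (@act _ W g).

Definition covered (x : W) : Prop := exists (U : opModule C) (f : U -> W) u,
  [/\ Uq_module U, Uq_hom f & x = f u].
Hypothesis cov : forall x, lspan covered x.

Let cov_eq (M : lmodType K) (f g : W -> M) : lin f -> lin g ->
  (forall x, covered x -> f x = g x) -> f =1 g.
Proof.
move=> fl gl fg x; have := cov x; apply: lspan_sub fg _; first by rewrite (lin0 fl) (lin0 gl).
by move=> a y z hy hz; rewrite fl gl hy hz.
Qed.

Let idl := @lin_id K W.
Let cl g h : lin (fun x : W => act g (act h x)) := lin_comp (Wl h) (Wl g).

(** The relations of U_q are linear equations in the vector, and with the type and finiteness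
    conditions they pass to homomorphic images and to sums. It is applied to S_q(V), which is
    covered by the tensor powers of V. *)
Lemma covered_module : Uq_module W.
Proof.
split; last 2 first.
- move=> x; have := cov x; apply: lspan_sub; first exact: lspan0.
    by move=> a y z; apply: lspan_comb.
  by move=> y [U [f [u [[_ U1 _] fh ->]]]]; apply: (wspan_hom fh); apply: U1.
- move=> x; have := cov x; apply: (lspan_sub (T := @lfinite C W)); first exact: lfinite0.
    move=> a y z hy hz; apply: (lfiniteD Wl) hz; have [s [sy sa]] := hy; exists s; split=> //.
    exact: lspan_scale.
  by move=> y [U [f [u [[_ _ UF] fh ->]]]]; apply: (lfinite_hom fh); apply: UF.
split=> [||i|i j|i j|i j|i|i j x ij|i j x ij|i j x ij].
- exact: Wl.
- move=> i; apply: cov_eq (cl _ _) idl _ => x [U [f [u [[Ur _ _] [fl fa] ->]]]].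
  by rewrite -!fa (act_KV Ur).
- apply: cov_eq (cl _ _) idl _ => x [U [f [u [[Ur _ _] [fl fa] ->]]]].
  by rewrite -!fa (act_VK Ur).
- apply: cov_eq (cl _ _) (cl _ _) _ => x [U [f [u [[Ur _ _] [fl fa] ->]]]].
  by rewrite -!fa (act_KK Ur).
- apply: cov_eq (cl _ _) (lin_scale _ (cl _ _)) _ => x [U [f [u [[Ur _ _] [fl fa] ->]]]].
  by rewrite -!fa -(linZ fl) (act_KE Ur).
- apply: cov_eq (cl _ _) (lin_scale _ (cl _ _)) _ => x [U [f [u [[Ur _ _] [fl fa] ->]]]].
  by rewrite -!fa -(linZ fl) (act_KF Ur).
- have l1 := lin_add (cl (gE i) (gF i)) (lin_opp (cl (gF i) (gE i))).
  have l2 := lin_scale (qi C i - (qi C i)^-1)^-1 (lin_add (Wl (gK i)) (lin_opp (Wl (gKV i)))).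
  apply: cov_eq l1 l2 _ => x [U [f [u [[Ur _ _] [fl fa] ->]]]].
  by rewrite -!fa -!(linB fl) -(linZ fl) (act_EF Ur).
- move: x; apply: cov_eq (cl _ _) (cl _ _) _ => x [U [f [u [[Ur _ _] [fl fa] ->]]]].
  by rewrite -!fa (act_EFneq Ur).
- move: x; apply: cov_eq (serre_sum_lin _ (Wl _) (Wl _)) (@lin_cst0 C W W) _ => x [U [f [u [[Ur _ _] [fl fa] ->]]]].
  by rewrite (serre_sum_hom _ _ fl (fa _) (fa _)) (act_serreE Ur) // (lin0 fl).
- move: x; apply: cov_eq (serre_sum_lin _ (Wl _) (Wl _)) (@lin_cst0 C W W) _ => x [U [f [u [[Ur _ _] [fl fa] ->]]]].
  by rewrite (serre_sum_hom _ _ fl (fa _) (fa _)) (act_serreF Ur) // (lin0 fl).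
Qed.

End Cover.

Section SqModule.
Variable C : fieldType.
Hypothesis C0 : [pchar C] =i pred0.
Local Notation K := (Kq C).
Local Notation V := (Vmod C).
Local Notation VV := (otens V V).
Local Notation uK := (@uK C).
Local Notation ev := (@ev C).
Local Notation TV := (TV C).
Local Notation eK := (@eT K).
Local Notation Sq := (Sq C).
Local Notation sproj := (@sproj C).

Definition Tmod : opModule C := @OpModule C TV (@TV_act C).

Lemma Tact_lin g : lin (@act C Tmod g). Proof. exact: lext_lin. Qed.

Let HV : Uq_rel V. Proof. by case: (V_module C). Qed.
Let Vl g : lin (@act C V g) := act_lin HV g.

Lemma Tact_eK g w : TV_act g (eK w) = word_act C g (map lord w).
Proof. by rewrite /TV_act /eT lext_linU /mw fmE. Qed.

(** A generator acts on a product through its coproduct as soon as the left factor is in the image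
    of m. The right factor is arbitrary, since [word_act] peels letters off from the left. *)
Definition tcop (W : opModule C) (m : W -> TV) : Prop := forall g t y,
  TV_act g (m t * y) = match g with
    | gE i => m (act (gE i) t) * TV_act (gK i) y + m t * TV_act (gE i) y
    | gF i => m (act (gF i) t) * y + m (act (gKV i) t) * TV_act (gF i) y
    | gK i => m (act (gK i) t) * TV_act (gK i) y
    | gKV i => m (act (gKV i) t) * TV_act (gKV i) y
    end.

Lemma tcop_eK g a w : TV_act g (vinj (ev a) * eK w) = match g with
    | gE i => vinj (act (gE i) (ev a)) * TV_act (gK i) (eK w) + vinj (ev a) * TV_act (gE i) (eK w)
    | gF i => vinj (act (gF i) (ev a)) * (eK w) + vinj (act (gKV i) (ev a)) * TV_act (gF i) (eK w)
    | gK i => vinj (act (gK i) (ev a)) * TV_act (gK i) (eK w)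
    | gKV i => vinj (act (gKV i) (ev a)) * TV_act (gKV i) (eK w)
    end.
Proof. by rewrite vinj_ev -eT_cat cat1s; case: g => i; rewrite !Tact_eK -?vinj_ev. Qed.

Section Tcop.
Variables (W : opModule C) (m : W -> TV).
Hypotheses (Wl : forall g, lin (@act C W g)) (ml : lin m).

Definition tcopr (g : Uq_gen) (t : W) (y : TV) : TV := match g with
    | gE i => m (act (gE i) t) * TV_act (gK i) y + m t * TV_act (gE i) y
    | gF i => m (act (gF i) t) * y + m (act (gKV i) t) * TV_act (gF i) y
    | gK i => m (act (gK i) t) * TV_act (gK i) y
    | gKV i => m (act (gKV i) t) * TV_act (gKV i) y
    end.

Lemma tcopr_linl g y : lin (tcopr g ^~ y).
Proof.
have L (f : W -> W) z : lin f -> lin (fun t => m (f t) * z).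
  by move=> fl; exact: (lin_comp (lin_comp fl ml) (@TV_mull_lin C z)).
by case: g => i; [apply: lin_add (L _ _ (Wl _)) (L _ _ (@lin_id K W))|
  apply: lin_add (L _ _ (Wl _)) (L _ _ (Wl _))|apply: L (Wl _)|apply: L (Wl _)].
Qed.

Lemma tcopr_linr g t : lin (tcopr g t).
Proof.
have L (f : TV -> TV) z : lin f -> lin (fun y => m z * f y).
  by move=> fl; exact: (lin_comp fl (@TV_mulr_lin C (m z))).
by case: g => i; [apply: lin_add (L _ _ (Tact_lin _)) (L _ _ (Tact_lin _))|
  apply: lin_add (L _ _ (@lin_id K TV)) (L _ _ (Tact_lin _))|apply: L (Tact_lin _)|apply: L (Tact_lin _)].
Qed.

Lemma tcopl_linl g y : lin (fun t => TV_act g (m t * y)).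
Proof. exact: (lin_comp (lin_comp ml (@TV_mull_lin C y)) (Tact_lin g)). Qed.

Lemma tcopl_linr g t : lin (fun y => TV_act g (m t * y)).
Proof. exact: (lin_comp (@TV_mulr_lin C (m t)) (Tact_lin g)). Qed.
End Tcop.

Lemma lin_eq_comb (R : nzRingType) (M N : lmodType R) (f g : M -> N) a x y :
  lin f -> lin g -> f x = g x -> f y = g y -> f (a *: x + y) = g (a *: x + y).
Proof. by move=> fl gl hx hy; rewrite fl gl hx hy. Qed.

Lemma lin_eq0 (R : nzRingType) (M N : lmodType R) (f g : M -> N) :
  lin f -> lin g -> f 0 = g 0.
Proof. by move=> fl gl; rewrite (lin0 fl) (lin0 gl). Qed.

Lemma tcop_vinj : tcop (W := V) (@vinj C).
Proof.
have vl := @vinj_lin C.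
move=> g t y; rewrite -/(tcopr (W := V) (@vinj C) g t y).
elim/TV_ind: y => [|a x y hx hy|w].
- exact: (lin_eq0 (tcopl_linr _ g t) (tcopr_linr _ g t)).
- exact: (lin_eq_comb a (tcopl_linr _ g t) (tcopr_linr _ g t) hx hy).
move: t; apply: V_ind => [a x y hx hy||a].
- exact: (lin_eq_comb a (tcopl_linl vl g _) (tcopr_linl Vl vl g _) hx hy).
- exact: (lin_eq0 (tcopl_linl vl g _) (tcopr_linl Vl vl g _)).
exact: tcop_eK.
Qed.

Lemma copE_ring (T : pzRingType) (a b c d e f g : T) :
  a * (b * c) + d * (e * c + f * g) = (a * b + d * e) * c + d * f * g.
Proof. by rewrite mulrDr mulrDl !mulrA addrA. Qed.

Lemma copF_ring (T : pzRingType) (a b c d e f g : T) :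
  a * (b * c) + d * (e * c + f * g) = (a * b + d * e) * c + (d * f) * g.
Proof. by rewrite mulrDr mulrDl !mulrA addrA. Qed.

Section TcopTens.
Variables (W W' : opModule C) (m : W -> TV) (m' : W' -> TV).
Hypotheses (Wl : forall g, lin (@act C W g)) (Wl' : forall g, lin (@act C W' g)).
Hypotheses (ml : lin m) (ml' : lin m') (mc : tcop m) (mc' : tcop m').
Local Notation WW := (otens W W').

Let m2l v : lin (fun u : W => m u * m' v).
Proof. exact: (lin_comp ml (@TV_mull_lin C _)). Qed.
Let m2r u : lin (fun v : W' => m u * m' v).
Proof. exact: (lin_comp ml' (@TV_mulr_lin C _)). Qed.
Let mm : WW -> TV := tlift idfun (fun u v => m u * m' v).
Let mml : lin mm := tlift_lin m2l m2r.
Let e u v : mm (u (x) v) = m u * m' v := tliftE m2l m2r u v.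

(** Coassociativity: moving a generator past the two left factors one after the other amounts to the
    action on their tensor product. *)
Lemma tcop_tens : tcop mm.
Proof.
have WWl := @otens_lin C W W' Wl Wl'.
move=> g t y; rewrite -/(tcopr mm g t y); move: t.
have l1 := tcopl_linl mml g y; have l2 := tcopr_linl WWl mml g y.
apply: (tens_eqK l1 l2) => u v.
have e0 : TV_act g (mm (u (x) v) * y) = TV_act g (m u * (m' v * y)) by rewrite e mulrA.
have eE i : mm (act (gE i) (u (x) v : WW)) = m (act (gE i) u) * m' (act (gK i) v) + m u * m' (act (gE i) v).
  by have h := congr1 mm (otensE Wl Wl' i u v); apply: etrans h _; rewrite (linD mml) !e.
have eF i : mm (act (gF i) (u (x) v : WW)) = m (act (gF i) u) * m' v + m (act (gKV i) u) * m' (act (gF i) v).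
  by have h := congr1 mm (otensF Wl Wl' i u v); apply: etrans h _; rewrite (linD mml) !e.
have eK i : mm (act (gK i) (u (x) v : WW)) = m (act (gK i) u) * m' (act (gK i) v).
  by have h := congr1 mm (otensK Wl Wl' i u v); apply: etrans h _; rewrite e.
have eKV i : mm (act (gKV i) (u (x) v : WW)) = m (act (gKV i) u) * m' (act (gKV i) v).
  by have h := congr1 mm (otensKV Wl Wl' i u v); apply: etrans h _; rewrite e.
apply: etrans e0 _; rewrite mc /tcopr; case: g {l1 l2} => i.
- by rewrite eE e !mc'; apply: copE_ring.
- by rewrite eF eKV !mc'; apply: copF_ring.
- by rewrite eK !mc' mulrA.
- by rewrite eKV !mc' mulrA.
Qed.

Lemma tcop_hom (f : W' -> Tmod) : Uq_hom f ->
  Uq_hom (tlift idfun (fun u v => m u * f v) : WW -> Tmod).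
Proof.
move=> [fl fa].
have h1 v : lin (fun u : W => m u * f v) := lin_comp ml (@TV_mull_lin C _).
have h2 u : lin (fun v : W' => m u * f v) := lin_comp fl (@TV_mulr_lin C _).
have hl := tlift_lin h1 h2; have hE := tliftE h1 h2.
split; [exact: hl|move=> g].
have l1 := lin_comp (@otens_lin C W W' Wl Wl' g) hl; have l2 := lin_comp hl (Tact_lin g).
apply: (tens_eqK l1 l2) => u v.
have hf := fa : forall g x, f (act g x) = TV_act g (f x).
have r : act g (tlift idfun (fun u v => m u * f v) (u (x) v) : Tmod) = TV_act g (m u * f v).
  by rewrite hE.
apply: etrans (esym r); rewrite mc; case: g {l1 l2 r} => i.
- have h := congr1 (tlift idfun (fun u v => m u * f v)) (otensE Wl Wl' i u v).
  by apply: etrans h _; rewrite (linD hl) !hE !hf.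
- have h := congr1 (tlift idfun (fun u v => m u * f v)) (otensF Wl Wl' i u v).
  by apply: etrans h _; rewrite (linD hl) !hE !hf.
- have h := congr1 (tlift idfun (fun u v => m u * f v)) (otensK Wl Wl' i u v).
  by apply: etrans h _; rewrite !hE !hf.
- have h := congr1 (tlift idfun (fun u v => m u * f v)) (otensKV Wl Wl' i u v).
  by apply: etrans h _; rewrite !hE !hf.
Qed.
End TcopTens.

Lemma tcop_m2 : tcop (W := VV) (@m2 C).
Proof. exact: (tcop_tens Vl Vl (@vinj_lin C) (@vinj_lin C) tcop_vinj tcop_vinj). Qed.

(** Induction on the left context: the coproduct moves the generator past one letter at a time. With
    empty context the generators act on the quadratic relation itself, which stays in the quantum
    exterior square by [wedge_act]. *)
Lemma ideal_gen_lin g w r y : @Sq_rel C r -> ideal_gen (@Sq_rel C) (TV_act g (eK w * r * y)).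
Proof.
move=> [t wt ->]; rewrite -[tlift _ _ t]/(m2 t).
have I0 u z : @wedge2 C u -> ideal_gen (@Sq_rel C) (m2 u * z).
  move=> wu; rewrite -[m2 u * z]addr0 -[m2 u]mul1r; apply: ideal_genD (ideal_gen0 _).
  by exists u.
elim: w g => [|a w IH] g.
  rewrite eT_nil mul1r tcop_m2; have wa g' := wedge_act C0 g' wt.
  case: g => i.
  - exact: (ideal_gen_add (I0 _ _ (wa (gE i))) (I0 _ _ wt)).
  - exact: (ideal_gen_add (I0 _ _ (wa (gF i))) (I0 _ _ (wa (gKV i)))).
  - exact: (I0 _ _ (wa (gK i))).
  - exact: (I0 _ _ (wa (gKV i))).
have -> : eK (a :: w) * m2 t * y = vinj (ev a) * (eK w * m2 t * y).
  by rewrite -cat1s eT_cat vinj_ev !mulrA.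
have I1 u z : ideal_gen (@Sq_rel C) z -> ideal_gen (@Sq_rel C) (u * z).
  by move=> hz; rewrite -[u * z]mulr1; apply: ideal_gen_mul.
have I2 : ideal_gen (@Sq_rel C) (eK w * m2 t * y).
  rewrite -[_ * y]addr0; apply: ideal_genD (ideal_gen0 _).
  by exists t.
have h := tcop_vinj g (ev a) (eK w * m2 t * y); rewrite h {h}; case: g => i.
- exact: (ideal_gen_add (I1 _ _ (IH (gK i))) (I1 _ _ (IH (gE i)))).
- exact: (ideal_gen_add (I1 _ _ I2) (I1 _ _ (IH (gF i)))).
- exact: (I1 _ _ (IH (gK i))).
- exact: (I1 _ _ (IH (gKV i))).
Qed.

Lemma TV_act_ideal g x : ideal_gen (@Sq_rel C) x -> ideal_gen (@Sq_rel C) (TV_act g x).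
Proof.
have l0 := lin0 (Tact_lin g).
elim=> [|s r y z Sr _ IH]; first by have -> : TV_act g 0 = 0 := l0; constructor.
have -> : TV_act g (s * r * y + z) = TV_act g (s * r * y) + TV_act g z := linD (Tact_lin g) _ _.
suff h : ideal_gen (@Sq_rel C) (TV_act g (s * r * y)) by exact: ideal_gen_add h IH.
have l := lin_comp (lin_comp (@TV_mull_lin C r) (@TV_mull_lin C y)) (Tact_lin g).
apply: (proj1 (lspan_ideal_gen _ _)); move: s.
apply: word_ind => [|a s s' hs hs'|w].
- by have -> : TV_act g (0 * r * y) = 0 := lin0 l; apply: lspan0.
- have -> : TV_act g ((a *: s + s') * r * y) = a *: TV_act g (s * r * y) + TV_act g (s' * r * y) := l a s s'.
  exact: (lspan_comb a hs hs').
exact: (proj2 (lspan_ideal_gen _ _) (ideal_gen_lin g w y Sr)).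
Qed.

Local Notation Smod := (Sq_mod C).

Lemma Sq_actE g t : @act C Smod g (sproj t) = sproj (TV_act g t).
Proof.
apply/aprojP; have e := linB (Tact_lin g) (repr (sproj t : qalg (@Sq_rel C))) t.
have h : ideal_gen (@Sq_rel C) (repr (sproj t : qalg (@Sq_rel C)) - t) by apply/aprojP; rewrite aprojK.
have := TV_act_ideal g h; by have -> : TV_act g (repr (sproj t : qalg (@Sq_rel C)) - t) = TV_act g (repr (sproj t : qalg (@Sq_rel C))) - TV_act g t := e.
Qed.

Lemma sproj_hom : Uq_hom (sproj : Tmod -> Smod).
Proof. by split=> [|g x]; [exact: (@sproj_lin C)|rewrite Sq_actE]. Qed.

Lemma Sq_act_lin g : lin (@act C Smod g).
Proof. exact: (quot_lin (@sproj_lin C) (@Sq_repr C) (lin_comp (Tact_lin g) (@sproj_lin C)) (Sq_actE g)). Qed.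

(** Tensor powers nested to the right and ended by the trivial module, in the pattern of the
    recursion in [word_act]. *)
Fixpoint Vn (n : nat) : opModule C := if n is n'.+1 then otens V (Vn n') else triv C.
Lemma Vn_module n : Uq_module (Vn n).
Proof. elim: n => [|n IH]; [exact: triv_module|exact: (otens_module (V_module C) IH)]. Qed.

Let Vnl n g : lin (@act C (Vn n) g).
Proof. by case: (Vn_module n) => h _ _; apply: act_lin h g. Qed.

Fixpoint Mn (n : nat) : Vn n -> Tmod :=
  match n return Vn n -> Tmod with
  | 0 => fun c : K => c *: 1
  | n'.+1 => tlift idfun (fun v x => vinj v * Mn x)
  end.

Lemma Mn_hom n : Uq_hom (@Mn n).
Proof.
elim: n => [|n IH]; last exact: (tcop_hom Vl (@Vnl n) (@vinj_lin C) tcop_vinj IH).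
split=> [a x y|g c]; first by rewrite /= scalerDl -scalerA.
have e : TV_act g (1 : TV) = word_act C g [::] := Tact_eK g [::].
apply: esym; have l := linZ (Tact_lin g) c 1; apply: etrans l _.
have e' : act g (1 : Tmod) = word_act C g [::] := e.
rewrite e'; case: g {e e'} => i /=; by rewrite ?scaler0 ?scale0r.
Qed.

Lemma MnS n v x : @Mn n.+1 (v (x) x) = vinj v * Mn x.
Proof.
have [ml _] := Mn_hom n.
apply: tliftE => [y|u]; [exact: (lin_comp (@vinj_lin C) (@TV_mull_lin C _))|exact: (lin_comp ml (@TV_mulr_lin C _))].
Qed.

Fixpoint evn (w : word) : Vn (size w) :=
  match w return Vn (size w) with
  | [::] => (1 : K)
  | a :: w' => ev a (x) evn w'
  end.

Lemma Mn_evn w : Mn (evn w) = eK w.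
Proof.
elim: w => [|a w IH]; first by rewrite /= scale1r.
by rewrite -[evn (a :: w)]/(ev a (x) evn w) MnS IH vinj_ev -eT_cat.
Qed.

Definition Sn n (x : Vn n) : Smod := sproj (Mn x).
Lemma Sn_hom n : Uq_hom (@Sn n).
Proof.
have [l1 a1] := Mn_hom n; have [l2 a2] := sproj_hom; split; first exact: (lin_comp l1 l2).
by move=> g x; rewrite /Sn a1 a2.
Qed.

Lemma Sn_evn w : Sn (evn w) = sw C w.
Proof. by rewrite /Sn Mn_evn. Qed.

Lemma Sq_module : Uq_module Smod.
Proof.
apply: covered_module => [g|x]; first exact: Sq_act_lin.
have [t ->] := Sq_repr x; elim/TV_ind: t => [|a y z hy hz|w].
- by rewrite (lin0 (@sproj_lin C)); apply: lspan0.
- by rewrite (@sproj_lin C); apply: lspan_comb hy hz.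
apply: lspan_in; exists (Vn (size w)), (@Sn _), (evn w).
by split; [exact: Vn_module|exact: Sn_hom|rewrite Sn_evn].
Qed.

End SqModule.

Lemma lin_ext (R : nzRingType) (M N : lmodType R) (f g : M -> N) : f =1 g -> lin g -> lin f.
Proof. by move=> fg gl a x y; rewrite !fg gl. Qed.

(** * The braiding modulo q - 1 *)

Section Lattices.
Variables (A F : comNzRingType) (l : {rmorphism A -> F}).

(** The span over A inside a module over F; the application has F = C(q). [alat] says that a subset
    is an A-submodule. *)
Inductive aspan (M : lmodType F) (S : M -> Prop) : M -> Prop :=
| aspan0 : aspan S 0
| aspanD a x y : S x -> aspan S y -> aspan S (l a *: x + y).

Definition alat (M : lmodType F) (L : M -> Prop) : Prop :=
  L 0 /\ forall a x y, L x -> L y -> L (l a *: x + y).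

Section Basics.
Variable M : lmodType F.
Implicit Types (S L : M -> Prop).

Lemma alatD L x y : alat L -> L x -> L y -> L (x + y).
Proof. by move=> [_ h] hx hy; rewrite -[x]scale1r -(rmorph1 l); apply: h. Qed.

Lemma alatZ L a x : alat L -> L x -> L (l a *: x).
Proof. by move=> [h0 h] hx; rewrite -[_ *: _]addr0; apply: h. Qed.

Lemma aspan_lat S : alat (aspan S).
Proof.
split=> [|a x y]; first exact: aspan0.
elim=> [|b u v Su _ IH] hy; first by rewrite scaler0 add0r.
by rewrite scalerDr scalerA -rmorphM -addrA; apply: aspanD => //; apply: IH.
Qed.

Lemma aspan_in S x : S x -> aspan S x.
Proof. by move=> Sx; rewrite -[x]addr0 -[x]scale1r -(rmorph1 l); apply: aspanD (aspan0 _). Qed.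

Lemma aspan_sub S L : alat L -> (forall x, S x -> L x) -> forall x, aspan S x -> L x.
Proof. by move=> [L0 LD] SL x; elim=> // a u v /SL Lu _ Lv; apply: LD. Qed.
End Basics.

Lemma alat_preim (M N : lmodType F) (f : M -> N) (L : N -> Prop) : lin f -> alat L ->
  alat (fun x => L (f x)).
Proof. by move=> fl [L0 LD]; split=> [|a x y hx hy]; rewrite ?(lin0 fl) ?fl //; apply: LD. Qed.

Lemma aspan_image (M N : lmodType F) (f : M -> N) (S : M -> Prop) (L : N -> Prop) :
  lin f -> alat L -> (forall x, S x -> L (f x)) -> forall x, aspan S x -> L (f x).
Proof. by move=> fl hL h; apply: aspan_sub h; apply: alat_preim. Qed.

(** The lattice generated by pure tensors within the tensor product over F. Its relation to the
    tensor product over A is established later, through [AmA_incl]. *)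
Definition tl (M N : lmodType F) (L : M -> Prop) (L' : N -> Prop) : tens M N -> Prop :=
  aspan (fun t => exists x y, [/\ L x, L' y & t = x (x) y]).

Lemma tl_in (M N : lmodType F) (L : M -> Prop) (L' : N -> Prop) x y : L x -> L' y -> tl L L' (x (x) y).
Proof. by move=> hx hy; apply: aspan_in; exists x, y. Qed.

Lemma tl_lat (M N : lmodType F) (L : M -> Prop) (L' : N -> Prop) : alat (tl L L').
Proof. exact: aspan_lat. Qed.

Lemma tl_genl (M N : lmodType F) (S L : M -> Prop) (L' : N -> Prop) :
  (forall x, L x -> aspan S x) -> forall t, tl L L' t -> tl S L' t.
Proof.
move=> h t; apply: (aspan_sub (tl_lat S L')) => _ [x [y [/h Sx hy ->]]].
by apply: (aspan_image (tpurel y) (tl_lat S L')) Sx => z Sz; apply: tl_in.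
Qed.

Lemma tl_genr (M N : lmodType F) (L : M -> Prop) (S L' : N -> Prop) :
  (forall x, L' x -> aspan S x) -> forall t, tl L L' t -> tl L S t.
Proof.
move=> h t; apply: (aspan_sub (tl_lat L S)) => _ [x [y [hx /h Sy ->]]].
by apply: (aspan_image (tpurer x) (tl_lat L S)) Sy => z Sz; apply: tl_in.
Qed.

Lemma tl_flip (M N : lmodType F) (L : M -> Prop) (L' : N -> Prop) t : tl L L' t -> tl L' L (tflip t).
Proof.
apply: (aspan_image (@tflip_lin _ M N) (tl_lat L' L)) => _ [x [y [hx hy ->]]].
by rewrite tflipE; apply: tl_in.
Qed.

Section Three.
Variables (U V W : lmodType F) (LU : U -> Prop) (LV : V -> Prop) (LW : W -> Prop).

Lemma tl_assoc t : tl (tl LU LV) LW t -> tl LU (tl LV LW) (tassoc t).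
Proof.
apply: (aspan_image (@tassoc_lin _ U V W) (tl_lat _ _)) => _ [x [w [hx hw ->]]]; move: x hx.
apply: (aspan_image (lin_comp (tpurel w) (@tassoc_lin _ U V W)) (tl_lat _ _)) => _ [u [v [hu hv ->]]].
by rewrite tassocE; apply: tl_in => //; apply: tl_in.
Qed.

Lemma tl_assocV t : tl LU (tl LV LW) t -> tl (tl LU LV) LW (tassocV t).
Proof.
apply: (aspan_image (@tassocV_lin _ U V W) (tl_lat _ _)) => _ [u [x [hu hx ->]]]; move: x hx.
apply: (aspan_image (lin_comp (tpurer u) (@tassocV_lin _ U V W)) (tl_lat _ _)) => _ [v [w [hv hw ->]]].
by rewrite tassocVE; apply: tl_in => //; apply: tl_in.
Qed.

Lemma tl_swap23 t : tl (tl LU LV) LW t -> tl (tl LU LW) LV (tswap23 t).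
Proof.
apply: (aspan_image (@tswap23_lin _ U V W) (tl_lat _ _)) => _ [x [w [hx hw ->]]]; move: x hx.
apply: (aspan_image (lin_comp (tpurel w) (@tswap23_lin _ U V W)) (tl_lat _ _)) => _ [u [v [hu hv ->]]].
by rewrite tswap23E; apply: tl_in => //; apply: tl_in.
Qed.

Let i : {rmorphism F -> F} := idfun.

Lemma tassocK : cancel (@tassoc F U V W) (@tassocV F U V W).
Proof.
apply: tens_eq3 => [||u v w]; [exact: (lin_comp (@tassoc_lin _ U V W) (@tassocV_lin _ U V W))|exact: lin_id|].
by rewrite tassocE tassocVE.
Qed.

Lemma tassocVK : cancel (@tassocV F U V W) (@tassoc F U V W).
Proof.
have l1 := lin_comp (@tassocV_lin _ U V W) (@tassoc_lin _ U V W).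
apply: (tens_eq (phi := i) l1 (@lin_id F _)) => u; apply: (tens_eq (phi := i)) => [||v w].
- exact: (lin_comp (tpurer u) l1).
- exact: tpurer.
by rewrite tassocVE tassocE.
Qed.
End Three.

Lemma tswap23K (U V W : lmodType F) : cancel (@tswap23 F U V W) (@tswap23 F U W V).
Proof.
apply: tens_eq3 => [||u v w]; [exact: (lin_comp (@tswap23_lin _ U V W) (@tswap23_lin _ U W V))|exact: lin_id|].
by rewrite !tswap23E.
Qed.

Lemma tflipK (U V : lmodType F) : cancel (@tflip F U V) (@tflip F V U).
Proof.
have l1 := lin_comp (@tflip_lin _ U V) (@tflip_lin _ V U).
by apply: (tens_eq (phi := (idfun : {rmorphism F -> F})) l1 (@lin_id F _)) => u v; rewrite !tflipE.
Qed.

Variable delta : A.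

Lemma delta_comb (M : lmodType F) (x z : M) b c : c = l (delta * b) ->
  c *: x + l delta *: z = l delta *: (l b *: x + z).
Proof. by move=> ->; rewrite scalerDr scalerA rmorphM. Qed.

(** The congruence of f with the identity modulo [delta] times the lattice; [delta] will be q -
    1. *)
Definition nearid (M : lmodType F) (L : M -> Prop) (f : M -> M) : Prop :=
  forall t, L t -> exists2 z, L z & f t = t + l delta *: z.

Lemma nearid_aspan (M : lmodType F) (S : M -> Prop) (f : M -> M) : lin f ->
  (forall x, S x -> exists2 z, aspan S z & f x = x + l delta *: z) -> nearid (aspan S) f.
Proof.
move=> fl h t; apply: (aspan_sub (L := fun t => exists2 z, aspan S z & f t = t + l delta *: z)) h t.
split=> [|a x y [z hz ex] [z' hz' ey]].
  by exists 0; [exact: aspan0|rewrite (lin0 fl) scaler0 addr0].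
exists (l a *: z + z'); first exact: (proj2 (aspan_lat S)).
by rewrite fl ex ey !scalerDr addrACA !scalerA [l a * _]mulrC.
Qed.

Lemma nearid_tl (M N : lmodType F) (L : M -> Prop) (L' : N -> Prop) (f : tens M N -> tens M N) : lin f ->
  (forall x y, L x -> L' y -> exists2 z, tl L L' z & f (x (x) y) = x (x) y + l delta *: z) ->
  nearid (tl L L') f.
Proof. by move=> fl h; apply: nearid_aspan => // _ [x [y [hx hy ->]]]; apply: h. Qed.

Lemma nearid_comp (M : lmodType F) (L : M -> Prop) (f g : M -> M) : alat L -> lin f ->
  nearid L f -> nearid L g -> nearid L (fun x => f (g x)).
Proof.
move=> hL fl hf hg t Lt; have [z hz e] := hg t Lt; have [z1 hz1 e1] := hf _ Lt.
have [z2 hz2 e2] := hf _ hz; exists (z1 + (z + l delta *: z2)).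
  by apply: alatD => //; apply: alatD => //; apply: alatZ.
by rewrite e (linD fl) (linZ fl) e1 e2 !scalerDr -!addrA.
Qed.

Lemma nearid_conj (M N : lmodType F) (L : M -> Prop) (L' : N -> Prop) (h : M -> N) (k : N -> M) (f : N -> N) :
  lin k -> cancel h k -> (forall t, L t -> L' (h t)) -> (forall t, L' t -> L (k t)) ->
  nearid L' f -> nearid L (fun t => k (f (h t))).
Proof.
move=> kl hk hh hk' hf t Lt; have [z hz e] := hf _ (hh _ Lt); exists (k z); first exact: hk'.
by rewrite e (linD kl) (linZ kl) hk.
Qed.

Lemma nearid_mapl (M N : lmodType F) (L : M -> Prop) (L' : N -> Prop) (f : M -> M) : lin f ->
  nearid L f -> nearid (tl L L') (tmap f (@idfun N)).
Proof.
move=> fl hf; have l1 := tmap_lin fl (@lin_id F N).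
apply: nearid_tl => // x y hx hy; have [z hz e] := hf x hx; exists (z (x) y); first exact: tl_in.
by rewrite (tmapE fl (@lin_id F N)) e tpureDl tpureZl.
Qed.

Lemma nearid_mapr (M N : lmodType F) (L : M -> Prop) (L' : N -> Prop) (f : N -> N) : lin f ->
  nearid L' f -> nearid (tl L L') (tmap (@idfun M) f).
Proof.
move=> fl hf; have l1 := tmap_lin (@lin_id F M) fl.
apply: nearid_tl => // x y hx hy; have [z hz e] := hf y hy; exists (x (x) z); first exact: tl_in.
by rewrite (tmapE (@lin_id F M) fl) e tpureDr tpureZr.
Qed.

Lemma nearid_id (M : lmodType F) (L : M -> Prop) (f : M -> M) : alat L -> (forall x, f x = x) -> nearid L f.
Proof. by move=> [L0 _] h t _; exists 0; rewrite ?scaler0 ?addr0. Qed.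
End Lattices.

Lemma image_lat (B F : comNzRingType) (l : {rmorphism B -> F}) (M : lmodType B) (N : lmodType F) (f : M -> N) :
  semilin l f -> alat l (fun x => exists y, x = f y).
Proof.
move=> fl; split=> [|a x y [u ->] [v ->]]; first by exists 0; rewrite (semilin0 fl).
by exists (a *: u + v); rewrite fl.
Qed.

(** * The R-matrix modulo q - 1 *)

Section Braid.
Variable C : fieldType.
Hypothesis C0 : [pchar C] =i pred0.
Local Notation K := (Kq C).
Local Notation A := (laurent_ring C).
Local Notation V := (Vmod C).
Local Notation uK := (@uK C).
Local Notation uA := (@uA C).
Local Notation ev := (@ev C).
Local Notation e2 := (@e2 C).
Local Notation lvm := (@lval C : {rmorphism A -> K}).
Local Notation delta := (uA 1%Zc - 1).
Local Notation nearid := (nearid lvm delta).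
Local Notation tl := (tl lvm).
Local Notation aspan := (aspan lvm).
Local Notation alat := (alat lvm).
Variable Rm : Rfamily C.
Hypotheses (HR : universal_R Rm) (Rn : R_normalised Rm).

Section TwoModules.
Variables U W : opModule C.
Hypotheses (HU : Uq_module U) (HW : Uq_module W).

Lemma RmE t : Rm t = tflip (Rcheck Rm t : tens W U).
Proof. by rewrite /Rcheck tflipK. Qed.

Lemma Rm_lin : lin (@Rm U W).
Proof.
have [h _] := UR_hom HR HU HW.
exact: (lin_ext (f := @Rm U W) RmE (lin_comp h (@tflip_lin K W U))).
Qed.
End TwoModules.

Definition good (U W : opModule C) (LU : U -> Prop) (LW : W -> Prop) : Prop :=
  nearid (tl LU LW) (@Rm U W).

Section ThreeModules.
Variables U V W : opModule C.
Hypotheses (HU : Uq_module U) (HV : Uq_module V) (HW : Uq_module W).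
Variables (LU : U -> Prop) (LV : V -> Prop) (LW : W -> Prop).

Lemma nearid_R13 : good LU LW -> nearid (tl (tl LU LV) LW) (@R13 C Rm U V W).
Proof.
move=> h; have l1 := tmap_lin (Rm_lin HU HW) (@lin_id K V).
apply: (nearid_conj (L' := tl (tl LU LW) LV) (@tswap23_lin _ U W V) (@tswap23K _ U V W)).
- exact: tl_swap23.
- exact: tl_swap23.
by apply: nearid_mapl h; apply: Rm_lin.
Qed.

Lemma R13_lin : lin (@R13 C Rm U V W).
Proof.
have l1 := tmap_lin (Rm_lin HU HW) (@lin_id K V).
exact: (lin_comp (lin_comp (@tswap23_lin _ U V W) l1) (@tswap23_lin _ U W V)).
Qed.

(** By the first hexagon axiom R acts as R_13 R_23, a composite of conjugates of maps that are
    congruent to the identity; the conjugating associativity and exchange maps preserve the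
    lattices. *)
Lemma good_otensl : good LU LW -> good LV LW -> good (U := otens U V) (tl LU LV) LW.
Proof.
move=> h1 h2 t ht.
have hR : nearid (tl (tl LU LV) LW) (@R23 C Rm U V W).
  apply: (nearid_conj (L' := tl LU (tl LV LW)) (@tassocV_lin _ U V W) (@tassocK _ U V W)).
  - exact: tl_assoc.
  - exact: tl_assocV.
  by apply: nearid_mapr h2; apply: Rm_lin.
have [z hz e] := nearid_comp (tl_lat _ _ _) R13_lin (nearid_R13 h1) hR ht.
by exists z => //; rewrite -e; exact: (UR_coprodl HR HU HV HW t).
Qed.

Lemma good_otensr : good LU LV -> good LU LW -> good (W := otens V W) LU (tl LV LW).
Proof.
move=> h1 h2 t ht.
have hR : nearid (tl (tl LU LV) LW) (@R12 C Rm U V W).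
  by apply: nearid_mapl h1; apply: Rm_lin.
have hc := nearid_comp (tl_lat _ _ _) R13_lin (nearid_R13 h2) hR.
have [z hz e] := nearid_conj (@tassoc_lin _ U V W) (@tassocVK _ U V W)
  (fun t => @tl_assocV _ _ lvm _ _ _ LU LV LW t) (fun t => @tl_assoc _ _ lvm _ _ _ LU LV LW t) hc ht.
exists z => //; rewrite -e.
have a1 := UR_coprodr HR HU HV HW (tassocV t).
have a2 := congr1 (@Rm U (otens V W)) (@tassocVK K U V W t).
by have a3 := etrans (esym a2) a1; apply: a3.
Qed.
End ThreeModules.

(** Naturality: R at p t (x) y is the image of R at t (x) y. The lattice LU only has to be spanned
    over A by images of good lattices, and p must send these into LU so that the error term stays in
    the lattice. *)
Lemma good_coverl (U W : opModule C) (LU : U -> Prop) (LW : W -> Prop) :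
  Uq_module U -> Uq_module W ->
  (forall x, LU x -> aspan (fun x => exists (U' : opModule C) (L' : U' -> Prop) (p : U' -> U) t,
     [/\ Uq_module U', Uq_hom p, good L' LW, forall s, L' s -> LU (p s) & L' t /\ x = p t]) x) ->
  good LU LW.
Proof.
move=> HU HW cov.
pose S := fun x => exists (U' : opModule C) (L' : U' -> Prop) (p : U' -> U) t,
     [/\ Uq_module U', Uq_hom p, good L' LW, forall s, L' s -> LU (p s) & L' t /\ x = p t].
have SL x : S x -> LU x by move=> [U' [L' [p [t [_ _ _ h [ht ->]]]]]]; apply: h.
have h : nearid (tl S LW) (@Rm U W).
  apply: nearid_tl; first exact: Rm_lin.
  move=> _ y [U' [L' [p [t [HU' hp hg hL [ht ->]]]]]] hy.
  have [z hz e] := hg _ (tl_in lvm ht hy); have [pl _] := hp.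
  have idh : Uq_hom (@idfun W) by split.
  have N := UR_natural HR HU' HW HU HW hp idh (t (x) y).
  exists (tmap p (@idfun W) z).
    apply: (aspan_image (tmap_lin pl (@lin_id K W)) (tl_lat _ S LW)) hz => _ [s [y' [hs hy' ->]]].
    rewrite (tmapE pl (@lin_id K W)); apply: tl_in => //.
    by exists U', L', p, s.
  have tE := tmapE pl (@lin_id K W); have tL := tmap_lin pl (@lin_id K W).
  by move: N; rewrite tE e (linD tL) (linZ tL) tE => ->.
move=> t ht; have [z hz e] := h t (tl_genl cov ht); exists z => //.
by apply: (aspan_sub (tl_lat _ LU LW)) hz => _ [x [y [hx hy ->]]]; apply: tl_in => //; apply: SL.
Qed.

Lemma good_coverr (U W : opModule C) (LU : U -> Prop) (LW : W -> Prop) :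
  Uq_module U -> Uq_module W ->
  (forall x, LW x -> aspan (fun x => exists (U' : opModule C) (L' : U' -> Prop) (p : U' -> W) t,
     [/\ Uq_module U', Uq_hom p, good LU L', forall s, L' s -> LW (p s) & L' t /\ x = p t]) x) ->
  good LU LW.
Proof.
move=> HU HW cov.
pose S := fun x => exists (U' : opModule C) (L' : U' -> Prop) (p : U' -> W) t,
     [/\ Uq_module U', Uq_hom p, good LU L', forall s, L' s -> LW (p s) & L' t /\ x = p t].
have SL x : S x -> LW x by move=> [U' [L' [p [t [_ _ _ h [ht ->]]]]]]; apply: h.
have h : nearid (tl LU S) (@Rm U W).
  apply: nearid_tl; first exact: Rm_lin.
  move=> x _ hx [U' [L' [p [t [HU' hp hg hL [ht ->]]]]]].
  have [z hz e] := hg _ (tl_in lvm hx ht); have [pl _] := hp.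
  have idh : Uq_hom (@idfun U) by split.
  have N := UR_natural HR HU HU' HU HW idh hp (x (x) t).
  exists (tmap (@idfun U) p z).
    apply: (aspan_image (tmap_lin (@lin_id K U) pl) (tl_lat _ LU S)) hz => _ [y' [s [hy' hs ->]]].
    rewrite (tmapE (@lin_id K U) pl); apply: tl_in => //.
    by exists U', L', p, s.
  have tE := tmapE (@lin_id K U) pl; have tL := tmap_lin (@lin_id K U) pl.
  by move: N; rewrite tE e (linD tL) (linZ tL) tE => ->.
move=> t ht; have [z hz e] := h t (tl_genr cov ht); exists z => //.
by apply: (aspan_sub (tl_lat _ LU LW)) hz => _ [x [y [hx hy ->]]]; apply: tl_in => //; apply: SL.
Qed.

Lemma trivial_hom (T : opModule C) (m : tens T T -> T) :
  (forall g, lin (@act C T g)) ->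
  (forall i (x : T), act (gE i) x = 0 /\ act (gF i) x = 0) ->
  (forall i (x : T), act (gK i) x = x /\ act (gKV i) x = x) ->
  lin m -> Uq_hom (m : otens T T -> T).
Proof.
move=> Tl EF0 KK ml; split; [exact: ml|move=> g].
have E0 i x := proj1 (EF0 i x); have F0 i x := proj2 (EF0 i x).
have K1 i x := proj1 (KK i x); have K2 i x := proj2 (KK i x).
have t0l (t : T) : (0 : T) (x) t = 0 := lin0 (tpurel t).
have t0r (t : T) : t (x) (0 : T) = 0 := lin0 (tpurer t).
have l1 := lin_comp (otens_lin Tl Tl g) ml; have l2 := lin_comp ml (Tl g).
apply: (tens_eqK l1 l2) => u v; case: g {l1 l2} => i.
- by rewrite (otensE Tl Tl i u v) !E0 t0l t0r addr0 (lin0 ml).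
- by rewrite (otensF Tl Tl i u v) !F0 t0l t0r addr0 (lin0 ml).
- by rewrite (otensK Tl Tl i u v) !K1.
- by rewrite (otensKV Tl Tl i u v) !K2.
Qed.

Section Triv.
Variables T W : opModule C.
Hypotheses (HT : Uq_module T) (HW : Uq_module W).
Variables (one : T) (mulT : tens T T -> T).
Hypothesis one_gen : forall a : T, exists c : K, a = c *: one.
Hypothesis mulT_hom : Uq_hom (mulT : otens T T -> T).
Hypothesis one_mul : mulT (one (x) one) = one.
Let mulT_lin : lin mulT. Proof. by case: mulT_hom. Qed.

Lemma triv_tensl (t : tens T W) : exists w, t = one (x) w.
Proof.
elim/tens_ind: t => [|a w t [w' ->]]; first by exists 0; rewrite (lin0 (tpurer one)).
have [c ->] := one_gen a; exists (c *: w + w').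
by rewrite (tpurer one) tpureZl.
Qed.

Lemma triv_tensr (t : tens W T) : exists w, t = w (x) one.
Proof.
elim/tens_ind: t => [|w a t [w' ->]]; first by exists 0; rewrite (lin0 (tpurel one)).
have [c ->] := one_gen a; exists (c *: w + w').
by rewrite (tpurel one) tpureZr.
Qed.

(* By the hexagon R is idempotent on 1 (x) W; being bijective, it is the identity. *)
Lemma Rm_trivl (t : tens T W) : Rm (t : otens T W) = t.
Proof.
have [w ->] := triv_tensl t.
have [w1 e1] := triv_tensl (Rm (one (x) w : otens T W)).
have [w2 e2] := triv_tensl (Rm (one (x) w1 : otens T W)).
have HTT := otens_module HT HT.
have idh : Uq_hom (@idfun W) by split.
have := UR_natural HR HTT HW HT HW mulT_hom idh ((one (x) one) (x) w).
have tE := tmapE mulT_lin (@lin_id K W).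
rewrite tE one_mul (UR_coprodl HR HT HT HW) /R13 /R23 tassocE.
rewrite (tmapE (@lin_id K T) (Rm_lin HT HW)) e1 tassocVE tswap23E /idfun.
rewrite (tmapE (Rm_lin HT HW) (@lin_id K T)) e2 tswap23E tE one_mul => e.
have [g gK _] := UR_bij HR HT HW.
by move: e => /= e; rewrite -[LHS]gK e2 e -e1 gK.
Qed.

Lemma Rm_trivr (t : tens W T) : Rm (t : otens W T) = t.
Proof.
have [w ->] := triv_tensr t.
have [w1 e1] := triv_tensr (Rm (w (x) one : otens W T)).
have [w2 e2] := triv_tensr (Rm (w1 (x) one : otens W T)).
have HTT := otens_module HT HT.
have idh : Uq_hom (@idfun W) by split.
have := UR_natural HR HW HTT HW HT idh mulT_hom (w (x) (one (x) one)).
have tE := tmapE (@lin_id K W) mulT_lin.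
have := UR_coprodr HR HW HT HT ((w (x) one) (x) one); rewrite tassocE => ->.
rewrite tE one_mul /R13 /R12.
rewrite (tmapE (Rm_lin HW HT) (@lin_id K T)) e1 tswap23E /idfun.
rewrite (tmapE (Rm_lin HW HT) (@lin_id K T)) e2 tswap23E tassocE tE one_mul => e.
have [g gK _] := UR_bij HR HW HT.
by move: e => /= e; rewrite -[LHS]gK e2 e -e1 gK.
Qed.

End Triv.

Section TrivC.
Let T := triv C.
Let HT : Uq_module T := triv_module C.
Let one : T := (1 : K).

Let one_gen (a : T) : exists c : K, a = c *: one.
Proof. by exists (a : K); rewrite [RHS]mulr1. Qed.

Let mulT : tens T T -> T := tlift idfun (fun a b : T => (a : K) *: b).
Let ml1 (b : T) : lin (fun a : T => (a : K) *: b).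
Proof. by move=> c x y; rewrite scalerDl -scalerA. Qed.
Let ml2 (a : T) : lin (fun b : T => (a : K) *: b).
Proof. exact: (lin_scale _ (@lin_id K T)). Qed.
Let mulT_lin : lin mulT := tlift_lin ml1 ml2.

Let mulT_hom : Uq_hom (mulT : otens T T -> T).
Proof.
apply: (trivial_hom _ _ _ mulT_lin) => [g|i x|i x].
- by case: HT => h _ _; apply: act_lin h g.
- by split.
by split.
Qed.

Let one_mul : mulT (one (x) one) = one.
Proof. by rewrite /mulT (tliftE ml1 ml2) scale1r. Qed.

Definition Ltriv : T -> Prop := aspan (fun x => x = one).

Lemma good_trivl (W : opModule C) (L : W -> Prop) : Uq_module W -> good (U := T) Ltriv L.
Proof.
move=> HW; apply: nearid_id; first exact: tl_lat.
exact: (Rm_trivl HT HW one_gen mulT_hom one_mul).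
Qed.

Lemma good_trivr (W : opModule C) (L : W -> Prop) : Uq_module W -> good (W := T) L Ltriv.
Proof.
move=> HW; apply: nearid_id; first exact: tl_lat.
exact: (Rm_trivr HT HW one_gen mulT_hom one_mul).
Qed.
End TrivC.

Definition LV : V -> Prop := aspan (fun v => exists a, v = ev a).

(** The sum of the coefficients is the value at q = 1, so [theta_eq0] applies. *)
Lemma lpev_sum0 l : lp_sum l = Z0 -> exists b : A, lpev uK l = lvm (delta * b).
Proof.
move=> l0; have [b e] : exists b : A, lpev uA l = delta * b; last first.
  by exists b; rewrite -e; apply: esym; apply: lval_lpev.
apply: theta_eq0; rewrite theta_lpev.
suff -> : lpev (@u1 C) l = zr C (lp_sum l) by rewrite l0.
elim: l {l0} => [|x l IH]; first by rewrite lpev_nil.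
by rewrite lpev_cons IH mulr1 -zrD.
Qed.

Lemma e2_tl w : tl LV LV (e2 w).
Proof.
have h0 : tl LV LV 0 := aspan0 _ _.
case: w => [|a [|b [|c w]]]; [exact: h0|exact: h0| |exact: h0].
by apply: tl_in; apply: aspan_in; [exists a|exists b].
Qed.

Lemma fvev_delta (v : fv) : all (fun x => Z.eqb (lp_sum x.2) Z0) v ->
  exists2 z, tl LV LV z & fvev uK e2 v = lvm delta *: z.
Proof.
elim: v => [|x v IH]; first by exists 0; [exact: aspan0|rewrite fvev_nil scaler0].
move=> /andP[/Z.eqb_eq /lpev_sum0[b e] /IH[z hz ez]].
exists (lvm b *: e2 x.1 + z); first exact: (proj2 (tl_lat _ _ _) b _ _ (e2_tl x.1) hz).
have h1 := delta_comb (e2 x.1) z e.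
have h2 : fvev uK e2 (x :: v) = lpev uK x.2 *: e2 x.1 + lvm delta *: z by rewrite -ez fvev_cons.
by have h := etrans h2 h1; apply: h.
Qed.

(** The normalisation makes Rcheck explicit on V (x) V, and [flip_check] shows that it is the flip
    modulo q - 1; R is Rcheck followed by the flip. *)
Lemma good_VV : good LV LV.
Proof.
have HV := V_module C; have Rl := Rm_lin HV HV.
have h : nearid (tl (fun v => exists a, v = ev a) (fun v => exists a, v = ev a)) (@Rm V V).
  apply: nearid_tl => // _ _ [a ->] [b ->].
  have /fvev_delta[z hz ez] := all2lP flip_checkP a b.
  exists (tflip z).
    apply: (aspan_image (@tflip_lin _ V V) (tl_lat _ _ _)) (hz) => _ [x [y [hx hy ->]]]; rewrite tflipE.
    apply: tl_genl (fun x hx => hx) _ _; apply: tl_genr (fun x hx => hx) _ _; exact: tl_in.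
  have e : Rcheck Rm (ev a (x) ev b) = ev b (x) ev a + lvm delta *: z.
    rewrite (Rcheck_R0v C0 Rn) /R0v VVextE; move: ez; rewrite fvevB (fvev_word (uK0 C)) => <-.
    by rewrite [RHS]addrC subrK.
  rewrite RmE e (linD (@tflip_lin K V V)) (linZ (@tflip_lin K V V)) tflipE; exact: erefl.
move=> t ht; have ht' := tl_genl (fun x hx => hx) (tl_genr (fun x hx => hx) ht).
have [z hz e] := h t ht'; exists z => //.
apply: (aspan_sub (tl_lat _ LV LV)) hz => _ [x [y [hx hy ->]]]; apply: tl_in; exact: aspan_in.
Qed.

End Braid.

(** * Base change and products *)

Section BaseChangeTheory.
Variables (A C : comNzRingType) (th : {rmorphism A -> C}).

Section One.
Variable M : lmodType A.
Local Notation B := (bchange th M).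

Lemma bpure_semilin : semilin th (bpure th : M -> B).
Proof.
have D z z' : bpure th (z + z') = bpure th z + bpure th z' :> B.
  by rewrite /bpure -qprojD; apply/qprojP; rewrite opprD addrA; apply: lspan_in; exact: bchange_add.
have Z a z : bpure th (a *: z) = th a *: bpure th z :> B.
  by rewrite /bpure -qprojZ; apply/qprojP; apply: lspan_in; exact: bchange_scale.
by move=> a x y; rewrite D Z.
Qed.

Lemma bchange_ind (P : B -> Prop) : P 0 -> (forall c x y, P y -> P (c *: bpure th x + y)) -> forall b, P b.
Proof.
move=> P0 PD b; rewrite -[b]qprojK; elim/malg_ind: (repr b) => [|c x t IH].
  by rewrite -(scale0r 0) qprojZ scale0r.
by rewrite qprojD qprojZ; apply: PD.
Qed.

Lemma bchange_eq (P : lmodType C) (f g : B -> P) : lin f -> lin g ->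
  (forall x, f (bpure th x) = g (bpure th x)) -> f =1 g.
Proof.
move=> fl gl fg; apply: bchange_ind => [|c x y h]; first by rewrite (lin0 fl) (lin0 gl).
by rewrite fl gl fg h.
Qed.

Variables (P : lmodType C) (f : M -> P).
Hypothesis fl : semilin th f.

Lemma bliftE x : blift f (bpure th x) = f x.
Proof. by apply: blift_pure; rewrite ?rmorph1. Qed.

Lemma blift_lin : lin (@blift A C th M P f).
Proof.
pose i : {rmorphism C -> C} := idfun.
move=> a x y; have R b : lext i f (repr (qproj (bchange_rel th (M:=M)) b)) = lext i f b.
  by apply: lext_qmod; apply: (blift_rel (theta := th)); rewrite ?rmorph1.
have e : a *: x + y = qproj (bchange_rel th (M:=M)) (a *: repr x + repr y) by rewrite qprojD qprojZ !qprojK.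
by rewrite {1}e [LHS]R (lextD i) (lextZ i).
Qed.
End One.

Section BliftTwo.
Variables (M N : lmodType A) (P : lmodType C) (H : M -> N -> P).
Hypotheses (Hl : forall n, semilin th (H^~ n)) (Hr : forall m, semilin th (H m)).

Definition blift2 (b : bchange th M) (b' : bchange th N) : P :=
  blift (fun m : M => blift (H m) b') b.

Let aux (b' : bchange th N) : semilin th (fun m => blift (H m) b').
Proof.
move=> a x y; move: b'.
have l1 := lin_add (lin_scale (th a) (blift_lin (Hr x))) (blift_lin (Hr y)).
have e := bchange_eq (blift_lin (Hr (a *: x + y))) l1; apply: e => n.
by rewrite !(bliftE (Hr _)) Hl.
Qed.

Lemma blift2_linl b' : lin (blift2^~ b').
Proof. exact: (blift_lin (aux b')). Qed.

Lemma blift2E m n : blift2 (bpure th m) (bpure th n) = H m n.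
Proof. by rewrite /blift2 (bliftE (aux _)) (bliftE (Hr _)). Qed.

Lemma blift2_linr b : lin (blift2 b).
Proof.
move=> a x y; move: b.
have l1 := lin_add (lin_scale a (blift2_linl x)) (blift2_linl y).
have e := bchange_eq (blift2_linl (a *: x + y)) l1; apply: e => m.
by rewrite /blift2 !(bliftE (aux _)) (blift_lin (Hr m)).
Qed.
End BliftTwo.

Section Bmix.
Variables M N : lmodType A.
(** Base change commutes with tensor products. This bilinear map is the nontrivial direction, from
    which the inverse of the canonical identification is built. *)
Definition bmix : bchange th M -> bchange th N -> bchange th (tens M N) :=
  blift2 (fun m n => bpure th (m (x) n)).

Let Hl n : semilin th (fun m : M => bpure th (m (x) n) : bchange th (tens M N)).
Proof. by move=> a x y; rewrite (tpurel n) bpure_semilin. Qed.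
Let Hr m : semilin th (fun n : N => bpure th (m (x) n) : bchange th (tens M N)).
Proof. by move=> a x y; rewrite (tpurer m) bpure_semilin. Qed.

Lemma bmix_linl b' : lin (bmix^~ b'). Proof. exact: (blift2_linl Hl Hr b'). Qed.

Lemma bmix_linr b : lin (bmix b). Proof. exact: (blift2_linr Hl Hr b). Qed.

Lemma bmixE m n : bmix (bpure th m) (bpure th n) = bpure th (m (x) n).
Proof. exact: (blift2E Hl Hr m n). Qed.
End Bmix.
End BaseChangeTheory.

Section Bil.
Variables (F : comNzRingType) (M N M' N' P : lmodType F) (H : M -> N -> M' -> N' -> P).
Hypothesis H1 : forall b a' b', lin (fun a => H a b a' b').
Hypothesis H2 : forall a a' b', lin (fun b => H a b a' b').
Hypothesis H3 : forall a b b', lin (fun a' => H a b a' b').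
Hypothesis H4 : forall a b a', lin (fun b' => H a b a' b').

(** The common shape of the products of [tens_alg] and of [braided]. *)
Definition bil (s : tens M N) (t : tens M' N') : P :=
  tlift idfun (fun a b => tlift idfun (H a b) t) s.

Let i : {rmorphism F -> F} := idfun.

Lemma bil_in a b : lin (fun t => tlift idfun (H a b) t).
Proof. exact: tlift_lin. Qed.

Let inE a b a' b' : tlift idfun (H a b) (a' (x) b') = H a b a' b'.
Proof. exact: tliftE. Qed.

Let out1 t b : lin (fun a => tlift idfun (H a b) t).
Proof.
move=> c x y; move: t; have l1 := lin_add (lin_scale c (bil_in x b)) (bil_in y b).
by apply: (tens_eq (phi := i) (bil_in _ b) l1) => a' b'; rewrite !inE H1.
Qed.

Let out2 t a : lin (fun b => tlift idfun (H a b) t).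
Proof.
move=> c x y; move: t; have l1 := lin_add (lin_scale c (bil_in a x)) (bil_in a y).
by apply: (tens_eq (phi := i) (bil_in a _) l1) => a' b'; rewrite !inE H2.
Qed.

Lemma bil_linl t : lin (bil^~ t).
Proof. exact: tlift_lin (out1 t) (out2 t). Qed.

Lemma bil_pure a b t : bil (a (x) b) t = tlift idfun (H a b) t.
Proof. exact: tliftE (out1 t) (out2 t) a b. Qed.

Lemma bil_linr s : lin (bil s).
Proof.
move=> c x y; move: s; have l1 := lin_add (lin_scale c (bil_linl x)) (bil_linl y).
by apply: (tens_eq (phi := i) (bil_linl _) l1) => a b; rewrite !bil_pure bil_in.
Qed.

Lemma bilE a b a' b' : bil (a (x) b) (a' (x) b') = H a b a' b'.
Proof. by rewrite bil_pure inE. Qed.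
End Bil.

Section TmapLin.
Variables (F : comNzRingType) (M M' N N' : lmodType F).
Let i : {rmorphism F -> F} := idfun.

Lemma tmap_linf (X : lmodType F) (f : X -> M -> M') (g : N -> N') t :
  (forall x, lin (f x)) -> (forall m, lin (f^~ m)) -> lin g -> lin (fun x => tmap (f x) g t).
Proof.
move=> f1 f2 gl c x y; move: t; have l z := tmap_lin (f1 z) gl.
have l1 := lin_add (lin_scale c (l x)) (l y).
apply: (tens_eq (phi := i) (l _) l1) => m n.
by rewrite !(tmapE (f1 _) gl) f2 tpureDl tpureZl.
Qed.

Lemma tmap_ling (X : lmodType F) (f : M -> M') (g : X -> N -> N') t :
  lin f -> (forall x, lin (g x)) -> (forall m, lin (g^~ m)) -> lin (fun x => tmap f (g x) t).
Proof.
move=> fl g1 g2 c x y; move: t; have l z := tmap_lin fl (g1 z).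
have l1 := lin_add (lin_scale c (l x)) (l y).
apply: (tens_eq (phi := i) (l _) l1) => m n.
by rewrite !(tmapE fl (g1 _)) g2 tpureDr tpureZr.
Qed.
End TmapLin.

(* Injectivity of a tensor product of injective semilinear maps, one of whose
   factors has a basis [s k] with coordinates [c k]. *)
Section TensInj.
Variables (A F : comNzRingType) (l : {rmorphism A -> F}).
Variables (M S : lmodType A) (W T : lmodType F) (f : M -> W) (g : S -> T).
Hypotheses (fl : semilin l f) (gl : semilin l g).
Hypothesis finj : injective f.
Variables (X : choiceType) (s : X -> S) (c : X -> S -> A) (ck : X -> T -> F).
Variable supp : S -> {fset X}.
Hypothesis cl : forall k, lin (c k : S -> A^o).
Hypothesis ckl : forall k, lin (ck k : T -> F^o).
Hypothesis ckc : forall k x, ck k (g x) = l (c k x).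
Hypothesis sc : forall x, x = \sum_(k <- supp x) c k x *: s k.
Hypothesis c0 : forall k x, k \notin supp x -> c k x = 0.

Let tf1 x : semilin l (fun m : M => f m (x) g x).
Proof. by move=> a m m'; rewrite fl tpureDl tpureZl. Qed.
Let tf2 m : semilin l (fun x : S => f m (x) g x).
Proof. by move=> a x x'; rewrite gl tpureDr tpureZr. Qed.

Definition tinc : tens M S -> tens W T := tlift l (fun m x => f m (x) g x).
Lemma tinc_semilin : semilin l tinc.
Proof. by move=> a x y; apply: tlift_comb => b *; [apply: tf1|apply: tf2]. Qed.

Lemma tincE m x : tinc (m (x) x) = f m (x) g x.
Proof. by apply: tlift_pure => b *; [apply: tf1|apply: tf2]. Qed.

Let g1 k x : lin (fun m : M => c k x *: m). Proof. exact: (lin_scale _ (@lin_id A M)). Qed.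
Let g2 k (m : M) : lin (fun x : S => c k x *: m).
Proof. by move=> a x y; rewrite cl scalerDl -scalerA. Qed.
Let gam k : tens M S -> M := tlift idfun (fun m x => c k x *: m).
Let gam_lin k : lin (gam k) := tlift_lin (g1 k) (g2 k).
Let gamE k m x : gam k (m (x) x) = c k x *: m := tliftE (g1 k) (g2 k) m x.

Let G1 k x : lin (fun w : W => ck k x *: w). Proof. exact: (lin_scale _ (@lin_id F W)). Qed.
Let G2 k (w : W) : lin (fun x : T => ck k x *: w).
Proof. by move=> a x y; rewrite ckl scalerDl -scalerA. Qed.
Let Gam k : tens W T -> W := tlift idfun (fun w x => ck k x *: w).
Let Gam_lin k : lin (Gam k) := tlift_lin (G1 k) (G2 k).
Let GamE k w x : Gam k (w (x) x) = ck k x *: w := tliftE (G1 k) (G2 k) w x.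

Let Gam_tinc k t : Gam k (tinc t) = f (gam k t).
Proof.
have l1 : semilin l (fun t => Gam k (tinc t)) by move=> a x y; rewrite tinc_semilin Gam_lin.
have l2 : semilin l (fun t => f (gam k t)) by move=> a x y; rewrite gam_lin fl.
by apply: (tens_eq (phi := l) l1 l2) => m x; rewrite tincE GamE gamE ckc (semilinZ fl).
Qed.

Let gam_sum t : exists D : {fset X}, t = \sum_(k <- D) gam k t (x) s k.
Proof.
suff [D h] : exists D : {fset X}, forall D', fsubset D D' -> t = \sum_(k <- D') gam k t (x) s k.
  by exists D; apply: h.
elim/tens_ind: t => [|m x t [D h]].
  by exists fset0 => D' _; rewrite big1 // => k _; rewrite (lin0 (gam_lin k)) (lin0 (tpurel _)).
exists (fsetU (supp x) D) => D'; rewrite fsubUset => /andP[xD' DD'].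
have -> : \sum_(k <- D') gam k (m (x) x + t) (x) s k =
    \sum_(k <- D') m (x) (c k x *: s k) + \sum_(k <- D') gam k t (x) s k.
  rewrite -big_split; apply: eq_bigr => k _ /=.
  by rewrite (linD (gam_lin k)) gamE tpureDl tpureZl tpureZr.
rewrite -(h D' DD') -(lin_sum _ _ _ (tpurer m)); congr (_ (x) _ + _).
rewrite {1}[x]sc (big_fset_incl _ xD') // => k _ kx.
by rewrite c0 // scale0r.
Qed.

(** An element is the sum of its slices [gam k t] tensored with [s k]. For t in the kernel each
    slice is sent to 0 by the injective map f, hence is 0. *)
Lemma tinc_inj : injective tinc.
Proof.
move=> t t' e; apply/eqP; rewrite -subr_eq0; apply/eqP.
have {e} : tinc (t - t') = 0 by rewrite (semilinB tinc_semilin) e subrr.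
move: (t - t') => {t'}t e; have [D ->] := gam_sum t; rewrite big1 // => k _.
have -> : gam k t = 0; last by rewrite (lin0 (tpurel _)).
by apply: finj; rewrite -Gam_tinc e (lin0 (Gam_lin k)) (semilin0 fl).
Qed.
End TensInj.

(** * Lattices in S_q(V) and in A_m(V) *)

Section Powers.
Variable C : fieldType.
Hypothesis C0 : [pchar C] =i pred0.
Local Notation K := (Kq C).
Local Notation A := (laurent_ring C).
Local Notation uA := (@uA C).
Local Notation ev := (@ev C).
Local Notation Smod := (Sq_mod C).
Local Notation SA := (SA C).
Local Notation lvm := (@lval C : {rmorphism A -> K}).
Local Notation delta := (uA 1%Zc - 1).
Local Notation tl := (tl lvm).
Local Notation aspan := (aspan lvm).
Local Notation alat := (alat lvm).
Variable Rm : Rfamily C.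
Hypotheses (HR : universal_R Rm) (Rn : R_normalised Rm).
Local Notation LV := (@LV C).
Local Notation good := (good Rm).

Definition LS (x : Smod) : Prop := x \in @SA_pred C.

Lemma sval_semilin : semilin lvm (@sval_SA C : SA -> Smod). Proof. by []. Qed.

Lemma LS_sval x : LS x -> exists y : SA, x = sval_SA y.
Proof. by move=> h; exists (SAelt h). Qed.

Lemma sval_LS (y : SA) : LS (sval_SA y). Proof. exact: sval_SAP. Qed.

Lemma LS_lat : alat LS.
Proof.
have [h0 h] := image_lat sval_semilin; split.
  by have [y ->] := h0; apply: sval_LS.
move=> a x y /LS_sval hx /LS_sval hy; have [z ->] := h a x y hx hy; exact: sval_LS.
Qed.

Lemma LSM (x y : Smod) : LS x -> LS y -> LS ((x : Sq C) * (y : Sq C)).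
Proof. by move=> /LS_sval[u ->] /LS_sval[v ->]; exact: (sval_LS (u * v)). Qed.

Lemma LS_sw w : LS (sw C w).
Proof. by rewrite -sval_swA; apply: sval_LS. Qed.

Lemma LS_span x : LS x -> aspan (fun y : Smod => exists w, y = sw C w) x.
Proof.
move=> /LS_sval[y ->] {x}; move: y.
have hl := aspan_lat lvm (fun y : Smod => exists w, y = sw C w).
apply: (SA_ind C0) => [|a x y hx hy|w _].
- exact: (proj1 hl).
- exact: (proj2 hl a _ _ hx hy).
by apply: aspan_in; exists w; rewrite sval_swA.
Qed.

Fixpoint LVn (n : nat) : Vn C n -> Prop :=
  match n return Vn C n -> Prop with
  | 0 => @Ltriv C
  | n'.+1 => tl LV (@LVn n')
  end.

Lemma LVn_evn w : LVn (evn C w).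
Proof.
elim: w => [|a w IH]; first by apply: aspan_in.
by apply: tl_in IH; apply: aspan_in; exists a.
Qed.

Lemma LV_LS v : LV v -> LS (sproj (vinj v)).
Proof.
have vl := lin_comp (@vinj_lin C) (@sproj_lin C).
apply: (aspan_image vl LS_lat) => _ [a ->].
by rewrite vinj_ev; exact: (LS_sw [:: a]).
Qed.

Lemma SnS n v (x : Vn C n) : Sn (v (x) x : Vn C n.+1) = sproj (vinj v) * (Sn x : Sq C).
Proof. by rewrite /Sn MnS sprojM. Qed.

Lemma LVn_LS n (x : Vn C n) : LVn x -> LS (Sn x).
Proof.
elim: n x => [|n IH] x.
  apply: (aspan_image (proj1 (Sn_hom C0 0)) LS_lat) => _ ->.
  by have h := LS_sw [::]; rewrite -(Sn_evn C [::]) in h.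
have e := proj1 (Sn_hom C0 n.+1).
apply: (aspan_image e LS_lat) => _ [v [y [hv hy ->]]].
have h := LSM (LV_LS hv) (IH y hy); by rewrite -SnS in h.
Qed.

(** S_A(V_A) is spanned by the images of the lattices in the tensor powers of V. The predicate P
    carries along what is known about the n-th power. *)
Lemma LS_cover (P : nat -> Prop) x : (forall n, P n) -> LS x ->
  aspan (fun x => exists n (t : Vn C n), [/\ P n, LVn t & x = Sn t]) x.
Proof.
move=> hP /LS_span; apply: (aspan_sub (aspan_lat _ _)) => _ [w ->]; apply: aspan_in.
by exists (size w), (evn C w); split=> //; [exact: LVn_evn|rewrite (Sn_evn C)].
Qed.

Let HV := V_module C.
Let HS := Sq_module C0.
Let HVn := @Vn_module C.

Lemma good_V_Vn n : good LV (@LVn n).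
Proof.
elim: n => [|n IH]; first exact: (good_trivr HR HV).
exact: (good_otensr HR HV HV (HVn n) (good_VV C0 HR Rn) IH).
Qed.

Lemma good_r (U : opModule C) (LU : U -> Prop) : Uq_module U -> (forall n, good LU (@LVn n)) -> good LU LS.
Proof.
move=> HU h; apply: (good_coverr HR HU HS) => x /(LS_cover h).
apply: (aspan_sub (aspan_lat _ _)) => _ [n [t [hg ht ->]]]; apply: aspan_in.
by exists (Vn C n), (@LVn n), (@Sn C n), t; split=> //; [exact: Sn_hom|exact: LVn_LS].
Qed.

Lemma good_l (W : opModule C) (LW : W -> Prop) : Uq_module W -> (forall n, good (@LVn n) LW) -> good LS LW.
Proof.
move=> HW h; apply: (good_coverl HR HS HW) => x /(LS_cover h).
apply: (aspan_sub (aspan_lat _ _)) => _ [n [t [hg ht ->]]]; apply: aspan_in.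
by exists (Vn C n), (@LVn n), (@Sn C n), t; split=> //; [exact: Sn_hom|exact: LVn_LS].
Qed.

(** The second factor is extended from V to S_q(V) while the first is still V; only then is the
    first factor extended. *)
Lemma good_SS : good LS LS.
Proof.
have hV : good LV LS := good_r HV good_V_Vn.
apply: (good_l HS) => n; elim: n => [|n IH]; first exact: (good_trivl HR HS).
exact: (good_otensl HR HV (HVn n) HS hV IH).
Qed.

Lemma Am_module n : Uq_module (Am Rm n).
Proof. by elim: n => [|n IH]; [exact: HS|exact: (otens_module IH HS)]. Qed.

Fixpoint LAm (n : nat) : Am Rm n -> Prop :=
  match n return Am Rm n -> Prop with
  | 0 => LS
  | n'.+1 => tl (@LAm n') LS
  end.

Lemma LAm_lat n : alat (@LAm n).
Proof. by case: n => [|n]; [exact: LS_lat|exact: tl_lat]. Qed.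

Lemma good_S_Am n : good LS (@LAm n).
Proof.
elim: n => [|n IH]; first exact: good_SS.
exact: (good_otensr HR HS (Am_module n) HS IH good_SS).
Qed.

Lemma Rcheck_Am n (b a : _) : LS b -> LAm a ->
  exists2 z, tl (@LAm n) LS z & Rcheck Rm (b (x) a : otens Smod (Am Rm n)) = a (x) b + lvm delta *: z.
Proof.
move=> hb ha; have [z hz e] := good_S_Am (tl_in lvm hb ha); exists (tflip z).
  exact: tl_flip hz.
by rewrite /Rcheck e (linD (@tflip_lin K _ _)) (linZ (@tflip_lin K _ _)) tflipE.
Qed.

End Powers.

(** Bilinearity is not a field of [ralg]; it is what allows identities of products to be checked on
    generators. *)
Definition ralg_bilin (F : nzRingType) (X : ralg F) : Prop :=
  (forall x : X, lin (fun y => ralg_mul x y)) /\ (forall y : X, lin (fun x => ralg_mul x y)).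

Section RalgBilin.
Variable F : comNzRingType.

Section TensAlg.
Variables X Y : ralg F.
Hypotheses (HX : ralg_bilin X) (HY : ralg_bilin Y).
Let H (a : X) (b : Y) (a' : X) (b' : Y) : tens X Y := ralg_mul a a' (x) ralg_mul b b'.
Let H1 b a' b' : lin (fun a => H a b a' b').
Proof. by move=> c x y; rewrite /H (proj2 HX) tpureDl tpureZl. Qed.
Let H2 a a' b' : lin (fun b => H a b a' b').
Proof. by move=> c x y; rewrite /H (proj2 HY) tpureDr tpureZr. Qed.
Let H3 a b b' : lin (fun a' => H a b a' b').
Proof. by move=> c x y; rewrite /H (proj1 HX) tpureDl tpureZl. Qed.
Let H4 a b a' : lin (fun b' => H a b a' b').
Proof. by move=> c x y; rewrite /H (proj1 HY) tpureDr tpureZr. Qed.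

Lemma tens_alg_bilin : ralg_bilin (tens_alg X Y).
Proof.
split=> s; [exact: (bil_linr H1 H2 H3 H4 s)|exact: (bil_linl H1 H2 H3 H4 s)].
Qed.

Lemma tens_alg_mulE (a a' : X) (b b' : Y) :
  @ralg_mul _ (tens_alg X Y) (a (x) b) (a' (x) b') = ralg_mul a a' (x) ralg_mul b b'.
Proof. exact: (bilE H1 H2 H3 H4). Qed.
End TensAlg.

Variables (B : comNzRingType) (th : {rmorphism B -> F}) (X : ralg B).
Hypothesis HX : ralg_bilin X.
Let H (a b : X) : bchange th X := bpure th (ralg_mul a b).
Let Hl b : semilin th (H^~ b).
Proof. by move=> c x y; rewrite /H (proj2 HX) bpure_semilin. Qed.
Let Hr a : semilin th (H a).
Proof. by move=> c x y; rewrite /H (proj1 HX) bpure_semilin. Qed.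

Lemma bchange_alg_bilin : ralg_bilin (bchange_alg th X).
Proof. split=> b; [exact: (blift2_linr Hl Hr b)|exact: (blift2_linl Hl Hr b)]. Qed.

Lemma bchange_alg_mulE (a b : X) :
  @ralg_mul _ (bchange_alg th X) (bpure th a) (bpure th b) = bpure th (ralg_mul a b).
Proof. exact: (blift2E Hl Hr). Qed.
End RalgBilin.

Lemma lin_near (R : nzRingType) (M N : lmodType R) (f : M -> N) c x y z w :
  lin f -> f y = w -> x = y + c *: z -> f x = w + c *: f z.
Proof. by move=> fl <- ->; rewrite (linD fl) (linZ fl). Qed.

Section BraidedBil.
Variable C : fieldType.
Variable Rm : Rfamily C.
Variables X Y : opAlg C.
Hypothesis RL : lin (@Rcheck C Rm Y X).
Hypothesis X1 : forall x : X, lin (fun y => oa_mul x y).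
Hypothesis X2 : forall y : X, lin (fun x => oa_mul x y).
Hypothesis Y1 : forall x : Y, lin (fun y => oa_mul x y).
Hypothesis Y2 : forall y : Y, lin (fun x => oa_mul x y).

Let H (a : X) (b : Y) (a' : X) (b' : Y) : tens X Y :=
  tmap (fun x => oa_mul a x) (fun y => oa_mul y b') (Rcheck Rm (b (x) a' : otens Y X)).
Let ml a b' : lin (tmap (fun x : X => oa_mul a x) (fun y : Y => oa_mul y b')) := tmap_lin (X1 a) (Y2 b').
Let H1 b a' b' : lin (fun a => H a b a' b').
Proof. exact: (tmap_linf _ X1 X2 (Y2 b')). Qed.
Let H2 a a' b' : lin (fun b => H a b a' b').
Proof. exact: (lin_comp (lin_comp (tpurel a') RL) (ml a b')). Qed.
Let H3 a b b' : lin (fun a' => H a b a' b').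
Proof. exact: (lin_comp (lin_comp (tpurer b) RL) (ml a b')). Qed.
Let H4 a b a' : lin (fun b' => H a b a' b').
Proof. exact: (tmap_ling (f := fun x => oa_mul a x) (g := fun b' y => oa_mul y b') _ (X1 a) Y2 Y1). Qed.

Lemma braided_linl (t : braided Rm X Y) : lin (fun s : braided Rm X Y => oa_mul s t).
Proof. exact: (bil_linl H1 H2 H3 H4 t). Qed.

Lemma braided_linr (t : braided Rm X Y) : lin (fun s : braided Rm X Y => oa_mul t s).
Proof. exact: (bil_linr H1 H2 H3 H4 t). Qed.

Lemma braided_mulE a b a' b' : oa_mul (a (x) b : braided Rm X Y) (a' (x) b' : braided Rm X Y) =
  tmap (fun x => oa_mul a x) (fun y => oa_mul y b') (Rcheck Rm (b (x) a' : otens Y X)).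
Proof. exact: (bilE H1 H2 H3 H4). Qed.
End BraidedBil.

(** * The classical limit of A_m(V) *)

Section LimitAm.
Variable C : fieldType.
Hypothesis C0 : [pchar C] =i pred0.
Local Notation K := (Kq C).
Local Notation A := (laurent_ring C).
Local Notation uA := (@uA C).
Local Notation Smod := (Sq_mod C).
Local Notation SA := (SA C).
Local Notation lvm := (@lval C : {rmorphism A -> K}).
Local Notation thm := (@theta C : {rmorphism A -> C}).
Local Notation delta := (uA 1%Zc - 1).
Local Notation tl := (tl lvm).
Variable Rm : Rfamily C.
Hypotheses (HR : universal_R Rm) (Rn : R_normalised Rm).
Local Notation Am := (Am Rm).
Local Notation AmA := (AmA C).
Local Notation incl := (@AmA_incl C Rm).
Local Notation inL := (@LAm C Rm).
Local Notation LS := (@LS C).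

Let HS := Sq_module C0.
Let RL n : lin (@Rcheck C Rm Smod (Am n)).
Proof. by case: (UR_hom HR HS (Am_module C0 Rm n)). Qed.

Lemma Am_mul_lin n : (forall x : Am n, lin (fun y => oa_mul x y)) /\
  (forall y : Am n, lin (fun x => oa_mul x y)).
Proof.
elim: n => [|n [IH1 IH2]]; first by split=> x; [exact: Sq_mulr_lin|exact: Sq_mull_lin].
have Y1 (x : Sq_alg C) : lin (fun y => oa_mul x y) by exact: Sq_mulr_lin.
have Y2 (y : Sq_alg C) : lin (fun x => oa_mul x y) by exact: Sq_mull_lin.
have h1 := braided_linr (X := Am n) (Y := Sq_alg C) (@RL n) IH1 IH2 Y1 Y2.
have h2 := braided_linl (X := Am n) (Y := Sq_alg C) (@RL n) IH1 IH2 Y1 Y2.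
by split=> t; [apply: h1|apply: h2].
Qed.

Lemma Am_mulE n (a a' : Am n) (b b' : Sq_alg C) :
  oa_mul (a (x) b : Am n.+1) (a' (x) b' : Am n.+1) =
  tmap (fun x => oa_mul a x) (fun y => oa_mul y b') (Rcheck Rm (b (x) a' : otens Smod (Am n))).
Proof.
have [IH1 IH2] := Am_mul_lin n.
have Y1 (x : Sq_alg C) : lin (fun y => oa_mul x y) by exact: Sq_mulr_lin.
have Y2 (y : Sq_alg C) : lin (fun x => oa_mul x y) by exact: Sq_mull_lin.
exact: (braided_mulE (X := Am n) (Y := Sq_alg C) (@RL n) IH1 IH2 Y1 Y2).
Qed.

Lemma tl_map2 (M N M' N' : lmodType K) (f : M -> M') (g : N -> N') L L' L2 L2' : lin f -> lin g ->
  (forall x, L x -> L2 (f x)) -> (forall x, L' x -> L2' (g x)) ->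
  forall t, tl L L' t -> tl L2 L2' (tmap f g t).
Proof.
move=> fl gl hf hg; apply: (aspan_image (tmap_lin fl gl) (tl_lat _ _ _)) => _ [x [y [hx hy ->]]].
by rewrite (tmapE fl gl); apply: tl_in; [apply: hf|apply: hg].
Qed.

(** Rcheck sends b (x) a' to a' (x) b modulo q - 1, and the multiplications by a and b' preserve the
    lattices. Closure of the lattice at level n is a premise because the lemma is used inside the
    induction that proves it. *)
Lemma Am_mul_near n (a a' : Am n) (b b' : Sq_alg C) :
  (forall x y, inL x -> inL y -> inL (oa_mul x y : Am n)) ->
  inL a -> inL a' -> LS b -> LS b' ->
  exists2 z, tl (@LAm C Rm n) LS z &
    oa_mul (a (x) b : Am n.+1) (a' (x) b' : Am n.+1) = oa_mul a a' (x) oa_mul b b' + lvm delta *: z.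
Proof.
move=> hm ha ha' hb hb'; have [z hz e] := Rcheck_Am C0 HR Rn hb ha'.
have l1 := proj1 (Am_mul_lin n) a.
have l2 : lin (fun y : Sq_alg C => oa_mul y b') by exact: Sq_mull_lin.
exists (tmap (fun x => oa_mul a x) (fun y => oa_mul y b') z).
  by apply: (tl_map2 l1 l2) hz => x hx; [apply: hm|apply: LSM].
have h1 := lin_near (tmap_lin l1 l2) (tmapE l1 l2 a' b) e.
by have h := etrans (Am_mulE a a' b b') h1; apply: h.
Qed.

Lemma LAm_mul n (x y : Am n) : inL x -> inL y -> inL (oa_mul x y).
Proof.
elim: n x y => [|n IH] x y; first exact: LSM.
have [l1 l2] := Am_mul_lin n.+1; have hl := LAm_lat Rm n.+1.
move=> hx hy; move: x hx; apply: (aspan_image (l2 y) hl) => _ [a [b [ha hb ->]]].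
move: y hy; apply: (aspan_image (l1 _) hl) => _ [a' [b' [ha' hb' ->]]].
have [z hz ->] := Am_mul_near IH ha ha' hb hb'.
have h0 : tl (@LAm C Rm n) LS (oa_mul a a' (x) @oa_mul C (Sq_alg C) b b' : tens (Am n) Smod).
  by apply: tl_in; [exact: IH|exact: LSM].
by apply: (alatD hl h0); apply: alatZ.
Qed.

Lemma incl_semilin n : semilin lvm (@AmA_incl C Rm n).
Proof.
elim: n => [|n IH]; first exact: sval_semilin.
exact: (tinc_semilin IH (@sval_semilin C)).
Qed.

Lemma inclE n t x : incl (t (x) x : AmA n.+1) = incl t (x) (sval_SA x : Smod).
Proof. exact: (tincE (@incl_semilin n) (@sval_semilin C)). Qed.

(** By induction through [tinc_inj], with the irreducible words as basis of the last factor. *)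
Lemma incl_inj n : injective (@AmA_incl C Rm n).
Proof.
elim: n => [|n IH]; first exact: val_inj.
apply: (tinc_inj (@incl_semilin n) (@sval_semilin C) IH (s := fun k => mkSA (<< k >>))
  (c := @coordA C) (ck := @coordK C) (supp := fun x => msupp (liftA x))) => [k a x y|k|k x|x|k x kx].
- by rewrite /coordA (liftA_lin C0) mcoeffD mcoeffZ.
- exact: (coordK_lin C0).
- exact: (coordK_sval C0).
- exact: (SA_coord C0).
- exact: mcoeff_outdom.
Qed.

Lemma incl_LAm n t : inL (@AmA_incl C Rm n t).
Proof.
elim: n t => [|n IH] t; first exact: sval_LS.
have hl := LAm_lat Rm n.+1; have il := @incl_semilin n.+1.
elim/tens_ind: t => [|m x t ht]; first by rewrite (semilin0 il); case: hl.
have h0 : @LAm C Rm n.+1 (@AmA_incl C Rm n m (x) (sval_SA x : Smod)).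
  by apply: tl_in; [exact: IH|exact: sval_LS].
have e2 := semilinD il (m (x) x) t; have e := @inclE n m x.
have e3 := etrans e2 (congr1 (fun z => z + @AmA_incl C Rm n.+1 t) e).
exact: (eq_ind_r (@LAm C Rm n.+1) (alatD hl h0 ht) e3).
Qed.

Lemma LAm_incl n (x : Am n) : inL x -> exists t, x = @AmA_incl C Rm n t.
Proof.
elim: n x => [|n IH] x; first exact: LS_sval.
apply: (aspan_sub (image_lat (@incl_semilin n.+1))) => _ [a [b [/IH[t ->] /LS_sval[y ->] ->]]].
by exists (t (x) y); exact: esym (@inclE n t y).
Qed.

(** The lattice [LAm] is closed under the braided product and is the image of the tensor power over
    A, so a preimage of the product can be chosen. *)
Lemma mul_exists n : exists mul : AmA n -> AmA n -> AmA n, braided_form Rm mul.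
Proof.
have h (x y : AmA n) : exists z, incl z = oa_mul (incl x) (incl y).
  by have [z ->] := LAm_incl (LAm_mul (incl_LAm x) (incl_LAm y)); exists z.
exists (fun x y => projT1 (cid (h x y))); split; first exact: incl_inj.
by move=> x y; case: (cid (h x y)).
Qed.

Local Notation red := (@AmA_red C).
Local Notation Sbar := (@Sq_bar C).
Local Notation Pbar := (tens_alg_pow Sbar).

Lemma SA_bilin : ralg_bilin (SA_alg C).
Proof.
split=> z a x y; apply: val_inj.
  exact: (@Sq_mulr_lin C (sval_SA z) (lval a) (sval_SA x) (sval_SA y)).
exact: (@Sq_mull_lin C (sval_SA z) (lval a) (sval_SA x) (sval_SA y)).
Qed.

Lemma Sbar_bilin : ralg_bilin Sbar.
Proof. exact: (bchange_alg_bilin thm SA_bilin). Qed.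

Lemma Sbar_mulE (x y : SA) : @ralg_mul _ Sbar (bpure thm x) (bpure thm y) = bpure thm (x * y).
Proof. exact: (bchange_alg_mulE thm SA_bilin x y). Qed.

Lemma Pbar_bilin n : ralg_bilin (Pbar n).
Proof. by elim: n => [|n IH]; [exact: Sbar_bilin|exact: (tens_alg_bilin IH Sbar_bilin)]. Qed.

Let bp_semilin : semilin thm (bpure thm : SA -> Sbar) := bpure_semilin thm (M := SA).
Let r1 (M : lmodType A) (P : lmodType C) (f : M -> P) (x : SA) : semilin thm f ->
  semilin thm (fun m : M => f m (x) (bpure thm x : Sbar)).
Proof. by move=> fl a m m'; rewrite fl tpureDl tpureZl. Qed.
Let r2 (P : lmodType C) (p : P) : semilin thm (fun x : SA => p (x) (bpure thm x : Sbar)).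
Proof. by move=> a x x'; rewrite bp_semilin tpureDr tpureZr. Qed.

Lemma red_semilin n : semilin thm (@AmA_red C n).
Proof.
elim: n => [|n IH]; first exact: bp_semilin.
by move=> a x y; apply: (tlift_comb (phi := thm)) => b *; [exact: (r1 _ IH)|exact: r2].
Qed.

Lemma redE n t x : red (t (x) x : AmA n.+1) = red t (x) (bpure thm x : Sbar).
Proof.
by apply: (tlift_pure (phi := thm)) => b *; [exact: (r1 _ (@red_semilin n))|exact: r2].
Qed.

Lemma theta_delta : theta delta = 0.
Proof. by apply/eqP; rewrite rmorphB rmorph1 subr_eq0; apply/eqP; exact: theta_uA. Qed.

(** Bilinearity is pulled back along the injective map [incl], and so holds for a product obtained
    by choice. *)
Lemma braided_form_bilin n mul : @braided_form C Rm n mul ->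
  (forall x, lin (mul x)) /\ (forall y, lin (mul^~ y)).
Proof.
move=> [inj h]; have il := @incl_semilin n; have [l1 l2] := Am_mul_lin n.
split=> z a x y; apply: inj; rewrite h.
  have e1 := congr1 (fun t => oa_mul (incl z) t) (il a x y); apply: etrans e1 _.
  by rewrite l1 -!h il.
have e1 := congr1 (fun t => oa_mul t (incl z)) (il a x y); apply: etrans e1 _.
by rewrite l2 -!h il.
Qed.

Lemma braided_form_pure n mul (mul0 : AmA n -> AmA n -> AmA n) (t t' : AmA n) (x x' : SA) :
  @braided_form C Rm n.+1 mul -> braided_form Rm mul0 ->
  exists z, mul (t (x) x) (t' (x) x') = (mul0 t t' (x) (x * x') : AmA n.+1) + delta *: z.
Proof.
move=> [inj h] [_ h0]; have il := @incl_semilin n.+1.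
have [z hz e] := Am_mul_near (@LAm_mul n) (incl_LAm t) (incl_LAm t') (sval_LS x) (sval_LS x').
have [z' ez] := @LAm_incl n.+1 z hz; exists z'; apply: inj.
have a1 := h (t (x) x) (t' (x) x').
have a2 := congr2 (fun u v => @oa_mul C (Am n.+1) u v) (@inclE n t x) (@inclE n t' x').
have a3 := etrans a1 (etrans a2 e).
have b1 := semilinD il (mul0 t t' (x) (x * x')) (delta *: z').
have b2 := semilinZ il delta z'; have b3 := @inclE n (mul0 t t') (x * x').
have b4 := etrans b1 (congr2 (fun u v => u + v) b3 b2).
have c0 : sval_SA (x * x') = @oa_mul C (Sq_alg C) (sval_SA x) (sval_SA x') by [].
have c1 := congr2 (fun (u : Am n) (v : Smod) => u (x) v + lvm delta *: incl z') (h0 t t') c0.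
have c2 := congr1 (fun u : Am n.+1 => (oa_mul (incl t) (incl t') (x) @oa_mul C (Sq_alg C) (sval_SA x) (sval_SA x')) + lvm delta *: u) ez.
have a4 := etrans a3 c2; have b5 := etrans b4 c1.
by have a5 := etrans a4 (esym b5); apply: a5.
Qed.

Lemma near_red (M : lmodType A) (P : lmodType C) (f : M -> P) x y z : semilin thm f ->
  x = y + delta *: z -> f x = f y.
Proof. by move=> fl ->; rewrite (semilinD fl) (semilinZ fl) [thm _]theta_delta scale0r addr0. Qed.

(** Induction on n over all admissible products. Modulo q - 1 the product of pure tensors is
    computed in the components, with the product given by [mul_exists] one level below, and theta
    sends q - 1 to 0. *)
Lemma red_mul n mul : @braided_form C Rm n mul -> forall x y,
  red (mul x y) = @ralg_mul _ (Pbar n) (red x) (red y).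
Proof.
elim: n mul => [|n IH] mul bf x y.
  have e : mul x y = x * y :> SA by case: bf => inj h; apply: inj; rewrite h.
  by rewrite e; exact: (esym (Sbar_mulE x y)).
have [l1 l2] := braided_form_bilin bf; have [p1 p2] := Pbar_bilin n.+1.
have rl := @red_semilin n.+1; have [mul0 bf0] := mul_exists n.
have f1 y' : semilin thm (fun x => red (mul x y')) by move=> a u v; rewrite l2 rl.
have f2 y' : semilin thm (fun x => @ralg_mul _ (Pbar n.+1) (red x) (red y')) by move=> a u v; rewrite rl p2.
have g1 x' : semilin thm (fun y => red (mul x' y)) by move=> a u v; rewrite l1 rl.
have g2 x' : semilin thm (fun y => @ralg_mul _ (Pbar n.+1) (red x') (red y)) by move=> a u v; rewrite rl p1.
apply: (tens_eq (f1 y) (f2 y)) => t s; apply: (tens_eq (g1 _) (g2 _)) => t' s'.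
have [z e] := braided_form_pure t t' s s' bf bf0.
have e1 := near_red rl e; have e2 := @redE n (mul0 t t') (s * s').
have e3 := IH mul0 bf0 t t'.
have e4 := congr2 (fun u v => u (x) v : Pbar n.+1) e3 (esym (Sbar_mulE s s')).
have e5 := esym (tens_alg_mulE (Pbar_bilin n) Sbar_bilin (red t) (red t') (bpure thm s) (bpure thm s')).
have e6 := congr2 (fun u v => @ralg_mul _ (Pbar n.+1) u v) (esym (@redE n t s)) (esym (@redE n t' s')).
exact: etrans e1 (etrans e2 (etrans e4 (etrans e5 e6))).
Qed.

Fixpoint redV (n : nat) : Pbar n -> bchange thm (AmA n) :=
  match n return Pbar n -> bchange thm (AmA n) with
  | 0 => fun x => x
  | n'.+1 => tlift idfun (fun p b => bmix (@redV n' p) b)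
  end.

Lemma redV_lin n : lin (@redV n).
Proof.
elim: n => [|n IH] //; apply: tlift_lin => [b|p]; last exact: bmix_linr.
exact: (lin_comp IH (bmix_linl b)).
Qed.

Lemma redVE n p b : @redV n.+1 (p (x) b) = bmix (redV p) b.
Proof.
apply: tliftE => [b'|p']; last exact: bmix_linr.
exact: (lin_comp (@redV_lin n) (bmix_linl b')).
Qed.

Lemma redV_red n t : @redV n (red t) = bpure thm t.
Proof.
elim: n t => [|n IH] //.
have f1 : semilin thm (fun t => redV (@AmA_red C n.+1 t)).
  by move=> a x y; rewrite red_semilin redV_lin.
apply: (tens_eq f1 (bpure_semilin thm (M := AmA n.+1))) => t x.
have e1 := congr1 (@redV n.+1) (@redE n t x); have e2 := redVE (red t) (bpure thm x).
have e3 := congr1 (fun u => bmix u (bpure thm x)) (IH t).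
exact: etrans e1 (etrans e2 (etrans e3 (bmixE thm t x))).
Qed.

Definition canon n : bchange thm (AmA n) -> Pbar n := blift (@AmA_red C n).
Lemma canon_lin n : lin (@canon n). Proof. exact: (blift_lin (@red_semilin n)). Qed.

Lemma canonE n t : @canon n (bpure thm t) = red t. Proof. exact: (bliftE (@red_semilin n)). Qed.

Lemma canonK n : cancel (@canon n) (@redV n).
Proof.
have l1 := lin_comp (@canon_lin n) (@redV_lin n).
by apply: (bchange_eq l1 (@lin_id _ _)) => t; rewrite canonE redV_red.
Qed.

Lemma canon_bmix n x b : @canon n.+1 (bmix x b) = canon x (x) b.
Proof.
have l1 := lin_comp (bmix_linl (N := SA) b) (@canon_lin n.+1).
have l2 := lin_comp (@canon_lin n) (tpurel (b : Sbar)).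
move: x; apply: (bchange_eq l1 l2) => t.
have m1 := lin_comp (bmix_linr (bpure thm t)) (@canon_lin n.+1).
have m2 := tpurer (canon (bpure thm t) : Pbar n) : lin (fun y : Sbar => _ (x) y).
move: b {l1 l2}; apply: (bchange_eq m1 m2) => y.
have e1 := congr1 (@canon n.+1) (bmixE thm t y).
have e2 := etrans e1 (etrans (@canonE n.+1 (t (x) y)) (@redE n t y)).
have e3 := congr1 (fun u : Pbar n => u (x) (bpure thm y : Sbar)) (esym (@canonE n t)).
exact: etrans e2 e3.
Qed.

Lemma canonVK n : cancel (@redV n) (@canon n).
Proof.
elim: n => [|n IH].
  have h := bchange_eq (@canon_lin 0) (@lin_id C (bchange thm SA)) (@canonE 0).
  by move=> x; apply: h.
have l1 := lin_comp (@redV_lin n.+1) (@canon_lin n.+1).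
apply: (tens_eq (phi := (idfun : {rmorphism C -> C})) l1 (@lin_id _ _)) => p b.
have e1 := congr1 (@canon n.+1) (redVE p b); have e2 := canon_bmix (redV p) b.
have e3 := congr1 (fun u : Pbar n => u (x) b) (IH p).
exact: etrans e1 (etrans e2 e3).
Qed.

Lemma red_one n : red (AmA_one C n) = ralg_one (Pbar n).
Proof.
elim: n => [|n IH] //; have e := @redE n (AmA_one C n) 1; apply: etrans e _.
by rewrite IH.
Qed.

Lemma Am_bar_iso n mul : braided_form Rm mul -> alg_iso (@Am_bar_canon C n mul).
Proof.
move=> bf; have [l1 l2] := braided_form_bilin bf.
have Hb : ralg_bilin (@Ralg A (AmA n) mul (AmA_one C n)) by split.
have [b1 b2] := bchange_alg_bilin thm Hb; have [p1 p2] := Pbar_bilin n.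
have cl := @canon_lin n.
split.
- exact: cl.
- exists (@redV n); [exact: canonK|exact: canonVK].
- by have e := etrans (@canonE n (AmA_one C n)) (red_one n); apply: e.
move=> x y.
have f1 y' := lin_comp (b2 y') cl; have f2 y' := lin_comp cl (p2 (canon y')).
have g1 x' := lin_comp (b1 x') cl; have g2 x' := lin_comp cl (p1 (canon x')).
move: x; apply: (bchange_eq (f1 y) (f2 y)) => t.
move: y; apply: (bchange_eq (g1 _) (g2 _)) => s.
have e1 := congr1 (@canon n) (bchange_alg_mulE thm Hb t s).
have e2 := etrans e1 (etrans (@canonE n (mul t s)) (red_mul bf t s)).
have e3 := congr2 (fun u v => @ralg_mul _ (Pbar n) u v) (esym (@canonE n t)) (esym (@canonE n s)).
by have e := etrans e2 e3; apply: e.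
Qed.

Theorem limit_Am n : exists2 mul : AmA n -> AmA n -> AmA n,
  braided_form Rm mul & alg_iso (@Am_bar_canon C n mul).
Proof. by have [mul bf] := mul_exists n; exists mul => //; apply: Am_bar_iso. Qed.

End LimitAm.

(** * The classical limit of S_q(V) *)

Section MpolyExt.
Variables (R : comNzRingType) (n : nat) (M : lmodType R).
Local Notation Pn := (mpoly n R).

Definition mext (F : multinom n -> M) (p : Pn) : M := \sum_(m <- mpoly.msupp p) mpoly.mcoeff m p *: F m.

Lemma mextE F k p : (mpoly.msize p <= k)%N -> mext F p = \sum_(m : 'X_{1..n < k}) mpoly.mcoeff m p *: F m.
Proof.
move=> le_pk; rewrite /mext (big_mksub 'X_{1..n < k}) ?mpoly.msupp_uniq //=; first last.
  by move=> m /mpoly.msize_mdeg_lt /leq_trans; apply.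
by rewrite big_rmcond //= => m /mpoly.memN_msupp_eq0 ->; rewrite scale0r.
Qed.

Lemma mext_lin F : lin (mext F).
Proof.
move=> a x y; pose k := maxn (mpoly.msize (a *: x + y)) (maxn (mpoly.msize x) (mpoly.msize y)).
rewrite !(@mextE F k) ?leq_max ?leqnn ?orbT // scaler_sumr -big_split; apply: eq_bigr => m _ /=.
by rewrite mpoly.mcoeffD mpoly.mcoeffZ scalerDl scalerA.
Qed.

Lemma mextX F m : mext F 'X_[m] = F m.
Proof. by rewrite /mext mpoly.msuppX big_seq1 mpoly.mcoeffX eqxx scale1r. Qed.
End MpolyExt.

Definition mon (C : comNzRingType) (w : word) : mpoly 7 C := \prod_(a <- w) 'X_(lord a).
Definition wd (m : multinom 7) : word := flatten [seq nseq (m (lord a)) a | a <- letters].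
Definition cntm (w : word) : multinom 7 := (\sum_(a <- w) U_(lord a))%MM.

Section Monomials.
Variable C : comNzRingType.
Local Notation mon := (@mon C).

Lemma mon_cat v w : mon (v ++ w) = mon v * mon w.
Proof. by rewrite /mon big_cat. Qed.

Lemma mon_cons a w : mon (a :: w) = 'X_(lord a) * mon w.
Proof. by rewrite /mon big_cons. Qed.

Lemma mon_cntm w : mon w = 'X_[cntm w].
Proof. by rewrite /mon /cntm mprodXE. Qed.

Lemma count_wd m a : count_mem a (wd m) = m (lord a).
Proof.
rewrite /wd /= !count_cat !count_nseq /=.
by case: a; rewrite /= ?mul1n ?mul0n ?addn0 ?add0n.
Qed.

Lemma count_cntm w a : cntm w (lord a) = count_mem a w.
Proof.
rewrite /cntm mnm_sumE; elim: w => [|b w IH]; first by rewrite big_nil.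
by rewrite big_cons IH mnm1E /= (can_eq lordK).
Qed.

Lemma wd_cntm w : perm_eq (wd (cntm w)) w.
Proof. by apply/allP => a _; rewrite /= count_wd count_cntm. Qed.

Lemma mon_wd m : mon (wd m) = 'X_[m].
Proof.
rewrite mon_cntm; congr 'X_[_]; apply/mnmP => i.
by rewrite -(ordlK i) count_cntm count_wd.
Qed.

Lemma mpoly_lin_eq (M : lmodType C) (f g : mpoly 7 C -> M) : lin f -> lin g ->
  (forall w, f (mon w) = g (mon w)) -> f =1 g.
Proof.
move=> fl gl fg p; rewrite [p]mpolyE (lin_sum _ _ _ fl) (lin_sum _ _ _ gl).
by apply: eq_bigr => m _; rewrite (linZ fl) (linZ gl) -mon_wd fg.
Qed.
End Monomials.

(** The head of w is carried by adjacent exchanges to the front of w', and the tails are treated by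
    induction behind the growing prefix x. *)
Lemma perm_invariant (T : Type) (F : word -> T) :
  (forall x a b y, F (x ++ a :: b :: y) = F (x ++ b :: a :: y)) ->
  forall w w', perm_eq w w' -> F w = F w'.
Proof.
move=> h w w' ww'; rewrite -[w]cat0s -[w']cat0s; move: [::] => x.
elim: w w' x ww' => [|a w IH] w' x; first by rewrite perm_sym => /perm_nilP ->.
move=> p; have aw' : a \in w' by rewrite -(perm_mem p) mem_head.
have [u [v w'E]] : exists u v, w' = u ++ a :: v.
  exists (take (index a w') w'), (drop (index a w').+1 w').
  by rewrite -{1}(cat_take_drop (index a w') w') (drop_nth a) ?index_mem // nth_index.
have {p} : perm_eq w (u ++ v).
  by move: p; rewrite w'E perm_sym (perm_catCA u [:: a] v) /= perm_cons perm_sym.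
move=> p'; have := IH (u ++ v) (rcons x a) p'; rewrite w'E !cat_rcons => -> {p' w'E IH}.
elim/last_ind: u v => [|u b IHu] v //.
have := IHu (b :: v); rewrite !cat_rcons => ->.
by have := h (x ++ u) a b v; rewrite -!catA.
Qed.

Definition comm_check : bool :=
  all2l (fun a b => lltb b a ==> all (fun x => Z.eqb (lp_sum x.2) Z0) (fv_sub (rule2 a b) (fv_word [:: b; a]))).
Lemma comm_checkP : comm_check. Proof. by vm_compute. Qed.

Section ClassicalValues.
Variable C : fieldType.
Local Notation u1 := (@u1 C).

Lemma lpev_u1 l : lpev u1 l = zr C (lp_sum l).
Proof. by elim: l => [|x l IH]; rewrite ?lpev_nil // lpev_cons IH mulr1 -zrD. Qed.

Lemma fvev_sum0 (M : lmodType C) (e : word -> M) v :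
  all (fun x => Z.eqb (lp_sum x.2) Z0) v -> fvev u1 e v = 0.
Proof.
elim: v => [|x v IH]; first by rewrite fvev_nil.
by move=> /andP[/Z.eqb_eq h /IH hv]; rewrite fvev_cons hv lpev_u1 h scale0r addr0.
Qed.

(* at q = 1 the quadratic relations are commutators *)
Lemma fvev_rule2 (M : lmodType C) (e : word -> M) a b : lltb b a -> fvev u1 e (rule2 a b) = e [:: b; a].
Proof.
move=> ba; have /implyP /(_ ba) h := all2lP comm_checkP a b.
have := fvev_sum0 e h; rewrite fvevB (fvev_word (@u10 C)) => /eqP.
by rewrite subr_eq0 => /eqP.
Qed.
End ClassicalValues.

Lemma mpoly_scaleAr (C : comNzRingType) (a : C) (x y : mpoly 7 C) : x * (a *: y) = a *: (x * y).
Proof. by rewrite -scalerAr. Qed.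

Section SymLimit.
Variable C : fieldType.
Hypothesis C0 : [pchar C] =i pred0.
Local Notation K := (Kq C).
Local Notation A := (laurent_ring C).
Local Notation uK := (@uK C).
Local Notation uA := (@uA C).
Local Notation uAD := (@uAD C).
Local Notation u1 := (@u1 C).
Local Notation SA := (SA C).
Local Notation TA := {malg A[{fmonom 'I_7}]}.
Local Notation eA := (@eT A).
Local Notation lvm := (@lval C : {rmorphism A -> K}).
Local Notation thm := (@theta C : {rmorphism A -> C}).
Local Notation Pol := (mpoly 7 C).
Local Notation mon := (@mon C).
Local Notation Sbar := (@Sq_bar C).

(** The element phi at q = 1, with x_i for the variable of v_i: x_0^2 + 2 (x_1 x_{-1} + x_2 x_{-2} +
    x_3 x_{-3}). *)
Definition phi0 : Pol := fvev u1 mon phi_fv.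

Variables (phi : 'M[C]_7) (c : C).
Hypotheses (c_neq0 : c != 0) (phiE : sym_tensor phi = c *: phi0).

Local Notation S1 := (S1_times (sym_tensor phi)).
Local Notation Q := (qalg S1).

Definition qpi : Pol -> Q := @aproj C Pol S1.
Lemma qpi_lin : lin qpi. Proof. by move=> a x y; rewrite /qpi aprojD aprojZ. Qed.

Lemma qpiM x y : qpi (x * y) = qpi x * qpi y. Proof. exact: aprojM. Qed.

Lemma S1_letter i : S1 ('X_i * (c *: phi0)).
Proof.
exists (fun j => (j == i)%:R); rewrite phiE; congr (_ * _).
rewrite (bigD1 i) //= eqxx scale1r big1 ?addr0 // => j ji.
by rewrite (negPf ji) scale0r.
Qed.

Lemma qpi_phi x y : (0 < size x + size y)%N -> qpi (mon x * phi0 * mon y) = 0.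
Proof.
suff h a w : qpi (phi0 * mon (a :: w)) = 0.
  case: x => [|a x] xy; last by rewrite [mon _ * _]mulrC -mulrA -mon_cat h.
  by case: y xy => [|a y] // _; rewrite /mon big_nil mul1r h.
have : qpi ('X_(lord a) * (c *: phi0)) = 0.
  rewrite -(lin0 qpi_lin); apply/aprojP; rewrite subr0 -['X_(lord a) * _]addr0.
  rewrite -['X_(lord a) * _]mul1r -['X_(lord a) * _]mulr1 mulrA.
  by apply: ideal_genD (ideal_gen0 _); apply: S1_letter.
rewrite mpoly_scaleAr (linZ qpi_lin) => /(congr1 (fun z => c^-1 *: z)).
rewrite scalerK // scaler0 => h.
by rewrite mon_cons [phi0 * _]mulrC -mulrA [mon w * _]mulrC mulrA qpiM h mul0r.
Qed.

Definition toQ : TA -> Q := lext thm (fun m => qpi (mon (wm m))).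
Lemma toQ_semilin : semilin thm toQ. Proof. exact: lext_semilin. Qed.

Lemma toQ_eA w : toQ (eA w) = qpi (mon w).
Proof. by rewrite /toQ /eT lextU mwK. Qed.

Lemma toQ_fvev e v : toQ (fvev uA e v) = fvev u1 (fun w => toQ (e w)) v.
Proof. exact: (fvev_semilin (phi := thm) e v (@theta_uA C) toQ_semilin). Qed.

Lemma qpi_fvev e v : fvev u1 (fun w => qpi (e w)) v = qpi (fvev u1 e v).
Proof.
by apply: esym; exact: (fvev_semilin (phi := (idfun : {rmorphism C -> C})) e v (fun=> erefl) qpi_lin).
Qed.

Lemma mon_ctx x y v : fvev u1 (fun p => mon (x ++ p ++ y)) v = mon x * fvev u1 mon v * mon y.
Proof.
rewrite /fvev mulr_sumr mulr_suml; apply: eq_bigr => z _.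
by rewrite !mon_cat mulrA -scalerAr -scalerAl.
Qed.

(** At q = 1 a quadratic rule exchanges two commuting variables. The rule for v_0 v_0 is only used
    in words of length at least 3, where the two sides differ by phi0 times a monomial of positive
    degree. *)
Lemma toQ_red x a b y : red (size (x ++ a :: b :: y)) a b ->
  toQ (eA (x ++ a :: b :: y)) = toQ (fvev uA (fun p => eA (x ++ p ++ y)) (rl a b)).
Proof.
move=> r; rewrite toQ_eA toQ_fvev.
have -> : fvev u1 (fun w => toQ (eA (x ++ w ++ y))) (rl a b) = fvev u1 (fun p => qpi (mon (x ++ p ++ y))) (rl a b).
  by apply: eq_fvev' => p; apply: toQ_eA.
rewrite qpi_fvev mon_ctx; move: r; rewrite /red /rl; case: ifP => [ba _|_ /=].
  rewrite fvev_rule2 // -[a :: b :: y]/([:: a; b] ++ y) !mon_cat mulrA; congr (qpi (_ * _ * _)).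
  by rewrite !mon_cons mulrCA.
case: a; rewrite // => /andP[]; case: b; rewrite // => _ h.
apply/eqP; rewrite -subr_eq0 -(linB qpi_lin) -[L3 :: _]/([:: L3; L3] ++ y) !mon_cat mulrA.
rewrite -mulrBl -mulrBr; apply/eqP.
have <- : phi0 = mon [:: L3; L3] - fvev u1 mon rule33 by rewrite /phi0 fvevB (fvev_word (@u10 C)).
by apply: qpi_phi; move: h; rewrite size_cat /=; lia.
Qed.

Lemma toQ_NA t : toQ (NA t) = toQ t.
Proof.
have h := nform_compat (u := uA) toQ_semilin toQ_red.
have f1 : semilin thm (fun t => toQ (NA t)) by move=> a x y; rewrite NA_lin toQ_semilin.
apply: (word_eq (phi := thm) f1 toQ_semilin) => w.
by have e := etrans (congr1 toQ (NA_eA C w)) (h w); apply: e.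
Qed.

Lemma toQM x y : toQ (x * y) = toQ x * toQ y.
Proof.
have ql := qalg_mull_lin (S := S1); have qr := qalg_mulr_lin (S := S1) (@mpoly_scaleAr C).
have f1 z : semilin thm (fun x => toQ (x * z)) by move=> a u v; rewrite mulrDl -scalerAl toQ_semilin.
have f2 z : semilin thm (fun x => toQ x * toQ z) by move=> a u v; rewrite toQ_semilin ql.
have g1 z : semilin thm (fun y => toQ (z * y)) by move=> a u v; rewrite mulrDr malg_scaleAr toQ_semilin.
have g2 z : semilin thm (fun y => toQ z * toQ y) by move=> a u v; rewrite toQ_semilin qr.
move: x; apply: (word_eq (phi := thm) (f1 y) (f2 y)) => w.
move: y; apply: (word_eq (phi := thm) (g1 _) (g2 _)) => w'.
by rewrite -eT_cat !toQ_eA mon_cat qpiM.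
Qed.

Definition SAtoQ (x : SA) : Q := toQ (liftA x).
Lemma SAtoQ_mkSA t : SAtoQ (mkSA t) = toQ t.
Proof. by have e := etrans (congr1 toQ (liftA_mkSA C0 t)) (toQ_NA t); apply: e. Qed.

Lemma SAtoQ_semilin : semilin thm SAtoQ.
Proof. by move=> a x y; rewrite /SAtoQ (liftA_lin C0) toQ_semilin. Qed.

Lemma SAtoQM x y : SAtoQ (x * y) = SAtoQ x * SAtoQ y.
Proof.
have e1 := congr1 SAtoQ (congr2 (fun u v : SA => u * v) (esym (liftAK C0 x)) (esym (liftAK C0 y))).
have e2 := congr1 SAtoQ (esym (mkSAM (liftA x) (liftA y))).
have e3 := etrans e1 (etrans e2 (etrans (SAtoQ_mkSA _) (toQM _ _))).
exact: e3.
Qed.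

Lemma SAtoQ1 : SAtoQ 1 = 1.
Proof.
have e := etrans (congr1 SAtoQ (esym (mkSA1 C))) (SAtoQ_mkSA 1); apply: etrans e _.
by have e := toQ_eA [::]; rewrite /mon big_nil in e; apply: e.
Qed.

Local Notation bp := (bpure thm : SA -> Sbar).
Definition bsw (w : word) : Sbar := bp (swA C w).

Lemma bp_fvev e v : bp (fvev uA e v) = fvev u1 (fun w => bp (e w)) v.
Proof. exact: (fvev_semilin (phi := thm) e v (@theta_uA C) (bpure_semilin thm (M := SA))). Qed.

Lemma sval_fvev v (e : word -> SA) : sval_SA (fvev uA e v) = fvev uK (fun w => sval_SA (e w)) v.
Proof. exact: (fvev_semilin (phi := lvm) e v (fun=> erefl) (@sval_semilin C)). Qed.

Lemma bsw_swap x a b y : bsw (x ++ a :: b :: y) = bsw (x ++ b :: a :: y).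
Proof.
suff h a' b' : lltb b' a' -> bsw (x ++ a' :: b' :: y) = bsw (x ++ b' :: a' :: y).
  case: (ltngtP (lidx b) (lidx a)) => [/h //|/h -> //|/(can_inj lidxK) -> //].
move=> ba.
have e : swA C (x ++ a' :: b' :: y) = fvev uA (fun p => swA C (x ++ p ++ y)) (rule2 a' b').
  apply: val_inj; rewrite [LHS]sval_swA [RHS]sval_fvev.
  have h := sw_rule2_ctx C0 x y ba; apply: etrans h _.
  by apply: eq_fvev' => p; rewrite sval_swA.
by rewrite /bsw e bp_fvev fvev_rule2.
Qed.

(** v_i phi = 0 holds in S_q(V) and has its coefficients in A, hence it holds in the A-form inside
    S_q(V) and survives the specialisation. *)
Lemma bsw_phi i y : fvev u1 (fun p => bsw (i :: p ++ y)) phi_fv = 0.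
Proof.
rewrite -bp_fvev -(semilin0 (bpure_semilin thm (M := SA))); congr bpure.
apply: val_inj; rewrite [LHS]sval_fvev.
have h : fvev uK (fun p => sw C ([:: i] ++ p ++ y)) phi_fv = 0.
  by rewrite sw_ctx; apply: (phi_ctx C0); rewrite /= addSn.
have h2 : fvev uK (fun w => sval_SA (swA C (i :: w ++ y))) phi_fv = fvev uK (fun p => sw C ([:: i] ++ p ++ y)) phi_fv.
  by apply: eq_fvev' => p; rewrite sval_swA.
exact: etrans h2 h.
Qed.

Definition toS : Pol -> Sbar := mext (fun m => bsw (wd m)).
Lemma toS_lin : lin toS. Proof. exact: mext_lin. Qed.

Lemma toS_mon w : toS (mon w) = bsw w.
Proof. by rewrite mon_cntm /toS mextX; apply: (perm_invariant bsw_swap); apply: wd_cntm. Qed.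

Lemma toS_fvev e v : toS (fvev u1 e v) = fvev u1 (fun w => toS (e w)) v.
Proof. exact: (fvev_semilin (phi := (idfun : {rmorphism C -> C})) e v (fun=> erefl) toS_lin). Qed.

Lemma toS_ideal x : ideal_gen S1 x -> toS x = 0.
Proof.
elim=> [|a s b y Sx _ IH]; first exact: (lin0 toS_lin).
rewrite (linD toS_lin) IH addr0; case: Sx => d ->; rewrite phiE.
have -> : a * ((\sum_i d i *: 'X_i) * (c *: phi0)) * b = \sum_i (c * d i) *: ('X_i * phi0 * (a * b)).
  rewrite [a * _]mulrC -mulrA mpoly_scaleAr -scalerAl !mulr_suml scaler_sumr.
  by apply: eq_bigr => i _; rewrite -!scalerAl scalerA.
have e0 := lin_sum (index_enum 'I_7) xpredT (fun i => (c * d i) *: ('X_i * phi0 * (a * b))) toS_lin.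
apply: etrans e0 _; apply: big1 => i _; move: (a * b) => z.
have e1 := linZ toS_lin (c * d i) ('X_i * phi0 * z); apply: etrans e1 _.
suff e2 : toS ('X_i * phi0 * z) = 0 by rewrite e2 scaler0.
have l1 : lin (fun z => toS ('X_i * phi0 * z)).
  by move=> k u v; rewrite mulrDr mpoly_scaleAr toS_lin.
have l2 : lin (fun z : Pol => 0 : Sbar) by move=> k u v; rewrite scaler0 addr0.
apply: (mpoly_lin_eq l1 l2) => w.
have e3 : 'X_i * phi0 * mon w = fvev u1 (fun p => mon ([:: ordl i] ++ p ++ w)) phi_fv.
  by rewrite mon_ctx /mon big_seq1 ordlK.
have e4 := etrans (congr1 toS e3) (toS_fvev _ _); apply: etrans e4 _.
have e5 := bsw_phi (ordl i) w; apply: etrans e5; apply: eq_fvev' => p; exact: toS_mon.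
Qed.

Definition fS : Sbar -> Q := blift SAtoQ.
(** The inverse of [fS]. The map [fS] exists because of the normal forms, [gS] because of the
    relations valid in the A-form; on words they are visibly inverse to each other. *)
Definition gS (z : Q) : Sbar := toS (repr z).

Lemma gS_qpi t : gS (qpi t) = toS t.
Proof.
apply/eqP; rewrite -subr_eq0 -(linB toS_lin); apply/eqP; apply: toS_ideal.
by apply/aprojP; rewrite aprojK.
Qed.

Lemma qpi_surj z : exists t, z = qpi t.
Proof. by exists (repr z); rewrite /qpi aprojK. Qed.

Lemma gS_lin : lin gS.
Proof. exact: (quot_lin qpi_lin qpi_surj toS_lin gS_qpi). Qed.

Lemma fS_lin : lin fS. Proof. exact: (blift_lin SAtoQ_semilin). Qed.

Lemma fSE x : fS (bp x) = SAtoQ x. Proof. exact: (bliftE SAtoQ_semilin x). Qed.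

Lemma fS_bsw w : fS (bsw w) = qpi (mon w).
Proof. by have e := etrans (fSE (swA C w)) (etrans (SAtoQ_mkSA (eA w)) (toQ_eA w)); apply: e. Qed.

Lemma SA_eq (M : lmodType C) (f g : SA -> M) : semilin thm f -> semilin thm g ->
  (forall w, f (swA C w) = g (swA C w)) -> f =1 g.
Proof.
move=> fl gl fg x; have [t <-] := mkSA_surj x.
have f1 : semilin thm (fun t => f (mkSA t)) by move=> a u v; rewrite mkSA_lin fl.
have g1 : semilin thm (fun t => g (mkSA t)) by move=> a u v; rewrite mkSA_lin gl.
exact: (word_eq (phi := thm) f1 g1 fg).
Qed.

Lemma fSK : cancel fS gS.
Proof.
have l1 := lin_comp fS_lin gS_lin; apply: (bchange_eq l1 (@lin_id C Sbar)).
have bl := bpure_semilin thm (M := SA).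
have f1 : semilin thm (fun x => gS (fS (bp x))).
  by move=> a u v; rewrite bl l1.
apply: (SA_eq f1 bl) => w.
have e := etrans (congr1 gS (fS_bsw w)) (etrans (gS_qpi (mon w)) (toS_mon w)).
exact: e.
Qed.

Lemma gSK : cancel gS fS.
Proof.
move=> z; have [t ->] := qpi_surj z; rewrite gS_qpi; move: t {z}.
apply: (mpoly_lin_eq (lin_comp toS_lin fS_lin) qpi_lin) => w.
by rewrite toS_mon fS_bsw.
Qed.

Lemma fS_iso : @alg_iso C Sbar (Sym_quot phi) fS.
Proof.
have ql := qalg_mull_lin (S := S1); have qr := qalg_mulr_lin (S := S1) (@mpoly_scaleAr C).
have [b1 b2] := Sbar_bilin C.
split.
- exact: fS_lin.
- exists gS; [exact: fSK|exact: gSK].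
- by have e := etrans (fSE 1) SAtoQ1; apply: e.
move=> x y.
have f1 z := lin_comp (b2 z) fS_lin; have f2 z := lin_comp fS_lin (ql (fS z)).
have g1 z := lin_comp (b1 z) fS_lin; have g2 z := lin_comp fS_lin (qr (fS z)).
move: x; apply: (bchange_eq (f1 y) (f2 y)) => s.
move: y; apply: (bchange_eq (g1 _) (g2 _)) => t.
have e1 := congr1 fS (Sbar_mulE s t).
have e2 := etrans e1 (etrans (fSE (s * t)) (SAtoQM s t)).
have e3 := congr2 (fun u v : Q => u * v) (esym (fSE s)) (esym (fSE t)).
by have e := etrans e2 e3; apply: e.
Qed.

End SymLimit.

(* 1 + a X + b X^2 is exp(a X) when X^3 = 0 and b = a^2/2 *)
Lemma exp_invariant (R : comNzRingType) (A : algType R) (X T Y : A) (a b : R) :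
  X * T = - (T * Y) -> Y * (Y * Y) = 0 -> a * a = b + b ->
  (1 + a *: X + b *: (X * X)) * T * (1 + a *: Y + b *: (Y * Y)) = T.
Proof.
move=> XT Y3 ab; pose Y2 := Y * Y.
have -> : (1 + a *: X + b *: (X * X)) * T = T * (1 - a *: Y + b *: Y2).
  rewrite !mulrDl !mulrDr mul1r mulr1 mulrN -!scalerAl -!scalerAr XT scalerN; congr (_ + _ *: _).
  by rewrite -mulrA XT mulrN mulrA XT mulNr opprK -mulrA.
have YY2 : Y * Y2 = 0 by [].
have Y2Y : Y2 * Y = 0 by rewrite -mulrA.
have Y22 : Y2 * Y2 = 0 by rewrite /Y2 -mulrA YY2 mulr0.
rewrite -mulrA -/Y2 -[RHS]mulr1; congr (_ * _).
rewrite !mulrDl !mulrDr !mul1r !mulr1 !mulNr -!scalerAl -!scalerAr !scalerA -/Y2 YY2 Y2Y Y22 !scaler0.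
rewrite subr0 !addr0 ab scalerDl opprD; move: (a *: Y) (b *: Y2) => p r.
by rewrite !addrA subrK [1 + p + r - p]addrAC !addrK.
Qed.

(** * The invariant quadratic form *)

Section Invariants.
Variable C : fieldType.
Hypothesis C0 : [pchar C] =i pred0.
Local Notation mon := (@mon C).

Definition tabmx (f : letter -> letter -> Z) : 'M[C]_7 := \matrix_(i, j) zr C (f (ordl i) (ordl j)).

Definition tabsum (f : letter -> Z) : Z := foldr (fun a s => Z.add (f a) s) Z0 letters.

Lemma tabmx_mul f g : tabmx f *m tabmx g = tabmx (fun a b => tabsum (fun c => Z.mul (f a c) (g c b))).
Proof.
apply/matrixP => i j; rewrite !mxE big_letters /tabsum /letters /= !big_cons big_nil addr0.
by rewrite !mxE !lordK !zrD !zrM addr0.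
Qed.

Lemma tabmx_tr f : (tabmx f)^T = tabmx (fun a b => f b a).
Proof. by apply/matrixP => i j; rewrite !mxE. Qed.

Lemma tabmx_opp f : - tabmx f = tabmx (fun a b => Z.opp (f a b)).
Proof. by apply/matrixP => i j; rewrite !mxE zrN. Qed.

Lemma tabmx_eq f g : all2l (fun a b => Z.eqb (f a b) (g a b)) -> tabmx f = tabmx g.
Proof. by move=> h; apply/matrixP => i j; rewrite !mxE; have /Z.eqb_eq -> := all2lP h (ordl i) (ordl j). Qed.

(** The matrices at q = 1, where q + q^-1 becomes 2. The generators K_i and K_i^-1 get the default 0
    and are excluded by [nilp]. *)
Definition Vtab (g : Uq_gen) (a b : letter) : Z :=
  match g, a, b with
  | gE alpha1, L0, L1 => 1 | gE alpha1, L2, L3 => 2 | gE alpha1, L3, L4 => -2 | gE alpha1, L5, L6 => -1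
  | gE alpha2, L1, L2 => 1 | gE alpha2, L4, L5 => -1
  | gF alpha1, L1, L0 => 1 | gF alpha1, L3, L2 => 1 | gF alpha1, L4, L3 => -1 | gF alpha1, L6, L5 => -1
  | gF alpha2, L2, L1 => 1 | gF alpha2, L5, L4 => -1
  | _, _, _ => 0
  end%Zc.

Definition nilp (g : Uq_gen) : Prop := match g with gE _ | gF _ => True | _ => False end.

Lemma V_mx_tab g : nilp g -> V_mx 1 g = tabmx (Vtab g).
Proof.
move=> hg; apply/matrixP => i j; rewrite [RHS]mxE -{1}(ordlK i) -{1}(ordlK j).
move: (ordl i) (ordl j) => a b.
have z0 : zr C 0%Zc = 0 by []. have z1 : zr C 1%Zc = 1 by []. have z2 : zr C 2%Zc = 2 by [].
have zm1 : zr C (-1)%Zc = - 1 := zrN C 1%Zc. have zm2 : zr C (-2)%Zc = - 2 := zrN C 2%Zc.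
case: g hg => [] [] // _; rewrite !mxE -!val_eqE /= !inordK //; case: a; case: b => /=;
  rewrite ?(z0, z1, z2, zm1, zm2) ?invr1; ring.
Qed.

(** The tensor that pairs v_i with v_{-i} and v_0 with itself: in the numbering of the basis,
    opposite vectors have indices of sum 6. *)
Definition ftab (a b : letter) : Z := if eqn (lidx a + lidx b) 6 then 1%Zc else 0%Zc.
Definition form0 : 'M[C]_7 := tabmx ftab.

(** The root vectors annihilate the tensor [form0] and have cube zero. By [exp_invariant] their
    exponentials then fix it. *)
Lemma V_mx_form g : nilp g ->
  V_mx (1 : C) g * form0 = - (form0 * (V_mx (1 : C) g)^T) /\ (V_mx (1 : C) g)^T * ((V_mx (1 : C) g)^T * (V_mx (1 : C) g)^T) = 0.
Proof.
move=> hg; rewrite (V_mx_tab hg) tabmx_tr /form0.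
have -> : (0 : 'M[C]_7) = tabmx (fun _ _ => Z0) by apply/matrixP => i j; rewrite !mxE.
have mE f f' : tabmx f * tabmx f' = tabmx f *m tabmx f' by [].
rewrite !mE !tabmx_mul !mE !tabmx_mul tabmx_opp.
by split; apply: tabmx_eq; case: g hg => [] [] //.
Qed.

Lemma exp_mx3 (z : C) (X : 'M[C]_7) : X * (X * X) = 0 ->
  exp_mx z X = 1 + z *: X + (z ^+ 2 / 2) *: (X * X).
Proof.
move=> X3; have Xk k : X ^+ k.+3 = 0 by rewrite !exprS mulrA mulrA -[X * X * X]mulrA X3 mul0r.
rewrite /exp_mx !big_ord_recl big_ord0 /= !Xk !scaler0 !addr0 !expr1 expr0 expr0 fact0 divr1 scale1r.
by rewrite divr1 addrA expr2.
Qed.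

Lemma form0_exp (z : C) g : nilp g -> exp_mx z (V_mx (1 : C) g) *m form0 *m (exp_mx z (V_mx (1 : C) g))^T = form0.
Proof.
move=> hg; have [XT Y3] := V_mx_form hg; set X := V_mx (1 : C) g in XT Y3 *.
have X3 : X * (X * X) = 0.
  apply: trmx_inj; rewrite trmx0 -[RHS]Y3 -[X * _]/(X *m (X *m X)) !trmx_mul.
  by rewrite -mulmxA.
have n2 : (2 : C) != 0 by have := C0 2; rewrite !inE /= => /negbT.
have ab : z * z = z ^+ 2 / 2 + z ^+ 2 / 2 by field.
have := exp_invariant XT Y3 ab; rewrite (exp_mx3 z X3) => {2}<-.
congr (_ * _); rewrite !linearD /= !linearZ /= trmx1; congr (_ + _ *: _).
exact: trmx_mul.
Qed.

Lemma form0_invariant : G2_invariant form0.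
Proof.
move=> g; elim=> [|i z h _ IH|i z h _ IH]; first by rewrite trmx1 mul1mx mulmx1.
  by rewrite trmx_mul !mulmxA -!(mulmxA (exp_mx _ _)) -[h *m _ *m _]mulmxA (mulmxA h) IH mulmxA form0_exp.
by rewrite trmx_mul !mulmxA -!(mulmxA (exp_mx _ _)) -[h *m _ *m _]mulmxA (mulmxA h) IH mulmxA form0_exp.
Qed.

Lemma form0_neq0 : form0 != 0.
Proof.
apply/eqP => /matrixP /(_ (lord L3) (lord L3)); rewrite !mxE => /eqP.
by rewrite oner_eq0.
Qed.

Lemma sym_tensorZ c (T : 'M[C]_7) : sym_tensor (c *: T) = c *: sym_tensor T.
Proof.
rewrite /sym_tensor scaler_sumr; apply: eq_bigr => i _; rewrite scaler_sumr; apply: eq_bigr => j _.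
by rewrite mxE scalerA.
Qed.

(** In the symmetric algebra each pair of opposite vectors occurs twice, which gives the
    coefficients 2 of phi0; phi has the same coefficients at q = 1. *)
Lemma sym_tensor_form0 : sym_tensor form0 = phi0 C.
Proof.
have e i : \sum_j form0 i j *: ('X_i * 'X_j) = 'X_i * 'X_(rev_ord i) :> mpoly 7 C.
  rewrite (bigD1 (rev_ord i)) //= big1 => [|j ji].
    rewrite mxE addr0 /ftab; have -> : eqn (lidx (ordl i) + lidx (ordl (rev_ord i))) 6.
      by case: i => [[|[|[|[|[|[|[|i]]]]]]] hi].
    by rewrite scale1r.
  rewrite mxE /ftab; case: ifP => h; last by rewrite scale0r.
  case/eqP: ji; rewrite -(ordlK j) -(ordlK i); move: (ordl i) (ordl j) h => a b.
  by case: a; case: b => // _; apply: val_inj.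
rewrite /sym_tensor (eq_bigr _ (fun i _ => e i)) big_letters !big_cons big_nil /phi0.
have -> : phi_fv = [:: ([:: L0; L6], [:: (0, 1); (6, 1)]); ([:: L1; L5], [:: (3, 1); (5, 1)]);
  ([:: L2; L4], [:: (0, 1); (2, 1)]); ([:: L3; L3], [:: (0, 1)])]%Zc.
  by vm_compute.
rewrite !fvev_cons fvev_nil !lpev_u1 /= !mon_cons /mon !big_nil !mulr1.
have r a b : val (lord a) = (6 - lidx b)%N -> rev_ord (lord b) = lord a by move=> h; apply: val_inj.
rewrite (r L6 L0) // (r L5 L1) // (r L4 L2) // (r L3 L3) // (r L2 L4) // (r L1 L5) // (r L0 L6) //.
have z1 : zr C 1%Zc = 1 by []. have z2 : zr C 2%Zc = 1 + 1 by [].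
rewrite z1 z2 !scalerDl !scale1r; ring.
Qed.

(** As phi spans the invariants, the nonzero invariant [form0] is a multiple of it, with a nonzero
    scalar. The two quadratic elements are therefore proportional. *)
Lemma limit_Sq phi : spans_invariants phi -> exists f : Sq_bar C -> Sym_quot phi, alg_iso f.
Proof.
move=> [_ /(_ _ form0_invariant)[c e]].
have c0 : c != 0 by apply/eqP => c0; have := form0_neq0; rewrite e c0 scale0r eqxx.
have phiE : sym_tensor phi = c^-1 *: phi0 C.
  by rewrite -sym_tensor_form0 e sym_tensorZ scalerK.
by exists (@fS C phi); apply: (fS_iso C0 (invr_neq0 c0) phiE).
Qed.
End Invariants.

Theorem lemma3p9 (R : realType) :
  (forall phi : 'M[R[i]]_7, spans_invariants phi ->
     exists f : Sq_bar R[i] -> Sym_quot phi, alg_iso f)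
  /\
  (forall Rm : Rfamily R[i], universal_R Rm -> R_normalised Rm ->
     forall n : nat, exists2 mul : AmA R[i] n -> AmA R[i] n -> AmA R[i] n,
       braided_form Rm mul & alg_iso (@Am_bar_canon R[i] n mul)).
Proof.
have C0 : [pchar R[i]] =i pred0 := Num.Theory.pchar_num _.
split=> [phi|Rm HR Rn n]; first exact: limit_Sq.
exact: (limit_Am C0 HR Rn n).
Qed.
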